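(* Let $\mathfrak g$ be a simple Lie algebra of type $B_n$. There is a one-to-one correspondence, given by assigning to $(\Gamma^1,\Gamma^2)$ the conjugacy class of the model nilpotent pair described in the context, between the set of pairs $(\Gamma^1,\Gamma^2)$ of centrally symmetric skew diagrams ($\Gamma^2$ possibly empty) satisfying (a), (b), (c) below and the set of conjugacy classes of almost principal nilpotent pairs in $\mathfrak g$: (a) $|\Gamma^1|+|\Gamma^2|=2n+1$; (b) $\Gamma^1$ is integral and $\Gamma^2$ is non-integral; (c) either (i) $\Gamma^1$ is near rectangular of type a) or b) and $\Gamma^2=\emptyset$; or (ii) $\Gamma^1=\{(0,0)\}$ and $\Gamma^2$ is (non-empty and) rectangular.
   Context: $K$ is an algebraically closed field of characteristic $0$. A nilpotent pair in a semisimple Lie algebra $\mathfrak g$ over $K$ is a pair $\mathbf e=(e_1,e_2)$ of commuting nilpotent elements for which there is a pair $(h_1,h_2)$ of commuting semisimple elements with rational eigenvalues in the adjoint action and $[h_i,e_j]=\delta_{i,j}e_j$. $Z(\mathbf e)$ is the simultaneous centralizer in $\mathfrak g$. The pair is almost principal if $\dim Z(\mathbf e)=\mathrm{rk}\,\mathfrak g+1$. Conjugacy is under the adjoint group of $\mathfrak g$. Diagrams. A diagram is a subset $\Gamma\subset\mathbb R^2$ with $\Gamma\subset\mathbb Z^2+(x,y)$ for some $x,y\in\mathbb R$. It is connected if any two of its elements are joined by a finite sequence of elements of $\Gamma$ with consecutive elements at Euclidean distance $1$. A skew diagram is a finite connected diagram $\Gamma$ such that $(i,j),(i+1,j+1)\in\Gamma$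 implies $(i+1,j),(i,j+1)\in\Gamma$. It is centrally symmetric if $\Gamma=-\Gamma$; then it is integral if $\Gamma\subset\mathbb Z^2$ and non-integral if $\Gamma\subset\mathbb Z^2+(1/2,1/2)$ (the empty diagram is allowed). A southwest (resp. northeast) corner of $\Gamma$ is $(i,j)\in\Gamma$ with $(i-1,j),(i,j-1)\notin\Gamma$ (resp. $(i+1,j),(i,j+1)\notin\Gamma$). $\Gamma$ is rectangular if it has exactly one southwest corner and exactly one northeast corner. A centrally symmetric skew diagram $\Gamma$ is near rectangular of type a) (resp. type b)) if it has exactly two southwest corners $(i,j)$, $(k,l)$, with $i<k$, and $\Gamma\setminus\{(i,j),(-i,-j)\}$ (resp. $\Gamma\setminus\{(k,l),(-k,-l)\}$) is rectangular. Model pair. Given $(\Gamma^1,\Gamma^2)$ satisfying (a) and (b), let $V=\bigoplus_{k=1,2}\bigoplus_{(i,j)\in\Gamma^k}K v^k_{i,j}$, with $v^k_{i,j}=0$ if $(i,j)\notin\Gamma^k$, carry the symmetric bilinear form $(v^n_{i,j},v^m_{k,l})=\delta_{i,-k}\delta_{j,-l}\delta_{n,m}$, and identify $\mathfrak g$ with $\mathfrak{so}(V)$. The model nilpotent pair is $\mathbf e=(e_1,e_2)$ with $e_1v^k_{i,j}=(-1)^{i+j}v^k_{i+1,j}$, $e_2v^k_{i,j}=(-1)^{i+j+1}v^k_{i,j+1}$ (with $h_1v^k_{i,j}=i\,v^k_{i,j}$, $h_2v^k_{i,j}=j\,v^k_{i,j}$). *)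

(* Defs.v *)
From HB Require Import structures.
From mathcomp Require Import all_boot all_order all_algebra.
From mathcomp Require Import finmap.
From mathcomp Require Import boolp classical_sets functions reals.
From mathcomp Require Import ring.

Set Implicit Arguments.
Unset Strict Implicit.
Unset Printing Implicit Defensive.

Import Order.TTheory GRing.Theory Num.Theory.
Local Open Scope ring_scope.

HB.mixin Record Vector_isLieAlgebra (K : fieldType) L of Vector K L := {
  lie : L -> L -> L;
  lie_linearl : forall y, linear (lie^~ y);
  lie_linearr : forall x, linear (lie x);
  liexx : forall x, lie x x = 0;
  lie_jacobi : forall x y z,
    lie x (lie y z) + lie y (lie z x) + lie z (lie x y) = 0
}.

#[short(type="lieAlgType")]
HB.structure Definition LieAlgebra (K : fieldType) :=
  {L of Vector K L & Vector_isLieAlgebra K L}.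

Section LieNotions.
Variables (K : fieldType) (g : lieAlgType K).
Implicit Types (x h : g) (e : g * g).

HB.instance Definition _ x :=
  GRing.isSemilinear.Build K g g *:%R (lie x)
    (GRing.semilinear_linear (lie_linearr x)).

Definition ad x : 'End(g) := linfun (lie x).

Lemma adE x y : ad x y = lie x y.
Proof. exact: lfunE. Qed.

Definition ad_pow x k : 'End(g) := iter k (comp_lfun (ad x)) \1%VF.

Definition ad_nilpotent x := exists k, ad_pow x k = 0.

(* Over an algebraically closed field, semisimple means diagonalizable. *)
Definition ad_semisimple h :=
  exists b : seq g, basis_of fullv b /\
    forall v, v \in b -> exists c : K, lie h v = c *: v.

Definition ad_rational h :=
  forall c : K, passmx.leigenvalue (ad h) c -> exists q : rat, c = ratr q.

Definition nilpotent_pair e :=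
  [/\ lie e.1 e.2 = 0, ad_nilpotent e.1, ad_nilpotent e.2 &
      exists h : g * g,
        [/\ lie h.1 h.2 = 0,
            ad_semisimple h.1 /\ ad_semisimple h.2,
            ad_rational h.1 /\ ad_rational h.2,
            lie h.1 e.1 = e.1 /\ lie h.2 e.2 = e.2 &
            lie h.1 e.2 = 0 /\ lie h.2 e.1 = 0]].

Definition pair_centralizer e : {vspace g} :=
  (lker (ad e.1) :&: lker (ad e.2))%VS.

(* The rank is the smallest dimension of a Fitting null space
   g^0(x) = {y | (ad x)^k y = 0 for some k}; k = dim g always suffices. *)
Definition nilspace x : {vspace g} := lker (ad_pow x (\dim {:g})).

Lemma lie_rank_ex : exists r, `[< exists x, \dim (nilspace x) = r >].
Proof. by exists (\dim (nilspace 0)); apply/asboolP; exists 0. Qed.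

Definition lie_rank : nat := ex_minn lie_rank_ex.

Definition almost_principal e := \dim (pair_centralizer e) = lie_rank.+1.

(* exp (ad x) for ad-nilpotent x: the truncation is exact since then
   (ad x)^(dim g) = 0. *)
Definition exp_ad x : 'End(g) :=
  \sum_(k < (\dim {:g}).+1) (k`!%:R)^-1 *: ad_pow x k.

(* The adjoint group of a semisimple g in characteristic 0 is generated by the
   exp (ad x) with x ad-nilpotent; the inverse of exp (ad x) is exp (ad (-x)). *)
Inductive adjoint_group : 'End(g) -> Prop :=
| AdjointId : adjoint_group \1%VF
| AdjointExp x s :
    ad_nilpotent x -> adjoint_group s -> adjoint_group (exp_ad x \o s)%VF.

Definition conjugacy_class e : set (g * g) :=
  [set f | exists2 s, adjoint_group s & f = (s e.1, s e.2)]%classic.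

Definition almost_principal_classes : set (set (g * g)) :=
  [set C | exists e, [/\ nilpotent_pair e, almost_principal e &
                         C = conjugacy_class e]]%classic.

End LieNotions.

Arguments lie_rank {K} g.
Arguments almost_principal_classes {K} g.

Definition lie_isomorphism (K : fieldType) (g g' : lieAlgType K) (f : g -> g') :=
  [/\ linear f, bijective f & forall x y, f (lie x y) = lie (f x) (f y)].

Section So.
Variables (K : fieldType) (m : nat) (J : 'M[K]_m).

(* Matrices act on columns and (u, v) = u^T J v; the map below vanishes at A iff
   (A u, v) + (u, A v) = 0 for all u, v. *)
Definition so_defect (A : 'M[K]_m) : 'M[K]_m := A^T *m J + J *m A.

Lemma so_defect_linear : linear so_defect.
Proof.
move=> a A B; rewrite /so_defect linearP /= mulmxDl mulmxDr.
by rewrite -scalemxAl -scalemxAr scalerDr addrACA.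
Qed.

HB.instance Definition _ :=
  GRing.isSemilinear.Build K 'M[K]_m 'M[K]_m *:%R so_defect
    (GRing.semilinear_linear so_defect_linear).

Definition so_space : {vspace 'M[K]_m} := lker (linfun so_defect).

Lemma so_spaceP (A : 'M[K]_m) :
  reflect (A^T *m J + J *m A = 0) (A \in so_space).
Proof. by rewrite memv_ker lfunE; apply: eqP. Qed.

Definition so := subvs_of so_space.

HB.instance Definition _ := Vector.on so.

Definition so_mx (x : so) : 'M[K]_m := vsval x.

Lemma so_mx_inj : injective so_mx. Proof. exact: subvs_inj. Qed.

Lemma so_mx_linear : linear so_mx. Proof. by []. Qed.

HB.instance Definition _ :=
  GRing.isSemilinear.Build K so 'M[K]_m *:%R so_mx
    (GRing.semilinear_linear so_mx_linear).

Definition mx_comm (A B : 'M[K]_m) : 'M[K]_m := A *m B - B *m A.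

Lemma mx_comm_so A B :
  A \in so_space -> B \in so_space -> mx_comm A B \in so_space.
Proof.
move=> /so_spaceP/eqP; rewrite addr_eq0 => /eqP hA.
move=> /so_spaceP/eqP; rewrite addr_eq0 => /eqP hB.
apply/so_spaceP; rewrite /mx_comm linearB /= !trmx_mul mulmxBl mulmxBr.
rewrite -!mulmxA hA hB !mulmxN !mulmxA hA hB !mulNmx !opprK.
by rewrite addrA subrK subrr.
Qed.

Definition so_lie (x y : so) : so := vsproj so_space (mx_comm (so_mx x) (so_mx y)).

Lemma so_lieE x y : so_mx (so_lie x y) = mx_comm (so_mx x) (so_mx y).
Proof. by apply: vsprojK; apply: mx_comm_so; apply: subvsP. Qed.

Lemma so_lie_linearl y : linear (so_lie^~ y).
Proof.
move=> a x x'; apply: so_mx_inj; rewrite linearP /= !so_lieE linearP.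
rewrite /mx_comm /=.
by rewrite mulmxDl mulmxDr -scalemxAl -scalemxAr scalerBr opprD addrACA.
Qed.

Lemma so_lie_linearr x : linear (so_lie x).
Proof.
move=> a y y'; apply: so_mx_inj; rewrite linearP /= !so_lieE linearP.
rewrite /mx_comm /=.
by rewrite mulmxDl mulmxDr -scalemxAl -scalemxAr scalerBr opprD addrACA.
Qed.

Lemma so_liexx x : so_lie x x = 0.
Proof. by apply: so_mx_inj; rewrite so_lieE /mx_comm subrr linear0. Qed.

Lemma so_lie_jacobi x y z :
  so_lie x (so_lie y z) + so_lie y (so_lie z x) + so_lie z (so_lie x y) = 0.
Proof.
apply: so_mx_inj; rewrite !linearD linear0 /= !so_lieE /mx_comm.
move: (so_mx x) (so_mx y) (so_mx z) => A B C.
rewrite !mulmxBl !mulmxBr !mulmxA.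
by apply/matrixP=> i j; rewrite !mxE; ring.
Qed.

HB.instance Definition _ := Vector_isLieAlgebra.Build K so
  so_lie_linearl so_lie_linearr so_liexx so_lie_jacobi.

End So.

Section Diagrams.
Variable R : realType.
Implicit Types (G : {fset R * R}) (p q c : R * R).
Local Open Scope fset_scope.
Local Open Scope ring_scope.

Definition in_lattice c G :=
  forall p, p \in G -> (p.1 - c.1 \is a Num.int) && (p.2 - c.2 \is a Num.int).

Definition is_diagram G := exists c, in_lattice c G.

Definition adjacent : rel (R * R) := fun p q =>
  Num.sqrt ((p.1 - q.1) ^+ 2 + (p.2 - q.2) ^+ 2) == 1.

Definition connected_diagram G :=
  forall p q, p \in G -> q \in G ->
    exists s : seq (R * R),
      [/\ path adjacent p s, all (mem G) s & last p s = q].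

Definition skew_diagram G :=
  [/\ is_diagram G, connected_diagram G &
      forall i j : R, (i, j) \in G -> (i + 1, j + 1) \in G ->
        (i + 1, j) \in G /\ (i, j + 1) \in G].

Definition centrally_symmetric G := G = [fset - p | p in G].

Definition integral_diagram G := in_lattice (0, 0) G.
Definition nonintegral_diagram G := in_lattice (1 / 2, 1 / 2) G.

Definition sw_corners G : {fset R * R} :=
  [fset p in G | ((p.1 - 1, p.2) \notin G) && ((p.1, p.2 - 1) \notin G)].
Definition ne_corners G : {fset R * R} :=
  [fset p in G | ((p.1 + 1, p.2) \notin G) && ((p.1, p.2 + 1) \notin G)].

Definition rectangular G := #|` sw_corners G| = 1%N /\ #|` ne_corners G| = 1%N.

Definition near_rectangular_a G :=
  exists i j k l : R, [/\ sw_corners G = [fset (i, j); (k, l)], i < k &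
    rectangular (G `\` [fset (i, j); (- i, - j)])].
Definition near_rectangular_b G :=
  exists i j k l : R, [/\ sw_corners G = [fset (i, j); (k, l)], i < k &
    rectangular (G `\` [fset (k, l); (- k, - l)])].

Definition admissible_pairs (n : nat) : set ({fset R * R} * {fset R * R}) :=
  [set G |
    [/\ skew_diagram G.1 /\ centrally_symmetric G.1,
        skew_diagram G.2 /\ centrally_symmetric G.2,
        (#|` G.1| + #|` G.2|)%N = n.*2.+1,
        integral_diagram G.1 /\ nonintegral_diagram G.2 &
        (near_rectangular_a G.1 \/ near_rectangular_b G.1) /\ G.2 = fset0 \/
        [/\ G.1 = [fset (0, 0)], G.2 != fset0 & rectangular G.2]]]%classic.

End Diagrams.

Arguments admissible_pairs R n : clear implicits.

Section Model.
Variables (K : fieldType) (R : realType) (G : {fset R * R} * {fset R * R}).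

(* Index set of the basis v^k_{i,j}; [model_pos] returns (k, (i, j)), with
   k = false, true for the first and second diagram. *)
Definition model_index : finType := (G.1 + G.2)%type.

Definition model_dim : nat := #|model_index|.

Definition model_pos (a : 'I_model_dim) : bool * (R * R) :=
  match enum_val a with
  | inl p => (false, fsval p)
  | inr p => (true, fsval p)
  end.

Definition model_form : 'M[K]_model_dim :=
  \matrix_(a, b)
    let: (k, (i, j)) := model_pos b in (model_pos a == (k, (- i, - j)))%:R.

(* The floor is only there to read the integer i + j off the real number. *)
Definition model_e1 : 'M[K]_model_dim :=
  \matrix_(a, b)
    let: (k, (i, j)) := model_pos b in
    if model_pos a == (k, (i + 1, j)) then (-1) ^ Num.floor (i + j) else 0.

Definition model_e2 : 'M[K]_model_dim :=
  \matrix_(a, b)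
    let: (k, (i, j)) := model_pos b in
    if model_pos a == (k, (i, j + 1)) then (-1) ^ (Num.floor (i + j) + 1) else 0.

End Model.

(* [g] is a copy of so(W), where W is the space of columns with the form J, by
   means of [psi].  For each isometry P from the model space V onto W, with
   inverse Q, the model pair is carried to so(W) by X |-> P X Q, and then to [g].
   The result is the union of the conjugacy classes so obtained; it is a single
   class exactly when the choice of the isometry does not matter. *)
Definition model_class (K : fieldType) (R : realType) (m : nat) (J : 'M[K]_m)
    (g : lieAlgType K) (psi : so J -> g)
    (G : {fset R * R} * {fset R * R}) : set (g * g) :=
  [set f | exists (P : 'M[K]_(m, model_dim G)) (Q : 'M[K]_(model_dim G, m))
                  (x1 x2 : so J),
    [/\ P *m Q = 1%:M /\ Q *m P = 1%:M,
        P^T *m J *m P = model_form K G,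
        so_mx x1 = P *m model_e1 K G *m Q,
        so_mx x2 = P *m model_e2 K G *m Q &
        conjugacy_class (psi x1, psi x2) f]]%classic.

(* Main.v *)
(** Write Z(e) as the space of skew forms B with X^T B + B X = Y^T B + B Y = 0, where
    X, Y are the two members of the pair, and grade everything by the common
    eigenvalues w_i of h_1, h_2.  A kernel-versus-image count for the raising operators
    X and Y shows that dim Z(e) is at least the number of unordered pairs {i, j} with
    w_i + w_j = 0, plus the dimension of the space of invariant forms supported in
    "outer" degrees.  Hence dim Z(e) = n + 1 forces the weights to be distinct, so that
    V has a basis of cells, and leaves room for a single outer form.  Corners of the
    diagram, and columns of even height, each produce outer forms, which leaves only
    the near rectangles and the point together with a rectangle.  Conversely those
    shapes have a second, matching upper bound: an invariant form B is determined by
    B(v, .) for v a southwest corner, and this functional kills half of the cells.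

    A pair is determined up to isometry by its shape: ratios of the matrix entries of
    X^k Y^l give a diagonal intertwiner, and the remaining discrepancy between the two
    quadratic forms is constant along edges.  Isometry and conjugacy under the adjoint
    group coincide because exponentials of nilpotents move any unit vector to any
    other, and -1 has determinant -1 in odd dimension.  Distinct shapes are separated
    by the nilpotency indices of X and Y. *)
Require Import Defs.
From HB Require Import structures.
From mathcomp Require Import all_boot all_order all_algebra.
From mathcomp Require Import finmap.
From mathcomp Require Import boolp classical_sets functions reals.
From mathcomp Require Import perm ring lra zify.

Set Implicit Arguments.
Unset Strict Implicit.
Unset Printing Implicit Defensive.

Import Order.TTheory GRing.Theory Num.Theory.
Local Open Scope ring_scope.

(** * Centralizers as spaces of invariant skew forms *)

Section SkewForms.
Variables (K : fieldType) (m : nat).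
Implicit Types (B X Y : 'M[K]_m) (r : rel 'I_m).

(** Three obstacles shape the proof. The hypotheses concern [ad] in an abstract [g], while the
    combinatorics lives on V. Every [X] in so(J) kills some nonzero v because dim V is odd, and on
    the wedge products of v with w the operator [ad X] acts as [X] on w; this carries nilpotency and
    diagonalizability down to [X]. The rank is defined as a minimal Fitting null space, so the
    dimension hypothesis becomes usable only after that minimum is computed for so(J); its lower
    bound is a semicontinuity argument along lines, fed by the odd powers of a regular semisimple
    element. The weights lie in K, which has no order, and they become integers only along arrows
    starting at a known weight. The counts therefore use degrees in {0, -1, -2, ...} inside K and
    compare components through duality with respect to J. Convexity and bounding boxes become
    available once every cell is connected to the cell of weight 0; otherwise there are two
    components, both of them full rectangles. *)

Lemma dim_ge_entries p q (U : {vspace 'M[K]_(p, q)}) (T : finType)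
    (u : T -> 'M[K]_(p, q)) (a : T -> 'I_p) (b : T -> 'I_q) :
  (forall t, u t \in U) -> (forall s t, (u t (a s) (b s) != 0) = (s == t)) ->
  (#|T| <= \dim U)%N.
Proof.
move=> uU ab; pose X := [tuple u (enum_val i) | i < #|T|].
have Xi (i : 'I_#|T|) : X`_i = u (enum_val i) by rewrite -tnth_nth tnth_mktuple.
have fX : free X.
  apply/freeP=> k Xk i; have /matrixP/(_ (a (enum_val i)) (b (enum_val i))) := Xk.
  rewrite summxE (bigD1 i) //= big1 ?addr0 => [|j ji].
    rewrite Xi !mxE => /eqP.
    by rewrite mulf_eq0 => /orP[/eqP//|]; rewrite -[_ == 0]negbK ab eqxx.
  rewrite Xi !mxE; apply/eqP; rewrite mulf_eq0.
  by rewrite orbC -[_ == 0]negbK ab (inj_eq enum_val_inj) eq_sym ji.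
have: (<<X>> <= U)%VS.
  by apply/span_subvP=> _ /mapP[i _ ->].
by move/dimvS; rewrite (eqP fX) size_tuple.
Qed.

Definition symz B := B + B^T.
Lemma symz_linear : linear symz.
Proof. by move=> a A B; rewrite /symz linearP /= scalerDr addrACA. Qed.
HB.instance Definition _ :=
  GRing.isSemilinear.Build K 'M[K]_m 'M[K]_m *:%R symz
    (GRing.semilinear_linear symz_linear).

Definition actm X B := X^T *m B + B *m X.
Lemma actm_linear X : linear (actm X).
Proof.
move=> a A B; rewrite /actm mulmxDr mulmxDl -scalemxAl -scalemxAr scalerDr.
by rewrite addrACA.
Qed.
HB.instance Definition _ X :=
  GRing.isSemilinear.Build K 'M[K]_m 'M[K]_m *:%R (actm X)
    (GRing.semilinear_linear (actm_linear X)).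

(** Masking erases the entries that are allowed to be nonzero, so the kernel of [mask r] consists of
    the matrices supported on [r]; this makes [forms r] a [vspace]. *)
Definition mask r B : 'M[K]_m := \matrix_(i, j) if r i j then 0 else B i j.
Lemma mask_linear r : linear (mask r).
Proof.
by move=> a A B; apply/matrixP=> i j; rewrite !mxE; case: ifP; rewrite ?mulr0 ?addr0.
Qed.
HB.instance Definition _ r :=
  GRing.isSemilinear.Build K 'M[K]_m 'M[K]_m *:%R (mask r)
    (GRing.semilinear_linear (mask_linear r)).

Definition skewsp : {vspace 'M[K]_m} := lker (linfun symz).
Definition kact X : {vspace 'M[K]_m} := lker (linfun (actm X)).
(* For a nondegenerate symmetric J, A |-> J A identifies the centralizer of
   X and Y in so(J) with this space, which does not involve J. *)
Definition zforms X Y : {vspace 'M[K]_m} := (skewsp :&: (kact X :&: kact Y))%VS.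
Definition forms r : {vspace 'M[K]_m} := (skewsp :&: lker (linfun (mask r)))%VS.

Lemma skewspP B : reflect (B^T = - B) (B \in skewsp).
Proof.
rewrite memv_ker lfunE /= /symz addrC addr_eq0; exact: eqP.
Qed.

Lemma kactP X B : reflect (X^T *m B + B *m X = 0) (B \in kact X).
Proof. by rewrite memv_ker lfunE; exact: eqP. Qed.

Lemma zformsP X Y B : reflect
  [/\ B^T = - B, X^T *m B + B *m X = 0 & Y^T *m B + B *m Y = 0] (B \in zforms X Y).
Proof.
rewrite !memv_cap; apply: (iffP and3P) => -[a b c]; split;
  by [exact/skewspP | exact/kactP].
Qed.

Lemma formsP r B : reflect
  (B^T = - B /\ forall i j, ~~ r i j -> B i j = 0) (B \in forms r).
Proof.
rewrite memv_cap memv_ker lfunE /=; apply: (iffP andP).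
  move=> [/skewspP-> /eqP/matrixP h]; split=> // i j /negPf rij.
  by have := h i j; rewrite !mxE rij.
move=> [/skewspP-> h]; split=> //; apply/eqP/matrixP=> i j; rewrite !mxE.
by case: ifP => // /negbT /h.
Qed.

(** Rank-nullity: [U] contains the direct sum of [U0] and [U1], and the image of [U] fits into [U1]
    alone, which leaves at least the dimension of [U0] for the kernel. *)
Lemma dim_ker_ge (V : vectType K) (f : 'End(V)) (U U0 U1 : {vspace V}) :
  (U0 <= U)%VS -> (U1 <= U)%VS -> (U0 :&: U1 = 0)%VS -> (f @: U <= U1)%VS ->
  (\dim U0 <= \dim (U :&: lker f))%N.
Proof.
move=> U0U U1U U01 fU; have := limg_ker_dim f U; have := dimvS fU.
have : (U0 + U1 <= U)%VS by rewrite subv_add U0U.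
by move/dimvS; rewrite dimv_disjoint_sum //; lia.
Qed.

Lemma actm_skew X B : B^T = - B -> (actm X B)^T = - actm X B.
Proof.
by move=> sB; rewrite /actm linearD /= !trmx_mul sB trmxK mulmxN mulNmx -opprD addrC.
Qed.

Lemma actm_comm X Y B : X *m Y = Y *m X -> actm X (actm Y B) = actm Y (actm X B).
Proof.
move=> XY; have XYT : X^T *m Y^T = Y^T *m X^T by rewrite -!trmx_mul XY.
rewrite /actm !mulmxDr !mulmxDl !mulmxA XYT -[B *m Y *m X]mulmxA -XY mulmxA.
by rewrite addrACA.
Qed.

Lemma actm_neq0 X B i j : actm X B i j != 0 ->
  (exists2 k, X k i != 0 & B k j != 0) \/ (exists2 k, X k j != 0 & B i k != 0).
Proof.
rewrite /actm !mxE => h.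
have [/existsP[k /andP[]]|/existsPn h1] := boolP [exists k, (X k i != 0) && (B k j != 0)].
  by left; exists k.
have [/existsP[k /andP[]]|/existsPn h2] := boolP [exists k, (X k j != 0) && (B i k != 0)].
  by right; exists k.
case/eqP: h; rewrite !big1 ?addr0 // => k _; rewrite ?mxE; apply/eqP; rewrite mulf_eq0.
  by have := h2 k; rewrite negb_and !negbK orbC.
by have := h1 k; rewrite negb_and !negbK.
Qed.

Lemma forms_sub r r' : subrel r r' -> (forms r <= forms r')%VS.
Proof.
move=> rr'; apply/subvP=> B /formsP[sB h]; apply/formsP; split=> // i j.
by move=> /(contra (rr' i j)); apply: h.
Qed.

Lemma actm_forms X B r r' : symmetric r' -> B \in forms r ->
  (forall i j k, X k i != 0 -> r k j -> r' i j) -> actm X B \in forms r'.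
Proof.
move=> sr' /formsP[sB h] hX; apply/formsP; split; first exact: actm_skew.
move=> i j; apply: contraNeq => /actm_neq0[[k Xk Bk]|[k Xk Bk]].
  by apply: (hX _ _ k) => //; apply: contraNT Bk => /h->.
rewrite sr'; apply: (hX _ _ k) => //; apply: contraNT Bk => /h Bki.
by move/matrixP: sB => /(_ i k); rewrite !mxE Bki => /eqP; rewrite eq_sym oppr_eq0.
Qed.

Lemma forms_disjoint r r' : (forall i j, r i j -> ~~ r' i j) ->
  (forms r :&: forms r' = 0)%VS.
Proof.
move=> rr'; apply/eqP; rewrite -subv0; apply/subvP=> B.
rewrite memv_cap memv0 => /andP[/formsP[_ h] /formsP[_ h']].
apply/eqP/matrixP=> i j; rewrite mxE.
by have [/rr'/h'|/h] := boolP (r i j).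
Qed.

Lemma dim_forms_ge r : symmetric r ->
  (#|[pred p : 'I_m * 'I_m | (p.1 < p.2)%N && r p.1 p.2]| <= \dim (forms r))%N.
Proof.
move=> sr; set P := [pred p | _]; rewrite -card_sig.
pose u (t : {p | P p}) : 'M[K]_m :=
  delta_mx (val t).1 (val t).2 - delta_mx (val t).2 (val t).1.
apply: (@dim_ge_entries _ _ _ _ u (fun t => (val t).1) (fun t => (val t).2)).
  move=> t; rewrite /u; have /andP[] := valP t; case: (val t) => i j /= ij rij.
  apply/formsP; split.
    by rewrite linearB /= !trmx_delta opprB.
  move=> k l; apply: contraNeq; rewrite !mxE.
  case: andP => [[/eqP-> /eqP->] //|_]; case: andP => [[/eqP-> /eqP->] _|_].
    by rewrite sr.
  by rewrite subrr eqxx.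
move=> s t; rewrite /u -val_eqE; have /andP[] := valP t; have /andP[] := valP s.
case: (val s) (val t) => k l [i j] /= kl rkl ij rij; rewrite !mxE xpair_eqE.
have -> : (k == j) && (l == i) = false.
  by apply/negP=> /andP[/eqP kj /eqP li]; move: kl ij; rewrite kj li; lia.
by rewrite subr0; case: (_ && _); rewrite ?oner_eq0 ?eqxx.
Qed.

(* Both inequalities hold because the kernel of a nilpotent operator raising a
   grading is at least as large as the bottom piece, which the image misses. *)
Lemma zforms_in_ge X Y (r r0 r00 : rel 'I_m) :
  X *m Y = Y *m X -> symmetric r -> symmetric r0 -> symmetric r00 ->
  subrel r0 r -> subrel r00 r0 ->
  (forall i j k, X k i != 0 -> r k j -> r i j) ->
  (forall i j k, X k i != 0 -> r0 k j -> r0 i j && ~~ r00 i j) ->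
  (forall i j k, Y k i != 0 -> r k j -> r i j && ~~ r0 i j) ->
  (\dim (forms r00) <= \dim (zforms X Y :&: forms r))%N.
Proof.
move=> XY sr sr0 sr00 r0r r000 hX hX0 hY.
pose r01 i j := r0 i j && ~~ r00 i j.
pose r1 i j := r i j && ~~ r0 i j.
have step1 : (\dim (forms r00) <= \dim (forms r0 :&: kact X))%N.
  apply: (@dim_ker_ge _ _ _ _ (forms r01)).
  - exact: forms_sub.
  - by apply: forms_sub => i j /andP[].
  - by apply: forms_disjoint => i j; rewrite /r01 => ->; rewrite andbF.
  - apply/subvP=> _ /memv_imgP[B BF ->]; rewrite lfunE /=.
    by apply: (@actm_forms _ _ r0) => // i j; rewrite /r01 sr0 sr00.
apply: leq_trans step1 _.
have -> : (zforms X Y :&: forms r = (forms r :&: kact X) :&: kact Y)%VS.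
  apply/eqP; rewrite eqEsubv; apply/andP; split; apply/subvP=> B.
    by rewrite !memv_cap => /andP[/and3P[-> -> ->] ->].
  by rewrite !memv_cap => /andP[/andP[/andP[-> ->] ->] ->].
(* Second count, on the forms already killed by [X]: the action of [Y] lands in the degrees of [r]
   outside [r0], and commutation keeps the result inside [kact X]. *)
apply: (@dim_ker_ge _ _ _ _ (forms r1 :&: kact X)).
- by apply: capvS => //; apply: forms_sub.
- by apply: capvS => //; apply: forms_sub => i j /andP[].
- apply/eqP; rewrite -subv0; apply/subvP=> B; rewrite !memv_cap.
  move=> /andP[/andP[B0 _] /andP[B1 _]].
  rewrite -(@forms_disjoint r0 r1) ?memv_cap ?B0 //.
  by move=> i j h; rewrite /r1 h andbF.
- apply/subvP=> _ /memv_imgP[B + ->]; rewrite lfunE memv_cap => /andP[BF /kactP XB].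
  rewrite memv_cap; apply/andP; split.
    by apply: (@actm_forms _ _ r) => // i j; rewrite /r1 sr sr0.
  by apply/kactP; rewrite -/(actm X _) actm_comm // /actm XB mulmx0 mul0mx addr0.
Qed.

Lemma zforms_ge X Y (r r0 r00 : rel 'I_m) :
  X *m Y = Y *m X -> symmetric r -> symmetric r0 -> symmetric r00 ->
  subrel r0 r -> subrel r00 r0 ->
  (forall i j k, X k i != 0 -> r k j -> r i j) ->
  (forall i j k, X k i != 0 -> r0 k j -> r0 i j && ~~ r00 i j) ->
  (forall i j k, Y k i != 0 -> r k j -> r i j && ~~ r0 i j) ->
  (#|[pred p : 'I_m * 'I_m | (p.1 < p.2)%N && r00 p.1 p.2]| +
   \dim (zforms X Y :&: forms (fun i j => ~~ r i j)) <= \dim (zforms X Y))%N.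
Proof.
move=> XY sr sr0 sr00 r0r r000 hX hX0 hY.
have h1 := zforms_in_ge XY sr sr0 sr00 r0r r000 hX hX0 hY.
have h0 := dim_forms_ge sr00.
set Z1 := (zforms X Y :&: forms r)%VS in h1.
set Z2 := (_ :&: forms (fun i j => _))%VS.
have Z12 : (Z1 :&: Z2 = 0)%VS.
  apply/eqP; rewrite -subv0; apply/subvP=> B; rewrite !memv_cap.
  move=> /andP[/andP[_ B0] /andP[_ B1]].
  rewrite -(@forms_disjoint r (fun i j => ~~ r i j)) ?memv_cap ?B0 //.
  by move=> i j ->.
have : (Z1 + Z2 <= zforms X Y)%VS by rewrite subv_add !capvSl.
by move/dimvS; rewrite dimv_disjoint_sum //; lia.
Qed.

End SkewForms.

Lemma dim_le_map (K : fieldType) (V V' : vectType K) (f : {linear V -> V'})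
    (U : {vspace V}) (W : {vspace V'}) :
  (forall x, x \in U -> f x \in W) -> (forall x, x \in U -> f x = 0 -> x = 0) ->
  (\dim U <= \dim W)%N.
Proof.
move=> fUW finj; rewrite -(limg_ker_dim (linfun f) U).
have -> : (U :&: lker (linfun f) = 0)%VS.
  apply/eqP; rewrite -subv0; apply/subvP=> x; rewrite memv_cap memv_ker lfunE memv0.
  by move=> /andP[xU /eqP /(finj _ xU) ->].
rewrite dimv0 add0n; apply: dimvS; apply/subvP=> _ /memv_imgP[x xU ->].
by rewrite lfunE; exact: fUW.
Qed.

(** * Explicit invariant forms and an upper bound for their number *)

Section ZForms.
Variables (K : fieldType) (m : nat).
Implicit Types (B X Y : 'M[K]_m) (f g : 'rV[K]_m).

Lemma mx_pow_supp (V : zmodType) (w : 'I_m -> V) (e : V) X k :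
  (forall i j, X i j != 0 -> w i = w j + e) ->
  forall i j, (X ^+ k) i j != 0 -> w i = w j + e *+ k.
Proof.
move=> hX; elim: k => [|k IH] i j.
  by rewrite expr0 mxE; case: (i =P j) => [->|_]; rewrite ?mulr0n ?addr0 ?eqxx //.
rewrite exprS mxE => h.
have [/existsP[l /andP[Xl /IH]]|/existsPn hl] :=
  boolP [exists l, (X i l != 0) && ((X ^+ k) l j != 0)].
  by rewrite (hX _ _ Xl) mulrSr addrA => ->.
case/eqP: h; apply: big1 => l _; apply/eqP; rewrite mulf_eq0.
by have := hl l; rewrite negb_and !negbK.
Qed.

Lemma mx_mul_neq0 m1 m2 m3 (A : 'M[K]_(m1, m2)) (B : 'M[K]_(m2, m3)) i j :
  (A *m B) i j != 0 -> exists2 k, A i k != 0 & B k j != 0.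
Proof.
rewrite mxE => h.
have [/existsP[k /andP[]]|/existsPn hl] :=
  boolP [exists k, (A i k != 0) && (B k j != 0)]; first by exists k.
case/eqP: h; apply: big1 => l _; apply/eqP; rewrite mulf_eq0.
by have := hl l; rewrite negb_and !negbK.
Qed.

Lemma mulmx_exprS X k : X *m X ^+ k = X ^+ k.+1.
Proof. by rewrite exprS. Qed.

Lemma mulmx_exprSr X k : X ^+ k *m X = X ^+ k.+1.
Proof. by rewrite exprSr. Qed.

Lemma kact_expr X B k : B \in kact X ->
  (X ^+ k)^T *m B = (-1) ^+ k *: (B *m X ^+ k).
Proof.
move=> /kactP/eqP; rewrite addr_eq0 => /eqP XB.
elim: k => [|k IH]; first by rewrite !expr0 scale1r trmx1 mul1mx mulmx1.
rewrite [in LHS]exprSr trmx_mul -mulmxA IH -scalemxAr mulmxA XB.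
by rewrite exprS mulN1r scaleNr mulNmx scalerN -mulmxA mulmx_exprS.
Qed.

(** Row vectors are linear functionals and this is their exterior product. In the applications the
    functionals are mostly coordinates at southwest corners, which vanish on the images of [X] and
    [Y]. *)
Definition corner f g : 'M[K]_m := f^T *m g - g^T *m f.

Lemma corner_zforms X Y f g :
  f *m X = 0 -> f *m Y = 0 -> g *m X = 0 -> g *m Y = 0 -> corner f g \in zforms X Y.
Proof.
have inv Z : f *m Z = 0 -> g *m Z = 0 -> Z^T *m corner f g + corner f g *m Z = 0.
  move=> fZ gZ; rewrite /corner mulmxBr mulmxBl !mulmxA -!trmx_mul -!mulmxA fZ gZ.
  by rewrite trmx0 !mul0mx !mulmx0 subrr addr0.
move=> fX fY gX gY; apply/zformsP; split; try exact: inv.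
by rewrite /corner linearB /= !trmx_mul !trmxK opprB.
Qed.

(** For odd [r] this is the symplectic form preserved by a nilpotent Jordan block of even size
    [r.+1], pulled back along the string of functionals f, fY, ..., fY^r. *)
Definition chain Y f r : 'M[K]_m :=
  \sum_(k < r.+1) (-1) ^+ k *: ((f *m Y ^+ (r - k))^T *m (f *m Y ^+ k)).

Lemma chainE Y f r i j : chain Y f r i j =
  \sum_(k < r.+1) (-1) ^+ k * ((f *m Y ^+ (r - k)) 0 i * (f *m Y ^+ k) 0 j).
Proof.
rewrite /chain summxE; apply: eq_bigr => k _.
by rewrite mxE [in LHS]mxE big_ord1 [in LHS]mxE.
Qed.

(** Reversing the summation index transposes the sum and, as [r] is odd, changes every sign; this
    gives skewness. The action of [Y] telescopes to two end terms, each containing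
    [f *m Y ^+ r.+1]. *)
Lemma chain_zforms X Y f r : X *m Y = Y *m X -> odd r ->
  f *m X = 0 -> f *m Y ^+ r.+1 = 0 -> chain Y f r \in zforms X Y.
Proof.
move=> XY r_odd fX fY; apply/zformsP; split.
- rewrite /chain linear_sum /= (reindex_inj rev_ord_inj) /= -sumrN.
  apply: eq_bigr => k _; rewrite linearZ /= trmx_mul trmxK subSS.
  have kr : (k <= r)%N by rewrite -ltnS.
  rewrite subKn // -scaleNr; congr (_ *: _).
  by rewrite -signr_odd oddB // r_odd addTb signrN signr_odd.
- have fYX k : f *m Y ^+ k *m X = 0.
    have -> : f *m Y ^+ k *m X = f *m X *m Y ^+ k.
      by rewrite -!mulmxA; congr (_ *m _); apply/esym; apply: commrX.
    by rewrite fX mul0mx.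
  rewrite /chain mulmx_sumr mulmx_suml -big_split big1 //= => k _.
  rewrite -scalemxAr -scalemxAl [X^T *m (_ *m _)]mulmxA -trmx_mul fYX.
  by rewrite -[_ *m _ *m X]mulmxA fYX trmx0 mul0mx mulmx0 scaler0 addr0.
rewrite /chain mulmx_sumr mulmx_suml -big_split /=.
pose t k := (f *m Y ^+ (r.+1 - k))^T *m (f *m Y ^+ k).
pose u k := - ((-1) ^+ k *: t k).
rewrite (eq_bigr (fun k : 'I_r.+1 => u k.+1 - u k)) => [|k _].
  rewrite -(big_mkord xpredT (fun k => u k.+1 - u k)) telescope_sumr // /u /t.
  by rewrite subn0 fY trmx0 mul0mx mulmx0 !scaler0 subrr.
rewrite /u /t subSS subSn -1?ltnS // opprK exprS mulN1r scaleNr opprK addrC.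
rewrite -scalemxAr -scalemxAl; congr (_ *: _ + _ *: _).
  by rewrite -[LHS]mulmxA -[f *m _ *m Y]mulmxA mulmx_exprSr.
by rewrite [LHS]mulmxA -trmx_mul -[f *m _ *m Y]mulmxA mulmx_exprSr.
Qed.

Definition reaches X Y (p i : 'I_m) k l :=
  exists2 c, c != 0 &
    X ^+ k *m Y ^+ l *m delta_mx p 0 = c *: (delta_mx i 0 : 'cV[K]_m).

(* A form B in [zforms X Y] is determined by the functional B(v_p, .), and that
   functional kills x^k y^l v_p for k + l even. *)
Lemma zforms_le X Y (p q : 'I_m) (E : {pred 'I_m}) :
  2%:R != 0 :> K -> X *m Y = Y *m X ->
  (forall i, i != q -> exists k l, reaches X Y p i k l) ->
  (forall i, i \in E -> exists k l, ~~ odd (k + l) /\ reaches X Y p i k l) ->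
  (\dim (zforms X Y) + #|E| <= m)%N.
Proof.
move=> two XY hq hE.
pose F : {pred 'I_m} := predC E.
pose phi B : 'rV[K]_#|F| := \row_t B p (enum_val t).
have phi_lin : linear phi by move=> a A B; apply/rowP=> t; rewrite !mxE.
pose phiL : {linear 'M[K]_m -> 'rV[K]_#|F|} := HB.pack phi
  (GRing.isSemilinear.Build K 'M[K]_m 'rV[K]_#|F| *:%R phi
    (GRing.semilinear_linear phi_lin)).
suff : (\dim (zforms X Y) <= \dim (fullv : {vspace 'rV[K]_#|F|}))%N.
  rewrite dimvf /dim /= mul1n => h.
  have c : (#|E| + #|F| = m)%N by rewrite -[RHS]card_ord; exact: cardC.
  by rewrite -[leqRHS]c addnC leq_add2l.
apply: (dim_le_map (f := phiL)) => [B _|B ZB phi0]; first exact: memvf.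
have /zformsP[sB BX BY] := ZB.
have Bskew i j : B i j = - B j i by move/matrixP: sB => /(_ j i); rewrite !mxE.
have inv k l : (X ^+ k *m Y ^+ l)^T *m B = (-1) ^+ (k + l) *: (B *m (X ^+ k *m Y ^+ l)).
  have BX' : B \in kact X by apply/kactP.
  have BY' : B \in kact Y by apply/kactP.
  rewrite trmx_mul -mulmxA (kact_expr _ BX') -scalemxAr mulmxA (kact_expr _ BY').
  rewrite -scalemxAl scalerA exprD; congr (_ *: _); rewrite -mulmxA.
  congr (_ *m _); apply: commrX; apply/commr_sym/commrX; exact: XY.
have entry (A : 'M[K]_m) i j : A i j = ((delta_mx i 0 : 'cV[K]_m)^T *m A *m (delta_mx j 0 : 'cV[K]_m)) 0 0.
  by rewrite trmx_delta -rowE -colE !mxE.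
have Bp c : B p c = 0.
  case: (boolP (c \in E)) => [/hE[k [l [kl [a a0 Ha]]]]|cE].
    pose u : 'cV[K]_m := delta_mx p 0.
    pose b := (u^T *m B *m (X ^+ k *m Y ^+ l *m u)) 0 0.
    (* For even k + l the operator [X ^+ k *m Y ^+ l] is self-adjoint for [B], so transposing this 1
       x 1 matrix only produces the sign of the skew form. *)
    have b0 : b = - b.
      have bT : (u^T *m B *m (X ^+ k *m Y ^+ l *m u))^T =
         - (u^T *m B *m (X ^+ k *m Y ^+ l *m u)).
        rewrite !trmx_mul trmxK sB mulNmx mulmxN; congr (- _).
        rewrite -trmx_mul -!mulmxA [(X ^+ k *m _)^T *m _]mulmxA inv -signr_odd (negPf kl).
        by rewrite expr0 scale1r -!mulmxA.
      by have := congr1 (fun A : 'M_1 => A 0 0) bT; rewrite [X in X = _]mxE [X in _ = X]mxE.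
    have: a * B p c = 0.
      have : b = 0.
        apply/eqP; move/eqP: b0; rewrite -subr_eq0 opprK -mulr2n -mulr_natl mulf_eq0.
        by rewrite (negPf two).
      rewrite /b Ha -scalemxAr mxE => <-; congr (_ * _); exact: entry.
    by move/eqP; rewrite mulf_eq0 (negPf a0) => /eqP.
  have cF : c \in F by [].
  have /rowP/(_ (enum_rank_in cF c)) := phi0.
  by rewrite !mxE enum_rankK_in.
have pB : (delta_mx p 0 : 'cV[K]_m)^T *m B = 0.
  by rewrite trmx_delta -rowE; apply/rowP=> j; rewrite !mxE.
have Bi i j : i != q -> B i j = 0.
  move=> /hq[k [l [a a0 Ha]]].
  have : a *: ((delta_mx i 0 : 'cV[K]_m)^T *m B) = 0.
    rewrite scalemxAl -linearZ /= -Ha trmx_mul -mulmxA inv -scalemxAr mulmxA pB.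
    by rewrite mul0mx scaler0.
  move/eqP; rewrite scaler_eq0 (negPf a0) /= trmx_delta -rowE => /eqP/rowP/(_ j).
  by rewrite !mxE.
(* [Bi] kills every row but that of [q] and, by skewness, every column but that of [q]; the entry
   left over is diagonal. *)
apply/matrixP=> i j; rewrite [RHS]mxE.
have [iq|iq] := eqVneq i q; last exact: Bi.
have [jq|jq] := eqVneq j q; last by rewrite Bskew Bi ?oppr0.
apply/eqP; have := Bskew i j; rewrite iq jq => /eqP.
by rewrite -subr_eq0 opprK -mulr2n -mulr_natl mulf_eq0 (negPf two).
Qed.

Lemma two_forms_dim (U : {vspace 'M[K]_m}) B1 B2 : B1 \in U -> B2 \in U ->
  B1 != 0 -> B2 != 0 -> (forall i j, B1 i j != 0 -> B2 i j = 0) -> (1 < \dim U)%N.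
Proof.
have ex B : B != 0 -> exists p : 'I_m * 'I_m, B p.1 p.2 != 0.
  move=> B0; apply/existsP; apply: contraNT B0 => /existsPn h.
  by apply/eqP/matrixP=> i j; rewrite mxE; have /= := h (i, j); rewrite negbK => /eqP.
move=> U1 U2 /ex[p1 h1] /ex[p2 h2] dis.
pose p (b : bool) := if b then p1 else p2.
have := @dim_ge_entries K m m U bool (fun b : bool => if b then B1 else B2)
  (fun b => (p b).1) (fun b => (p b).2).
rewrite card_bool; apply; first by case.
case; case; rewrite /p //=.
- by rewrite (dis _ _ h1) eqxx.
- by apply/negbTE; rewrite negbK; apply: contraNT h2 => /dis->.
Qed.

End ZForms.

Lemma zforms_conj_le (K : fieldType) m m' (X Y : 'M[K]_m) (P : 'M[K]_(m, m'))
    (Q : 'M[K]_(m', m)) : P *m Q = 1%:M ->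
  (\dim (zforms X Y) <= \dim (zforms (Q *m X *m P) (Q *m Y *m P)))%N.
Proof.
move=> PQ; pose phi (B : 'M[K]_m) := P^T *m B *m P.
have phi_lin : linear phi.
  by move=> a A B; rewrite /phi mulmxDr mulmxDl -scalemxAr -scalemxAl.
pose phiL : {linear 'M[K]_m -> 'M[K]_m'} := HB.pack phi
  (GRing.isSemilinear.Build K 'M[K]_m 'M[K]_m' *:%R phi
    (GRing.semilinear_linear phi_lin)).
have QPT : Q^T *m P^T = 1%:M by rewrite -trmx_mul PQ trmx1.
have inv (Z B : 'M[K]_m) : Z^T *m B + B *m Z = 0 ->
    (Q *m Z *m P)^T *m phi B + phi B *m (Q *m Z *m P) = 0.
  move=> ZB; rewrite /phi !trmx_mul !mulmxA -[_ *m Q^T *m P^T]mulmxA QPT mulmx1.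
  rewrite -[_ *m P *m Q]mulmxA PQ mulmx1.
  by rewrite -mulmxDl -[_ *m Z^T *m B]mulmxA -[_ *m B *m Z]mulmxA -mulmxDr ZB mulmx0 mul0mx.
apply: (dim_le_map (f := phiL)) => B.
  move=> /zformsP[sB BX BY]; apply/zformsP; split; try exact: inv.
  by rewrite /= /phi !trmx_mul trmxK sB mulNmx mulmxN mulmxA.
move=> _ /= /(congr1 (fun A => Q^T *m A *m Q)).
by rewrite /phi mulmx0 mul0mx !mulmxA QPT mul1mx -mulmxA PQ mulmx1.
Qed.

Lemma zforms_conj (K : fieldType) m m' (X Y : 'M[K]_m) (P : 'M[K]_(m, m'))
    (Q : 'M[K]_(m', m)) : P *m Q = 1%:M -> Q *m P = 1%:M ->
  \dim (zforms (Q *m X *m P) (Q *m Y *m P)) = \dim (zforms X Y).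
Proof.
move=> PQ QP; apply/eqP; rewrite eqn_leq zforms_conj_le // andbT.
have := @zforms_conj_le K m' m (Q *m X *m P) (Q *m Y *m P) Q P QP.
by rewrite !mulmxA PQ !mul1mx -![_ *m P *m Q]mulmxA PQ !mulmx1.
Qed.

(** * The Lie algebra so(J) *)

Lemma mx_eq0_col (K : fieldType) m p (A : 'M[K]_(m, p)) :
  (forall w : 'cV_p, A *m w = 0) -> A = 0.
Proof.
move=> h; apply/matrixP=> i j; have := congr1 (fun M : 'cV_m => M i 0) (h (delta_mx j 0)).
by rewrite -colE !mxE.
Qed.

Section Wedge.
Variables (K : fieldType) (m : nat) (J : 'M[K]_m).
Hypotheses (J_sym : J^T = J) (J_unit : J \in unitmx).
Implicit Types (v w : 'cV[K]_m) (A B X : 'M[K]_m).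

(** The element of so(J) attached to the exterior product of v and w: x is sent to (w, x) v - (v, x)
    w. *)
Definition wedge v w : 'M[K]_m := (v *m w^T - w *m v^T) *m J.

Lemma wedge_so v w : wedge v w \in so_space J.
Proof.
apply/so_spaceP; rewrite /wedge; set U := _ - _.
have UT : U^T = - U by rewrite /U linearB /= !trmx_mul !trmxK opprB.
by rewrite trmx_mul J_sym UT mulmxN mulNmx mulmxA addNr.
Qed.

Lemma wedge_comm X v w : X^T *m J + J *m X = 0 ->
  mx_comm X (wedge v w) = wedge (X *m v) w + wedge v (X *m w).
Proof.
move/eqP; rewrite addr_eq0 => /eqP XJ.
have JX : J *m X = - (X^T *m J) by rewrite XJ opprK.
rewrite /mx_comm /wedge -[_ *m J *m X]mulmxA JX mulmxN opprK !mulmxA -!mulmxDl.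
congr (_ *m J); rewrite !trmx_mul mulmxBr mulmxBl !mulmxA.
have sw (a b c d : 'M[K]_m) : a - b + (c - d) = a - d + (c - b).
  by apply/matrixP=> i j; rewrite !mxE; ring.
exact: sw.
Qed.

Lemma wedge_eq0 v w : v != 0 -> wedge v w = 0 -> exists c, w = c *: v.
Proof.
move=> v0 /(congr1 (mulmxr (invmx J))); rewrite /= mul0mx mulmxK // => /matrixP vw.
have [i vi] : exists i, v i 0 != 0.
  apply/existsP; apply: contraNT v0 => /existsPn h.
  by apply/eqP/matrixP=> i j; rewrite ord1 mxE; have := h i; rewrite negbK => /eqP.
exists (w i 0 / v i 0); apply/matrixP=> j k; rewrite !mxE ord1.
have := vw i j; rewrite !mxE !big_ord1 !mxE => /eqP; rewrite subr_eq0 => /eqP h.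
by rewrite mulrAC -h mulrAC mulfV // mul1r.
Qed.

(** With [v] fixed in the kernel of [X], the operator [ad X] acts on [wedge v w] as [X] acts on w.
    Properties of [ad X] thus descend to [X] up to the line of [v], the ambiguity of w in
    [wedge v w]. *)
Lemma iter_wedge X v w k : X^T *m J + J *m X = 0 -> X *m v = 0 ->
  iter k (mx_comm X) (wedge v w) = wedge v (X ^+ k *m w).
Proof.
move=> XJ Xv; elim: k => [|k IH] /=; first by rewrite expr0 mul1mx.
rewrite IH wedge_comm // Xv mulmxA mulmx_exprS.
by rewrite {1}/wedge mul0mx trmx0 mulmx0 subrr mul0mx add0r.
Qed.

Lemma so_mxP (x : so J) : (so_mx x)^T *m J + J *m so_mx x = 0.
Proof. by apply/so_spaceP; exact: subvsP. Qed.

Lemma so_mx_surj A : A^T *m J + J *m A = 0 -> exists x : so J, so_mx x = A.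
Proof. by move=> /so_spaceP h; exists (vsproj (so_space J) A); exact: vsprojK. Qed.

Lemma so_mx_lie (x y : so J) : so_mx (lie x y) = mx_comm (so_mx x) (so_mx y).
Proof. exact: so_lieE. Qed.

Lemma so_mx_iter (x y : so J) k :
  so_mx (iter k (lie x) y) = iter k (mx_comm (so_mx x)) (so_mx y).
Proof. by elim: k => //= k <-; rewrite so_mx_lie. Qed.

End Wedge.

Section OddSo.
Variables (K : fieldType) (n : nat).
Local Notation m := n.*2.+1.
Variable (J : 'M[K]_m).
Hypotheses (J_sym : J^T = J) (J_unit : J \in unitmx) (two : 2%:R != 0 :> K).
Implicit Types (X : 'M[K]_m).

(** Comparing determinants in X^T J = - J X gives det X = - det X, since the size is odd. *)
Lemma so_ker X : X^T *m J + J *m X = 0 -> exists2 v : 'cV[K]_m, v != 0 & X *m v = 0.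
Proof.
move/eqP; rewrite addr_eq0 => /eqP/(congr1 determinant).
rewrite -mulNmx !det_mulmx det_tr -scaleN1r detZ -signr_odd /= odd_double /= expr1.
rewrite mulN1r mulNr mulrC => /eqP.
rewrite -subr_eq0 opprK -mulr2n -mulr_natl mulf_eq0 (negPf two) mulf_eq0.
have := J_unit; rewrite unitmxE unitfE => /negPf -> /=; rewrite -det_tr => /det0P[v v0 vX].
by exists v^T; rewrite ?trmx_eq0 // -[X]trmxK -trmx_mul vX trmx0.
Qed.

(** X^k w is a multiple of the kernel vector [v] for every w; the extra power kills that
    multiple. *)
Lemma ad_nilp_mx X k : X^T *m J + J *m X = 0 ->
  (forall A, A \in so_space J -> iter k (mx_comm X) A = 0) -> X ^+ k.+1 = 0.
Proof.
move=> XJ adX; have [v v0 Xv] := so_ker XJ.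
have Xw (w : 'cV_m) : X ^+ k.+1 *m w = 0.
  have := adX _ (wedge_so J_sym v w); rewrite iter_wedge // => /(wedge_eq0 J_unit v0)[c].
  by rewrite -mulmx_exprS -mulmxA => ->; rewrite -scalemxAr Xv scaler0.
exact: mx_eq0_col.
Qed.

(** Skewness gives (w, X w) = 0, so for each w either X w = 0 or w is orthogonal to [v]. A vector
    space is not the union of two proper subspaces, and [v] is not orthogonal to everything. *)
Lemma skew_rank1 X (v : 'cV[K]_m) : X^T *m J + J *m X = 0 -> v != 0 ->
  (forall w : 'cV_m, exists c, X *m w = c *: v) -> X = 0.
Proof.
move=> XJ v0 Xv; pose b (w : 'cV_m) := w^T *m J *m v.
have skew (w : 'cV_m) : w^T *m J *m X *m w = 0.
  set c := LHS; have : c^T = - c.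
    rewrite /c !trmx_mul trmxK J_sym; move/eqP: XJ; rewrite addr_eq0 => /eqP XJ.
    by rewrite !mulmxA -[w^T *m X^T *m J]mulmxA XJ mulmxN mulNmx !mulmxA.
  move/matrixP=> c0; apply/matrixP=> i j; rewrite !ord1 mxE; have /eqP := c0 0 0.
  by rewrite !mxE -subr_eq0 opprK -mulr2n -mulr_natl mulf_eq0 (negPf two) => /eqP.
have dich (w : 'cV_m) : X *m w = 0 \/ b w = 0.
  have [c Xw] := Xv w; have := skew w; rewrite -mulmxA Xw -scalemxAr => /eqP.
  by rewrite scaler_eq0 => /orP[/eqP c0|/eqP h]; [left; rewrite c0 scale0r|right].
apply: mx_eq0_col => w1; have [//|b1] := dich w1; apply/eqP.
have [w2 b2] : exists w2, b w2 != 0.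
  apply: contrapT => /forallNP h; case/eqP: v0.
  have : J *m v = 0.
    rewrite -[J *m v]trmxK -[RHS]trmx0; congr (_^T); apply: mx_eq0_col => w.
    by rewrite -[w]trmxK -trmx_mul mulmxA; have /negP := h w; rewrite negbK /b => /eqP ->;
      rewrite trmx0.
  by move/(congr1 (mulmx (invmx J))); rewrite mulKmx // mulmx0.
have X2 : X *m w2 = 0 by have [//|/eqP] := dich w2; rewrite (negPf b2).
have [|] := dich (w1 + w2); first by rewrite mulmxDr X2 addr0 => /eqP.
rewrite /b linearD /= mulmxDl mulmxDl -/(b w1) -/(b w2) b1 add0r => /eqP.
by rewrite (negPf b2).
Qed.

(** The enlarged list makes the product of the factors x - c an odd polynomial with simple roots.
    Oddness keeps its value at [X] inside so(J), and simple roots turn its vanishing at [X] into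
    diagonalizability. *)
Lemma symmetric_roots (S : seq K) : exists T : seq K,
  uniq (0 :: T ++ map -%R T) /\ {subset S <= 0 :: T ++ map -%R T}.
Proof.
elim: S => [|c S [T [uT sT]]]; first by exists [::].
have [cT|cT] := boolP (c \in 0 :: T ++ map -%R T).
  by exists T; split=> // x; rewrite inE => /predU1P[->|/sT].
exists (c :: T); split; last first.
  move=> x; rewrite inE => /predU1P[->|/sT]; rewrite !inE ?eqxx ?orbT //.
  rewrite !mem_cat /= inE => /or3P[->|->|->]; rewrite ?orbT //.
have /perm_uniq -> : perm_eq (0 :: (c :: T) ++ map -%R (c :: T))
    (c :: - c :: (0 :: T ++ map -%R T)).
  by apply/seq.permP=> p; rewrite /= !count_cat /= ; lia.
have c0 : c != 0 by apply: contraNneq cT => ->; rewrite inE eqxx.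
have cc : c != - c by rewrite -subr_eq0 opprK -mulr2n -mulr_natl mulf_eq0 negb_or two.
rewrite 2!cons_uniq uT andbT inE (negPf cc) /= cT /=.
apply: contra cT; rewrite !inE !mem_cat oppr_eq0 (negPf c0) /= => /orP[h|].
  by apply/orP; right; apply/mapP; exists (- c); rewrite ?opprK.
by rewrite (mem_map oppr_inj) => ->.
Qed.

Lemma horner_mx_skew X (S : seq K) : X^T *m J + J *m X = 0 ->
  (horner_mx X (\prod_(c <- S) ('X - c%:P)))^T *m J =
  (-1) ^+ size S *: (J *m horner_mx X (\prod_(c <- map -%R S) ('X - c%:P))).
Proof.
move/eqP; rewrite addr_eq0 => /eqP XJ.
elim: S => [|c S IH] /=; first by rewrite !big_nil !rmorph1 trmx1 mul1mx mulmx1 scale1r.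
rewrite !big_cons !rmorphM !rmorphB /= !horner_mx_X !horner_mx_C.
set A := X - _; set P := horner_mx X _; set Q := horner_mx X _ in IH *.
have AJ : A^T *m J = - (J *m (X - (- c)%:M)).
  rewrite /A linearB /= tr_scalar_mx mulmxBl XJ mulmxBr mul_scalar_mx mul_mx_scalar.
  by rewrite scaleNr opprK opprD.
rewrite -!mulmxE trmx_mul -mulmxA AJ mulmxN mulmxA IH -scalemxAl -mulmxA exprS mulN1r scaleNr.
congr (- (_ *: (_ *m _))).
have -> : X - (- c)%:M = horner_mx X ('X - (- c)%:P).
  by rewrite rmorphB /= horner_mx_X horner_mx_C.
by rewrite /Q mulmxE -!rmorphM mulrC.
Qed.

(** By the wedge computation, the product of the X - c over the symmetrized list sends every w into
    the line of [v]; it also lies in so(J), so [skew_rank1] makes it zero. The quantification over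
    all lists containing [S] leaves the freedom to symmetrize. *)
Lemma ad_semisimple_mx X (S : seq K) : X^T *m J + J *m X = 0 ->
  (forall (S' : seq K) A, {subset S <= S'} -> A \in so_space J ->
     foldr (fun c A => mx_comm X A - c *: A) A S' = 0) ->
  diagonalizable X.
Proof.
move=> XJ adX; have [v v0 Xv] := so_ker XJ.
have [T [uT ST]] := symmetric_roots S.
set rs := 0 :: _ in uT ST.
apply/diagonalizableP; exists rs => //; apply: mxminpoly_min.
set P := horner_mx X _.
have step S' (w : 'cV_m) : foldr (fun c A => mx_comm X A - c *: A) (wedge J v w) S' =
    wedge J v (horner_mx X (\prod_(c <- S') ('X - c%:P)) *m w).
  elim: S' => [|c S' IH] /=; first by rewrite big_nil rmorph1 mul1mx.
  rewrite IH wedge_comm // Xv big_cons rmorphM rmorphB /= horner_mx_X horner_mx_C.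
  rewrite -mulmxE -mulmxA mulmxBl mul_scalar_mx; set u := _ *m w.
  rewrite /wedge mul0mx trmx0 mulmx0 subrr mul0mx add0r.
  rewrite scalemxAl -mulmxBl; congr (_ *m J).
  have -> : (X *m u - c *: u)^T = (X *m u)^T - c *: u^T by rewrite linearB linearZ.
  rewrite mulmxBr mulmxBl -scalemxAr -scalemxAl scalerBr.
  by apply/matrixP=> i j; rewrite !mxE; ring.
apply: (skew_rank1 _ v0) => [|w].
  have := horner_mx_skew rs XJ; rewrite -/P => ->.
  have -> : \prod_(c <- map -%R rs) ('X - c%:P) = \prod_(c <- rs) ('X - c%:P).
    apply: perm_big; rewrite /rs /= oppr0 perm_cons map_cat -map_comp.
    by rewrite (eq_map (@opprK _)) map_id perm_catC.
  rewrite -/P -signr_odd /rs /= size_cat size_map addnn odd_double /= expr1.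
  by rewrite scaleN1r addNr.
apply: (wedge_eq0 J_unit v0); rewrite -step; apply: adX => //.
exact: wedge_so.
Qed.

End OddSo.

(** * Exponentials of nilpotent matrices *)

Section MatrixExp.
Variables (K : fieldType) (m' : nat).
Local Notation m := m'.+1.
Hypothesis (charK : forall k, k.+1%:R != 0 :> K).
Implicit Types (X A : 'M[K]_m).

Lemma fact_neq0 k : k`!%:R != 0 :> K.
Proof. by case: (k`!) (fact_gt0 k). Qed.

Definition expmx r X : 'M[K]_m := \sum_(i < r) (i`!%:R)^-1 *: X ^+ i.

(** The commutator with [X] is the sum of left multiplication by X and right multiplication by -X,
    which commute, so the binomial formula applies. Both are written as matrices acting on [mxvec]
    in order to compute in a ring. *)
Lemma iter_mx_comm X A k :
  iter k (mx_comm X) A = \sum_(i < k.+1) (X ^+ (k - i) *m A *m (- X) ^+ i) *+ 'C(k, i).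
Proof.
pose L := lin_mulmx X : 'M[K]_(m * m); pose R := lin_mulmxr (- X) : 'M[K]_(m * m).
have LE (B : 'M[K]_m) : mxvec B *m L = mxvec (X *m B) by rewrite mul_vec_lin.
have RE (B : 'M[K]_m) : mxvec B *m R = mxvec (B *m - X) by rewrite mul_vec_lin.
have Lk (B : 'M[K]_m) j : mxvec B *m L ^+ j = mxvec (X ^+ j *m B).
  elim: j => [|j IH]; first by rewrite !expr0 mulmx1 mul1mx.
  by rewrite -mulmx_exprSr mulmxA IH LE mulmxA mulmx_exprS.
have Rk (B : 'M[K]_m) j : mxvec B *m R ^+ j = mxvec (B *m (- X) ^+ j).
  elim: j => [|j IH]; first by rewrite !expr0 !mulmx1.
  by rewrite -mulmx_exprSr mulmxA IH RE -mulmxA mulmx_exprSr.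
have iterE : mxvec (iter k (mx_comm X) A) = mxvec A *m (L + R) ^+ k.
  elim: k => [|k IH] /=; first by rewrite expr0 mulmx1.
  rewrite -mulmx_exprSr mulmxA -IH mulmxDr LE RE -linearD /= mulmxN.
  by [].
have LR : GRing.comm L R.
  rewrite /GRing.comm -!mulmxE; apply/row_matrixP=> i; rewrite !rowE -[delta_mx 0 i]vec_mxK.
  by rewrite !mulmxA !LE !RE LE mulmxA.
apply: (can_inj mxvecK); rewrite iterE exprDn_comm // mulmx_sumr linear_sum /=.
apply: eq_bigr => i _; rewrite -!scaler_nat -scalemxAr linearZ /= -Rk -Lk -mulmxA.
by rewrite mulmxE.
Qed.

(** exp(ad X) is conjugation by exp X. The terms on the left are the coefficients of a product of
    two truncated exponential polynomials, evaluated at 1; what the truncation cuts off contains a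
    vanishing power of [X]. *)
Lemma expmx_conj X A r : X ^+ r = 0 ->
  \sum_(k < r + r) (k`!%:R)^-1 *: iter k (mx_comm X) A = expmx r X *m A *m expmx r (- X).
Proof.
move=> Xr; pose p := \poly_(i < r) ((i`!%:R)^-1 *: X ^+ i *m A).
pose q := \poly_(i < r) ((i`!%:R)^-1 *: (- X) ^+ i).
have Xk k : (r <= k)%N -> X ^+ k = 0 by move=> /subnKC <-; rewrite exprD Xr mul0r.
have p1 : p.[1] = expmx r X *m A.
  by rewrite horner_poly mulmx_suml; apply: eq_bigr => i _; rewrite expr1n mulr1.
have q1 : q.[1] = expmx r (- X).
  by rewrite horner_poly; apply: eq_bigr => i _; rewrite expr1n mulr1.
have <- : (p * q).[1] = expmx r X *m A *m expmx r (- X).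
  by rewrite hornerM_comm ?p1 ?q1 // /comm_poly mulr1 mul1r.
rewrite (@horner_coef_wide _ (r + r)); last first.
  apply: leq_trans (size_polyMleq _ _) _; apply: leq_trans (leq_pred _) _.
  by apply: leq_add; exact: size_poly.
apply: eq_bigr => k _; rewrite expr1n mulr1 coefMr iter_mx_comm scaler_sumr.
apply: eq_bigr => -[i /=]; rewrite ltnS => ik _; rewrite !coef_poly.
case: ltnP => [_|ri]; last first.
  by rewrite Xk // !mul0mx mul0rn scaler0 mul0r.
case: ltnP => [_|ri]; last first.
  by rewrite exprNn (Xk i) // mulr0 mulmx0 mul0rn scaler0 mulr0.
rewrite -scalemxAl -mulmxE -!scalemxAl -scalemxAr !scalerA -scaler_nat scalerA.
congr (_ *: _); rewrite -(bin_fact ik) !natrM.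
have := fact_neq0 i; have := fact_neq0 (k - i).
have : 'C(k, i)%:R != 0 :> K by case: 'C(k, i) (bin_gt0 k i) => //=; rewrite ik.
move=> h1 h2 h3.
rewrite invfM mulrAC (mulVf h1) mul1r invfM.
by move: (i`!%:R^-1) ((k - i)`!%:R^-1) => a b; rewrite mulrC.
Qed.

(** The case A = 1 of [expmx_conj], where all iterated commutators of positive order vanish. *)
Lemma expmx_inv X r : X ^+ r.+1 = 0 -> expmx r.+1 X *m expmx r.+1 (- X) = 1%:M.
Proof.
move=> Xr; have := expmx_conj 1%:M Xr; rewrite mulmx1 => <-.
have z k : iter k.+1 (mx_comm X) 1%:M = 0.
  elim: k => [|k IH]; first by rewrite /= /mx_comm mulmx1 mul1mx subrr.
  by rewrite iterS IH /mx_comm mulmx0 mul0mx subrr.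
rewrite addSn big_ord_recl big1 => [|k _]; last by rewrite z scaler0.
by rewrite addr0 fact0 invr1 scale1r.
Qed.

Lemma expmx_isom (J : 'M[K]_m) X r : X ^+ r.+1 = 0 -> X^T *m J + J *m X = 0 ->
  (expmx r.+1 X)^T *m J *m expmx r.+1 X = J.
Proof.
move=> Xr /eqP; rewrite addr_eq0 -mulmxN => /eqP XJ.
have XJk k : (X ^+ k)^T *m J = J *m (- X) ^+ k.
  elim: k => [|k IH]; first by rewrite !expr0 trmx1 mul1mx mulmx1.
  by rewrite -mulmx_exprSr trmx_mul -mulmxA IH mulmxA XJ -mulmxA mulmx_exprS.
have -> : (expmx r.+1 X)^T *m J = J *m expmx r.+1 (- X).
  rewrite /expmx linear_sum /= mulmx_suml mulmx_sumr; apply: eq_bigr => k _.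
  by rewrite linearZ /= -scalemxAl XJk scalemxAr.
rewrite -mulmxA; have := @expmx_inv (- X) r; rewrite opprK => ->; first by rewrite mulmx1.
by rewrite exprNn Xr mulr0.
Qed.

End MatrixExp.

(** The images of the iterates drop in dimension until they stabilize, and a stable image of a
    nilpotent map is zero. This makes the truncation of [exp_ad] at dim g exact. *)
Lemma nilp_index (K : fieldType) (V : vectType K) (f : 'End(V)) k :
  (forall v, iter k f v = 0) -> forall v, iter (\dim {:V}) f v = 0.
Proof.
move=> fk; pose W i := iter i (fun U : {vspace V} => f @: U)%VS fullv.
have Wv i v : iter i f v \in W i.
  by elim: i => [|i IH]; [exact: memvf|apply: memv_img].
have Wi i u : u \in W i -> exists v, u = iter i f v.
  elim: i u => [|i IH] u; first by exists u.
  by move=> /memv_imgP[w /IH[v ->] ->]; exists v.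
have WS i : (W i.+1 <= W i)%VS.
  by elim: i => [|i IH]; [exact: subvf|apply: limgS].
have step i : (\dim (W i) + i <= \dim {:V})%N \/ W i = 0%VS.
  elim: i => [|i [IH|W0]]; first by left; rewrite addn0.
    have [e|ne] := eqVneq (W i.+1) (W i); last first.
      left; have [le eqi] := dimv_leqif_eq (WS i).
      have lt : (\dim (W i.+1) < \dim (W i))%N by rewrite ltn_neqAle eqi ne.
      by apply: leq_trans IH; rewrite addnS -addSn leq_add2r.
    right; have st j : W (i + j)%N = W i.
      by elim: j => [|j IHj]; rewrite ?addn0 // addnS /= -/(W _) IHj -[RHS]e.
    rewrite e -(st k); apply/eqP; rewrite -subv0; apply/subvP=> u /Wi[v ->].
    by rewrite iterD fk; elim: (i) => [|j IHj]; rewrite ?mem0v //=; move: IHj;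
      rewrite !memv0 => /eqP->; rewrite linear0.
  by right; rewrite /= -/(W i) W0 limg0.
move=> v; apply/eqP; rewrite -memv0; set D := \dim _.
suff <- : W D = 0%VS by exact: Wv.
have [|//] := step D; rewrite -/D -[leqRHS]add0n leq_add2r leqn0 dimv_eq0.
by move/eqP.
Qed.

Lemma sum_ord_stable (V : nmodType) (F : nat -> V) a b :
  (forall k, (a <= k)%N -> F k = 0) -> (a <= b)%N ->
  \sum_(k < b) F k = \sum_(k < a) F k.
Proof.
move=> Fa /subnKC <-; rewrite big_split_ord /= [X in _ + X]big1 ?addr0 // => k _.
by rewrite Fa ?leq_addr.
Qed.

Lemma invmxM (K : fieldType) m (A B : 'M[K]_m) : A \in unitmx -> B \in unitmx ->
  invmx (A *m B) = invmx B *m invmx A.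
Proof.
move=> Au Bu; have ABu : A *m B \in unitmx by rewrite unitmx_mul Au.
by rewrite -[RHS]mul1mx -(mulVmx ABu) -!mulmxA (mulKVmx Bu) mulmxV // mulmx1.
Qed.

(** * Passing between the abstract Lie algebra and matrices *)

Section Transport.
Variables (K : fieldType) (n : nat).
Local Notation m := n.*2.+1.
Variables (J : 'M[K]_m) (g : lieAlgType K).
Variables (psi : {linear so J -> g}) (phi : {linear g -> so J}).
Hypotheses (charK : forall k, k.+1%:R != 0 :> K).
Hypotheses (J_sym : J^T = J) (J_unit : J \in unitmx).
Hypotheses (psiK : cancel psi phi) (phiK : cancel phi psi).
Hypothesis psi_lie : forall x y, psi (lie x y) = lie (psi x) (psi y).
Implicit Types (x y : so J).

Lemma phi_lie u v : phi (lie u v) = lie (phi u) (phi v).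
Proof. by rewrite -{1}[u]phiK -{1}[v]phiK -psi_lie psiK. Qed.

Lemma so_mx_eq0 x : so_mx x = 0 -> x = 0.
Proof. by move=> x0; apply: so_mx_inj; rewrite x0 linear0. Qed.

Lemma dim_centralizer x1 x2 :
  \dim (pair_centralizer (psi x1, psi x2)) = \dim (zforms (so_mx x1) (so_mx x2)).
Proof.
apply/eqP; rewrite eqn_leq; apply/andP; split.
  pose f (u : g) : 'M[K]_m := J *m so_mx (phi u).
  have f_lin : linear f by move=> a u v; rewrite /f !linearP.
  pose fL : {linear g -> 'M[K]_m} := HB.pack f
    (GRing.isSemilinear.Build K g 'M[K]_m *:%R f (GRing.semilinear_linear f_lin)).
  apply: (dim_le_map (f := fL)) => [u|u _ /= /(congr1 (mulmx (invmx J)))]; last first.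
    rewrite /f mulKmx // mulmx0 => /so_mx_eq0 u0.
    by rewrite -[u]phiK u0 linear0.
  rewrite memv_cap !memv_ker !adE /= => /andP[/eqP u1 /eqP u2].
  have inv x : lie (psi x) u = 0 -> (so_mx x)^T *m f u + f u *m so_mx x = 0.
    move/(congr1 phi); rewrite phi_lie psiK linear0 => /(congr1 (@so_mx _ _ _)).
    rewrite so_mx_lie linear0 /mx_comm => /eqP; rewrite subr_eq0 => /eqP c.
    rewrite /f mulmxA; have /eqP := so_mxP x; rewrite addr_eq0 => /eqP ->.
    by rewrite mulNmx -!mulmxA c addNr.
  apply/zformsP; split; try exact: inv.
  by rewrite /= /f trmx_mul J_sym; have /eqP := so_mxP (phi u); rewrite addr_eq0 => /eqP.
pose f (B : 'M[K]_m) : g := psi (vsproj (so_space J) (invmx J *m B)).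
have f_lin : linear f by move=> a A B; rewrite /f mulmxDr -scalemxAr !linearP.
pose fL : {linear 'M[K]_m -> g} := HB.pack f
  (GRing.isSemilinear.Build K 'M[K]_m g *:%R f (GRing.semilinear_linear f_lin)).
have fin B : B^T = - B -> so_mx (vsproj (so_space J) (invmx J *m B)) = invmx J *m B.
  move=> sB; apply: vsprojK; apply/so_spaceP.
  by rewrite trmx_mul trmx_inv J_sym sB mulmxKV // mulKVmx // addNr.
apply: (dim_le_map (f := fL)) => [B|B] /zformsP[sB B1 B2]; last first.
  rewrite /= /f => /(congr1 phi); rewrite psiK linear0 => /(congr1 (@so_mx _ _ _)).
  by rewrite fin // linear0 => /(congr1 (mulmx J)); rewrite mulKVmx // mulmx0.
have inv x : (so_mx x)^T *m B + B *m so_mx x = 0 -> lie (psi x) (f B) = 0.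
  move=> /eqP; rewrite addr_eq0 => /eqP c.
  rewrite /f -psi_lie [lie x _](_ : _ = 0) ?linear0 //; apply: so_mx_eq0.
  have c' : J *m so_mx x = - ((so_mx x)^T *m J).
    by apply/eqP; rewrite -addr_eq0 addrC; apply/eqP/so_mxP.
  rewrite so_mx_lie fin // /mx_comm; apply/eqP; rewrite subr_eq0; apply/eqP.
  rewrite -[LHS](mulKmx J_unit) -mulmxA; congr (_ *m _).
  by rewrite mulmxA c' mulNmx -mulmxA mulKVmx // c opprK.
by rewrite memv_cap !memv_ker !adE /= !inv ?eqxx.
Qed.

Lemma ad_pow_psi x y k : ad_pow (psi x) k (psi y) = psi (iter k (lie x) y).
Proof.
elim: k => [|k IH]; first by rewrite /= id_lfunE.
by rewrite /= comp_lfunE -/(ad_pow _ k) IH adE psi_lie.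
Qed.

Lemma ad_powE (u v : g) k : ad_pow u k v = iter k (ad u) v.
Proof.
elim: k => [|k IH]; first by rewrite /= id_lfunE.
by rewrite /= comp_lfunE -/(ad_pow _ k) IH.
Qed.

Lemma mx_nilp_ad (X A : 'M[K]_m) k : X ^+ k = 0 -> iter (k + k) (mx_comm X) A = 0.
Proof.
move=> Xk; have Xj j : (k <= j)%N -> X ^+ j = 0.
  by move=> /subnKC <-; rewrite exprD Xk mul0r.
rewrite iter_mx_comm big1 // => i _; case: (leqP k i) => ki.
  by rewrite exprNn (Xj i) // mulr0 mulmx0 mul0rn.
by rewrite Xj ?mul0mx ?mul0rn //; lia.
Qed.

Lemma ad_nilpotentP x : ad_nilpotent (psi x) <-> exists k, so_mx x ^+ k = 0.
Proof.
split=> -[k h].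
  exists k.+1; apply: (ad_nilp_mx J_sym J_unit (charK 1) (so_mxP x)) => A.
  move=> /so_spaceP/so_mx_surj[y <-].
  by rewrite -so_mx_iter -[iter _ _ _]psiK -ad_pow_psi h lfunE /= !linear0.
exists (k + k)%N; apply/lfunP=> u; rewrite -[u]phiK ad_pow_psi lfunE /=.
rewrite [iter _ _ _](_ : _ = 0) ?linear0 //; apply: so_mx_eq0.
by rewrite so_mx_iter mx_nilp_ad.
Qed.

Lemma ad_semisimple_diag x : ad_semisimple (psi x) -> diagonalizable (so_mx x).
Proof.
move=> [b [bB bE]].
have [S bS] : exists S : seq K,
    forall v, v \in b -> exists2 c, c \in S & lie (psi x) v = c *: v.
  elim: b bE {bB} => [|v b IH] bE; first by exists [::].
  have [S hS] := IH (fun u ub => bE u (mem_behead (s := v :: b) ub)).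
  have [c vc] := bE v (mem_head _ _); exists (c :: S) => u.
  rewrite inE => /predU1P[->|/hS[d dS ud]]; first by exists c; rewrite ?mem_head.
  by exists d; rewrite // inE dS orbT.
apply: (ad_semisimple_mx J_sym J_unit (charK 1) (S := S) (so_mxP x)) => S' A SS'.
move=> /so_spaceP/so_mx_surj[y <-].
pose G S (u : g) := foldr (fun c u => lie (psi x) u - c *: u) u S.
have G_lin S0 : linear (G S0).
  move=> a u v; elim: S0 => //= c S0 ->; rewrite linearP /= scalerDr !scalerBr !scalerA.
  by rewrite opprD addrACA [c * a]mulrC.
pose GL : {linear g -> g} := HB.pack (G S')
  (GRing.isSemilinear.Build K g g *:%R (G S') (GRing.semilinear_linear (G_lin S'))).
(* [G S'] is a product of operators ad x - c, and [S'] contains the eigenvalue of every vector of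
   the basis [b]. *)
have G0 u : G S' u = 0.
  suff : (fullv <= lker (linfun GL))%VS.
    by move/subvP/(_ u (memvf u)); rewrite memv_ker lfunE => /eqP.
  rewrite -(span_basis bB); apply/span_subvP=> v vb; rewrite memv_ker lfunE /=.
  have [c cS vc] := bS _ vb; have {}cS := SS' _ cS; clear -vc cS.
  have Gv S0 : G S0 v = (\prod_(d <- S0) (c - d)) *: v.
    elim: S0 => [|d S0 IH] /=; first by rewrite big_nil scale1r.
    by rewrite IH linearZ /= vc !scalerA big_cons mulrBl scalerBl [_ * c]mulrC.
  by rewrite Gv (big_rem c) //= subrr mul0r scale0r.
have -> : foldr (fun c A => mx_comm (so_mx x) A - c *: A) (so_mx y) S' =
    so_mx (phi (G S' (psi y))).
  elim: (S') => [|c S0 IH] /=; first by rewrite psiK.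
  rewrite IH (linearB phi) (linearZ_LR phi) (linearB (@so_mx _ _ J)).
  by rewrite (linearZ_LR (@so_mx _ _ J)) phi_lie (psiK x) -so_mx_lie.
by rewrite G0 !linear0.
Qed.

Lemma exp_adE x y r : so_mx x ^+ r.+1 = 0 ->
  so_mx (phi (exp_ad (psi x) (psi y))) =
  expmx r.+1 (so_mx x) *m so_mx y *m expmx r.+1 (- so_mx x).
Proof.
move=> Xr; rewrite -(expmx_conj charK _ Xr).
pose F k := (k`!%:R)^-1 *: iter k (mx_comm (so_mx x)) (so_mx y).
rewrite -/(F _).
have -> : so_mx (phi (exp_ad (psi x) (psi y))) = \sum_(k < (\dim {:g}).+1) F k.
  rewrite /exp_ad sum_lfunE !linear_sum; apply: eq_bigr => k _.
  by rewrite /F scale_lfunE ad_pow_psi !linearZ /= psiK -so_mx_iter.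
have F0 k : (\dim {:g} <= k)%N -> F k = 0.
  move=> /subnKC <-; rewrite /F -so_mx_iter addnC iterD.
  have -> : iter (\dim {:g}) (lie x) y = 0.
    rewrite -[LHS]psiK -ad_pow_psi ad_powE (nilp_index (k := (r.+1 + r.+1))) ?linear0 //.
    move=> v; rewrite -ad_powE -[v]phiK ad_pow_psi.
    by rewrite [iter _ _ _](_ : _ = 0) ?linear0 //; apply: so_mx_eq0; rewrite so_mx_iter
      mx_nilp_ad.
  by rewrite so_mx_iter iter_fix ?linear0 ?scaler0 // /mx_comm mulmx0 mul0mx subrr.
have F1 k : (r.+1 + r.+1 <= k)%N -> F k = 0.
  move=> /subnKC <-; rewrite /F addnC iterD mx_nilp_ad //.
  by rewrite iter_fix ?scaler0 // /mx_comm mulmx0 mul0mx subrr.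
(* One sum stops at dim g, the other at [r.+1 + r.+1]; by [F0] and [F1] each contains all nonzero
   terms, whichever is longer. *)
case: (leqP (\dim {:g}).+1 (r.+1 + r.+1)) => h; last first.
  by apply: sum_ord_stable => //; exact: ltnW.
by apply/esym/sum_ord_stable => // k /ltnW; exact: F0.
Qed.

Lemma isom_unit A : A^T *m J *m A = J -> A \in unitmx.
Proof.
move=> AJ; have := J_unit; rewrite -[J in J \in _]AJ !unitmxE !det_mulmx.
by rewrite !unitfE !mulf_eq0 !negb_or => /andP[_].
Qed.

Lemma adjoint_isom s : adjoint_group s ->
  exists2 A, A^T *m J *m A = J & forall x, so_mx (phi (s (psi x))) = A *m so_mx x *m invmx A.
Proof.
elim=> [|u s' nilu _ [A AJ sA]].
  exists 1%:M; first by rewrite trmx1 mul1mx mulmx1.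
  by move=> x; rewrite id_lfunE psiK mul1mx invmx1 mulmx1.
have [k uk] : exists k, so_mx (phi u) ^+ k = 0 by apply/ad_nilpotentP; rewrite phiK.
have {}uk : so_mx (phi u) ^+ k.+1 = 0 by rewrite exprS uk mulr0.
set X := so_mx (phi u) in uk; set E := expmx k.+1 X.
have EE : E *m expmx k.+1 (- X) = 1%:M := expmx_inv charK uk.
have [Eu EV] : E \in unitmx /\ expmx k.+1 (- X) = invmx E.
  have Eu : E \in unitmx by case/mulmx1_unit: EE.
  by split=> //; rewrite -[RHS]mulmx1 -EE mulKmx.
have Au := isom_unit AJ.
exists (E *m A).
  rewrite trmx_mul -!mulmxA [J *m (E *m A)]mulmxA [E^T *m _]mulmxA [E^T *m _]mulmxA.
  by rewrite (expmx_isom charK uk (so_mxP _)) mulmxA.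
move=> x; rewrite comp_lfunE -{1}[u]phiK -[s' _]phiK (exp_adE _ uk) sA -/X -/E EV.
by rewrite !mulmxA invmxM // !mulmxA.
Qed.

End Transport.

(** * Orthogonal groups and the adjoint group *)

Section Frames.
Variables (K : fieldType) (m : nat) (J : 'M[K]_m).
Hypotheses (J_sym : J^T = J) (J_unit : J \in unitmx) (two : 2%:R != 0 :> K).
Hypothesis sqrtK : forall c : K, exists d, d ^+ 2 = c.
Implicit Types (u v w a b : 'cV[K]_m).

Definition bf u v : K := (u^T *m J *m v) 0 0.

Lemma bfE u v : u^T *m J *m v = (bf u v)%:M.
Proof. by rewrite /bf -mx11_scalar. Qed.

Lemma bfC u v : bf u v = bf v u.
Proof.
rewrite /bf; have <- : (v^T *m J *m u)^T = u^T *m J *m v by rewrite !trmx_mul trmxK J_sym mulmxA.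
by rewrite mxE.
Qed.

Lemma bfDr u v w : bf u (v + w) = bf u v + bf u w.
Proof. by rewrite /bf mulmxDr mxE. Qed.
Lemma bfDl u v w : bf (u + v) w = bf u w + bf v w.
Proof. by rewrite bfC bfDr !(bfC w). Qed.
Lemma bfZr c u v : bf u (c *: v) = c * bf u v.
Proof. by rewrite /bf -scalemxAr mxE. Qed.
Lemma bfZl c u v : bf (c *: u) v = c * bf u v.
Proof. by rewrite bfC bfZr bfC. Qed.
Lemma bfNr u v : bf u (- v) = - bf u v.
Proof. by rewrite -scaleN1r bfZr mulN1r. Qed.
Lemma bfNl u v : bf (- u) v = - bf u v.
Proof. by rewrite -scaleN1r bfZl mulN1r. Qed.
Definition bfl := (bfDr, bfDl, bfNr, bfNl, bfZr, bfZl).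

Lemma mul_bf (p : nat) (x : 'M[K]_(p, 1)) u v : x *m (u^T *m J *m v) = bf u v *: x.
Proof. by rewrite bfE mul_mx_scalar. Qed.

Lemma bf_nondeg u : u != 0 -> exists v, bf u v = 1.
Proof.
move=> u0; apply: contrapT => /forallNP h; case/eqP: u0.
have : u^T *m J = 0.
  apply: mx_eq0_col => v; rewrite bfE [bf u v](_ : _ = 0) ?scalemx0 ?raddf0 //.
  apply/eqP; apply: contrapT => /negP uv; case: (h ((bf u v)^-1 *: v)).
  by rewrite bfZr mulVf.
move/(congr1 (mulmxr (invmx J))); rewrite /= mulmxK // mul0mx => /(congr1 trmx).
by rewrite trmxK trmx0.
Qed.

Lemma frame_ext k (F : 'M[K]_(m, k)) : F^T *m J *m F = 1%:M -> (k < m)%N ->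
  exists2 v, F^T *m J *m v = 0 & bf v v = 1.
Proof.
move=> FF km.
suff [v Fv v0] : exists2 v, F^T *m J *m v = 0 & bf v v != 0.
  have [d d2] := sqrtK (bf v v); have d0 : d != 0 by rewrite -sqrf_eq0 d2.
  exists (d^-1 *: v); first by rewrite -scalemxAr Fv scaler0.
  by rewrite !bfl -d2; field.
have [z z0 Fz] : exists2 z : 'cV_m, z != 0 & F^T *m J *m z = 0.
  have : kermx (J *m F) != 0.
    rewrite kermx_eq0 /row_free neq_ltn; apply/orP; left.
    by apply: leq_ltn_trans (rank_leq_col _) km.
  rewrite -nz_row_eq0 => nz; exists (nz_row (kermx (J *m F)))^T; rewrite ?trmx_eq0 //.
  have /sub_kermxP nzJF := nz_row_sub (kermx (J *m F)).
  have -> : forall z : 'rV_m, F^T *m J *m z^T = (z *m (J *m F))^T.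
    by move=> z; rewrite !trmx_mul J_sym.
  by rewrite nzJF trmx0.
have [zz|] := eqVneq (bf z z) 0; last by exists z.
have [u zu] := bf_nondeg z0.
(* [u'] is the projection of [u] to the orthogonal complement of the frame. If [z] and [u'] are both
   isotropic, then z + u' has square 2. *)
pose u' := u - F *m (F^T *m J *m u).
have Fu' : F^T *m J *m u' = 0.
  by rewrite /u' mulmxBr [F^T *m J *m (F *m _)]mulmxA FF mul1mx subrr.
have zu' : bf z u' = 1.
  rewrite /u' bfDr bfNr zu /bf mulmxA.
  have -> : z^T *m J *m F = (F^T *m J *m z)^T by rewrite !trmx_mul trmxK J_sym mulmxA.
  by rewrite Fz trmx0 mul0mx mxE subr0.
clearbody u'; have [uu|] := eqVneq (bf u' u') 0; last by exists u'.
exists (z + u'); first by rewrite mulmxDr Fz Fu' addr0.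
by rewrite !bfl zz uu (bfC u') zu' add0r addr0.
Qed.

Lemma frame_row k (F : 'M[K]_(m, k)) v : F^T *m J *m F = 1%:M ->
  F^T *m J *m v = 0 -> bf v v = 1 -> (row_mx F v)^T *m J *m row_mx F v = 1%:M.
Proof.
move=> FF Fv vv; rewrite tr_row_mx mul_col_mx mul_col_row FF Fv bfE vv.
have -> : v^T *m J *m F = (F^T *m J *m v)^T by rewrite !trmx_mul trmxK J_sym mulmxA.
by rewrite Fv trmx0 -scalar_mx_block.
Qed.

Lemma frame_exists k : (k <= m)%N -> exists F : 'M[K]_(m, k), F^T *m J *m F = 1%:M.
Proof.
elim: k => [|k IH] km; first by exists 0; apply/matrixP=> -[].
have [F FF] := IH (ltnW km); have [v Fv vv] := frame_ext FF km.
by rewrite -addn1; exists (row_mx F v); exact: frame_row.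
Qed.

Lemma symmetric_cong1 : exists2 S : 'M[K]_m, S \in unitmx & S^T *m J *m S = 1%:M.
Proof.
have [S SS] := frame_exists (leqnn m); exists S => //.
by case/mulmx1_unit: SS.
Qed.

Definition isom (A : 'M[K]_m) := A^T *m J *m A = J.

Lemma isom1 : isom 1%:M.
Proof. by rewrite /isom trmx1 mul1mx mulmx1. Qed.

Lemma isom_inU A : isom A -> A \in unitmx.
Proof.
rewrite /isom => AJ; have := J_unit; rewrite -[J in J \in _]AJ !unitmxE !det_mulmx.
by rewrite !unitfE !mulf_eq0 !negb_or => /andP[_].
Qed.

Lemma isomM A B : isom A -> isom B -> isom (A *m B).
Proof.
by rewrite /isom => AJ BJ; rewrite trmx_mul -[RHS]BJ -[in RHS]AJ !mulmxA.
Qed.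

Lemma bf_isom A u v : isom A -> bf (A *m u) (A *m v) = bf u v.
Proof. by move=> AJ; rewrite /bf -[in RHS]AJ trmx_mul !mulmxA. Qed.

Definition refl a : 'M[K]_m := 1%:M - 2%:R *: (a *m (a^T *m J)).

Lemma reflE a v : refl a *m v = v - (2%:R * bf a v) *: a.
Proof.
by rewrite /refl mulmxBl mul1mx -scalemxAl -mulmxA mul_bf scalerA.
Qed.

Lemma refl_invol a : bf a a = 1 -> refl a *m refl a = 1%:M.
Proof.
move=> aa; apply/eqP; rewrite -subr_eq0; apply/eqP; apply: mx_eq0_col => v.
rewrite mulmxBl -mulmxA !reflE mul1mx !bfl aa.
by apply/matrixP=> i j; rewrite !mxE; ring.
Qed.

Lemma refl_isom a : bf a a = 1 -> isom (refl a).
Proof.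
move=> aa; rewrite /isom.
have -> : (refl a)^T *m J = J *m refl a.
  rewrite /refl linearB linearZ /= trmx1 !trmx_mul trmxK J_sym mulmxBl mulmxBr mul1mx mulmx1.
  by rewrite -scalemxAl -scalemxAr !mulmxA.
by rewrite -mulmxA refl_invol // mulmx1.
Qed.

Lemma refl_conj A a : isom A -> refl (A *m a) = A *m refl a *m invmx A.
Proof.
move=> AJ; have Au := isom_inU AJ.
rewrite /refl mulmxBr mulmx1 mulmxBl mulmxV // -scalemxAr -scalemxAl; congr (_ - _ *: _).
have AJ' : A^T *m J = J *m invmx A by rewrite -[in RHS]AJ mulmxK.
by rewrite trmx_mul -!mulmxA AJ'.
Qed.

Lemma reflN a : refl (- a) = refl a.
Proof.
have aT : (- a)^T = - a^T by rewrite linearN.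
by rewrite /refl aT !mulNmx mulmxN opprK.
Qed.

Inductive refl_prod : nat -> 'M[K]_m -> Prop :=
| ReflProd0 : refl_prod 0 1%:M
| ReflProdS k a A : bf a a = 1 -> refl_prod k A -> refl_prod k.+1 (refl a *m A).

Lemma refl_prod_opp1 : refl_prod m (- 1%:M).
Proof.
have [F FF FR] : exists2 F : 'M[K]_(m, m), F^T *m J *m F = 1%:M &
    refl_prod m (1%:M - 2%:R *: (F *m (F^T *m J))).
  suff : forall k, (k <= m)%N -> exists2 F : 'M[K]_(m, k), F^T *m J *m F = 1%:M &
      refl_prod k (1%:M - 2%:R *: (F *m (F^T *m J))) by apply.
  elim=> [|k IH] km.
    exists 0; first by apply/matrixP=> -[].
    by rewrite mul0mx scaler0 subr0; exact: ReflProd0.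
  have [F FF FR] := IH (ltnW km); have [v Fv vv] := frame_ext FF km.
  have FvR : 1%:M - 2%:R *: (row_mx F v *m ((row_mx F v)^T *m J)) =
      refl v *m (1%:M - 2%:R *: (F *m (F^T *m J))).
    rewrite tr_row_mx mul_col_mx mul_row_col scalerDr opprD addrA.
    rewrite [RHS]mulmxBr mulmx1 -scalemxAr.
    rewrite [refl v *m (F *m _)](_ : _ = F *m (F^T *m J)); last first.
      rewrite /refl mulmxBl mul1mx -scalemxAl -[v *m _ *m _]mulmxA !mulmxA.
      rewrite -[v *m v^T *m J]mulmxA -[v *m _ *m F]mulmxA.
      have -> : v^T *m J *m F = (F^T *m J *m v)^T by rewrite !trmx_mul trmxK J_sym mulmxA.
      by rewrite Fv trmx0 mulmx0 !mul0mx scaler0 subr0.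
    by rewrite addrAC.
  rewrite -addn1; exists (row_mx F v); first exact: frame_row.
  by rewrite FvR addn1; exact: ReflProdS.
have : F *m (F^T *m J) = 1%:M by apply: mulmx1C; rewrite FF.
move=> e; move: FR; rewrite e.
rewrite (_ : _ - _ = - 1%:M) //.
by apply/matrixP=> i j; rewrite !mxE; ring.
Qed.

(** Cartan-Dieudonne, by enlarging an orthonormal frame fixed by the isometry. The image u of a new
    frame vector v returns to v by the reflection along u - v or, when that vector is isotropic, by
    the reflections along u + v and then v. The squares of u - v and u + v add up to 4, so one of
    them is nonzero. *)
Lemma isom_refl_prod A : isom A -> exists k, refl_prod k A.
Proof.
suff H : forall d k (F : 'M[K]_(m, k)) A, (k + d = m)%N -> F^T *m J *m F = 1%:M ->
    isom A -> A *m F = F -> exists k, refl_prod k A.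
  move=> AJ; apply: (H m 0%N 0 A) => //; first by apply/matrixP=> -[].
  by rewrite mulmx0.
elim=> [|d IH] k F B kd FF BJ BF.
  exists 0%N; rewrite addn0 in kd; move: F FF BF; rewrite kd => F FF BF.
  have Fu : F \in unitmx by case/mulmx1_unit: FF.
  by rewrite -[B](mulmxK Fu) BF mulmxV //; exact: ReflProd0.
have km : (k < m)%N by lia.
have [v Fv vv] := frame_ext FF km.
pose u := B *m v.
have uu : bf u u = 1 by rewrite bf_isom.
have Fu : F^T *m J *m u = 0.
  rewrite /u -{1}BF trmx_mul -Fv -!mulmxA (mulmxA J) (mulmxA B^T) (mulmxA B^T) BJ.
  by rewrite !mulmxA.
have fixF a : F^T *m J *m a = 0 -> refl a *m F = F.
  move=> Fa; rewrite /refl mulmxBl mul1mx -scalemxAl -!mulmxA.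
  have -> : a^T *m (J *m F) = (F^T *m J *m a)^T by rewrite !trmx_mul trmxK J_sym.
  by rewrite Fa trmx0 mulmx0 scaler0 subr0.
have kd' : (k + 1 + d = m)%N by lia.
have finish (C : 'M[K]_m) : isom C -> C *m F = F -> C *m u = v -> exists k, refl_prod k (C *m B).
  move=> CJ CF Cu; apply: (IH _ (row_mx F v) _ kd').
  - exact: frame_row.
  - exact: isomM.
  - by rewrite mul_mx_row -!mulmxA BF CF -/u Cu.
have unit_of (a : 'cV_m) : F^T *m J *m a = 0 -> bf a a != 0 ->
    exists2 c, c != 0 & bf (c *: a) (c *: a) = 1.
  move=> _ aa; have [e e2] := sqrtK (bf a a); have e0 : e != 0 by rewrite -sqrf_eq0 e2.
  by exists e^-1; rewrite ?invr_eq0 // !bfl -e2; field.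
have [uv|uv] := eqVneq (bf (u - v) (u - v)) 0; last first.
  have Fuv : F^T *m J *m (u - v) = 0 by rewrite mulmxBr Fu Fv subrr.
  have [c c0 cc] := unit_of _ Fuv uv.
  set a := c *: (u - v) in cc.
  have Fa : F^T *m J *m a = 0 by rewrite -scalemxAr Fuv scaler0.
  have [j RB] : exists k, refl_prod k (refl a *m B).
    apply: finish; [exact: refl_isom|exact: fixF|].
    have e : 2%:R * bf a u * c = 1.
      by rewrite -[RHS]cc /a !bfl uu vv (bfC v u); ring.
    by rewrite reflE /a scalerA e scale1r opprB addrC subrK.
  by exists j.+1; rewrite -[B]mul1mx -(refl_invol cc) -mulmxA; exact: ReflProdS.
have uv' : bf (u + v) (u + v) != 0.
  have : bf (u + v) (u + v) = 2%:R * 2%:R.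
    rewrite -[LHS]addr0 -[X in _ + X]uv !bfl uu vv (bfC v u); ring.
  by move=> ->; rewrite mulf_neq0.
have Fuv : F^T *m J *m (u + v) = 0 by rewrite mulmxDr Fu Fv addr0.
have [c c0 cc] := unit_of _ Fuv uv'.
set a := c *: (u + v) in cc.
have Fa : F^T *m J *m a = 0 by rewrite -scalemxAr Fuv scaler0.
have [j RB] : exists k, refl_prod k (refl v *m refl a *m B).
  apply: finish.
  - by apply: isomM; apply: refl_isom.
  - by rewrite -mulmxA !fixF.
  have e : 2%:R * bf a u * c = 1.
    by rewrite -[RHS]cc /a !bfl uu vv (bfC v u); ring.
  rewrite -mulmxA (reflE a u) /a scalerA e scale1r opprD addrA subrr add0r mulmxN reflE vv.
  by rewrite mulr1 -[2%:R]/(1 + 1) scalerDl scale1r opprB addrK.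
exists j.+2; rewrite -[B]mul1mx -(refl_invol cc) -mulmxA; apply: ReflProdS => //.
by rewrite -[_ *m B]mul1mx -(refl_invol vv) -mulmxA; apply: ReflProdS => //; rewrite mulmxA.
Qed.

End Frames.

(** * Isometries modulo exponentials of nilpotents *)

Section ExpGroup.
Variables (K : fieldType) (m' : nat).
Local Notation m := m'.+1.
Variable (J : 'M[K]_m).
Hypotheses (charK : forall k, k.+1%:R != 0 :> K).
Hypotheses (J_sym : J^T = J) (J_unit : J \in unitmx) (m_ge3 : (2 < m)%N).
Hypothesis sqrtK : forall c : K, exists d, d ^+ 2 = c.
Implicit Types (A E : 'M[K]_m) (a b : 'cV[K]_m).
Local Notation bf := (bf J).
Local Notation isom := (isom J).
Local Notation refl := (refl J).

Inductive exp_grp : 'M[K]_m -> Prop :=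
| ExpGrp1 : exp_grp 1%:M
| ExpGrpS (X : 'M[K]_m) r A : X^T *m J + J *m X = 0 -> X ^+ r.+1 = 0 -> exp_grp A ->
    exp_grp (expmx r.+1 X *m A).

Lemma exp_grp_isom A : exp_grp A -> isom A.
Proof.
elim=> [|X r A' XJ Xr _ IH]; first exact: isom1.
by apply: isomM => //; exact: expmx_isom.
Qed.

Lemma exp_grpM A B : exp_grp A -> exp_grp B -> exp_grp (A *m B).
Proof.
move=> + GB; elim=> [|X r A' XJ Xr _ IH]; first by rewrite mul1mx.
by rewrite -mulmxA; exact: ExpGrpS.
Qed.

Lemma so_opp (X : 'M[K]_m) : X^T *m J + J *m X = 0 -> (- X)^T *m J + J *m (- X) = 0.
Proof. by move=> XJ; rewrite linearN /= mulNmx mulmxN -opprD XJ oppr0. Qed.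

Lemma expr0_opp (X : 'M[K]_m) r : X ^+ r = 0 -> (- X) ^+ r = 0.
Proof. by move=> Xr; rewrite exprNn Xr mulr0. Qed.

Lemma exp_grpV A : exp_grp A -> exp_grp (invmx A).
Proof.
elim=> [|X r A' XJ Xr GA IH]; first by rewrite invmx1; exact: ExpGrp1.
have EE := expmx_inv charK Xr; have [Eu _] := mulmx1_unit EE.
rewrite invmxM ?(isom_inU J_unit (exp_grp_isom GA)) //; apply: exp_grpM => //.
rewrite -[invmx _]mulmx1 -EE mulKmx // -[expmx _ _]mulmx1.
by apply: ExpGrpS; [exact: so_opp|exact: expr0_opp|exact: ExpGrp1].
Qed.

Lemma conjmx_expr (O X : 'M[K]_m) k : O \in unitmx -> (O *m X *m invmx O) ^+ k = O *m X ^+ k *m invmx O.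
Proof.
move=> Ou; elim: k => [|k IH]; first by rewrite !expr0 mulmx1 mulmxV.
by rewrite -!mulmx_exprS IH !mulmxA mulmxKV.
Qed.

Lemma conjmx_so (O X : 'M[K]_m) : isom O -> X^T *m J + J *m X = 0 ->
  (O *m X *m invmx O)^T *m J + J *m (O *m X *m invmx O) = 0.
Proof.
move=> OJ XJ; have Ou := isom_inU J_unit OJ.
have OtJ : O^T *m J = J *m invmx O by rewrite -[in RHS]OJ mulmxK.
have JO : J *m O = (invmx O)^T *m J.
  by rewrite -[in RHS]OJ !mulmxA -trmx_mul mulmxV // trmx1 mul1mx.
rewrite !trmx_mul -!mulmxA OtJ !mulmxA JO -[_ *m X^T *m J]mulmxA -[_ *m J *m X]mulmxA.
by rewrite -mulmxDl -mulmxDr XJ mulmx0 mul0mx.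
Qed.

Lemma exp_grp_conj O A : isom O -> exp_grp A -> exp_grp (O *m A *m invmx O).
Proof.
move=> OJ; have Ou := isom_inU J_unit OJ.
elim=> [|X r A' XJ Xr _ IH]; first by rewrite mulmx1 mulmxV //; exact: ExpGrp1.
have -> : O *m (expmx r.+1 X *m A') *m invmx O =
   expmx r.+1 (O *m X *m invmx O) *m (O *m A' *m invmx O).
  have -> : expmx r.+1 (O *m X *m invmx O) = O *m expmx r.+1 X *m invmx O.
    rewrite /expmx mulmx_sumr mulmx_suml; apply: eq_bigr => k _.
    by rewrite conjmx_expr // -scalemxAr -scalemxAl.
  by rewrite !mulmxA mulmxKV.
apply: ExpGrpS => //; first exact: conjmx_so.
by rewrite conjmx_expr // Xr mulmx0 mul0mx.
Qed.

(* The transformation is exp of the wedge of a and the isotropic vector b - a. *)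
Lemma exp_grp_move a b : bf a a = 1 -> bf b b = 1 -> bf a b = 1 ->
  exists2 E, exp_grp E & E *m a = b.
Proof.
move=> aa bb ab; pose u := b - a; pose X := wedge J (- a) u.
have XE v : X *m v = bf a v *: u - bf u v *: a.
  rewrite /X /wedge -mulmxA mulmxBl -!mulmxA.
  rewrite !(mulmxA _ J) !mul_bf bfNl // scalerN scaleNr.
  by rewrite opprK addrC.
have uu : bf u u = 0 by rewrite /u !bfl // aa bb ab bfC // ab; ring.
have au : bf a u = 0 by rewrite /u !bfl // aa ab subrr.
have Xa : X *m a = u by rewrite XE aa bfC // au scale1r scale0r subr0.
have Xu : X *m u = 0 by rewrite XE au uu !scale0r subrr.
have XJ : X^T *m J + J *m X = 0 by apply/so_spaceP; exact: wedge_so.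
have X3 : X ^+ 3 = 0.
  have -> : X ^+ 3 = X *m (X *m X) by rewrite !mulmxE -expr2 -exprS.
  apply: mx_eq0_col => v; rewrite -2!mulmxA (XE v).
  by rewrite mulmxBr -!scalemxAr Xu Xa scaler0 sub0r mulmxN -scalemxAr Xu scaler0 oppr0.
exists (expmx 3 X *m 1%:M); first by apply: ExpGrpS => //; exact: ExpGrp1.
rewrite mulmx1 /expmx !big_ord_recl big_ord0 addr0 /= !mulmxDl -!scalemxAl.
rewrite expr0 expr1 mul1mx expr2 -mulmxE -mulmxA Xa Xu scaler0 addr0 invr1 !scale1r.
by rewrite /u addrC subrK.
Qed.

(** If (a, b) = 1 a single exponential suffices, and (a, b) = -1 is the same case for -b. Otherwise
    a is moved to w and w to b, where w = t(a + b) + r z is a unit vector having product 1 with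
    both: this forces t = 1/(1 + c) and r^2 = 1 - 2t. The unit vector z orthogonal to a and b is
    where dimension at least 3 enters. *)
Lemma exp_grp_trans a b : bf a a = 1 -> bf b b = 1 ->
  exists2 E, exp_grp E & E *m a = b \/ E *m a = - b.
Proof.
move=> aa bb; set c := bf a b.
have [c1|c1] := eqVneq c 1.
  by have [E GE Ea] := exp_grp_move aa bb c1; exists E => //; left.
have [cN1|cN1] := eqVneq c (- 1).
  have nn : bf (- b) (- b) = 1 by rewrite !bfl // bb opprK.
  have an : bf a (- b) = 1 by rewrite bfl // -/c cN1 opprK.
  by have [E GE Ea] := exp_grp_move aa nn an; exists E => //; right.
have d1 : 1 - c != 0 by rewrite subr_eq0 eq_sym.
have d2 : 1 + c != 0 by rewrite addrC addr_eq0.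
have [e e2] := sqrtK (1 - c ^+ 2).
have e0 : e != 0 by rewrite -sqrf_eq0 e2 -[1](expr1n _ 2) subr_sqr mulf_neq0.
pose b' := e^-1 *: (b - c *: a).
have ab' : bf a b' = 0 by rewrite /b' !bfl // aa -/c mulr1 subrr mulr0.
have bb' : bf b' b' = 1.
  rewrite /b' !bfl // (bfC J_sym b a) -/c aa bb.
  by transitivity (e^-1 * (e^-1 * (1 - c ^+ 2))); [ring|rewrite -e2; field].
have [z Fz zz] : exists2 z, (row_mx a b')^T *m J *m z = 0 & bf z z = 1.
  apply: frame_ext => //; try exact: charK.
  rewrite tr_row_mx mul_col_mx mul_col_row !bfE ab' aa bfC // ab' bb'.
  by rewrite !raddf0 -scalar_mx_block.
have [za zb] : bf a z = 0 /\ bf b z = 0.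
  move: Fz; rewrite tr_row_mx !mul_col_mx !bfE -col_mx0 => /eq_col_mx[h1 h2].
  have e1 : bf a z = 0 by move/matrixP: h1 => /(_ 0 0); rewrite !mxE.
  have e3 : bf b' z = 0 by move/matrixP: h2 => /(_ 0 0); rewrite !mxE.
  split=> //; move/eqP: e3; rewrite /b' !bfl // e1 mulr0 subr0 mulf_eq0 invr_eq0 (negPf e0).
  by move/eqP.
pose t := (1 + c)^-1; have [r r2] := sqrtK (1 - 2%:R * t).
pose w := t *: (a + b) + r *: z.
have ww : bf w w = 1.
  rewrite /w !bfl // (bfC J_sym z a) (bfC J_sym z b) (bfC J_sym b a) za zb zz -/c aa bb.
  transitivity (2%:R * t * t * (1 + c) + r ^+ 2); first by ring.
  by rewrite r2 /t; field.
have aw : bf a w = 1 by rewrite /w !bfl // za aa -/c /t; field.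
have wb : bf w b = 1.
  by rewrite /w !bfl // (bfC J_sym z b) zb bb -/c /t; field.
have [E1 G1 Ea] := exp_grp_move aa ww aw.
have [E2 G2 Ew] := exp_grp_move ww bb wb.
exists (E2 *m E1); first exact: exp_grpM.
by left; rewrite -mulmxA Ea.
Qed.

(** An exponential product moving a to b or -b conjugates one reflection into the other, and such
    products form a normal subgroup of the isometries; so all reflections agree modulo that
    subgroup. *)
Lemma refl_mod a b : bf a a = 1 -> bf b b = 1 ->
  exists2 E, exp_grp E & refl b = E *m refl a.
Proof.
move=> aa bb; have [E GE Ea] := exp_grp_trans aa bb.
have rb : refl b = E *m refl a *m invmx E.
  rewrite -refl_conj //; last exact: exp_grp_isom.
  by case: Ea => ->; rewrite ?reflN.
have ra := refl_isom J_sym aa; have r2 := refl_invol aa.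
have rV : invmx (refl a) = refl a.
  by rewrite -[RHS](mulKmx (isom_inU J_unit ra)) r2 mulmx1.
exists (E *m (refl a *m invmx E *m invmx (refl a))).
  by apply: exp_grpM => //; apply: exp_grp_conj => //; exact: exp_grpV.
by rewrite rb rV -!mulmxA r2 mulmx1.
Qed.

Lemma refl_prod_mod a k A : bf a a = 1 -> refl_prod J k A ->
  exists2 E, exp_grp E & A = if odd k then E *m refl a else E.
Proof.
move=> aa; have ra := refl_isom J_sym aa; have r2 := refl_invol aa.
have rV : invmx (refl a) = refl a.
  by rewrite -[RHS](mulKmx (isom_inU J_unit ra)) r2 mulmx1.
elim=> [|j b B bb _ [E GE ->]] /=; first by exists 1%:M => //; exact: ExpGrp1.
have [F GF ->] := refl_mod aa bb.
have GE' : exp_grp (F *m (refl a *m E *m refl a)).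
  by apply: exp_grpM => //; rewrite -[X in _ *m X]rV; exact: exp_grp_conj.
exists (F *m (refl a *m E *m refl a)) => //.
by case: (odd j) => /=; rewrite -!mulmxA ?r2 ?mulmx1.
Qed.

(** Modulo exponentials an isometry is 1 or one fixed reflection, by the parity of its number of
    reflection factors. In odd dimension -1 lies in the class of the reflection, so a sign corrects
    the parity. *)
Lemma isom_exp_grp A : odd m -> isom A -> exp_grp A \/ exp_grp (- A).
Proof.
move=> m_odd AJ; have [k RA] := isom_refl_prod J_sym J_unit (charK 1) sqrtK AJ.
have F0 : (0 : 'M[K]_(m, 0))^T *m J *m 0 = 1%:M by apply/matrixP=> -[].
have [a _ aa] := frame_ext J_sym J_unit (charK 1) sqrtK F0 isT.
have r2 := refl_invol aa; have ra := refl_isom J_sym aa.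
have rV : invmx (refl a) = refl a.
  by rewrite -[RHS](mulKmx (isom_inU J_unit ra)) r2 mulmx1.
have [E GE] := refl_prod_mod aa RA.
have [F GF] := refl_prod_mod aa (refl_prod_opp1 J_sym J_unit (charK 1) sqrtK).
rewrite m_odd => F1; case: (odd k) => AE; [right|by left; rewrite AE].
have -> : - A = F *m (refl a *m E *m refl a).
  by rewrite -[A]mul1mx -mulNmx F1 AE !mulmxA.
by apply: exp_grpM => //; rewrite -[X in _ *m X]rV; exact: exp_grp_conj.
Qed.

End ExpGroup.

Section Adjoint.
Variables (K : fieldType) (n : nat).
Local Notation m := n.*2.+1.
Variables (J : 'M[K]_m) (g : lieAlgType K).
Variables (psi : {linear so J -> g}) (phi : {linear g -> so J}).
Hypotheses (charK : forall k, k.+1%:R != 0 :> K).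
Hypotheses (J_sym : J^T = J) (J_unit : J \in unitmx) (n_gt0 : (0 < n)%N).
Hypothesis sqrtK : forall c : K, exists d, d ^+ 2 = c.
Hypotheses (psiK : cancel psi phi) (phiK : cancel phi psi).
Hypothesis psi_lie : forall x y, psi (lie x y) = lie (psi x) (psi y).

Lemma exp_grp_adjoint A : exp_grp J A -> exists2 s, adjoint_group s &
  forall x, so_mx (phi (s (psi x))) = A *m so_mx x *m invmx A.
Proof.
elim=> [|X r A' XJ Xr GA [s Gs sA]].
  exists \1%VF => [|x]; first exact: AdjointId.
  by rewrite id_lfunE psiK mul1mx invmx1 mulmx1.
have [x0 x0X] := so_mx_surj XJ; rewrite -x0X in Xr *.
have nx : ad_nilpotent (psi x0) by apply/ad_nilpotentP => //; exists r.+1.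
exists (exp_ad (psi x0) \o s)%VF; first exact: AdjointExp.
have EE := expmx_inv charK Xr; have [Eu _] := mulmx1_unit EE.
have Au := isom_inU J_unit (exp_grp_isom charK GA).
move=> x; rewrite comp_lfunE -[s _]phiK (exp_adE charK J_unit psiK phiK psi_lie _ Xr) sA invmxM // !mulmxA.
by rewrite -[expmx _ (- _)](mulKmx Eu) EE mulmx1.
Qed.

Lemma isom_adjoint A : isom J A -> exists2 s, adjoint_group s &
  forall x, so_mx (phi (s (psi x))) = A *m so_mx x *m invmx A.
Proof.
move=> AJ; have Au := isom_inU J_unit AJ.
have [||/exp_grp_adjoint//|/exp_grp_adjoint[s Gs sA]] := isom_exp_grp charK J_sym J_unit _ sqrtK _ AJ.
- by have := n_gt0; rewrite -muln2; lia.
- by rewrite /= odd_double.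
exists s => // x; rewrite sA -scaleN1r invmxZ ?unitmxZ ?unitrN1 // invrN1.
by rewrite !scaleN1r !mulNmx mulmxN opprK.
Qed.

Lemma conjugacy_classE x1 x2 (f : g * g) : conjugacy_class (psi x1, psi x2) f <->
  exists2 A, isom J A & (so_mx (phi f.1) = A *m so_mx x1 *m invmx A /\
                         so_mx (phi f.2) = A *m so_mx x2 *m invmx A).
Proof.
split=> [[s Gs ->]|[A AJ [f1 f2]]] /=.
  by have [A AJ sA] := adjoint_isom charK J_sym J_unit psiK phiK psi_lie Gs; exists A.
have [s Gs sA] := isom_adjoint AJ; exists s => //.
by case: f f1 f2 => f1 f2 /=; rewrite -!sA => /so_mx_inj/(can_inj phiK)-> /so_mx_inj/(can_inj phiK)->.
Qed.

End Adjoint.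

(** * The rank of so(J) *)

Section Generic.
Variable (K : fieldType).

(** Semicontinuity of the rank along a line: the polynomial is det(A(t) Q) for a right inverse Q of
    A(t0). *)
Lemma poly_row_free r q (A : 'M[{poly K}]_(r, q)) t0 :
  row_free (map_mx (horner_eval t0) A) ->
  exists2 p : {poly K}, p != 0 &
    forall t, p.[t] != 0 -> row_free (map_mx (horner_eval t) A).
Proof.
move=> /row_freeP[Q AQ]; pose p := \det (A *m map_mx polyC Q).
have pt t : p.[t] = \det (map_mx (horner_eval t) A *m Q).
  rewrite -[LHS]/(horner_eval t p) -det_map_mx map_mxM -map_mx_comp; congr (\det (_ *m _)).
  by apply/matrixP=> i j; rewrite !mxE /= /horner_eval hornerC.
exists p => [|t pt0].
  by apply/eqP=> p0; have := pt t0; rewrite p0 AQ det1 horner0 => /eqP; rewrite eq_sym oner_eq0.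
have u : map_mx (horner_eval t) A *m Q \in unitmx by rewrite unitmxE unitfE -pt.
by apply/row_freeP; exists (Q *m invmx (map_mx (horner_eval t) A *m Q)); rewrite mulmxA mulmxV.
Qed.

Hypothesis charK : forall k, k.+1%:R != 0 :> K.

Lemma natr_inj0 : injective (fun k : nat => k%:R : K).
Proof.
have H i j : (i < j)%N -> i%:R != j%:R :> K.
  move=> ij; rewrite -(subnK (ltnW ij)) natrD eq_sym -subr_eq0 addrK.
  by move: ij; rewrite -subn_gt0; case: (j - i)%N.
by move=> i j /= e; apply/eqP; case: ltngtP => // /H; rewrite e eqxx.
Qed.

Lemma poly_nonroot (p : {poly K}) : p != 0 -> exists t, p.[t] != 0.
Proof.
move=> p0; apply: contrapT => /forallNP h.
pose rs := [seq k%:R : K | k <- iota 0 (size p)].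
have := max_poly_roots p0 (rs := rs); rewrite /rs size_map size_iota ltnn => H.
suff : false by []. apply: H.
  by apply/allP=> _ /mapP[k _ ->]; rewrite rootE; have /negP := h k%:R; rewrite negbK.
by rewrite map_inj_uniq ?iota_uniq //; exact: natr_inj0.
Qed.

End Generic.

Section OddPowers.
Variables (K : fieldType) (n : nat).
Local Notation m := n.*2.+1.
Hypothesis charK : forall k, k.+1%:R != 0 :> K.
Implicit Types (J X : 'M[K]_m).

Lemma row_free_dim r (U : {vspace 'M[K]_m}) (G : {linear 'M[K]_m -> 'M[K]_m})
    (h : 'I_r -> 'M[K]_m) (A : 'M[K]_(r, m * m)) :
  injective G -> (forall i, row i A = mxvec (h i)) -> row_free A ->
  (forall i, G (h i) \in U) -> (r <= \dim U)%N.
Proof.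
move=> Ginj rA fA GU; pose F (v : 'rV[K]_r) := G (\sum_i v 0 i *: h i).
have F_lin : linear F.
  move=> a v w; rewrite /F -linearP; congr (G _); rewrite scaler_sumr -big_split.
  by apply: eq_bigr => i _; rewrite !mxE scalerDl scalerA.
pose FL : {linear 'rV[K]_r -> 'M[K]_m} := HB.pack F
  (GRing.isSemilinear.Build K 'rV[K]_r 'M[K]_m *:%R F (GRing.semilinear_linear F_lin)).
suff : (\dim (fullv : {vspace 'rV[K]_r}) <= \dim U)%N.
  by rewrite dimvf /dim /= mul1n.
apply: (dim_le_map (f := FL)) => [v _|v _ /=].
  by rewrite /= /F linear_sum; apply: memv_suml => i _; rewrite linearZ /= memvZ.
rewrite /F => /eqP; rewrite raddf_eq0 // => /eqP s0.
apply: (row_free_inj fA); rewrite mul0mx mulmx_sum_row -[RHS](linear0 mxvec) -s0 linear_sum.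
by apply: eq_bigr => i _; rewrite rA linearZ.
Qed.

(** On the line from [X] to [X0], for all but finitely many t the rank of the action is at least its
    rank at [X], while the n odd powers of X + tD are independent and, multiplied by [J], give n
    invariant forms. Rank-nullity then bounds the kernel at [X] from below. *)
Lemma actm_rank_rows J X X0 : J^T = J -> J \in unitmx ->
  X^T *m J + J *m X = 0 -> X0^T *m J + J *m X0 = 0 ->
  (forall c : 'rV[K]_n, \sum_(i < n) c 0 i *: X0 ^+ i.*2.+1 = 0 -> c = 0) ->
  (n <= \dim (skewsp K m :&: kact X))%N.
Proof.
move=> J_sym J_unit XJ X0J X0free; set Z := (_ :&: _)%VS.
rewrite leqNgt; apply/negP=> Zn; pose D := X0 - X.
pose f Y := linfun (actm Y) : 'End('M[K]_m).
pose W := (f X @: skewsp K m)%VS; pose r := \dim W.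
have Wr : (\dim Z + r = \dim (skewsp K m))%N := limg_ker_dim (f X) (skewsp K m).
have pre (i : 'I_r) : exists2 B, B \in skewsp K m & actm X B = (vbasis W)`_i.
  have : (vbasis W)`_i \in W by apply/vbasis_mem/mem_nth; rewrite size_tuple.
  by move=> /memv_imgP[B BS ->]; exists B; rewrite ?lfunE.
pose u i := s2val (cid2 (pre i)).
have uS i : u i \in skewsp K m by exact: (s2valP (cid2 (pre i))).
have uE i : actm X (u i) = (vbasis W)`_i by exact: (s2valP' (cid2 (pre i))).
(* Row i is the image, under the action of X + tD, of a fixed preimage [u i] of a basis vector of
   [W]; the rows are independent at t = 0. *)
pose A1 : 'M[{poly K}]_(r, m * m) := \matrix_(i, j)
  ((mxvec (actm X (u i)) 0 j)%:P + 'X * (mxvec (actm D (u i)) 0 j)%:P).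
pose Xt t := X + t *: D.
have XtJ t : (Xt t)^T *m J + J *m Xt t = 0.
  have DJ : D^T *m J + J *m D = 0.
    rewrite /D linearB /= mulmxBl mulmxBr addrACA X0J add0r -opprD XJ oppr0 //.
  rewrite /Xt linearD linearZ /= mulmxDl mulmxDr addrACA XJ add0r.
  by rewrite -scalemxAl -scalemxAr -scalerDr DJ scaler0.
have A1t t i : row i (map_mx (horner_eval t) A1) = mxvec (actm (Xt t) (u i)).
  have -> : actm (Xt t) (u i) = actm X (u i) + t *: actm D (u i).
    rewrite /actm /Xt linearD linearZ /= mulmxDl mulmxDr -scalemxAl -scalemxAr.
    by rewrite addrACA -scalerDr.
  apply/rowP=> j; rewrite linearD linearZ /= !mxE /horner_eval.
  by rewrite hornerD hornerM hornerX !hornerC.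
have free_rows (h : 'I_r -> 'M[K]_m) (A : 'M[K]_(r, m * m)) (v : 'rV_r) :
    (forall i, row i A = mxvec (h i)) -> v *m A = mxvec (\sum_i v 0 i *: h i).
  move=> rA; rewrite mulmx_sum_row linear_sum; apply: eq_bigr => i _.
  by rewrite rA linearZ.
have [p1 p1n0 p1t] : exists2 p : {poly K}, p != 0 &
    forall t, p.[t] != 0 -> row_free (map_mx (horner_eval t) A1).
  apply: (@poly_row_free _ _ _ _ 0); apply: inj_row_free => v.
  rewrite (free_rows (fun i => (vbasis W)`_i)) => [|i]; last first.
    by rewrite A1t /Xt scale0r addr0 uE.
  rewrite -[RHS](linear0 mxvec) => /(can_inj mxvecK) s0; apply/rowP=> i; rewrite mxE.
  have /freeP/(_ (v 0) s0 i)// := basis_free (vbasisP W).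
pose Xp : 'M[{poly K}]_m := map_mx polyC X + 'X *: map_mx polyC D.
have Xpt t : map_mx (horner_eval t) Xp = Xt t.
  by apply/matrixP=> i j; rewrite !mxE /horner_eval hornerD hornerM hornerX !hornerC.
(* These rows are independent at t = 1, where X + tD is [X0]. *)
pose A2 : 'M[{poly K}]_(n, m * m) := \matrix_(i < n) mxvec (Xp ^+ i.*2.+1).
have A2t t i : row i (map_mx (horner_eval t) A2) = mxvec (Xt t ^+ i.*2.+1).
  by rewrite -map_row rowK map_mxvec rmorphXn /= Xpt.
have [p2 p2n0 p2t] : exists2 p : {poly K}, p != 0 &
    forall t, p.[t] != 0 -> row_free (map_mx (horner_eval t) A2).
  apply: (@poly_row_free _ _ _ _ 1); apply: inj_row_free => v vA.
  apply: X0free; apply: (can_inj mxvecK); rewrite linear0 -[RHS]vA linear_sum mulmx_sum_row.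
  apply: eq_bigr => i _; rewrite linearZ /= A2t /Xt scale1r /D addrC subrK //.
have [t] := poly_nonroot charK (mulf_neq0 p1n0 p2n0).
rewrite hornerM mulf_eq0 negb_or => /andP[/p1t f1 /p2t f2].
have d1 : (r <= \dim (f (Xt t) @: skewsp K m))%N.
  apply: (row_free_dim (G := idfun) _ (A1t t)) => // i /=.
  by apply/memv_imgP; exists (u i); rewrite ?lfunE.
have d2 : (n <= \dim (skewsp K m :&: kact (Xt t)))%N.
  apply: (row_free_dim (G := mulmx J) _ (A2t t)) => // [|i].
    exact: (can_inj (mulKmx J_unit)).
  have oddX k : (Xt t ^+ k)^T *m J = (-1) ^+ k *: (J *m Xt t ^+ k).
    by apply: kact_expr; apply/kactP.
  rewrite memv_cap; apply/andP; split.
    apply/skewspP; rewrite trmx_mul J_sym oddX -signr_odd /= odd_double expr1 scaleN1r //.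
  apply/kactP; rewrite mulmxA; have /eqP := XtJ t; rewrite addr_eq0 => /eqP ->.
  by rewrite mulNmx -!mulmxA mulmx_exprS mulmx_exprSr addNr.
have Wt : (\dim (skewsp K m :&: kact (Xt t)) + \dim (f (Xt t) @: skewsp K m) =
  \dim (skewsp K m))%N := limg_ker_dim (f (Xt t)) (skewsp K m).
by move: (leq_add d2 d1); rewrite Wt -Wr leq_add2r leqNgt Zn.
Qed.

End OddPowers.

Section Rank.
Variables (K : fieldType) (n : nat).
Local Notation m := n.*2.+1.
Variables (J : 'M[K]_m) (g : lieAlgType K).
Variables (psi : {linear so J -> g}) (phi : {linear g -> so J}).
Hypotheses (charK : forall k, k.+1%:R != 0 :> K).
Hypotheses (J_sym : J^T = J) (J_unit : J \in unitmx).
Hypothesis sqrtK : forall c : K, exists d, d ^+ 2 = c.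
Hypotheses (psiK : cancel psi phi) (phiK : cancel phi psi).
Hypothesis psi_lie : forall x y, psi (lie x y) = lie (psi x) (psi y).

Lemma symmetric_cong m' (A B : 'M[K]_m') : A^T = A -> A \in unitmx -> B^T = B ->
  B \in unitmx -> exists2 P, P \in unitmx & P^T *m A *m P = B.
Proof.
move=> As Au Bs Bu; have [S Su SA] := symmetric_cong1 As Au (charK 1) sqrtK.
have [T Tu TB] := symmetric_cong1 Bs Bu (charK 1) sqrtK.
exists (S *m invmx T); first by rewrite unitmx_mul Su unitmx_inv.
transitivity ((invmx T)^T *m (S^T *m A *m S) *m invmx T).
  by rewrite trmx_mul !mulmxA.
by rewrite SA -TB !mulmxA -trmx_mul mulmxV // trmx1 mul1mx mulmxK.
Qed.

Lemma expmx_diag (d : 'rV[K]_m) k : diag_mx d ^+ k = diag_mx (\row_i d 0 i ^+ k).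
Proof.
elim: k => [|k IH].
  by apply/matrixP=> i j; rewrite !mxE; case: eqP.
rewrite -mulmx_exprSr IH mulmx_diag; congr diag_mx; apply/rowP=> i; rewrite !mxE.
by rewrite exprSr.
Qed.

Lemma iter_comm_diag (d : 'rV[K]_m) (A : 'M[K]_m) k i j :
  iter k (mx_comm (diag_mx d)) A i j = (d 0 i - d 0 j) ^+ k * A i j.
Proof.
elim: k A => [|k IH] A; first by rewrite mul1r.
rewrite iterS /mx_comm mul_diag_mx mul_mx_diag !mxE IH exprS; ring.
Qed.

Definition antidiag : 'M[K]_m := \matrix_(i, j) (j == rev_ord i)%:R.
(** The eigenvalues -n, ..., n are distinct in characteristic 0 and change sign under reversal of
    the indices: a regular semisimple element for the split form [antidiag]. *)
Definition grade : 'rV[K]_m := \row_i (i%:R - n%:R).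

Lemma antidiagl (A : 'M[K]_m) i j : (antidiag *m A) i j = A (rev_ord i) j.
Proof.
rewrite mxE (bigD1 (rev_ord i)) //= big1 => [|k ki]; rewrite mxE.
  by rewrite eqxx mul1r addr0.
by rewrite (negPf ki) mul0r.
Qed.

Lemma antidiag_sym : antidiag^T = antidiag.
Proof.
by apply/matrixP=> i j; rewrite !mxE eq_sym (can2_eq rev_ordK rev_ordK).
Qed.

Lemma antidiagr (A : 'M[K]_m) i j : (A *m antidiag) i j = A i (rev_ord j).
Proof.
by rewrite -antidiag_sym -[A]trmxK -trmx_mul mxE antidiagl [RHS]mxE.
Qed.

Lemma antidiag_unit : antidiag \in unitmx.
Proof.
suff /mulmx1_unit[] : antidiag *m antidiag = 1%:M by [].
by apply/matrixP=> i j; rewrite antidiagl !mxE rev_ordK eq_sym.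
Qed.

Lemma grade_rev (i : 'I_m) : grade 0 (rev_ord i) = - grade 0 i.
Proof.
rewrite !mxE /= opprB subSS natrB; last by rewrite -ltnS.
have e : (n.*2)%:R = n%:R + n%:R :> K by rewrite -addnn natrD.
by rewrite e; ring.
Qed.

Lemma grade_inj (i j : 'I_m) : grade 0 i = grade 0 j -> i = j.
Proof.
by rewrite !mxE => /addIr/(natr_inj0 charK)/val_inj.
Qed.

Lemma split_cartan : exists P, [/\ P \in unitmx, P^T *m J *m P = antidiag &
  let X0 := P *m diag_mx grade *m invmx P in X0^T *m J + J *m X0 = 0].
Proof.
have [P Pu PJ] := symmetric_cong J_sym J_unit antidiag_sym antidiag_unit.
exists P; split=> //=.
have PtJ : P^T *m J = antidiag *m invmx P by rewrite -PJ mulmxK.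
have JP : J *m P = (invmx P)^T *m antidiag.
  by rewrite -PJ !mulmxA -trmx_mul mulmxV // trmx1 mul1mx.
rewrite !trmx_mul -!mulmxA PtJ !mulmxA JP tr_diag_mx.
rewrite -[_ *m diag_mx _ *m antidiag]mulmxA -[_ *m antidiag *m diag_mx _]mulmxA.
rewrite -mulmxDl -mulmxDr [diag_mx _ *m _ + _](_ : _ = 0) ?mulmx0 ?mul0mx //.
apply/matrixP=> i j; rewrite [LHS]mxE antidiagr antidiagl mxE [X in _ + X]mxE [RHS]mxE.
by rewrite (can2_eq rev_ordK rev_ordK) grade_rev mulNrn subrr.
Qed.

(** On eigenvalues a relation says that t q(t^2) = 0 for t = 1, ..., n, where q has the coefficients
    [c]. So q would have n distinct roots and degree less than n. *)
Lemma odd_powers_free (P : 'M[K]_m) (c : 'rV[K]_n) : P \in unitmx ->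
  \sum_(i < n) c 0 i *: (P *m diag_mx grade *m invmx P) ^+ i.*2.+1 = 0 -> c = 0.
Proof.
move=> Pu s0; have {}s0 : \sum_(i < n) c 0 i *: diag_mx grade ^+ i.*2.+1 = 0.
  have : invmx P *m (\sum_(i < n) c 0 i *: (P *m diag_mx grade *m invmx P) ^+ i.*2.+1)
     *m P = 0 by rewrite s0 mulmx0 mul0mx.
  rewrite mulmx_sumr mulmx_suml => h; rewrite -[RHS]h; apply: eq_bigr => i _.
  by rewrite conjmx_expr // -scalemxAr -scalemxAl !mulmxA mulVmx // mul1mx mulmxKV.
have root_d (j : 'I_m) : \sum_(i < n) c 0 i * grade 0 j ^+ i.*2.+1 = 0.
  have /matrixP/(_ j j) := s0; rewrite summxE [RHS]mxE => h; rewrite -[RHS]h; apply: eq_bigr => i _.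
  by rewrite expmx_diag !mxE eqxx mulr1n.
pose q := \poly_(i < n) (if insub i is Some k then c 0 k else 0 : K).
have qi (i : 'I_n) : q`_i = c 0 i by rewrite coef_poly ltn_ord valK.
suff q0 : q = 0 by apply/rowP=> i; rewrite -qi q0 coef0 mxE.
apply/eqP; apply: contraT => q0.
pose rs := [seq (t.+1 ^ 2)%:R : K | t <- iota 0 n].
have := max_poly_roots (rs := rs) q0; rewrite size_map size_iota.
have qs : (size q <= n)%N by exact: size_poly.
move=> H; suff : (n < size q)%N by rewrite ltnNge qs.
apply: H; last first.
  rewrite map_inj_uniq ?iota_uniq // => s t /(natr_inj0 charK)/eqP.
  by rewrite eqn_exp2r // => /eqP[].
apply/allP=> _ /mapP[t + ->]; rewrite mem_iota /= => tn.
have jm : (n + t.+1 < m)%N by lia.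
have := root_d (Ordinal jm); rewrite rootE => r0; apply/eqP.
have gt : grade 0 (Ordinal jm) = t.+1%:R by rewrite mxE natrD; ring.
apply: (mulfI (charK t)); rewrite mulr0 -[RHS]r0 horner_poly mulr_sumr gt.
apply: eq_bigr => i _; rewrite valK exprS -muln2 mulnC exprM natrX.
by rewrite mulrCA.
Qed.

Lemma zforms1_ge (x : so J) : (n <= \dim (zforms (so_mx x) (so_mx x)))%N.
Proof.
have [P [Pu _ X0J]] := split_cartan.
have := actm_rank_rows charK J_sym J_unit (so_mxP x) X0J (fun c => odd_powers_free Pu).
by rewrite /zforms capvv.
Qed.

Lemma nilspace_ge (u : g) : (n <= \dim (nilspace u))%N.
Proof.
have := zforms1_ge (phi u); rewrite -(dim_centralizer J_sym J_unit psiK phiK psi_lie) phiK.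
move=> h; apply: leq_trans h _; apply: dimvS; apply/subvP=> v.
rewrite /pair_centralizer capvv /= !memv_ker adE => /eqP uv.
case D : (\dim {:g}) => [|d].
  have : v \in (0 : {vspace g})%VS.
    by have /eqP := D; rewrite dimv_eq0 => /eqP <-; exact: memvf.
  by rewrite memv0 => /eqP ->; rewrite linear0.
by rewrite ad_powE iterSr adE uv; elim: d {D} => //= d /eqP ->; rewrite linear0.
Qed.

(** For the regular element the null space consists of diagonal matrices, since the eigenvalues of
    [ad] at off-diagonal entries are nonzero. The diagonal changes sign under reversal, so it is 0
    in the middle and determined by its first n entries. *)
Lemma nilspace_le : exists u : g, (\dim (nilspace u) <= n)%N.
Proof.
have [P [Pu PJ X0J]] := split_cartan.
have [x0 x0E] := so_mx_surj X0J; exists (psi x0).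
pose C (A : 'M[K]_m) := invmx P *m A *m P.
pose F (u : g) : 'rV[K]_n := \row_i C (so_mx (phi u)) (inord i) (inord i).
have F_lin : linear F.
  have CP a A B : C (a *: A + B) = a *: C A + C B.
    by rewrite /C mulmxDr mulmxDl -scalemxAr -scalemxAl.
  have phiP a u v : so_mx (phi (a *: u + v)) = a *: so_mx (phi u) + so_mx (phi v).
    by rewrite !linearP.
  by move=> a u v; apply/rowP=> i; rewrite /F [LHS]mxE phiP CP !mxE.
pose FL : {linear g -> 'rV[K]_n} := HB.pack F
  (GRing.isSemilinear.Build K g 'rV[K]_n *:%R F (GRing.semilinear_linear F_lin)).
suff : (\dim (nilspace (psi x0)) <= \dim (fullv : {vspace 'rV[K]_n}))%N.
  by rewrite dimvf /dim /= mul1n.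
apply: (dim_le_map (f := FL)) => [u _|u]; first exact: memvf.
rewrite memv_ker -[u]phiK ad_pow_psi // => /eqP; rewrite -[RHS](linear0 psi).
move=> /(can_inj psiK)/(congr1 (@so_mx _ _ _)); rewrite so_mx_iter linear0 x0E.
set Y := so_mx (phi u); set k := \dim _ => Yk /= F0.
have CY j : iter j (mx_comm (diag_mx grade)) (C Y) =
    C (iter j (mx_comm (P *m diag_mx grade *m invmx P)) Y).
  elim: j => //= j ->; rewrite /C /mx_comm mulmxBr mulmxBl !mulmxA mulVmx // mul1mx.
  by rewrite mulmxKV // mulmxK.
have Cd i j : i != j -> C Y i j = 0.
  move=> ij; have := iter_comm_diag grade (C Y) k i j.
  rewrite CY Yk /C mulmx0 mul0mx mxE => /esym/eqP; rewrite mulf_eq0 expf_eq0 subr_eq0.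
  case/orP=> [/andP[_ /eqP/grade_inj ij']|/eqP//].
  by rewrite ij' eqxx in ij.
have Crev i : C Y (rev_ord i) (rev_ord i) = - C Y i i.
  have : (C Y)^T *m antidiag + antidiag *m C Y = 0.
    have PtJ : P^T *m J = antidiag *m invmx P by rewrite -PJ mulmxK.
    have JP : J *m P = (invmx P)^T *m antidiag.
      by rewrite -PJ !mulmxA -trmx_mul mulmxV // trmx1 mul1mx.
    have YJ := so_mxP (phi u); rewrite -/Y in YJ.
    rewrite /C -PJ !trmx_mul -!mulmxA (mulmxA P (invmx P)) mulmxV // mul1mx.
    rewrite (mulmxA (invmx P)^T) -trmx_mul mulmxV // trmx1 mul1mx.
    by rewrite -mulmxDr !mulmxA -mulmxDl YJ mul0mx mulmx0.
  move/matrixP=> /(_ (rev_ord i) i); rewrite mxE antidiagr antidiagl rev_ordK !mxE.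
  by move/eqP; rewrite addr_eq0 => /eqP.
have Ci i : C Y i i = 0.
  have small (j : 'I_m) : (j < n)%N -> C Y j j = 0.
    move=> jn; have /rowP/(_ (Ordinal jn)) := F0; rewrite !mxE /=.
    by rewrite phiK inord_val.
  case: (ltngtP i n) => [/small//|ni|ni].
    rewrite -[i]rev_ordK Crev small ?oppr0 //=.
    by have := ltn_ord i; lia.
  have ir : rev_ord i = i by apply: val_inj => /=; lia.
  have /eqP := Crev i; rewrite ir -subr_eq0 opprK -mulr2n -mulr_natl mulf_eq0.
  by rewrite (negPf (charK 1)) => /eqP.
have CY0 : C Y = 0.
  by apply/matrixP=> i j; rewrite [RHS]mxE; have [<-|/Cd//] := eqVneq i j; exact: Ci.
rewrite [phi u](_ : _ = 0) ?linear0 //; apply: so_mx_eq0.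
by rewrite -/Y -[Y](mulKVmx Pu) -[invmx P *m Y](mulmxK Pu) -/(C Y) CY0 mul0mx mulmx0.
Qed.

Lemma lie_rank_so : lie_rank g = n.
Proof.
rewrite /lie_rank; case: ex_minnP => r /asboolP[x xr] rmin.
apply/eqP; rewrite eqn_leq -{2}xr nilspace_ge andbT.
have [u un] := nilspace_le; apply: leq_trans un; apply: rmin.
by apply/asboolP; exists u.
Qed.

End Rank.

(** * Weights of a nilpotent pair *)

Lemma card_sym_rel m (r : rel 'I_m) : symmetric r ->
  #|[pred p : 'I_m * 'I_m | r p.1 p.2]| =
  (2 * #|[pred p : 'I_m * 'I_m | (p.1 < p.2)%N && r p.1 p.2]| + #|[pred i | r i i]|)%N.
Proof.
move=> sr; rewrite -!sum1_card (bigID (fun p => p.1 == p.2)) /= addnC; congr (_ + _)%N.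
  rewrite (bigID (fun p : 'I_m * 'I_m => (p.1 < p.2)%N)) /= mul2n -addnn; congr (_ + _)%N.
    by apply: eq_bigl => -[i j]; rewrite !inE /= -val_eqE /=; case: ltngtP; rewrite ?andbF ?andbT.
  rewrite (reindex_inj (h := fun p : 'I_m * 'I_m => (p.2, p.1))) /=; last first.
    by move=> [i j] [k l] /= [-> ->].
  by apply: eq_bigl => -[i j]; rewrite !inE /= sr -val_eqE /=; case: ltngtP; rewrite ?andbF ?andbT.
rewrite (reindex_onto (fun i => (i, i)) fst) /=; last by move=> [i j] /= /andP[_ /eqP->].
by apply: eq_bigl => i; rewrite !inE /= !eqxx !andbT.
Qed.

(** Some term of the Leibniz expansion is nonzero. For the form J this yields a permutation s with w
    (s i) = - w i. *)
Lemma det_neq0_perm (K : fieldType) m (A : 'M[K]_m) :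
  A \in unitmx -> exists s : 'S_m, forall i, A i (s i) != 0.
Proof.
rewrite unitmxE unitfE => dA; apply: contrapT => /forallNP h; case/eqP: dA.
rewrite /determinant; apply: big1 => s _; have /existsNP[i /negP] := h s.
by rewrite negbK => /eqP Ai; rewrite (bigD1 i) //= Ai mul0r mulr0.
Qed.

Section Weighted.
Variables (K : fieldType) (m : nat).
Hypothesis charK : forall k, k.+1%:R != 0 :> K.

(** What remains of the pair (h_1, h_2) after simultaneous diagonalization: the joint eigenvalues of
    the basis vectors. *)
Record weighted (X Y J : 'M[K]_m) (w : 'I_m -> K * K) := Weighted {
  wt_comm : X *m Y = Y *m X;
  wt_Xso : X^T *m J + J *m X = 0;
  wt_Yso : Y^T *m J + J *m Y = 0;
  wt_Jsym : J^T = J;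
  wt_Junit : J \in unitmx;
  wt_X : forall i j, X i j != 0 -> w i = w j + (1, 0);
  wt_Y : forall i j, Y i j != 0 -> w i = w j + (0, 1);
  wt_J : forall i j, J i j != 0 -> w i + w j = 0
}.

(** K has no order; this set replaces the nonpositive half-line. Subtracting 1 preserves it and, in
    characteristic 0, never leads to 0. *)
Definition nonposN (c : K) := `[< exists k : nat, c = - k%:R >].
Definition wneg (v : K * K) := nonposN v.1 && nonposN v.2.

Definition outforms (D : rel 'I_m) (w : 'I_m -> K * K) : {vspace 'M[K]_m} :=
  forms K (fun i j => ~~ (D i j && wneg (w i + w j))).

Lemma nonposN_pred c d : c = d + 1 -> nonposN c -> nonposN d && (d != 0).
Proof.
move=> cd /asboolP[k ck]; have dk : d = - k.+1%:R.
  by rewrite -[d](addrK 1) -cd ck -natr1; ring.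
by rewrite {2}dk oppr_eq0 charK andbT; apply/asboolP; exists k.+1.
Qed.

(** The instance of [zforms_ge] where [r] is the set of degrees in {0, -1, ...}^2, [r0] requires the
    second entry to be 0 and [r00] is degree 0. The relation [D], stable along arrows, allows forms
    that pair non-dual components to count as outer as well. *)
Lemma zforms_weight_ge X Y J w (D : rel 'I_m) : weighted X Y J w -> symmetric D ->
  (forall i j k, X k i != 0 -> D k j -> D i j) ->
  (forall i j k, Y k i != 0 -> D k j -> D i j) ->
  (#|[pred p : 'I_m * 'I_m | (p.1 < p.2)%N && (D p.1 p.2 && (w p.1 + w p.2 == 0)%R)]| +
   \dim (zforms X Y :&: outforms D w) <= \dim (zforms X Y))%N.
Proof.
move=> W sD XD YD.
have W1 i j k : X k i != 0 -> (w k + w j).1 = (w i + w j).1 + 1 /\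
    (w k + w j).2 = (w i + w j).2.
  by move=> /(wt_X W)->; split=> /=; ring.
have W2 i j k : Y k i != 0 -> (w k + w j).2 = (w i + w j).2 + 1 /\
    (w k + w j).1 = (w i + w j).1.
  by move=> /(wt_Y W)->; split=> /=; ring.
have nn0 : nonposN 0 by apply/asboolP; exists 0%N; rewrite oppr0.
have pair0 (v : K * K) : (v == 0) = (v.1 == 0) && (v.2 == 0) by case: v.
have := @zforms_ge K m X Y (fun i j => D i j && wneg (w i + w j))
  (fun i j => [&& D i j, nonposN (w i + w j).1 & (w i + w j).2 == 0])
  (fun i j => D i j && (w i + w j == 0)); apply.
- exact: wt_comm W.
- by move=> i j; rewrite sD addrC.
- by move=> i j; rewrite sD addrC.
- by move=> i j; rewrite sD addrC.
- by move=> i j /and3P[-> h /eqP h0] /=; rewrite /wneg h h0 nn0.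
- by move=> i j /andP[-> /eqP ->] /=; rewrite nn0 eqxx.
- move=> i j k Xk /andP[/(XD _ _ _ Xk)->] /andP[].
  by have [e ->] := W1 _ j _ Xk => /(nonposN_pred e)/andP[h _] h2; rewrite /wneg h h2.
- move=> i j k Xk /and3P[/(XD _ _ _ Xk)->].
  have [e ->] := W1 _ j _ Xk => /(nonposN_pred e)/andP[h h0] h2.
  by rewrite h h2 /= pair0 (negPf h0).
move=> i j k Yk /andP[/(YD _ _ _ Yk)->] /andP[].
have [e ->] := W2 _ j _ Yk => h1 /(nonposN_pred e)/andP[h h0].
by rewrite /wneg h1 h /= h0.
Qed.

End Weighted.

Section Distinct.
Variables (K : fieldType) (n : nat).
Local Notation m := n.*2.+1.
Hypothesis charK : forall k, k.+1%:R != 0 :> K.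
Variables (X Y J : 'M[K]_m) (w : 'I_m -> K * K).
Hypotheses (W : weighted X Y J w) (dimZ : (\dim (zforms X Y) <= n.+1)%N).

Lemma weight_dbl (v : K * K) : (v + v == 0) = (v == 0).
Proof.
have dbl (c : K) : (c + c == 0) = (c == 0).
  by rewrite -mulr2n -mulr_natl mulf_eq0 (negPf (charK 1)).
have pair0 (u : K * K) : (u == 0) = (u.1 == 0) && (u.2 == 0) by case: u.
by rewrite !pair0 !dbl.
Qed.

(** The permutation [s] negates weights, so the number [T] of ordered pairs with w_i = w_j is also
    the number of those with w_i + w_j = 0. There are at most n + 1 unordered zero sums off the
    diagonal, which leaves no room for coincidences. *)
Lemma weights_distinct : injective w /\ exists o, w o = 0.
Proof.
have [s sJ] := det_neq0_perm (wt_Junit W).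
have ws i : w (s i) = - w i by apply/eqP; rewrite -addr_eq0 addrC (wt_J W (sJ i)).
pose N := #|[pred p : 'I_m * 'I_m | (p.1 < p.2)%N && (w p.1 + w p.2 == 0)%R]|.
have NZ : (N <= n.+1)%N.
  have := zforms_weight_ge charK (D := fun _ _ => true) W (fun _ _ => erefl)
    (fun _ _ _ _ => id) (fun _ _ _ _ => id).
  by move/(leq_trans (leq_addr _ _)) => /leq_trans; apply.
pose n0 := #|[pred i | w i == 0]|.
pose T := (\sum_i #|[pred j | w i == w j]|)%N.
have T1 : T = (2 * N + n0)%N.
  have <- : #|[pred p : 'I_m * 'I_m | (w p.1 + w p.2 == 0)%R]| = (2 * N + n0)%N.
    rewrite (card_sym_rel (r := fun i j => w i + w j == 0)) => [|i j]; last by rewrite addrC.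
    by congr (_ + _)%N; apply: eq_card => i; rewrite !inE weight_dbl.
  rewrite /T -sum1_card; under eq_bigr do rewrite -sum1_card.
  rewrite pair_big_dep /= (reindex_inj (h := fun p : 'I_m * 'I_m => (s p.1, p.2))) /=.
    by apply: eq_bigl => -[i j]; rewrite !inE /= ws eq_sym -addr_eq0 addrC.
  by move=> [i j] [k l] [/perm_inj-> ->].
have T2 : T = (2 * #|[pred p : 'I_m * 'I_m | (p.1 < p.2)%N && (w p.1 == w p.2)]| + m)%N.
  have <- : #|[pred p : 'I_m * 'I_m | w p.1 == w p.2]| =
      (2 * #|[pred p : 'I_m * 'I_m | (p.1 < p.2)%N && (w p.1 == w p.2)]| + m)%N.
    rewrite (card_sym_rel (r := fun i j => w i == w j)) => [|i j]; last by rewrite eq_sym.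
    congr (_ + _)%N; rewrite -[RHS]card_ord; apply: eq_card => i; rewrite !inE.
    by rewrite eqxx.
  rewrite /T -sum1_card; under eq_bigr do rewrite -sum1_card.
  by rewrite pair_big_dep.
have mult_ge1 i : (1 <= #|[pred j | w i == w j]|)%N.
  by apply/card_gt0P; exists i; rewrite inE.
have T3 : (n0 * n0 + (m - n0) <= T)%N.
  have n0m : (n0 <= m)%N by rewrite -[X in (_ <= X)%N](card_ord m); exact: max_card.
  rewrite /T (bigID (fun i => w i == 0)) /=; apply: leq_add.
    rewrite {1}/n0 -sum_nat_const; apply: leq_sum => i /eqP wi.
    by rewrite /n0; apply: subset_leq_card; apply/fintype.subsetP=> j; rewrite !inE wi eq_sym.
  have -> : (m - n0 = \sum_(i | (w i != 0)%R) 1)%N.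
    rewrite sum1_card -[X in (X - _)%N](card_ord m) -(cardC [pred i | w i == 0]) addKn.
    by apply: eq_card => i; rewrite !inE.
  by apply: leq_sum => i _.
(* n0^2 + m - n0 <= T = 2N + n0 <= 2n + 2 + n0 leaves n0 <= 2, and comparing [T1] with [T2] shows
   that n0 is odd. *)
have n01 : n0 = 1%N by nia.
split; last first.
  have /card_gt0P[o] : (0 < n0)%N by rewrite n01.
  by rewrite inE => /eqP; exists o.
move=> i j wij; apply: contrapT => /eqP ij.
have uniq0 a b : w a = 0 -> w b = 0 -> a = b.
  move=> wa wb; have : (#|[pred i | (w i == 0)%R]| <= 1)%N by rewrite -/n0 n01.
  by move/card_le1P => /(_ a); rewrite inE wa eqxx => /(_ isT b); rewrite !inE wb eqxx => /esym/eqP.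
have wi0 : w i != 0.
  by apply: contra ij => /eqP wi; apply/eqP/uniq0; rewrite // -?wij.
have swap a b : w a != 0 -> w a = w b -> a != s b.
  move=> wa ab; apply: contra wa => /eqP e; rewrite -weight_dbl {2}e ws -ab.
  by rewrite subrr.
(* Each of these four indices shares its weight with another one, so T >= m + 4, while T = 2N + 1 <=
   m + 2. *)
pose S := [:: i; j; s i; s j].
have uS : uniq S.
  rewrite /= !inE !negb_or ij (inj_eq perm_inj) ij !andbT /=.
  by rewrite !swap // -?wij.
have : (m + size S <= T)%N.
  rewrite -(card_uniqP uS) -[X in (X + _)%N](card_ord m) -sum1_card.
  rewrite -[#|S|]sum1_card [X in (_ + X)%N]big_mkcond -big_split /=.
  apply: leq_sum => a _; case: ifP => [aS|_]; rewrite ?addn0 //.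
  have two b : b != a -> w a = w b -> (1 + 1 <= #|[pred j | w a == w j]|)%N.
    move=> ba ab; apply: (@leq_trans #|[:: a; b]|).
      by rewrite (card_uniqP _) //= inE eq_sym ba.
    by apply: subset_leq_card; apply/fintype.subsetP=> c; rewrite !inE => /orP[]/eqP->; rewrite ?ab.
  move: aS; rewrite !inE => /or4P[] /eqP e; subst a.
  - by apply: (two j); rewrite // eq_sym.
  - exact: (two i).
  - by apply: (two (s j)); rewrite ?ws ?wij // (inj_eq perm_inj) eq_sym.
  - by apply: (two (s i)); rewrite ?ws ?wij // (inj_eq perm_inj).
by rewrite T1 n01 /=; lia.
Qed.

End Distinct.

(** * Geodesics in grids *)

Inductive rpath (T : Type) (r1 r2 : T -> T -> Prop) (a : T) : T -> Prop :=
| RPath0 : rpath r1 r2 a a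
| RPath1 b c : rpath r1 r2 a b -> r1 b c -> rpath r1 r2 a c
| RPath2 b c : rpath r1 r2 a b -> r2 b c -> rpath r1 r2 a c.

Lemma rpath_cat (T : Type) (r1 r2 : T -> T -> Prop) a b c :
  rpath r1 r2 a b -> rpath r1 r2 b c -> rpath r1 r2 a c.
Proof.
by move=> ab; elim=> [//|d e _ ad /(RPath1 ad)|d e _ ad /(RPath2 ad)].
Qed.

Lemma rpath1 (T : Type) (r1 r2 : T -> T -> Prop) a b : r1 a b -> rpath r1 r2 a b.
Proof. exact: RPath1 (RPath0 _ _ _). Qed.

Lemma rpath2 (T : Type) (r1 r2 : T -> T -> Prop) a b : r2 a b -> rpath r1 r2 a b.
Proof. exact: RPath2 (RPath0 _ _ _). Qed.

Lemma rpath_swap (T : Type) (r1 r2 : T -> T -> Prop) a b :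
  rpath r1 r2 a b -> rpath r2 r1 a b.
Proof.
by elim=> [|d e _ ad /(RPath2 ad)|d e _ ad /(RPath1 ad)] //; exact: RPath0.
Qed.

Definition converse (T : Type) (r : T -> T -> Prop) a b := r b a.

Lemma rpath_rev (T : Type) (r1 r2 : T -> T -> Prop) a b :
  rpath r1 r2 a b -> rpath (converse r1) (converse r2) b a.
Proof.
elim=> [|d e _ ad de|d e _ ad de]; first exact: RPath0.
  by apply: rpath_cat ad; exact: rpath1.
by apply: rpath_cat ad; exact: rpath2.
Qed.

Section Grid.
Variable T : Type.

(** The exchange laws abstract X Y = Y X: with distinct positions there is no cancellation, so a
    path of one step in each direction can also be taken in the other order. *)
Record grid_rel (eX eY : T -> T -> Prop) (pos : T -> int * int) := GridRel {
  grid_inj : injective pos;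
  grid_X : forall a b, eX a b -> pos b = pos a + (1, 0);
  grid_Y : forall a b, eY a b -> pos b = pos a + (0, 1);
  grid_XY : forall a b c, eX a b -> eY b c -> exists2 d, eY a d & eX d c;
  grid_YX : forall a b c, eY a b -> eX b c -> exists2 d, eX a d & eY d c
}.

Definition swap_pos (pos : T -> int * int) a := ((pos a).2, (pos a).1).
Definition opp_pos (pos : T -> int * int) a := - pos a.

Lemma grid_swap eX eY pos : grid_rel eX eY pos -> grid_rel eY eX (swap_pos pos).
Proof.
move=> G; split.
- move=> a b [h2 h1]; apply: (grid_inj G); move: h1 h2.
  by case: (pos a) (pos b) => ? ? [? ?] /= -> ->.
- by move=> a b /(grid_Y G); rewrite /swap_pos => ->.
- by move=> a b /(grid_X G); rewrite /swap_pos => ->.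
- exact: grid_YX G.
- exact: grid_XY G.
Qed.

Lemma grid_opp eX eY pos : grid_rel eX eY pos ->
  grid_rel (converse eX) (converse eY) (opp_pos pos).
Proof.
move=> G; split.
- by move=> a b /oppr_inj/(grid_inj G).
- by move=> a b /(grid_X G); rewrite /opp_pos => ->; rewrite opprD subrK.
- by move=> a b /(grid_Y G); rewrite /opp_pos => ->; rewrite opprD subrK.
- by move=> a b c ab bc; have [d] := grid_YX G bc ab; exists d.
- by move=> a b c ab bc; have [d] := grid_XY G bc ab; exists d.
Qed.

Section Geodesic.
Variables (eX eY : T -> T -> Prop) (pos : T -> int * int).
Hypothesis G : grid_rel eX eY pos.
Local Notation reach := (rpath eX eY).
Local Notation areach := (rpath eX (converse eY)).

Lemma X_det a b c : eX a c -> eX b c -> a = b.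
Proof.
by move=> /(grid_X G) e /(grid_X G); rewrite e => /addIr/(grid_inj G).
Qed.

Lemma Y_det a b c : eY a b -> eY a c -> b = c.
Proof. by move=> /(grid_Y G) e /(grid_Y G); rewrite -e => /(grid_inj G). Qed.

Lemma reach_last a c : reach a c -> rpath eY eY a c \/ exists2 b, reach a b & eX b c.
Proof.
elim=> [|b d ab IH bd|b d ab IH bd]; first by left; exact: RPath0.
  by right; exists b.
case: IH => [v|[e ae eb]]; first by left; exact: RPath1 v bd.
have [f ef fd] := grid_XY G eb bd; right; exists f => //.
exact: RPath2 ae ef.
Qed.

(** If the path to [k] contains a horizontal step, that step can be moved to the end, where it must
    be the one from [k']. Otherwise the path is vertical, and a step right followed by descent leads
    from [k'] to [i]. *)
Lemma reach_left i k k' : reach i k -> eX k' k -> reach i k' \/ areach k' i.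
Proof.
move=> ik k'k; case: (reach_last ik) => [v|[b ib bk]]; last first.
  by left; rewrite (X_det k'k bk).
right; apply: (rpath_cat (rpath1 _ k'k)); apply: rpath_swap.
have : rpath (converse eY) (converse eY) k i by apply: rpath_rev.
elim=> [|b c _ kb bc|b c _ kb bc]; [exact: RPath0|exact: RPath1 kb bc|exact: RPath1 kb bc].
Qed.

Lemma areach_left i k k' : areach i k -> eX k' k -> areach i k' \/ reach k' i.
Proof.
move=> ik; elim: ik k' => [|b c ib IH bc|b c ib IH cb] k' k'c.
- by right; exact: rpath1.
- by left; rewrite (X_det k'c bc).
have [d k'd db] := grid_XY G k'c cb.
case: (IH _ db) => [id|di]; first by left; exact: RPath2 id k'd.
by right; apply: rpath_cat di; exact: rpath2.
Qed.

Lemma areach_up i k k' : areach i k -> eY k k' -> areach i k' \/ reach i k'.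
Proof.
move=> ik; elim: ik k' => [|b c ib IH bc|b c ib IH cb] k' ck'.
- by right; exact: rpath2.
- have [d bd dk'] := grid_XY G bc ck'.
  by case: (IH _ bd) => h; [left|right]; exact: RPath1 h dk'.
- by left; rewrite -(Y_det cb ck').
Qed.

Definition geodesic i k := [\/ reach i k, reach k i, areach i k | areach k i].
Definition adj i k := [\/ eX i k, eX k i, eY i k | eY k i].
Inductive conn i : T -> Prop :=
| Conn0 : conn i i
| ConnS k k' : conn i k -> adj k k' -> conn i k'.

End Geodesic.

Lemma geodesic_swap eX eY i k : geodesic eX eY i k -> geodesic eY eX i k.
Proof.
case=> h; have {}h := rpath_swap h.
- exact: Or41.
- exact: Or42.
- by apply: Or44; have := rpath_rev h.
- by apply: Or43; have := rpath_rev h.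
Qed.

Lemma geodesic_opp eX eY i k :
  geodesic (converse eX) (converse eY) i k -> geodesic eX eY i k.
Proof.
by case=> h; have {}h := rpath_rev h; [exact: Or42|exact: Or41|exact: Or44|exact: Or43].
Qed.

Lemma reach_adj eX eY pos i k k' : grid_rel eX eY pos -> rpath eX eY i k ->
  adj eX eY k k' -> geodesic eX eY i k'.
Proof.
move=> G ik [kk'|k'k|kk'|k'k].
- by apply: Or41; exact: RPath1 ik kk'.
- by case: (reach_left G ik k'k) => h; [exact: Or41|exact: Or44].
- by apply: Or41; exact: RPath2 ik kk'.
apply: geodesic_swap.
by case: (reach_left (grid_swap G) (rpath_swap ik) k'k) => h; [exact: Or41|exact: Or44].
Qed.

Lemma areach_adj eX eY pos i k k' : grid_rel eX eY pos -> rpath eX (converse eY) i k ->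
  adj eX eY k k' -> geodesic eX eY i k'.
Proof.
move=> G ik [kk'|k'k|kk'|k'k].
- by apply: Or43; exact: RPath1 ik kk'.
- by case: (areach_left G ik k'k) => h; [exact: Or43|exact: Or42].
- by case: (areach_up G ik kk') => h; [exact: Or43|exact: Or41].
- by apply: Or43; exact: RPath2 ik k'k.
Qed.

(** A monotone path extended by one step can again be made monotone: the exchange laws move a step
    in the wrong direction back along the path until it cancels, or else only perpendicular steps
    remain. *)
Lemma conn_geodesic eX eY pos i k : grid_rel eX eY pos -> conn eX eY i k ->
  geodesic eX eY i k.
Proof.
move=> G; elim=> [|j j' _ IH jj']; first by apply: Or41; exact: RPath0.
have opp_adj : adj (converse eX) (converse eY) j j'.
  by case: jj' => h; [exact: Or42|exact: Or41|exact: Or44|exact: Or43].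
case: IH => h.
- exact: reach_adj G h jj'.
- by apply: geodesic_opp; exact: reach_adj (grid_opp G) (rpath_rev h) opp_adj.
- exact: areach_adj G h jj'.
- by apply: geodesic_opp; exact: areach_adj (grid_opp G) (rpath_rev h) opp_adj.
Qed.

Section Convex.
Variables (eX eY : T -> T -> Prop) (pos : T -> int * int).
Hypothesis G : grid_rel eX eY pos.

Lemma reach_pos a b : rpath eX eY a b -> (pos a).1 <= (pos b).1 /\ (pos a).2 <= (pos b).2.
Proof.
elim=> [//|b' c _ [h1 h2] /(grid_X G) ->|b' c _ [h1 h2] /(grid_Y G) ->] /=; split; lia.
Qed.

Lemma areach_pos a b : rpath eX (converse eY) a b ->
  (pos a).1 <= (pos b).1 /\ (pos b).2 <= (pos a).2 /\
  ((pos b).2 = (pos a).2 -> rpath eX eY a b).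
Proof.
elim=> [|b' c _ [h1 [h2 h3]] e|b' c _ [h1 [h2 h3]] e].
- by split=> //; split=> // _; exact: RPath0.
- rewrite (grid_X G e) /=; split; first lia; split; first lia.
  by rewrite addr0 => /h3 h; exact: RPath1 h e.
have /(congr1 snd) /= h := grid_Y G e.
by split; [have /(congr1 fst) /= := grid_Y G e; lia|split; lia].
Qed.

Lemma reach_pred a b : rpath eX eY a b -> (pos a).1 < (pos b).1 ->
  exists2 c, rpath eX eY a c & eX c b.
Proof.
move=> ab ltab; case: (reach_last G ab) => // v; exfalso.
have : (pos b).1 = (pos a).1.
  elim: v => [//|? ? _ <- /(grid_Y G)->|? ? _ <- /(grid_Y G)->] /=; by rewrite addr0.
by lia.
Qed.

End Convex.

Lemma le_reach eX eY pos a b : grid_rel eX eY pos -> conn eX eY a b ->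
  (pos a).1 <= (pos b).1 -> (pos a).2 <= (pos b).2 -> rpath eX eY a b.
Proof.
move=> G /(conn_geodesic G)[//|ba|ab|ba] h1 h2.
- have [h3 h4] := reach_pos G ba.
  have -> : a = b; last exact: RPath0.
  apply: (grid_inj G); move: h1 h2 h3 h4.
  by case: (pos a) (pos b) => ? ? [? ?] /= *; congr pair; lia.
- by have [_ [h3 h]] := areach_pos G ab; apply: h; lia.
have ab : rpath eY (converse eX) a b by have := rpath_swap (rpath_rev ba).
have [h3 [h4 h]] := areach_pos (grid_swap G) ab.
by apply: rpath_swap; apply: h; move: h4 => /=; lia.
Qed.

(** Induction on the distance from (u, v) to [b]: as long as [b] lies further right, the path is
    reordered to end with a horizontal step and [b] is replaced by the cell before it; likewise
    vertically. *)
Lemma reach_box eX eY pos (G : grid_rel eX eY pos) a b u v : rpath eX eY a b ->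
  (pos a).1 <= u <= (pos b).1 -> (pos a).2 <= v <= (pos b).2 -> exists c, pos c = (u, v).
Proof.
move: {2}(absz _) (erefl (absz ((pos b).1 - u + ((pos b).2 - v)))) => d.
elim: d b => [|d IH] b e ab hu hv.
  by exists b; rewrite [LHS]surjective_pairing; congr pair; lia.
have [ub|ub] := boolP (u < (pos b).1).
  have [|c ac cb] := reach_pred G ab; first lia.
  have pc := grid_X G cb; have [h1 h2] : (pos b).1 = (pos c).1 + 1 /\ (pos b).2 = (pos c).2.
    by rewrite pc /= addr0.
  by apply: (IH c) => //; lia.
have [|c ac cb] := reach_pred (grid_swap G) (rpath_swap ab); first by rewrite /=; lia.
have pc := grid_Y G cb; have [h1 h2] : (pos b).2 = (pos c).2 + 1 /\ (pos b).1 = (pos c).1.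
  by rewrite pc /= addr0.
by apply: (IH c) => //; [lia|exact: rpath_swap|lia|lia].
Qed.

End Grid.

(** * Cells and components *)

Section Cells.
Variables (K : fieldType) (m : nat).
Hypothesis charK : forall k, k.+1%:R != 0 :> K.
Variables (X Y J : 'M[K]_m) (w : 'I_m -> K * K) (s : 'I_m -> 'I_m) (N : nat).
Hypotheses (W : weighted X Y J w) (winj : injective w).
Hypothesis sJ : forall i j, (J i j != 0) = (j == s i).
Hypotheses (XN : X ^+ N = 0) (YN : Y ^+ N = 0).

Lemma weight_sK i : w (s i) = - w i.
Proof. by apply/eqP; rewrite -addr_eq0 addrC (wt_J W) // sJ. Qed.

Lemma involK : involutive s.
Proof. by move=> i; apply: winj; rewrite !weight_sK opprK. Qed.

Lemma invol_inj : injective s.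
Proof. exact: (can_inj involK). Qed.

Definition mon k l := X ^+ k *m Y ^+ l.
(** As the weights are distinct, X^k Y^l v_p is a multiple of a single basis vector; [hits] says
    that this vector is v_i and the multiple is nonzero. *)
Definition hits p k l i := mon k l i p != 0.

Lemma XYcomm k l : Y ^+ l *m X ^+ k = X ^+ k *m Y ^+ l.
Proof.
apply/esym/commrX/commr_sym/commrX/commr_sym; exact: wt_comm W.
Qed.

Lemma monD k l k' l' : mon k l *m mon k' l' = mon (k + k') (l + l').
Proof.
rewrite /mon !exprD -!mulmxE -!mulmxA; congr (_ *m _).
by rewrite !mulmxA XYcomm.
Qed.

Lemma hits_weight p k l i : hits p k l i -> w i = w p + (k%:R, l%:R).
Proof.
move=> /mx_mul_neq0[j /(mx_pow_supp (wt_X W)) -> /(mx_pow_supp (wt_Y W)) ->].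
rewrite -addrA; congr (_ + _); rewrite addrC.
have h1 q : ((1, 0) : K * K) *+ q = (q%:R, 0).
  by elim: q => // q IH; rewrite mulrSr IH -natr1; congr pair; rewrite /= addr0.
have h2 q : ((0, 1) : K * K) *+ q = (0, q%:R).
  by elim: q => // q IH; rewrite mulrSr IH -natr1; congr pair; rewrite /= addr0.
by rewrite h1 h2; congr pair; rewrite /= ?addr0 ?add0r.
Qed.

Lemma hits0 p : hits p 0 0 p.
Proof. by rewrite /hits /mon !expr0 mulmx1 mxE eqxx oner_eq0. Qed.

Lemma hits_comp p k l j k' l' i : hits p k l j -> hits j k' l' i ->
  hits p (k' + k) (l' + l) i.
Proof.
move=> pj ji; rewrite /hits -monD mxE (bigD1 j) //= big1 => [|q qj].
  by rewrite addr0 mulf_neq0.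
apply/eqP; apply: contraTT qj => /negP; rewrite negbK.
rewrite mulf_eq0 => /negP; rewrite negb_or => /andP[_ pq].
by apply/eqP/winj; rewrite (hits_weight pj) (hits_weight pq).
Qed.

Lemma hits_split p k l k' l' i : hits p (k' + k) (l' + l) i ->
  exists2 j, hits p k l j & hits j k' l' i.
Proof. by rewrite /hits -monD => /mx_mul_neq0[j]; exists j. Qed.

Lemma hitsX p i : hits p 1 0 i = (X i p != 0).
Proof. by rewrite /hits /mon expr0 expr1 mulmx1. Qed.

Lemma hitsY p i : hits p 0 1 i = (Y i p != 0).
Proof. by rewrite /hits /mon expr0 expr1 mul1mx. Qed.

Lemma mon_skew k l : (mon k l)^T *m J = (-1) ^+ (k + l) *: (J *m mon k l).
Proof.
have JX : J \in kact X by apply/kactP; exact: wt_Xso W.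
have JY : J \in kact Y by apply/kactP; exact: wt_Yso W.
rewrite /mon trmx_mul -mulmxA (kact_expr _ JX) -scalemxAr [in LHS]mulmxA (kact_expr _ JY).
by rewrite -scalemxAl scalerA exprD -mulmxA XYcomm.
Qed.

Lemma mul_Jl (A : 'M[K]_m) i j : (J *m A) i j = J i (s i) * A (s i) j.
Proof.
rewrite mxE (bigD1 (s i)) //= big1 ?addr0 // => k ki.
by have := sJ i k; rewrite (negPf ki) => /negbT; rewrite negbK => /eqP ->; rewrite mul0r.
Qed.

Lemma J_neq0 i : J i (s i) != 0.
Proof. by rewrite sJ. Qed.

(** [mon k l] is its own adjoint for J up to sign, and J pairs i with [s i] only. *)
Lemma hits_dual p k l i : hits p k l i = hits (s i) k l (s p).
Proof.
have /matrixP/(_ p (s i)) := mon_skew k l; rewrite [RHS]mxE mul_Jl.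
have -> : ((mon k l)^T *m J) p (s i) = mon k l i p * J i (s i).
  rewrite mxE (bigD1 i) //= big1 ?addr0 ?mxE // => k' ki; rewrite mxE.
  have := sJ k' (s i); rewrite (inj_eq invol_inj) [i == k']eq_sym (negPf ki).
  by move/negbT; rewrite negbK => /eqP ->; rewrite mulr0.
move=> e; have := congr1 (fun c => c == 0) e; rewrite !mulf_eq0 signr_eq0 /=.
by rewrite (negPf (J_neq0 _)) orbF (negPf (J_neq0 _)) /= /hits => ->.
Qed.

Lemma X_dual i k : (X k i != 0) = (X (s i) (s k) != 0).
Proof. by rewrite -!hitsX; exact: hits_dual. Qed.

Lemma Y_dual i k : (Y k i != 0) = (Y (s i) (s k) != 0).
Proof. by rewrite -!hitsY; exact: hits_dual. Qed.

(** No arrow ends at p: these are the southwest corners. *)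
Definition source p := [forall i, (X p i == 0) && (Y p i == 0)].

Lemma sourceX p i : source p -> X p i = 0.
Proof. by move/forallP/(_ i)/andP=> [/eqP]. Qed.
Lemma sourceY p i : source p -> Y p i = 0.
Proof. by move/forallP/(_ i)/andP=> [_ /eqP]. Qed.

Lemma hits_ltN p k l i : hits p k l i -> (k < N)%N /\ (l < N)%N.
Proof.
rewrite /hits /mon => h; split; rewrite ltnNge; apply: contra h.
  by move=> /subnK <-; rewrite exprD XN mulr0 mul0mx mxE.
by move=> /subnK <-; rewrite exprD YN mulr0 mulmx0 mxE.
Qed.

Lemma source_exists i : exists p k l, source p /\ hits p k l i.
Proof.
pose P d := [exists k : 'I_N, [exists l : 'I_N, [exists p, (k + l == d)%N && hits p k l i]]].
have PI p k l : hits p k l i -> P (k + l)%N.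
  move=> h; have [kN lN] := hits_ltN h.
  apply/existsP; exists (Ordinal kN); apply/existsP; exists (Ordinal lN).
  by apply/existsP; exists p; rewrite eqxx.
have exP : exists d, P d by exists (0 + 0)%N; exact: PI (hits0 i).
have ubP d : P d -> (d <= N + N)%N.
  move=> /existsP[k /existsP[l /existsP[p /andP[/eqP <- _]]]].
  by apply: leq_add; apply: ltnW.
case: (ex_maxnP exP ubP) => d /existsP[k /existsP[l /existsP[p /andP[/eqP kl h]]]] dmax.
exists p, k, l; split=> //; apply/forallP=> j; apply/andP; split; apply: contraT => pj.
  have : hits j 1 0 p by rewrite hitsX.
  by move=> /hits_comp/(_ h)/PI/dmax; rewrite -kl; lia.
have : hits j 0 1 p by rewrite hitsY.
by move=> /hits_comp/(_ h)/PI/dmax; rewrite -kl; lia.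
Qed.

Definition edge i k := (X k i != 0) || (Y k i != 0).
Definition adjc i k := edge i k || edge k i.
Definition cconn := connect adjc.

Lemma adjc_sym : symmetric adjc.
Proof. by move=> i k; rewrite /adjc orbC. Qed.

Lemma cconn_sym : symmetric cconn.
Proof. exact/sym_connect_sym/adjc_sym. Qed.

Lemma cconn_trans i j k : cconn i j -> cconn j k -> cconn i k.
Proof. exact: connect_trans. Qed.

Lemma edge_dual i k : edge i k = edge (s k) (s i).
Proof. by rewrite /edge X_dual Y_dual. Qed.

Lemma cconn_dual i k : cconn i k = cconn (s i) (s k).
Proof.
suff H a b : cconn a b -> cconn (s a) (s b).
  by apply/idP/idP=> [/H//|/H]; rewrite !involK.
move=> /connectP[p + ->]; elim: p a => [|c p IH] a /=; first by rewrite /cconn connect0.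
move=> /andP[ac /IH h]; apply: cconn_trans h; apply: connect1.
by move: ac; rewrite /adjc edge_dual [edge c a]edge_dual orbC.
Qed.

Lemma hits_cconn p k l i : hits p k l i -> cconn p i.
Proof.
elim: k l i => [|k IH] l i.
  elim: l i => [|l IH] i; first by move=> h; have -> : i = p; [
    by apply: winj; rewrite (hits_weight h) addr0|exact: connect0].
  rewrite -[0%N]/(0 + 0)%N -add1n => /hits_split[j /IH pj]; rewrite hitsY => ji.
  by apply: cconn_trans pj _; apply: connect1; rewrite /adjc /edge ji orbT.
rewrite -add1n -[l]/(0 + l)%N => /hits_split[j /IH pj]; rewrite hitsX => ji.
by apply: cconn_trans pj _; apply: connect1; rewrite /adjc /edge ji.
Qed.

(* With w_p as origin, a component with a unique source is a full rectangle. *)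
Lemma rect_component p : source p -> cconn p (s p) ->
  (forall q, source q -> cconn p q -> q = p) ->
  exists A B, [/\ hits p A B (s p), ~~ odd (A + B),
    forall i, cconn p i -> exists k l, [/\ (k <= A)%N, (l <= B)%N & hits p k l i] &
    forall k l, (k <= A)%N -> (l <= B)%N -> exists i, hits p k l i].
Proof.
move=> sp psp up.
have from i : cconn p i -> exists k l, hits p k l i.
  move=> pi; have [q [k [l [sq h]]]] := source_exists i.
  have <- : q = p; last by exists k, l.
  by apply: up => //; apply: cconn_trans pi _; rewrite cconn_sym; exact: hits_cconn h.
have [A [B hAB]] := from _ psp; exists A, B; split=> //.
(* The value (v_p, X^A Y^B v_p) is nonzero, because the second argument is a multiple of v_(s p).
   For odd A + B, moving the monomial across the symmetric form would make this value its own
   negative. *)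
- have /matrixP/(_ p p) := mon_skew A B.
  rewrite [RHS]mxE mul_Jl.
  have -> : ((mon A B)^T *m J) p p = J p (s p) * mon A B (s p) p.
    rewrite -[_ *m J]trmxK [LHS]mxE trmx_mul trmxK (wt_Jsym W) mul_Jl //.
  apply: contraPN => oAB; rewrite -signr_odd oAB expr1 mulN1r => /eqP.
  rewrite -subr_eq0 opprK -mulr2n -mulr_natl !mulf_eq0 (negPf (charK 1)).
  by rewrite (negPf (J_neq0 _)) /= (negPf hAB).
(* Both i and its dual are reached from [p]; the dual of the second path leads on from i to [s p],
   so the exponents add up to (A, B). *)
- move=> i pi; have [k [l h]] := from _ pi; have : cconn p (s i).
    by apply: cconn_trans psp _; rewrite -cconn_dual.
  move=> /from[k' [l' h']]; rewrite hits_dual involK in h'.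
  exists k, l; have e := hits_weight (hits_comp h h').
  rewrite (hits_weight hAB) in e; move: e => /addrI[e1 e2].
  by split=> //; [rewrite (natr_inj0 charK e1)|rewrite (natr_inj0 charK e2)]; exact: leq_addl.
move=> k l kA lB; move: hAB; rewrite -(subnK kA) -(subnK lB) => /hits_split[j pj _].
by exists j.
Qed.

End Cells.

(** * Outer invariant forms *)

Section WeightedForms.
Variables (K : fieldType) (m : nat) (X Y J : 'M[K]_m) (w : 'I_m -> K * K).
Hypothesis charK : forall k, k.+1%:R != 0 :> K.
Hypothesis W : weighted X Y J w.

Lemma delta_mul_eq0 (Z : 'M[K]_m) d : (forall j, Z d j = 0) -> (delta_mx 0 d : 'rV[K]_m) *m Z = 0.
Proof. by move=> Zd; rewrite -rowE; apply/rowP=> j; rewrite !mxE. Qed.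

(** The coordinate at [d] vanishes on the image of [X], and its translates by [Y] are multiples of
    the coordinates at the cells below [d], ending at [i]. So [chain] applies to this segment of
    even height [r.+1]. *)
Lemma weighted_chain d i r : odd r -> (forall j, X d j = 0) ->
  hits X Y i 0 r d -> (forall j, w i <> w j + (0, 1)) ->
  exists B, [/\ B \in zforms X Y, B != 0 &
    forall a b, B a b != 0 -> w a + w b = w d + w i].
Proof.
move=> r_odd Xd hd nb; pose e : 'rV[K]_m := delta_mx 0 d; exists (chain Y e r).
have eY k j : (e *m Y ^+ k) 0 j != 0 -> w d = w j + (0, k%:R).
  rewrite -rowE mxE => h; apply: (hits_weight W (k := 0) (l := k)).
  by rewrite /hits /mon expr0 mul1mx.
have dwi := hits_weight W hd.
have r1 : ((0, r.+1%:R) : K * K) = (0, 1) + (0, r%:R).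
  by congr pair; rewrite /= ?addr0 // -natr1 addrC.
have eY0 : e *m Y ^+ r.+1 = 0.
  apply/rowP=> j; rewrite [RHS]mxE; apply/eqP; apply: contra_notT (nb j) => /eY.
  by rewrite dwi r1 addrA => /addIr.
have YrE : (e *m Y ^+ r) 0 i != 0.
  by rewrite -rowE mxE; move: hd; rewrite /hits /mon expr0 mul1mx.
split.
- by apply: chain_zforms => //; [exact: wt_comm W|exact: delta_mul_eq0].
- have [a ha] : exists a, chain Y e r i a != 0.
    exists d.
    rewrite chainE big_ord_recl big1 => [|k _].
      rewrite addr0 expr0 mul1r subn0 mulf_neq0 // expr0 mulmx1 mxE !eqxx.
      exact: oner_neq0.
    apply/eqP; apply: contraT; rewrite !mulf_eq0 !negb_or => /and3P[_ _ /eY /eqP].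
    rewrite -subr_eq0 opprD addNKr oppr_eq0 => /eqP[/eqP].
    by rewrite (negPf (charK _)).
  by apply: contraNneq ha => ->; rewrite mxE.
move=> a b; rewrite chainE => h.
have [/existsP[k]|/existsPn hk] := boolP [exists k : 'I_r.+1,
    ((e *m Y ^+ (r - k)) 0 a != 0) && ((e *m Y ^+ k) 0 b != 0)].
  move=> /andP[/eY da /eY db]; have kr : (k <= r)%N by rewrite -ltnS.
  have -> : w i = w d - (0, r%:R) by rewrite dwi addrK.
  rewrite -[w a](addrK (0, (r - k)%:R)) -da -[w b](addrK (0, k%:R)) -db.
  rewrite [LHS]surjective_pairing [RHS]surjective_pairing; congr pair; rewrite /= ?natrB //; ring.
case/eqP: h; apply: big1 => k _; apply/eqP; rewrite !mulf_eq0.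
by have := hk k; rewrite negb_and !negbK => ->; rewrite orbT.
Qed.

End WeightedForms.

Section Corners.
Variables (K : fieldType) (m : nat).
Implicit Types (X Y : 'M[K]_m) (f g : 'rV[K]_m).

Lemma zformsC X Y : zforms X Y = zforms Y X.
Proof. by rewrite /zforms [(kact X :&: _)%VS]capvC. Qed.

Lemma actm_corner X f g :
  X^T *m corner f g + corner f g *m X = corner (f *m X) g + corner f (g *m X).
Proof.
rewrite /corner !mulmxBr !mulmxBl !mulmxA -!trmx_mul -!mulmxA.
by rewrite addrACA -opprD [X in _ - X]addrC opprD addrACA.
Qed.

Lemma cornerC f g : corner g f = - corner f g.
Proof. by rewrite /corner opprB. Qed.

Lemma corner_skew f g : (corner f g)^T = - corner f g.
Proof. by rewrite -cornerC /corner linearB /= !trmx_mul !trmxK. Qed.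

Lemma corner0l g : corner 0 g = 0.
Proof. by rewrite /corner trmx0 mul0mx mulmx0 subrr. Qed.

Lemma corner0r f : corner f 0 = 0.
Proof. by rewrite cornerC corner0l oppr0. Qed.

Lemma cornerE f g i j : corner f g i j = f 0 i * g 0 j - g 0 i * f 0 j.
Proof. by rewrite /corner !mxE !big_ord1 !mxE. Qed.

(* Polarized version of [chain] for r = 1. *)
Lemma cross_zforms X Y f g : X *m Y = Y *m X ->
  f *m Y = 0 -> g *m Y = 0 -> f *m X *m X = 0 -> g *m X *m X = 0 ->
  corner (f *m X) g + corner (g *m X) f \in zforms X Y.
Proof.
move=> XY fY gY fX gX.
have fXY : f *m X *m Y = 0 by rewrite -mulmxA XY mulmxA fY mul0mx.
have gXY : g *m X *m Y = 0 by rewrite -mulmxA XY mulmxA gY mul0mx.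
apply/zformsP; split.
- by rewrite linearD /= !corner_skew -opprD.
- rewrite mulmxDr mulmxDl addrACA !actm_corner fX gX !corner0l !add0r.
  by rewrite cornerC addNr.
by rewrite mulmxDr mulmxDl addrACA !actm_corner fXY gXY fY gY !corner0l !corner0r !addr0.
Qed.

End Corners.

Section OutForms.
Variables (K : fieldType) (n : nat).
Local Notation m := n.*2.+1.
Hypothesis charK : forall k, k.+1%:R != 0 :> K.
Variables (X Y J : 'M[K]_m) (w : 'I_m -> K * K) (s : 'I_m -> 'I_m) (N : nat).
Hypotheses (W : weighted X Y J w) (winj : injective w).
Hypothesis sJ : forall i j, (J i j != 0) = (j == s i).
Hypotheses (XN : X ^+ N = 0) (YN : Y ^+ N = 0).
Variable o : 'I_m.
Hypotheses (wo : w o = 0) (dimZ : (\dim (zforms X Y) <= n.+1)%N).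

Let sK : involutive s := involK W winj sJ.
Let ws i : w (s i) = - w i := weight_sK W sJ i.
Local Notation conn := (cconn X Y).
Local Notation src := (source X Y).
Local Notation hits := (hits X Y).

Definition inpair i j := cconn X Y i (s j) && wneg (w i + w j).

Lemma fixed_point i : s i = i -> i = o.
Proof.
move=> si; apply: winj; have := ws i; rewrite si wo => /eqP.
by rewrite -subr_eq0 opprK (weight_dbl charK) => /eqP.
Qed.

Lemma so_o : s o = o.
Proof. by apply: winj; rewrite ws wo oppr0. Qed.

Lemma cconn_s i j : conn i (s j) = conn j (s i).
Proof. by rewrite (cconn_dual W winj sJ) sK cconn_sym. Qed.

(** The pairs {i, s i} already account for n dimensions, which leaves one for outer forms; two
    nonzero forms with disjoint supports would need two. Taking [D] to be connectedness of i with
    the dual of j makes forms pairing non-dual components outer. *)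
Lemma out_unique B1 B2 : B1 \in zforms X Y -> B2 \in zforms X Y ->
  (forall i j, B1 i j != 0 -> ~~ inpair i j) -> (forall i j, B2 i j != 0 -> ~~ inpair i j) ->
  (forall i j, B1 i j != 0 -> B2 i j = 0) -> B1 != 0 -> B2 != 0 -> False.
Proof.
move=> Z1 Z2 out1 out2 dis B10 B20.
pose D : rel 'I_m := fun i j => conn i (s j).
have edge_conn i k : adjc X Y i k -> conn i k by exact: connect1.
have sD : symmetric D by move=> i j; exact: cconn_s.
have XD i j k : X k i != 0 -> D k j -> D i j.
  by move=> Xk; apply: cconn_trans; apply: edge_conn; rewrite /adjc /edge Xk.
have YD i j k : Y k i != 0 -> D k j -> D i j.
  by move=> Yk; apply: cconn_trans; apply: edge_conn; rewrite /adjc /edge Yk orbT.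
have := zforms_weight_ge charK W sD XD YD => dimge.
have : (1 < \dim (zforms X Y :&: outforms D w))%N.
  have inF B : B \in zforms X Y -> (forall i j, B i j != 0 -> ~~ inpair i j) ->
      B \in (zforms X Y :&: outforms D w)%VS.
    move=> ZB outB; rewrite memv_cap ZB; have /zformsP[sB _ _] := ZB.
    apply/formsP; split=> // i j; rewrite negbK => h; apply/eqP; apply: contraTT h.
    exact: outB.
  exact: (two_forms_dim (inF _ Z1 out1) (inF _ Z2 out2)).
move: dimge; set c := #|_|; suff : (n <= c)%N by lia.
have sr : symmetric (fun i j : 'I_m => j == s i).
  by move=> i j; rewrite -(inj_eq (can_inj sK)) sK eq_sym.
have e : m = (2 * #|[pred p : 'I_m * 'I_m | (p.1 < p.2)%N && (p.2 == s p.1)]| +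
    #|[pred i | i == s i]|)%N.
  rewrite -(card_sym_rel sr) -[LHS]card_ord -!sum1_card.
  rewrite [RHS](reindex_onto (fun i => (i, s i)) fst) /=.
    by apply: eq_bigl => i; rewrite !inE /= !eqxx.
  by move=> [i j]; rewrite inE /= => /eqP->.
have : (#|[pred i | i == s i]| <= 1)%N.
  apply/card_le1_eqP => i j; rewrite !inE => /eqP/esym/fixed_point-> /eqP/esym/fixed_point->.
  by [].
have : (#|[pred p : 'I_m * 'I_m | (p.1 < p.2)%N && (p.2 == s p.1)]| <= c)%N.
  apply: subset_leq_card; apply/fintype.subsetP => -[i j]; rewrite !inE /=.
  move=> /andP[-> /eqP->] /=; rewrite /D sK /cconn connect0 ws subrr eqxx //.
move: e; clear; lia.
Qed.

Definition dlt (p : 'I_m) : 'rV[K]_m := delta_mx 0 p.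

Lemma dlt_source p : src p -> dlt p *m X = 0 /\ dlt p *m Y = 0.
Proof.
by move=> sp; split; rewrite -rowE; apply/rowP=> j; rewrite !mxE ?(sourceX _ sp) ?(sourceY _ sp).
Qed.

Lemma corner_dltE p q i j : corner (dlt p) (dlt q) i j != 0 ->
  (i = p /\ j = q) \/ (i = q /\ j = p).
Proof.
rewrite cornerE !mxE !eqxx /=.
case: (i =P p) => [->|_]; last first.
  case: (i =P q) => [->|_]; last by rewrite !mul0r subrr eqxx.
  by case: (j =P p) => [->|_]; [right|rewrite mulr0 mul0r subrr eqxx].
case: (j =P q) => [->|_]; first by left.
case: (p =P q) => [->|_]; last by rewrite mulr0 mul0r subrr eqxx.
by case: (j =P q) => [->|_]; [left|rewrite !mulr0 subrr eqxx].
Qed.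

Lemma corner_dlt_neq0 p q : p != q -> corner (dlt p) (dlt q) p q != 0.
Proof.
move=> pq; rewrite cornerE !mxE !eqxx /= (negPf pq) [q == p]eq_sym (negPf pq).
by rewrite mulr1 mul0r subr0 oner_eq0.
Qed.

Lemma mx_neq0 (A : 'M[K]_m) i j : A i j != 0 -> A != 0.
Proof. by apply: contraNneq => ->; rewrite mxE. Qed.

Lemma inpair_sym : symmetric inpair.
Proof. by move=> i j; rewrite /inpair cconn_s addrC. Qed.

Lemma corner_out p q : src p -> src q -> p != q -> ~~ inpair p q ->
  [/\ corner (dlt p) (dlt q) \in zforms X Y, corner (dlt p) (dlt q) != 0 &
   forall i j, corner (dlt p) (dlt q) i j != 0 -> ~~ inpair i j].
Proof.
move=> sp sq pq out; have [pX pY] := dlt_source sp; have [qX qY] := dlt_source sq.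
split; first exact: corner_zforms.
  exact: mx_neq0 (corner_dlt_neq0 pq).
by move=> i j /corner_dltE[[-> ->]|[-> ->]] //; rewrite inpair_sym.
Qed.

Lemma disconnected_out i j : conn o i -> ~~ conn o j -> ~~ inpair i j.
Proof.
move=> oi; apply: contra => /andP[isj _].
by rewrite (cconn_dual W winj sJ) so_o; apply: cconn_trans oi isj.
Qed.

(** The component of [o] is its own dual, so a corner form joining a source in it to a source
    outside is outer. Two different such pairs would give two outer forms with disjoint supports. *)
Lemma source_pair_unique p q p' q' : src p -> src q -> src p' -> src q' ->
  conn o p -> ~~ conn o q -> conn o p' -> ~~ conn o q' -> p = p' /\ q = q'.
Proof.
move=> sp sq sp' sq' op oq op' oq'.
have ne a b : conn o a -> ~~ conn o b -> a != b by move=> oa; apply: contraNneq => <-.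
have [Z1 B1 O1] := corner_out sp sq (ne _ _ op oq) (disconnected_out op oq).
have [Z2 B2 O2] := corner_out sp' sq' (ne _ _ op' oq') (disconnected_out op' oq').
apply: contrapT => npq; apply: (out_unique Z1 Z2 O1 O2) => // i j ij; apply/eqP.
apply: contraT => /corner_dltE ij'; case: npq; move: (corner_dltE ij) ij' op op' oq oq'.
by case=> -[-> ->] [] [-> ->] // oa ob na nb; exfalso; move/negP: na; apply.
Qed.

Lemma row_pred (Z : 'M[K]_m) i p : (forall j, Z i j != 0 -> j = p) ->
  dlt i *m Z = Z i p *: dlt p.
Proof.
move=> h; rewrite -rowE; apply/rowP=> j; rewrite !mxE eqxx /=.
have [->|jp] := eqVneq j p; first by rewrite mulr1.
by rewrite mulr0; apply/eqP; apply: contraNT jp => /h ->.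
Qed.

(* Z1, Z2 stand for X, Y in either order. *)
Lemma cross_out Z1 Z2 c c1 d d1 : zforms Z1 Z2 = zforms X Y -> Z1 *m Z2 = Z2 *m Z1 ->
  dlt c *m Z1 = 0 -> dlt d *m Z1 = 0 ->
  dlt c1 *m Z2 = 0 -> dlt d1 *m Z2 = 0 ->
  Z1 c1 c != 0 -> (forall j, Z1 c1 j != 0 -> j = c) -> (forall j, Z1 d1 j != 0 -> j = d) ->
  src c -> src d -> conn o c -> conn o c1 -> ~~ conn o d -> ~~ conn o d1 -> d != d1 ->
  False.
Proof.
move=> ZE ZC cZ dZ c1Z d1Z c1c c1u d1u sc sd oc oc1 od od1 dd1.
have ne a b : conn o a -> ~~ conn o b -> a != b by move=> oa; apply: contraNneq => <-.
have [Z2c B2 O2] := corner_out sc sd (ne _ _ oc od) (disconnected_out oc od).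
(* [B] pairs c with d1 and d with c1. It is outer, and its support is disjoint from that of the
   corner form of c and d. *)
pose B := corner (dlt c1 *m Z1) (dlt d1) + corner (dlt d1 *m Z1) (dlt c1).
have BE : B = Z1 c1 c *: corner (dlt c) (dlt d1) + Z1 d1 d *: corner (dlt d) (dlt c1).
  have cs x f g : corner (x *: f) g = x *: corner f g :> 'M[K]_m.
    by rewrite /corner linearZ /= -scalemxAl -scalemxAr scalerBr.
  by rewrite /B (row_pred c1u) (row_pred d1u) !cs.
have BZ : B \in zforms X Y.
  rewrite -ZE; apply: cross_zforms => //.
    by rewrite (row_pred c1u) -scalemxAl cZ scaler0.
  by rewrite (row_pred d1u) -scalemxAl dZ scaler0.
have Bsupp i j : B i j != 0 ->
    (i = c /\ j = d1) \/ (i = d1 /\ j = c) \/ (i = d /\ j = c1) \/ (i = c1 /\ j = d).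
  rewrite BE mxE [X in X + _]mxE [X in _ + X]mxE => h.
  have [e1|/corner_dltE[] ] := eqVneq (corner (dlt c) (dlt d1) i j) 0; [|by left|by right; left].
  have [e2|/corner_dltE[] h2] := eqVneq (corner (dlt d) (dlt c1) i j) 0.
  - by move: h; rewrite e1 e2 !mulr0 addr0 eqxx.
  - by right; right; left.
  - by right; right; right.
have Bout i j : B i j != 0 -> ~~ inpair i j.
  move=> /Bsupp[[-> ->]|[[-> ->]|[[-> ->]|[-> ->]]]]; first exact: disconnected_out.
  - by rewrite inpair_sym; exact: disconnected_out.
  - by rewrite inpair_sym; exact: disconnected_out.
  exact: disconnected_out.
have B0 : B != 0.
  apply: (mx_neq0 (i := c) (j := d1)); rewrite BE mxE [X in X + _]mxE [X in _ + X]mxE.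
  have -> : corner (dlt d) (dlt c1) c d1 = 0.
    apply/eqP; apply: contraT => /corner_dltE[[e _]|[_ e]].
      by have := ne _ _ oc od; rewrite e eqxx.
    by rewrite e eqxx in dd1.
  by rewrite mulr0 addr0 mulf_neq0 // corner_dlt_neq0 // ne.
apply: (out_unique BZ Z2c Bout O2) => // i j /Bsupp h; apply/eqP; apply: contraT.
move=> /corner_dltE h'; case: h h' => [[-> ->]|[[-> ->]|[[-> ->]|[-> ->]]]] [] [e1 e2].
- by rewrite e2 eqxx in dd1.
- by have := ne _ _ oc od; rewrite e1 eqxx.
- by have := ne _ _ oc od1; rewrite e1 eqxx.
- by rewrite e1 eqxx in dd1.
- by have := ne _ _ oc od; rewrite e1 eqxx.
- by move: c1c; rewrite e2 -[Z1 c c]mulr1; have /rowP/(_ c) := cZ; rewrite -rowE !mxE => ->;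
    rewrite mul0r eqxx.
- by move: c1c; rewrite e1; have /rowP/(_ c) := cZ; rewrite -rowE !mxE => ->; rewrite eqxx.
by have := ne _ _ oc od; rewrite e2 eqxx.
Qed.

End OutForms.

Record cells (K : fieldType) (n : nat) (X Y J : 'M[K]_n.*2.+1) (w : 'I_n.*2.+1 -> K * K)
    (s : 'I_n.*2.+1 -> 'I_n.*2.+1) (N : nat) (o : 'I_n.*2.+1) : Prop := Cells {
  cl_W : weighted X Y J w;
  cl_inj : injective w;
  cl_sJ : forall i j, (J i j != 0) = (j == s i);
  cl_XN : X ^+ N = 0;
  cl_YN : Y ^+ N = 0;
  cl_o : w o = 0;
  cl_dim : \dim (zforms X Y) = n.+1
}.

Lemma weighted_swap (K : fieldType) m (X Y J : 'M[K]_m) w :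
  weighted X Y J w -> weighted Y X J (fun i => ((w i).2, (w i).1)).
Proof.
case=> XY XJ YJ Js Ju wX wY wJ; split=> //.
- by move=> i j /wY ->.
- by move=> i j /wX ->.
move=> i j /wJ e; transitivity ((w i + w j).2, (w i + w j).1); first exact: erefl.
by rewrite e.
Qed.

Lemma cells_swap (K : fieldType) n (X Y J : 'M[K]_n.*2.+1) w s N o :
  cells X Y J w s N o -> cells Y X J (fun i => ((w i).2, (w i).1)) s N o.
Proof.
case=> W inj sJ XN YN wo dimZ; split=> //.
- exact: weighted_swap.
- move=> i j [h2 h1]; apply: inj; move: h1 h2.
  by case: (w i) (w j) => ? ? [? ?] /= -> ->.
- by rewrite wo.
by rewrite zformsC.
Qed.

Lemma cconn_swap (K : fieldType) m (X Y : 'M[K]_m) i j : cconn Y X i j = cconn X Y i j.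
Proof.
by apply: eq_connect => a b; rewrite /adjc /edge orbC [X in _ || X]orbC [X in X || _]orbC
  orbC.
Qed.

Lemma source_swap (K : fieldType) m (X Y : 'M[K]_m) p : source Y X p = source X Y p.
Proof. by apply: eq_forallb => i; rewrite andbC. Qed.

Lemma hits_swap (K : fieldType) m (X Y : 'M[K]_m) p k l i : X *m Y = Y *m X ->
  hits Y X p k l i = hits X Y p l k i.
Proof.
move=> XY; rewrite /hits; suff -> : mon Y X k l = mon X Y l k by [].
have cYX : GRing.comm Y X by exact: esym XY.
exact: (commr_sym (commrX k (commr_sym (commrX l cYX)))).
Qed.

(** * Two components: a point and a rectangle *)

Section TwoComponents.
Variables (K : fieldType) (n : nat).
Local Notation m := n.*2.+1.
Hypothesis charK : forall k, k.+1%:R != 0 :> K.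

(** If both rectangles contained a horizontal step, from c to c1 and from d to d1, then [cross_out]
    would produce a second outer form beside the corner form of c and d. *)
Lemma component_width (X Y J : 'M[K]_m) w s N o c d A B A' B' :
  cells X Y J w s N o ->
  source X Y c -> source X Y d -> cconn X Y o c -> ~~ cconn X Y o d ->
  (forall i, cconn X Y c i ->
    exists k l, [/\ (k <= A)%N, (l <= B)%N & hits X Y c k l i]) ->
  (forall k l, (k <= A)%N -> (l <= B)%N -> exists i, hits X Y c k l i) ->
  (forall i, cconn X Y d i ->
    exists k l, [/\ (k <= A')%N, (l <= B')%N & hits X Y d k l i]) ->
  (forall k l, (k <= A')%N -> (l <= B')%N -> exists i, hits X Y d k l i) ->
  (0 < A')%N -> A = 0%N.
Proof.
move=> [W inj sJ XN YN wo dimZ] sc sd oc od cin cex din dex A'0.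
apply/eqP; rewrite -leqn0 leqNgt; apply/negP=> A0.
have [c1 hc1] := cex 1%N 0%N A0 (leq0n _).
have [d1 hd1] := dex 1%N 0%N A'0 (leq0n _).
have cc1 := hits_cconn W inj hc1; have dd1 := hits_cconn W inj hd1.
have nat2 (p q : K * K) k l k' l' : p + (k%:R, l%:R) = p + (k'%:R, l'%:R) ->
    k = k' /\ l = l'.
  by move=> /addrI[/(natr_inj0 charK)-> /(natr_inj0 charK)->].
have predX (p p1 : 'I_m) (A0' B0' : nat) :
    (forall i, cconn X Y p i -> exists k l, [/\ (k <= A0')%N, (l <= B0')%N & hits X Y p k l i]) ->
    hits X Y p 1 0 p1 -> (forall j, X p1 j != 0 -> j = p) /\ (forall j, Y p1 j = 0).
  move=> pin hp1; have pp1 := hits_cconn W inj hp1; split=> j.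
    move=> Xj; apply: inj; have := hits_weight W hp1; rewrite (wt_X W Xj) => /addIr.
    by [].
  apply/eqP; apply: contraT => Yj.
  have [k [l [_ _ h]]] : exists k l, [/\ (k <= A0')%N, (l <= B0')%N & hits X Y p k l j].
    apply: pin; apply: cconn_trans pp1 _; rewrite cconn_sym; apply: connect1.
    by rewrite /adjc /edge Yj orbT.
  have hj : hits X Y j 0 1 p1 by rewrite hitsY.
  have e := hits_weight W (hits_comp W inj h hj); rewrite (hits_weight W hp1) in e.
  by have [_] := nat2 _ 0 _ _ _ _ e.
have [Xc1 Yc1] := predX _ _ _ _ cin hc1; have [Xd1 Yd1] := predX _ _ _ _ din hd1.
have row0 (Z : 'M[K]_m) p : (forall j, Z p j = 0) -> dlt K p *m Z = 0.
  by move=> h; rewrite -rowE; apply/rowP=> j; rewrite !mxE.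
apply: (cross_out charK W inj sJ wo (eq_leq dimZ) (Z1 := X) (Z2 := Y) (c := c) (c1 := c1)
  (d := d) (d1 := d1)) => //.
- exact: wt_comm W.
- by apply: row0 => j; exact: sourceX sc.
- by apply: row0 => j; exact: sourceX sd.
- exact: row0.
- exact: row0.
- by rewrite -(hitsX X Y).
- exact: cconn_trans oc cc1.
- by apply: contra od => od1; apply: cconn_trans od1 _; rewrite cconn_sym.
apply/eqP=> e; move: hd1; rewrite -e hitsX => /(wt_X W)/eqP.
by rewrite -subr_eq0 opprD addNKr oppr_eq0 => /eqP[/eqP]; rewrite oner_eq0.
Qed.

Lemma two_components (X Y J : 'M[K]_m) w s N o : cells X Y J w s N o ->
  (exists i, ~~ cconn X Y o i) ->
  exists p A B, [/\ odd A /\ odd B, w p + w p = - (A%:R, B%:R),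
    (forall i, i != o -> exists k l, [/\ (k <= A)%N, (l <= B)%N & hits X Y p k l i]),
    (forall k l, (k <= A)%N -> (l <= B)%N -> exists2 i, i != o & hits X Y p k l i) &
    forall i, i != o -> ~~ cconn X Y o i].
Proof.
move=> C; case: (C) => W inj sJ XN YN wo dimZ [i0 oi0].
have sK := involK W inj sJ; have ws := weight_sK W sJ.
have so := so_o W inj sJ wo.
have src i : exists2 p, source X Y p & cconn X Y p i.
  have [p [k [l [sp h]]]] := source_exists W inj XN YN i.
  by exists p => //; exact: (hits_cconn W inj h).
have [c sc co] := src o; have [d sd di] := src i0.
have oc : cconn X Y o c by rewrite cconn_sym.
have od : ~~ cconn X Y o d by apply: contra oi0 => od; apply: cconn_trans od di.
have uc c' : source X Y c' -> cconn X Y o c' -> c' = c.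
  by move=> sc' oc'; have [] := source_pair_unique charK W inj sJ wo (eq_leq dimZ) sc' sd sc sd.
have ud d' : source X Y d' -> ~~ cconn X Y o d' -> d' = d.
  by move=> sd' od'; have [] := source_pair_unique charK W inj sJ wo (eq_leq dimZ) sc sd' sc sd.
have o_s i : cconn X Y o i = cconn X Y o (s i).
  by rewrite (cconn_dual W inj sJ) so.
have dconn i : ~~ cconn X Y o i -> cconn X Y d i.
  move=> oi; have [d' sd' d'i] := src i; have <- // : d' = d.
  by apply: ud => //; apply: contra oi => od'; apply: cconn_trans od' d'i.
have cs : cconn X Y c (s c) by apply: cconn_trans co _; rewrite -o_s.
have ds : cconn X Y d (s d) by apply: dconn; rewrite -o_s.
have [A [B [cAB cpar cin cex]]] := rect_component charK W inj sJ XN YN sc cs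
  (fun q sq cq => uc q sq (cconn_trans oc cq)).
have odq q : cconn X Y d q -> ~~ cconn X Y o q.
  by move=> dq; apply: contra od => oq; apply: cconn_trans oq _; rewrite cconn_sym.
have [A' [B' [dAB dpar din dex]]] := rect_component charK W inj sJ XN YN sd ds
  (fun q sq dq => ud q sq (odq q dq)).
have wd : w d + w d = - (A'%:R, B'%:R).
  have e := hits_weight W dAB; rewrite ws in e.
  by rewrite -[LHS]opprK opprD {1}e addrAC subrr add0r.
(* The sum A' + B' is even. If both were even, the centre of the rectangle would be a cell of weight
   0, hence [o], which lies in the other component. *)
have dodd : odd A' /\ odd B'.
  suff oA : odd A' by split=> //; move: dpar; rewrite oddD oA negbK.
  apply: contraT => eA; have eB : ~~ odd B' by move: dpar; rewrite oddD (negPf eA).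
  have half_le k : (k./2 <= k)%N by rewrite -divn2 leq_div.
  have [i hi] := dex (A'./2) (B'./2) (half_le _) (half_le _).
  have wi : w i = 0.
    apply/eqP; rewrite -(weight_dbl charK) (hits_weight W hi) addrACA wd.
    have hh k : ~~ odd k -> (k./2)%:R + (k./2)%:R = k%:R :> K.
      by move=> ek; rewrite -natrD addnn -[in RHS](odd_double_half k) (negPf ek).
    have -> : ((A'./2)%:R, (B'./2)%:R) + ((A'./2)%:R, (B'./2)%:R) = (A'%:R, B'%:R) :> K * K.
      by congr pair; exact: hh.
    by rewrite addNr.
  have io : i = o by apply: inj; rewrite wi wo.
  by have := odq _ (hits_cconn W inj hi); rewrite io /cconn connect0.
(* Odd sides are positive, so the second rectangle has steps in both directions and the component of
   [o] has none. *)
have A0 : A = 0%N.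
  apply: (component_width C sc sd oc od cin cex din dex).
  by case: (A') dodd => // -[].
have B0 : B = 0%N.
  have XY := wt_comm W.
  apply: (component_width (cells_swap C) (c := c) (d := d) (A := B) (B := A) (A' := B') (B' := A')).
  - by rewrite source_swap.
  - by rewrite source_swap.
  - by rewrite cconn_swap.
  - by rewrite cconn_swap.
  - move=> i; rewrite cconn_swap => /cin[k [l [kA lB h]]]; exists l, k; split=> //.
    by rewrite hits_swap.
  - by move=> k l kB lA; have [i h] := cex l k lA kB; exists i; rewrite hits_swap.
  - move=> i; rewrite cconn_swap => /din[k [l [kA lB h]]]; exists l, k; split=> //.
    by rewrite hits_swap.
  - by move=> k l kB lA; have [i h] := dex l k lA kB; exists i; rewrite hits_swap.
  by case: (B') dodd => // -[].
have only i : cconn X Y o i -> i = c.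
  move=> oi; have [k [l [kA lB h]]] := cin _ (cconn_trans co oi).
  move: kA lB h; rewrite A0 B0 !leqn0 => /eqP-> /eqP-> h; apply: inj.
  by rewrite (hits_weight W h) addr0.
have oeq i : i != o -> ~~ cconn X Y o i.
  by apply: contra => /only ->; rewrite [o]only ?/cconn ?connect0.
exists d, A', B'; split=> //.
  by move=> i /oeq/dconn/din.
move=> k l kA lB; have [i h] := dex k l kA lB; exists i => //.
by apply: contraNneq (odq _ (hits_cconn W inj h)) => ->; rewrite /cconn connect0.
Qed.

End TwoComponents.

Section IntChar0.
Variable K : fieldType.
Hypothesis charK : forall k, k.+1%:R != 0 :> K.

Lemma intr_inj0 : injective (fun z : int => z%:~R : K).
Proof.
have H (z : int) : z%:~R = 0 :> K -> z = 0.
  case: z => [[|k]|k] //; first by rewrite -pmulrn => /eqP; rewrite (negPf (charK k)).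
  by rewrite NegzE mulrNz -pmulrn => /eqP; rewrite oppr_eq0 (negPf (charK k)).
by move=> a b /= e; apply/eqP; rewrite -subr_eq0; apply/eqP/H; rewrite rmorphB /= e subrr.
Qed.

Lemma nonposN_int (z : int) : nonposN (z%:~R : K) -> z <= 0.
Proof.
move=> /asboolP[k e]; have -> : z = - k%:Z by apply: intr_inj0; rewrite e rmorphN.
by rewrite oppr_le0.
Qed.
End IntChar0.

(** * Connected pairs and their integral positions *)

Section Connected.
Variables (K : fieldType) (n : nat).
Local Notation m := n.*2.+1.
Hypothesis charK : forall k, k.+1%:R != 0 :> K.

Record icells (X Y J : 'M[K]_m) w s N o (pos : 'I_m -> int * int) : Prop := ICells {
  ic_C : cells X Y J w s N o;
  ic_pos : forall i, w i = ((pos i).1%:~R, (pos i).2%:~R);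
  ic_conn : forall i, cconn X Y o i
}.

Lemma icells_swap X Y J w s N o pos : icells X Y J w s N o pos ->
  icells Y X J (fun i => ((w i).2, (w i).1)) s N o (swap_pos pos).
Proof.
case=> C wp cn; split; first exact: cells_swap.
  by move=> i; rewrite wp.
by move=> i; rewrite cconn_swap.
Qed.

Lemma icells_exist X Y J w s N o : cells X Y J w s N o -> (forall i, cconn X Y o i) ->
  exists pos, icells X Y J w s N o pos.
Proof.
move=> C cn; suff /choice[pos h] : forall i, exists z : int * int, w i = (z.1%:~R, z.2%:~R).
  by exists pos.
case: C => W inj sJ XN YN wo dimZ.
have step a b : adjc X Y a b -> (exists z : int * int, w a = (z.1%:~R, z.2%:~R)) ->
    exists z : int * int, w b = (z.1%:~R, z.2%:~R).
  move=> ab [z wa]; case/orP: ab => /orP[/(wt_X W)|/(wt_Y W)] e.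
  - exists (z + (1, 0)); rewrite e wa; congr pair; rewrite /= rmorphD //.
  - exists (z + (0, 1)); rewrite e wa; congr pair; rewrite /= rmorphD //.
  - exists (z - (1, 0)); rewrite -[LHS](addrK (1, 0)) -e wa; congr pair;
      by rewrite /= rmorphB.
  - exists (z - (0, 1)); rewrite -[LHS](addrK (0, 1)) -e wa; congr pair;
      by rewrite /= rmorphB.
move=> i; have /connectP[p + ->] := cn i.
have : exists z : int * int, w o = (z.1%:~R, z.2%:~R) by exists 0; rewrite wo.
elim: p (o) => [//|c p IH] a wa /= /andP[ac]; apply: IH.
exact: step ac wa.
Qed.

Section Fixed.
Variables (X Y J : 'M[K]_m) (w : 'I_m -> K * K) (s : 'I_m -> 'I_m) (N : nat) (o : 'I_m).
Variable pos : 'I_m -> int * int.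
Hypothesis IC : icells X Y J w s N o pos.

Let C := ic_C IC.
Let W := cl_W C.
Let winj := cl_inj C.
Let sJ := cl_sJ C.
Let wpos := ic_pos IC.

Lemma pos_inj : injective pos.
Proof. by move=> i j e; apply: winj; rewrite !wpos e. Qed.

Lemma int_pair (a b c d : int) : (a%:~R, b%:~R) = (c%:~R, d%:~R) :> K * K ->
  (a, b) = (c, d).
Proof. by case=> /(intr_inj0 charK)-> /(intr_inj0 charK)->. Qed.

Lemma pos_s i : pos (s i) = - pos i.
Proof.
have := weight_sK W sJ i; rewrite !wpos => e.
rewrite [LHS]surjective_pairing; apply: int_pair; rewrite e.
by congr pair; rewrite /= rmorphN.
Qed.

Lemma pos_o : pos o = 0.
Proof.
have := cl_o C; rewrite wpos => e; rewrite [LHS]surjective_pairing.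
exact: int_pair.
Qed.

Definition gX i k : Prop := X k i != 0.
Definition gY i k : Prop := Y k i != 0.

Lemma hits_pos i k a b : hits X Y i a b k -> pos k = pos i + (a%:Z, b%:Z).
Proof.
move=> /(hits_weight W); rewrite !wpos => e.
rewrite [LHS]surjective_pairing [pos i]surjective_pairing; apply: int_pair; rewrite e.
by congr pair; rewrite /= rmorphD.
Qed.

Lemma grid_cells : grid_rel gX gY pos.
Proof.
split; first exact: pos_inj.
- by move=> a b ab; apply: (@hits_pos _ _ 1 0); rewrite hitsX.
- by move=> a b ab; apply: (@hits_pos _ _ 0 1); rewrite hitsY.
- move=> a b c; rewrite /gX /gY -!(hitsX X Y) -!(hitsY X Y) => ab /(hits_comp W winj ab) h.
  have [d ad dc] := @hits_split K m X Y J w W a 0 1 1 0 c h.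
  by exists d; rewrite -?(hitsX X Y) -?(hitsY X Y).
move=> a b c; rewrite /gX /gY -!(hitsX X Y) -!(hitsY X Y) => ab /(hits_comp W winj ab) h.
have [d ad dc] := @hits_split K m X Y J w W a 1 0 0 1 c h.
by exists d; rewrite -?(hitsX X Y) -?(hitsY X Y).
Qed.

Lemma conn_cells i k : conn gX gY i k.
Proof.
have : cconn X Y i k by apply: cconn_trans (ic_conn IC k); rewrite cconn_sym; exact: ic_conn IC i.
move=> /connectP[p]; elim/last_ind: p k => [|p c IH] k /=; first by move=> _ ->; exact: Conn0.
rewrite rcons_path last_rcons => /andP[ip ac] ->.
apply: (ConnS (IH _ ip erefl)).
by case/orP: ac => /orP[h|h]; [exact: Or41|exact: Or43|exact: Or42|exact: Or44].
Qed.

Definition at_ u v := exists i, pos i = (u, v).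

Lemma le_rpath i k : (pos i).1 <= (pos k).1 -> (pos i).2 <= (pos k).2 -> rpath gX gY i k.
Proof. exact: le_reach grid_cells (conn_cells i k). Qed.

Lemma at_box a b c d u v : at_ a b -> at_ c d -> a <= u <= c -> b <= v <= d -> at_ u v.
Proof.
move=> [i pi] [k pk] hu hv; apply: (reach_box grid_cells (a := i) (b := k)).
- by apply: le_rpath; rewrite pi pk /=; lia.
- by rewrite pi pk.
by rewrite pi pk.
Qed.

Lemma at_opp u v : at_ u v -> at_ (- u) (- v).
Proof. by move=> [i pi]; exists (s i); rewrite pos_s pi. Qed.

Lemma le_hits i k a b : pos k = pos i + (a%:Z, b%:Z) -> hits X Y i a b k.
Proof.
move=> e.
have ik : rpath gX gY i k by apply: le_rpath; rewrite e /=; lia.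
have {ik} [a' [b' h]] : exists a b, hits X Y i a b k.
  elim: ik => [|j l _ [a' [b' h]] jl|j l _ [a' [b' h]] jl]; first by exists 0%N, 0%N; exact: hits0.
    by exists (1 + a')%N, (0 + b')%N; apply: (hits_comp W winj h); rewrite hitsX.
  by exists (0 + a')%N, (1 + b')%N; apply: (hits_comp W winj h); rewrite hitsY.
by move: (hits_pos h); rewrite e => /addrI[[-> ->]].
Qed.

Lemma dltX0 d : ~ at_ ((pos d).1 - 1) (pos d).2 -> dlt K d *m X = 0.
Proof.
move=> nl; rewrite -rowE; apply/rowP=> j; rewrite !mxE; apply/eqP; apply: contra_notT nl => Xdj.
have h : hits X Y j 1 0 d by rewrite hitsX.
by exists j; rewrite (hits_pos h) /= addr0 addrK -surjective_pairing.
Qed.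

Lemma dltY0 d : ~ at_ (pos d).1 ((pos d).2 - 1) -> dlt K d *m Y = 0.
Proof.
move=> nl; rewrite -rowE; apply/rowP=> j; rewrite !mxE; apply/eqP; apply: contra_notT nl => Ydj.
have h : hits X Y j 0 1 d by rewrite hitsY.
by exists j; rewrite (hits_pos h) /= addr0 addrK -surjective_pairing.
Qed.

Lemma weight_forms p q :
  (exists B, [/\ B \in zforms X Y, B != 0 & forall a b, B a b != 0 -> w a + w b = w p + w q]) ->
  exists B, [/\ B \in zforms X Y, B != 0 & forall a b, B a b != 0 -> pos a + pos b = pos p + pos q].
Proof.
move=> [B [BZ B0 BE]]; exists B; split=> // a b /BE; rewrite !wpos => e.
by rewrite [LHS]surjective_pairing; apply: int_pair; rewrite /= !rmorphD.
Qed.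

Lemma vchain d i r : odd r -> ~ at_ ((pos d).1 - 1) (pos d).2 ->
  pos d = pos i + (0, r%:Z) -> ~ at_ (pos i).1 ((pos i).2 - 1) ->
  exists B, [/\ B \in zforms X Y, B != 0 &
    forall a b, B a b != 0 -> pos a + pos b = pos d + pos i].
Proof.
move=> r_odd nl di nb; apply: weight_forms; apply: (weighted_chain charK W r_odd).
- move=> j; apply/eqP; apply: contra_notT nl => Xdj; exists j.
  have h : hits X Y j 1 0 d by rewrite hitsX.
  by rewrite (hits_pos h) /= addr0 addrK -surjective_pairing.
- exact: le_hits di.
move=> j; rewrite !wpos => -[] e1 e2; apply: nb; exists j.
have : pos i = pos j + (0, 1).
  rewrite [LHS]surjective_pairing; apply: int_pair; rewrite e1 e2.
  by congr pair; rewrite /= rmorphD.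
by move=> ->; rewrite [LHS]surjective_pairing; congr pair => /=; lia.
Qed.

Lemma corner_at p q : ~ at_ ((pos p).1 - 1) (pos p).2 -> ~ at_ (pos p).1 ((pos p).2 - 1) ->
  ~ at_ ((pos q).1 - 1) (pos q).2 -> ~ at_ (pos q).1 ((pos q).2 - 1) -> p != q ->
  exists B, [/\ B \in zforms X Y, B != 0 &
    forall a b, B a b != 0 -> pos a + pos b = pos p + pos q].
Proof.
move=> p1 p2 q1 q2 pq; exists (corner (dlt K p) (dlt K q)); split.
- by apply: corner_zforms; [exact: dltX0|exact: dltY0|exact: dltX0|exact: dltY0].
- by apply: (mx_neq0 (i := p) (j := q)); exact: corner_dlt_neq0.
by move=> a b /corner_dltE[[-> ->]|[-> ->]] //; rewrite addrC.
Qed.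

(** A positive coordinate keeps a degree out of {0, -1, -2, ...}^2, so both forms are outer; forms
    of different degrees have disjoint supports. *)
Lemma two_degrees (z1 z2 : int * int) :
  (exists B, [/\ B \in zforms X Y, B != 0 & forall a b, B a b != 0 -> pos a + pos b = z1]) ->
  (exists B, [/\ B \in zforms X Y, B != 0 & forall a b, B a b != 0 -> pos a + pos b = z2]) ->
  (0 < z1.1) || (0 < z1.2) -> (0 < z2.1) || (0 < z2.2) -> z1 <> z2 -> False.
Proof.
move=> [B1 [Z1 n1 h1]] [B2 [Z2 n2 h2]] p1 p2 z12.
have out z a b : pos a + pos b = z -> (0 < z.1) || (0 < z.2) -> ~~ inpair X Y w s a b.
  move=> e pz; apply/negP=> /andP[_ /andP[]]; rewrite !wpos /= -!intrD.
  move=> /(nonposN_int charK) u1 /(nonposN_int charK) u2.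
  by case/orP: pz; rewrite -e /=; lia.
apply: (out_unique charK W winj sJ (cl_o C) (eq_leq (cl_dim C)) Z1 Z2) => //.
- by move=> i j /h1/out; apply.
- by move=> i j /h2/out; apply.
by move=> i j /h1 e1; apply/eqP; apply: contra_notT z12 => /h2 <-.
Qed.

End Fixed.
End Connected.

(** * An upper bound by counting even cells *)

Lemma sum_sign (A : nat) : \sum_(k < A.+1) (-1) ^+ k = (~~ odd A)%:R :> int.
Proof.
elim: A => [|A IH]; first by rewrite big_ord_recl big_ord0.
by rewrite big_ord_recr /= IH -signr_odd /=; case: (odd A).
Qed.

(** The excess of even over odd cells is the product of the alternating sums along the two sides,
    each of which is 0 or 1. *)
Lemma even_cells (A B : nat) : (A.+1 * B.+1 <=
  2 * #|[pred p : 'I_A.+1 * 'I_B.+1 | ~~ odd (p.1 + p.2)]|)%N.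
Proof.
pose P := [pred p : 'I_A.+1 * 'I_B.+1 | ~~ odd (p.1 + p.2)].
have tot : (#|P| + #|predC P| = A.+1 * B.+1)%N by rewrite cardC card_prod !card_ord.
suff : 0 <= #|P|%:Z - #|predC P|%:Z by rewrite -/P; lia.
have -> : #|P|%:Z - #|predC P|%:Z = \sum_(p : 'I_A.+1 * 'I_B.+1) (-1) ^+ (p.1 + p.2).
  rewrite (bigID P) /= -sum1_card -[#|predC P|]sum1_card; congr (_ + _).
    rewrite -[LHS]natz natr_sum; apply: eq_bigr => p; rewrite inE => /negPf e.
    by rewrite -signr_odd e.
  rewrite -[X in - X]natz natr_sum -sumrN; apply: eq_big => [p|p]; first by rewrite !inE.
  by rewrite !inE negbK => e; rewrite -signr_odd e.
rewrite -(pair_bigA _ (fun (k : 'I_A.+1) (l : 'I_B.+1) => (-1) ^+ (k + l))) /=.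
under eq_bigr => k _ do under eq_bigr => l _ do rewrite exprD.
under eq_bigr => k _ do rewrite -mulr_sumr sum_sign.
by rewrite -mulr_suml sum_sign -natrM.
Qed.

Section UpperBound.
Variables (K : fieldType) (m : nat).
Hypothesis charK : forall k, k.+1%:R != 0 :> K.
Variables (X Y J : 'M[K]_m) (w : 'I_m -> K * K).
Hypotheses (W : weighted X Y J w) (winj : injective w).

Lemma hits_reaches p k l i : hits X Y p k l i -> reaches X Y p i k l.
Proof.
move=> h; exists (mon X Y k l i p) => //.
rewrite -colE; apply/colP=> j; rewrite [LHS]mxE [RHS]mxE [X in _ = _ * X]mxE andbT.
have [->|ji] := eqVneq j i; first by rewrite mulr1.
rewrite mulr0; apply/eqP; apply: contraNT ji => hj.
by apply/eqP/winj; rewrite (hits_weight W h) (hits_weight W hj).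
Qed.

(** At least half of a full rectangle reached from [p] lies at even distance, and [zforms_le]
    discards those cells. With at most [t] cells outside the rectangle, at least (m - t)/2 of the m
    cells are discarded. *)
Lemma zforms_hits_le p q (A B t : nat) :
  (forall i, i != q -> exists k l, hits X Y p k l i) ->
  (forall k l, (k <= A)%N -> (l <= B)%N -> exists i, hits X Y p k l i) ->
  (m <= A.+1 * B.+1 + t)%N -> (2 * \dim (zforms X Y) <= m + t)%N.
Proof.
move=> hq hAB mAB.
pose E : {pred 'I_m} := [pred i | [exists p0 : 'I_A.+1 * 'I_B.+1,
  ~~ odd (p0.1 + p0.2) && hits X Y p p0.1 p0.2 i]].
have ex (p0 : 'I_A.+1 * 'I_B.+1) : exists i, hits X Y p p0.1 p0.2 i.
  by apply: hAB; rewrite -ltnS ltn_ord.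
pose f p0 := xchoose (ex p0).
have fP (p0 : 'I_A.+1 * 'I_B.+1) : hits X Y p p0.1 p0.2 (f p0) by exact: xchooseP (ex p0).
have f_inj : injective f.
  move=> [k l] [k' l'] e; have := hits_weight W (fP (k, l)).
  rewrite e (hits_weight W (fP (k', l'))) /= => /addrI[].
  by move=> /(natr_inj0 charK)/val_inj-> /(natr_inj0 charK)/val_inj->.
have E_ge : (#|[pred p0 : 'I_A.+1 * 'I_B.+1 | ~~ odd (p0.1 + p0.2)]| <= #|E|)%N.
  rewrite -(card_imset _ f_inj); apply: subset_leq_card; apply/fintype.subsetP=> i.
  move=> /imsetP[p0 p0e ->]; rewrite inE; apply/existsP; exists p0.
  by rewrite inE in p0e; rewrite p0e fP.
have := @zforms_le K m X Y p q E (charK 1) (wt_comm W).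
have h1 i : i != q -> exists k l, reaches X Y p i k l.
  by move=> /hq[k [l /hits_reaches h]]; exists k, l.
have h2 i : i \in E -> exists k l, ~~ odd (k + l) /\ reaches X Y p i k l.
  rewrite inE => /existsP[p0 /andP[h /hits_reaches h']].
  by exists p0.1, p0.2.
move=> /(_ h1 h2); have := even_cells A B.
set c := #|_| in E_ge *; set d := \dim _; set e := #|E| in E_ge *.
by move: mAB E_ge; clear; move: (A.+1 * B.+1)%N; lia.
Qed.

End UpperBound.

(** * Connected diagrams are near rectangles *)

Section Shape.
Variables (K : fieldType) (n : nat).
Local Notation m := n.*2.+1.
Hypothesis charK : forall k, k.+1%:R != 0 :> K.

Definition bounded_by (pos : 'I_m -> int * int) (a b : int) :=
  forall i, (- a <= (pos i).1 <= a) && (- b <= (pos i).2 <= b).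

(** Duality makes the bounding box symmetric. The leftmost cell [s ia] and the topmost cell [ib]
    span a box all of whose lattice points are occupied, among them the northwest corner of the
    bounding box. *)
Lemma bounding_box (X Y J : 'M[K]_m) w s N o pos : icells X Y J w s N o pos ->
  exists a b, [/\ bounded_by pos a b, 0 <= a, 0 <= b, at_ pos (- a) b & at_ pos a (- b)].
Proof.
move=> IC.
have mx (f : 'I_m -> int) : exists i, forall j, f j <= f i.
  have [i _ h] := @arg_maxP _ _ _ o xpredT f isT.
  by exists i => j; exact: h.
have [ia ha] := mx (fun i => (pos i).1); have [ib hb] := mx (fun i => (pos i).2).
have ps := pos_s charK IC.
have bnd : bounded_by pos (pos ia).1 (pos ib).2.
  move=> i; have h1 := ha (s i); have h2 := hb (s i); have := ha i; have := hb i.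
  by move: h1 h2; rewrite ps /=; lia.
have := bnd o; rewrite (pos_o charK IC) /= => hb0.
have nw : at_ pos (- (pos ia).1) (pos ib).2.
  apply: (at_box charK IC (a := - (pos ia).1) (b := - (pos ia).2) (c := (pos ib).1)
    (d := (pos ib).2)).
  - by exists (s ia); rewrite ps [LHS]surjective_pairing.
  - by exists ib; rewrite -surjective_pairing.
  - by have := bnd ib; lia.
  by have := bnd ia; lia.
exists (pos ia).1, (pos ib).2; split=> //; [lia|lia|].
by have := at_opp charK IC nw; rewrite opprK.
Qed.

Section Box.
Variables (X Y J : 'M[K]_m) (w : 'I_m -> K * K) (s : 'I_m -> 'I_m) (N : nat) (o : 'I_m).
Variable pos : 'I_m -> int * int.
Variables a b : int.
Hypothesis IC : icells X Y J w s N o pos.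
Hypotheses (bnd : bounded_by pos a b) (a_ge0 : 0 <= a) (b_ge0 : 0 <= b).
Hypotheses (nw : at_ pos (- a) b) (se : at_ pos a (- b)).

Lemma at_bnd u v : at_ pos u v -> [/\ - a <= u, u <= a, - b <= v & v <= b].
Proof. by move=> [i pi]; have := bnd i; rewrite pi /= => /andP[/andP[? ?] /andP[? ?]]. Qed.

(** If the southwest corner is occupied, so is the northeast one, and convexity fills the rectangle.
    Then 2 dim Z(e) <= m = 2n + 1, so that dim Z(e) <= n. *)
Lemma not_rectangle : ~ at_ pos (- a) (- b).
Proof.
move=> [p pp].
have C := ic_C IC.
have all i : hits X Y p (absz ((pos i).1 + a)) (absz ((pos i).2 + b)) i.
  apply: (le_hits charK IC); have := bnd i => h.
  by rewrite pp [LHS]surjective_pairing; congr pair => /=; lia.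
pose La : nat := absz (a + a); pose Lb : nat := absz (b + b).
have ex (k l : nat) : (k <= La)%N -> (l <= Lb)%N -> exists i, hits X Y p k l i.
  move=> ka lb; have [q pq] : at_ pos a b.
    by have := at_opp charK IC (ex_intro _ p pp); rewrite !opprK.
  have [i pi] : at_ pos (k%:Z - a) (l%:Z - b).
    by apply: (at_box charK IC (ex_intro _ p pp) (ex_intro _ q pq)); lia.
  exists i; apply: (le_hits charK IC); rewrite pp pi; congr pair => /=; lia.
have size : (m <= La.+1 * Lb.+1 + 0)%N.
  pose f (i : 'I_m) : 'I_La.+1 * 'I_Lb.+1 :=
    (inord (absz ((pos i).1 + a)), inord (absz ((pos i).2 + b))).
  have f_inj : injective f.
    move=> i j [/(congr1 val) + /(congr1 val)]; have := bnd i; have := bnd j => hj hi.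
    rewrite /= !inordK; [|lia|lia|lia|lia] => e1 e2; apply: (pos_inj IC).
    by rewrite [LHS]surjective_pairing [RHS]surjective_pairing; congr pair; lia.
  by have := leq_card f f_inj; rewrite card_prod !card_ord addn0.
have := zforms_hits_le charK (cl_W C) (cl_inj C) (p := p) (q := p) _ ex size.
rewrite (cl_dim C) => h; have {}h : (2 * n.+1 <= m + 0)%N.
  by apply: h => i _; do 2!eexists; exact: all.
by move: h; clear; rewrite -muln2; lia.
Qed.

(** Nothing lies to the left of the leftmost column, so a segment of even height starting at its
    bottom carries a chain form. By [not_rectangle] the bottom lies above -b, which makes a positive
    second degree possible. *)
Lemma column_chain : at_ pos (- a) (b - 1) -> exists z, [/\
  exists B, [/\ B \in zforms X Y, B != 0 & forall i j, B i j != 0 -> pos i + pos j = z],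
  z.1 = - (a + a) & 0 < z.2].
Proof.
move=> atb.
have [i0 [pi0 min]] : exists i, (pos i).1 = - a /\
    forall j, (pos j).1 = - a -> (pos i).2 <= (pos j).2.
  have [i1 pi1] := nw; have P1 : (pos i1).1 == - a by rewrite pi1.
  have [i /eqP hi h] := @arg_minP _ _ _ i1 (fun i => (pos i).1 == - a) (fun i => (pos i).2) P1.
  by exists i; split=> // j /eqP /h.
set j := (pos i0).2; have pi0E : pos i0 = (- a, j) by rewrite -pi0 -surjective_pairing.
have jb : - b < j.
  have := bnd i0; rewrite pi0E /= => h.
  have jne : j <> - b by move=> e; apply: not_rectangle; exists i0; rewrite pi0E e.
  by lia.
have jb1 : j <= b - 1 by have [k pk] := atb; have := min k; rewrite pk /= -/j => /(_ erefl).
(* The segment ends at the top, or one cell lower when its height has to be made even; in the second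
   case parity gives j >= 2 - b, so t + j stays positive. *)
pose t := if odd (absz (b - j)) then b else b - 1.
have [tj1 tj2 todd] : [/\ j < t, 0 < t + j & odd (absz (t - j))].
  rewrite /t; case: ifP => odd_bj; first by split=> //; lia.
  by split; lia.
have tb : t <= b by rewrite /t; case: ifP; lia.
have [d pd] : at_ pos (- a) t.
  by apply: (at_box charK IC (ex_intro _ i0 pi0E) nw); lia.
exists (pos d + pos i0); split; last 2 first.
- by rewrite pd pi0E /=; lia.
- by rewrite pd pi0E /=; lia.
apply: (vchain charK IC todd).
- by rewrite pd /= => /at_bnd[]; lia.
- by rewrite pd pi0E; congr pair => /=; lia.
by rewrite pi0E /= => -[k pk]; have := min k; rewrite pk /= -/j => /(_ erefl); lia.
Qed.

Lemma box_neighbor : (0 < n)%N -> at_ pos (- a) (b - 1) \/ at_ pos (a - 1) (- b).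
Proof.
move=> n0; apply: contrapT => /not_orP[n1 n2].
have [c pc] := se.
have iso k : ~~ adjc X Y c k.
  apply/negP; rewrite /adjc /edge -!(hitsX X Y) -!(hitsY X Y).
  case/orP=> /orP[] /(hits_pos charK IC) e.
  - by have := bnd k; rewrite e pc /=; lia.
  - apply: n1; have := at_opp charK IC (u := a) (v := - b + 1).
    rewrite opprD opprK; apply; exists k; rewrite e pc; congr pair => /=; lia.
  - apply: n2; exists k; rewrite -[pos k](addrK (1%:Z, 0%:Z)) -e pc.
    by congr pair => /=; lia.
  have := bnd k; rewrite -[pos k](addrK (0%:Z, 1%:Z)) -e pc /=.
  by lia.
have all k : k = c.
  have : cconn X Y c k.
    by apply: cconn_trans (ic_conn IC k); rewrite cconn_sym; exact: (ic_conn IC c).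
  by move=> /connectP[[|x q] /=]; [|rewrite (negPf (iso x))].
have := all ord0; have := all ord_max => <- /(congr1 val) /=.
by move: n0; rewrite -muln2; lia.
Qed.

End Box.

Lemma at_swap (pos : 'I_m -> int * int) u v : at_ (swap_pos pos) u v <-> at_ pos v u.
Proof.
split=> -[i pi]; exists i; move: pi; rewrite /swap_pos; last by move=> ->.
by case: (pos i) => x y /= [-> ->].
Qed.

Lemma bounded_swap (pos : 'I_m -> int * int) a b :
  bounded_by pos a b -> bounded_by (swap_pos pos) b a.
Proof. by move=> h i; rewrite andbC; exact: h. Qed.

(** The left column gives an outer form of degree (-2a, positive), and any deviation would add one
    of another degree. A second cell in the bottom row gives degree (positive, -2b). If the row
    above it stops short of the left edge, its leftmost cell and the corner (a, -b) give a degree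
    with positive first entry. *)
Lemma near_rectangle (X Y J : 'M[K]_m) w s N o pos a b :
  icells X Y J w s N o pos -> bounded_by pos a b -> 0 <= a -> 0 <= b ->
  at_ pos (- a) b -> at_ pos a (- b) -> at_ pos (- a) (b - 1) ->
  [/\ ~ at_ pos (a - 1) (- b), at_ pos (- a) (1 - b), 0 < a & 0 < b].
Proof.
move=> IC bnd a_ge0 b_ge0 nw se atb.
have not_rectangle := not_rectangle IC bnd a_ge0 b_ge0.
have {}at_bnd u v : at_ pos u v -> [/\ - a <= u, u <= a, - b <= v & v <= b] := @at_bnd pos a b bnd u v.
have [z [U1 z1 z2]] := column_chain IC bnd a_ge0 b_ge0 nw atb.
have b0 : 0 < b.
  have [h1 h2 h3 h4] := at_bnd _ _ atb.
  by lia.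
have a0 : 0 < a.
  suff : a <> 0 by lia.
  by move=> ea; apply: not_rectangle; move: se; rewrite ea oppr0.
have bottom : ~ at_ pos (a - 1) (- b).
  move=> ata; have [z' [U2 z1' z2']] : exists z, [/\
      exists B, [/\ B \in zforms X Y, B != 0 & forall i j, B i j != 0 -> pos i + pos j = z],
      z.2 = - (b + b) & 0 < z.1].
    have [|z' [[B [BZ B0 BE]] e1 e2]] := column_chain (icells_swap IC) (bounded_swap bnd)
      b_ge0 a_ge0 _ (iffRL (at_swap _ _ _) ata); first by apply/at_swap.
    exists (z'.2, z'.1); split=> //; exists B; split=> //; first by rewrite zformsC.
    move=> i j /BE <-; rewrite /swap_pos [LHS]surjective_pairing.
    by congr pair.
  apply: (two_degrees charK IC U1 U2); rewrite ?z2 ?z2' ?orbT //.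
  by move=> e; move: z2'; rewrite -e z1; lia.
split=> //.
apply: contrapT => nat1.
have atu : at_ pos a (1 - b) by have := at_opp charK IC atb; rewrite opprK opprB.
have [i0 [pi0 min]] : exists i, (pos i).2 = 1 - b /\
    forall j, (pos j).2 = 1 - b -> (pos i).1 <= (pos j).1.
  have [i1 pi1] := atu; have P1 : (pos i1).2 == 1 - b by rewrite pi1.
  have [i /eqP hi h] := @arg_minP _ _ _ i1 (fun i => (pos i).2 == 1 - b) (fun i => (pos i).1) P1.
  by exists i; split=> // j /eqP /h.
set k := (pos i0).1; have pi0E : pos i0 = (k, 1 - b) by rewrite -pi0 -surjective_pairing.
have ka : - a < k.
  have := bnd i0; rewrite pi0E /= => h.
  have kne : k <> - a by move=> e; apply: nat1; exists i0; rewrite pi0E e.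
  by lia.
have left0 : ~ at_ pos (k - 1) (1 - b).
  by move=> [q pq]; have := min q; rewrite pq /= -/k => /(_ erefl); lia.
have [c pc] := se.
have bot u : at_ pos u (- b) -> u = a.
  move=> atu'; have [h1 h2 _ _] := at_bnd _ _ atu'; apply/eqP; apply: contra_notT bottom => ua.
  by apply: (at_box charK IC atu' se); move: ua; lia.
have c1 : ~ at_ pos (a - 1) (- b) by [].
have c2 : ~ at_ pos a (- b - 1) by move=> /at_bnd[]; lia.
(* If [i0] lies directly above the corner, the two cells are a column of height 2; otherwise both
   are southwest corners. *)
have [ek|ek] := eqVneq k a.
  have U3 : exists B, [/\ B \in zforms X Y, B != 0 &
      forall i j, B i j != 0 -> pos i + pos j = pos i0 + pos c].
    apply: (vchain charK IC (r := 1)) => //; rewrite ?pi0E ?pc //=.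
    by rewrite ek; congr pair => /=; lia.
  apply: (two_degrees charK IC U1 U3); rewrite ?z2 ?orbT //.
    by rewrite pi0E pc /= ek; lia.
  by move=> e; move: z1; rewrite e pi0E pc /= ek; lia.
have U3 : exists B, [/\ B \in zforms X Y, B != 0 &
    forall i j, B i j != 0 -> pos i + pos j = pos i0 + pos c].
  apply: (corner_at charK IC); rewrite ?pi0E ?pc //=.
  - by move=> h; have := bot k; rewrite [1 - b - 1]addrAC subrr sub0r in h => /(_ h) /eqP;
      rewrite (negPf ek).
  - by apply: contra_eqN pi0E => /eqP ->; rewrite pc; apply/eqP => -[_]; lia.
apply: (two_degrees charK IC U1 U3); rewrite ?z2 ?orbT //.
  by rewrite pi0E pc /=; lia.
by move=> e; move: z1; rewrite e pi0E pc /=; lia.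
Qed.

End Shape.

(** * Shapes and labelled grids *)

(* Cells are labelled by twice their coordinates, so that integral and
   half-integral diagrams both have integer labels. *)
Definition box (A B : nat) (z : int * int) : Prop := exists k l : nat,
  [/\ (k <= A)%N, (l <= B)%N & z = (k%:Z + k%:Z - A%:Z, l%:Z + l%:Z - B%:Z)].

Definition near_box (A B : nat) (z : int * int) : Prop :=
  [\/ box A B z, z = (A%:Z, - (B%:Z + 2)) | z = (- A%:Z, B%:Z + 2)].

Inductive shape_kind := NearBoxA | NearBoxB | PointBox.

(** [NearBoxB] is type b): its extra southwest corner, at the bottom right, has the larger first
    coordinate. [NearBoxA] is the transpose, so there [A] bounds the vertical extent of the box. *)
Definition shape (t : shape_kind) (A B : nat) (z : int * int) : Prop :=
  match t with
  | NearBoxA => near_box A B (z.2, z.1)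
  | NearBoxB => near_box A B z
  | PointBox => z = 0 \/ box A B z
  end.

(** The parities place the box in the integral or the half-integral lattice. For A = 0 a near box
    would be a single column or row, hence a rectangle. *)
Definition shape_valid (t : shape_kind) (A B : nat) : bool :=
  match t with
  | PointBox => odd A && odd B
  | _ => [&& ~~ odd A, ~~ odd B & (0 < A)%N]
  end.

Definition fits (I : Type) (lab : I -> int * int) (S : int * int -> Prop) : Prop :=
  (forall i, S (lab i)) /\ (forall z, S z -> exists i, lab i = z).

Section Grid.
Variable K : fieldType.
Hypothesis charK : forall k, k.+1%:R != 0 :> K.

Definition half (z : int * int) : K * K := (z.1%:~R / 2%:R, z.2%:~R / 2%:R).

Lemma halfD z1 z2 : half (z1 + z2) = half z1 + half z2.
Proof. by rewrite /half; congr pair; rewrite /= rmorphD mulrDl. Qed.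

Lemma halfN z : half (- z) = - half z.
Proof. by rewrite /half; congr pair; rewrite /= rmorphN mulNr. Qed.

Lemma half_dbl (a b : int) : half (a + a, b + b) = (a%:~R, b%:~R).
Proof.
have h (c : int) : (c + c)%:~R / 2%:R = c%:~R :> K.
  by rewrite rmorphD -mulr2n -[_ *+ 2]mulr_natr mulfK ?(charK 1).
by rewrite /half /= !h.
Qed.

Lemma half_inj : injective half.
Proof.
move=> [a b] [c d]; rewrite /half /= => -[e1 e2].
have h (x y : int) : x%:~R / 2%:R = y%:~R / 2%:R :> K -> x = y.
  by move=> /(mulIf (invr_neq0 (charK 1)))/(intr_inj0 charK).
by rewrite (h _ _ e1) (h _ _ e2).
Qed.

Lemma half_double (v : K * K) z : v + v = (z.1%:~R, z.2%:~R) -> v = half z.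
Proof.
case: v => a b [/= e1 e2]; rewrite /half -e1 -e2.
by congr pair; rewrite -mulr2n -[_ *+ 2]mulr_natr mulfK ?(charK 1).
Qed.

(** [weighted] only confines the supports of X, Y and J; the last three fields add that every entry
    allowed by the labels is nonzero. *)
Record grid m (X Y J : 'M[K]_m) (lab : 'I_m -> int * int) : Prop := Grid {
  gr_W : weighted X Y J (fun i => half (lab i));
  gr_inj : injective lab;
  gr_X : forall i j, lab i = lab j + (2, 0) -> X i j != 0;
  gr_Y : forall i j, lab i = lab j + (0, 2) -> Y i j != 0;
  gr_J : forall i j, lab i = - lab j -> J i j != 0
}.

Lemma grid_transpose m (X Y J : 'M[K]_m) lab :
  grid X Y J lab -> grid Y X J (swap_pos lab).
Proof.
case=> W inj gX gY gJ; split.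
- exact: (weighted_swap W).
- move=> i j; rewrite /swap_pos => -[e2 e1]; apply: inj.
  by rewrite [LHS]surjective_pairing e1 e2 -surjective_pairing.
- move=> i j; rewrite /swap_pos => -[e2 e1]; apply: gY.
  by rewrite [LHS]surjective_pairing e1 e2.
- move=> i j; rewrite /swap_pos => -[e2 e1]; apply: gX.
  by rewrite [LHS]surjective_pairing e1 e2.
move=> i j; rewrite /swap_pos => -[e2 e1]; apply: gJ.
by rewrite [LHS]surjective_pairing e1 e2.
Qed.

Lemma cells_grid_pair n (X Y J : 'M[K]_n.*2.+1) w s N o p A B :
  cells X Y J w s N o -> odd A -> odd B -> w p + w p = - (A%:R, B%:R) ->
  (forall i, i != o -> exists k l, [/\ (k <= A)%N, (l <= B)%N & hits X Y p k l i]) ->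
  (forall k l, (k <= A)%N -> (l <= B)%N -> exists2 i, i != o & hits X Y p k l i) ->
  exists lab, grid X Y J lab /\ fits lab (shape PointBox A B).
Proof.
move=> C oA oB wp hi hex; case: (C) => W inj sJ XN YN wo dimZ.
have box_weight p0 k l i : w p0 + w p0 = - (A%:R, B%:R) -> hits X Y p0 k l i ->
    w i = half (k%:Z + k%:Z - A%:Z, l%:Z + l%:Z - B%:Z).
  move=> e h; apply: half_double; rewrite (hits_weight W h) addrACA e.
  by rewrite addrC; congr pair; rewrite /= !rmorphD rmorphN /=.
have box_nz (z : int * int) : box A B z -> z != 0.
  move=> [k [l [_ _ ->]]]; apply/eqP => -[e _].
  have e_o : A = k.*2 by move: e; clear; lia.
    by move: oA; rewrite e_o odd_double.
have ex i : exists z, [/\ w i = half z, (z = 0 \/ box A B z) & (box A B z -> i != o)].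
  have [->|io] := eqVneq i o.
    exists 0; split; [|by left|by move=> /box_nz; rewrite eqxx].
    by rewrite wo; apply: half_double; rewrite addr0.
  have [k [l [kA lB h]]] := hi i io.
  exists (k%:Z + k%:Z - A%:Z, l%:Z + l%:Z - B%:Z); split=> //; first exact: box_weight wp h.
  by right; exists k, l.
have {ex} /choice[lab hlab] := ex; exists lab.
have wl i : w i = half (lab i) by case: (hlab i).
have labo : lab o = 0 by apply: half_inj; rewrite -wl wo; apply: half_double; rewrite addr0.
(* As A and B are odd, both labels of a box cell are odd, and no step joins it to the label 0 of
   [o]. *)
have nzo i j : lab i = lab j + (2, 0) \/ lab i = lab j + (0, 2) -> i != o /\ j != o.
  have b k : k != o -> box A B (lab k).
    by move=> ko; case: (hlab k) => wk [e|//] _; move: ko; rewrite -(inj_eq inj) wo wk e;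
      rewrite -[half 0](half_double (v := 0)) ?eqxx // addr0.
  move=> h; split; apply/negP=> /eqP e.
    have jo : j != o by apply/negP=> /eqP e'; move: h; rewrite e e' labo; case.
    have [k [l [_ _ ej]]] := b _ jo; move: h; rewrite e labo ej => -[] -[e1 e2].
      have e_o : B = l.*2 by move: e2; clear; lia.
    by move: oB; rewrite e_o odd_double.
    have e_o : A = k.*2 by move: e1; clear; lia.
    by move: oA; rewrite e_o odd_double.
  have io : i != o by apply/negP=> /eqP e'; move: h; rewrite e e' labo; case.
  have [k [l [_ _ ei]]] := b _ io; move: h; rewrite e labo ei => -[] -[e1 e2].
    have e_o : B = l.*2 by move: e2; clear; lia.
    by move: oB; rewrite e_o odd_double.
  have e_o : A = k.*2 by move: e1; clear; lia.
    by move: oA; rewrite e_o odd_double.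
have step i j a b : i != o -> j != o -> lab i = lab j + (a%:Z + a%:Z, b%:Z + b%:Z) ->
    hits X Y j a b i.
  move=> io jo e; have [k [l [kA lB h]]] := hi j jo.
  have [k' [l' [kA' lB' h']]] := hi i io.
  have ei := half_inj (etrans (esym (wl i)) (box_weight _ _ _ _ wp h')).
  have ej := half_inj (etrans (esym (wl j)) (box_weight _ _ _ _ wp h)).
  have ek : k' = (a + k)%N by move: e; rewrite ei ej => -[e1 _]; move: e1; clear; lia.
  have el : l' = (b + l)%N by move: e; rewrite ei ej => -[_ e1]; move: e1; clear; lia.
  rewrite ek el in h'; have [j' h1 h2] := hits_split W h'.
  suff <- : j' = j by [].
  by apply: inj; rewrite (hits_weight W h) (hits_weight W h1).
split; [split|split].
- have -> : (fun i => half (lab i)) = w by apply/funext => i; rewrite wl.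
  exact: W.
- by move=> i j e; apply: inj; rewrite !wl e.
- move=> i j e; have [io jo] := nzo i j (or_introl e).
  by rewrite -(hitsX X Y); apply: step.
- move=> i j e; have [io jo] := nzo i j (or_intror e).
  by rewrite -(hitsY X Y); apply: step.
- move=> i j e; rewrite sJ; apply/eqP/inj; rewrite (weight_sK W sJ) [w i]wl e halfN opprK.
  exact: wl.
- by move=> i; case: (hlab i).
move=> z [->|[k [l [kA lB ->]]]]; first by exists o.
have [i io h] := hex k l kA lB; exists i; apply: half_inj; rewrite -wl.
exact: box_weight wp h.
Qed.

End Grid.

Section CellsGrid.
Variables (K : fieldType) (n : nat).
Hypothesis charK : forall k, k.+1%:R != 0 :> K.

Lemma near_box_grid (X Y J : 'M[K]_n.*2.+1) w s N o pos a b :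
  icells X Y J w s N o pos -> bounded_by pos a b -> 0 <= a -> 0 <= b ->
  at_ pos (- a) b -> at_ pos a (- b) -> at_ pos (- a) (b - 1) ->
  exists A B lab, [/\ shape_valid NearBoxB A B, grid X Y J lab & fits lab (near_box A B)].
Proof.
move=> IC bnd a_ge0 b_ge0 nw se atb.
have [bottom atb' a0 b0] := near_rectangle charK IC bnd a_ge0 b_ge0 nw se atb.
pose lab i := ((pos i).1 + (pos i).1, (pos i).2 + (pos i).2).
have wl i : w i = half K (lab i) by rewrite half_dbl // (ic_pos IC).
have C := ic_C IC; have W := cl_W C.
have labE i u v : lab i = (u + u, v + v) -> pos i = (u, v).
  rewrite /lab; case: (pos i) => x y [/= e1 e2]; congr pair; [move: e1|move: e2]; clear; lia.
have labD i j u v : lab i = lab j + (u + u, v + v) -> pos i = pos j + (u, v).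
  rewrite /lab; case: (pos i) (pos j) => x y [x' y'] [/= e1 e2].
  by congr pair; [move: e1|move: e2]; rewrite /=; clear; lia.
have corner_lo u : at_ pos u (- b) -> u = a.
  move=> atu; have [i pi] := atu; have := bnd i; rewrite pi /= => h.
  apply/eqP; apply: contra_notT bottom => ua.
  by apply: (at_box charK IC atu se); move: h ua; clear; lia.
have corner_hi u : at_ pos u b -> u = - a.
  by move=> /(at_opp charK IC)/corner_lo; clear; lia.
have inner u v : - a <= u <= a -> - (b - 1) <= v <= b - 1 -> at_ pos u v.
  move=> hu hv; apply: (at_box charK IC atb' (at_opp charK IC atb')); rewrite ?opprK //.
  by move: hv; clear; lia.
exists (absz a).*2, (absz (b - 1)).*2, lab; split.
- by rewrite /= !odd_double /=; move: a0; clear; lia.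
- split.
  + have -> : (fun i => half K (lab i)) = w by apply/funext => i; rewrite wl.
    exact: W.
  + by move=> i j e; apply: (cl_inj C); rewrite !wl e.
  + move=> i j e; rewrite -(hitsX X Y); apply: (le_hits charK IC).
    exact: (labD _ _ 1 0).
  + move=> i j e; rewrite -(hitsY X Y); apply: (le_hits charK IC).
    exact: (labD _ _ 0 1).
  move=> i j e; rewrite (cl_sJ C); apply/eqP/(cl_inj C).
  by rewrite (weight_sK W (cl_sJ C)) [w i]wl e halfN opprK.
split.
  move=> i; have := bnd i; have ai : at_ pos (pos i).1 (pos i).2 by exists i; rewrite -surjective_pairing.
  move=> /andP[hu hv].
  have [e|nb] := eqVneq (pos i).2 b.
    apply: Or33; rewrite /lab e; rewrite e in ai; rewrite (corner_hi _ ai).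
    by congr pair => /=; move: a0 b0; clear; lia.
  have [e|nb'] := eqVneq (pos i).2 (- b).
    apply: Or32; rewrite /lab e; rewrite e in ai; rewrite (corner_lo _ ai).
    by congr pair => /=; move: a0 b0; clear; lia.
  apply: Or31; exists (absz ((pos i).1 + a)), (absz ((pos i).2 + (b - 1))).
  rewrite /lab; split; last congr pair => /=; move: hu hv nb nb' a0 b0; clear; lia.
move=> z; case=> [[k [l [kA lB ->]]]|->|->].
- have [||i pi] := inner (k%:Z - a) (l%:Z - (b - 1)).
  + by move: kA a0; clear; lia.
  + by move: lB b0; clear; lia.
  by exists i; rewrite /lab pi; congr pair => /=; move: a0 b0; clear; lia.
- have [i pi] := se.
  by exists i; rewrite /lab pi; congr pair => /=; move: a0 b0; clear; lia.
have [i pi] := nw.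
by exists i; rewrite /lab pi; congr pair => /=; move: a0 b0; clear; lia.
Qed.

Lemma cells_grid (X Y J : 'M[K]_n.*2.+1) w s N o : (0 < n)%N ->
  cells X Y J w s N o ->
  exists t A B lab, [/\ shape_valid t A B, grid X Y J lab & fits lab (shape t A B)].
Proof.
move=> n0 C; have [two|/forallNP one] := pselect (exists i, ~~ cconn X Y o i).
  have [p [A [B [[oA oB] wp hi hex _]]]] := two_components charK C two.
  have [lab [g f]] := cells_grid_pair charK C oA oB wp hi hex.
  by exists PointBox, A, B, lab; split=> //; rewrite /= oA oB.
have {one} /(icells_exist C)[pos IC] : forall i, cconn X Y o i.
  by move=> i; have /negP := one i; rewrite negbK.
have [a [b [bnd a0 b0 nw se]]] := bounding_box charK IC.
have [atb|ata] := box_neighbor charK IC bnd a0 b0 se n0.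
  have [A [B [lab [v g f]]]] := near_box_grid IC bnd a0 b0 nw se atb.
  by exists NearBoxB, A, B, lab.
have [A [B [lab [v g [f1 f2]]]]] := near_box_grid (icells_swap IC) (bounded_swap bnd) b0 a0
  (iffRL (at_swap _ _ _) se) (iffRL (at_swap _ _ _) nw) (iffRL (at_swap _ _ _) ata).
exists NearBoxA, A, B, (swap_pos lab); split=> //; first exact: (grid_transpose g).
split=> [i|[x y] h]; first by have := f1 i; rewrite /= -surjective_pairing.
by have [i e] := f2 (y, x) h; exists i; rewrite /swap_pos e.
Qed.

End CellsGrid.

(** * From almost principal nilpotent pairs to grids *)

Lemma so_conj (K : fieldType) m m' (Z J : 'M[K]_m) (P : 'M[K]_(m, m')) (Q : 'M[K]_(m', m)) :
  P *m Q = 1%:M -> Z^T *m J + J *m Z = 0 ->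
  (Q *m Z *m P)^T *m (P^T *m J *m P) + P^T *m J *m P *m (Q *m Z *m P) = 0.
Proof.
move=> PQ ZJ; have QPT : Q^T *m P^T = 1%:M by rewrite -trmx_mul PQ trmx1.
rewrite !trmx_mul !mulmxA -[_ *m Q^T *m P^T]mulmxA QPT mulmx1.
rewrite -[_ *m P *m Q]mulmxA PQ mulmx1.
by rewrite -mulmxDl -!mulmxA -mulmxDr ZJ mulmx0 mul0mx.
Qed.

Lemma expr_conj (K : fieldType) m m' (Z : 'M[K]_m) (P : 'M[K]_(m, m')) (Q : 'M[K]_(m', m)) k :
  P *m Q = 1%:M -> Q *m P = 1%:M -> (Q *m Z *m P) ^+ k = Q *m Z ^+ k *m P.
Proof.
move=> PQ QP; elim: k => [|k IH]; first by rewrite !expr0 mulmx1 QP.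
by rewrite -!mulmx_exprS IH !mulmxA -[_ *m P *m Q]mulmxA PQ mulmx1.
Qed.

Lemma weighted_exists (K : fieldType) m (X Y J H1 H2 : 'M[K]_m) :
  X *m Y = Y *m X -> X^T *m J + J *m X = 0 -> Y^T *m J + J *m Y = 0 ->
  H1^T *m J + J *m H1 = 0 -> H2^T *m J + J *m H2 = 0 ->
  J^T = J -> J \in unitmx -> H1 *m H2 = H2 *m H1 ->
  diagonalizable H1 -> diagonalizable H2 ->
  mx_comm H1 X = X -> mx_comm H2 Y = Y -> mx_comm H1 Y = 0 -> mx_comm H2 X = 0 ->
  exists P w, P \in unitmx /\
    weighted (invmx P *m X *m P) (invmx P *m Y *m P) (P^T *m J *m P) w.
Proof.
move=> XY XJ YJ H1J H2J Js Ju HH D1 D2 HX HY H1Y H2X.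
have [Q Qu /and3P[]] : codiagonalizable [:: H1; H2].
  apply/codiagonalizableP; split=> A; last by rewrite !inE => /orP[]/eqP->.
  by move=> B; rewrite !inE => /orP[]/eqP-> /orP[]/eqP->; rewrite /comm_mx ?HH.
move=> /diagonalizable_forPex[d1 /(simmxRL Qu)E1] /diagonalizable_forPex[d2 /(simmxRL Qu)E2] _.
set P := invmx Q; have Pu : P \in unitmx by rewrite unitmx_inv.
have iP : invmx P = Q by rewrite invmxK.
have PQ : P *m Q = 1%:M by rewrite mulVmx.
have QP : Q *m P = 1%:M by rewrite mulmxV.
exists P, (fun i => (d1 0 i, d2 0 i)); split=> //; rewrite iP.
have comm_conj (A B : 'M[K]_m) : Q *m mx_comm A B *m P = mx_comm (Q *m A *m P) (Q *m B *m P).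
  rewrite /mx_comm mulmxBr mulmxBl !mulmxA -![_ *m P *m Q]mulmxA PQ.
  by rewrite !mulmx1.
have diag_comm (d : 'rV[K]_m) (A : 'M[K]_m) i j :
    mx_comm (diag_mx d) A i j = (d 0 i - d 0 j) * A i j.
  by rewrite /mx_comm mul_diag_mx mul_mx_diag !mxE mulrBl [_ * d 0 j]mulrC.
have wt (H A : 'M[K]_m) d (c : K) : diag_mx d = Q *m H *m P -> mx_comm H A = c *: A ->
    forall i j, (Q *m A *m P) i j != 0 -> d 0 i = d 0 j + c.
  move=> E HA i j Aij; have := comm_conj H A; rewrite HA -E.
  rewrite -scalemxAr -scalemxAl => /matrixP/(_ i j).
  rewrite diag_comm mxE => /(mulIf Aij) ->; ring.
split.
- by rewrite !mulmxA -![_ *m P *m Q]mulmxA PQ !mulmx1 -[Q *m X *m Y]mulmxA XY !mulmxA.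
- exact: so_conj.
- exact: so_conj.
- by rewrite !trmx_mul trmxK Js mulmxA.
- by rewrite !unitmx_mul unitmx_tr Pu Ju.
- move=> i j h; congr pair; rewrite /=.
    by apply: (wt _ _ _ 1 E1 _ i j h); rewrite scale1r.
  by apply: (wt _ _ _ 0 E2 _ i j h); rewrite scale0r.
- move=> i j h; congr pair; rewrite /=.
    by apply: (wt _ _ _ 0 E1 _ i j h); rewrite scale0r.
  by apply: (wt _ _ _ 1 E2 _ i j h); rewrite scale1r.
have wJ d H : diag_mx d = Q *m H *m P -> H^T *m J + J *m H = 0 ->
    forall i j, (P^T *m J *m P) i j != 0 -> d 0 i + d 0 j = 0.
  move=> E HJ i j h; have := so_conj PQ HJ; rewrite -E tr_diag_mx => /matrixP/(_ i j).
  rewrite mxE mul_diag_mx mul_mx_diag ![(\matrix_(_, _) _) _ _]mxE [RHS]mxE.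
  rewrite [_ * d 0 j]mulrC -mulrDl => /eqP; rewrite mulf_eq0 (negPf h) orbF.
  by move/eqP.
by move=> i j h; congr pair; rewrite /=; [apply: wJ E1 _ i j h|apply: wJ E2 _ i j h].
Qed.

Section NilpotentPair.
Variables (K : fieldType) (n : nat).
Local Notation m := n.*2.+1.
Variables (J : 'M[K]_m) (g : lieAlgType K).
Variables (psi : {linear so J -> g}) (phi : {linear g -> so J}).
Hypotheses (charK : forall k, k.+1%:R != 0 :> K).
Hypotheses (J_sym : J^T = J) (J_unit : J \in unitmx) (n_gt0 : (0 < n)%N).
Hypothesis sqrtK : forall c : K, exists d, d ^+ 2 = c.
Hypotheses (psiK : cancel psi phi) (phiK : cancel phi psi).
Hypothesis psi_lie : forall x y, psi (lie x y) = lie (psi x) (psi y).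

Lemma nilpotent_pair_grid x1 x2 :
  nilpotent_pair (psi x1, psi x2) -> almost_principal (psi x1, psi x2) ->
  exists P t A B lab, [/\ P \in unitmx, shape_valid t A B,
    grid (invmx P *m so_mx x1 *m P) (invmx P *m so_mx x2 *m P) (P^T *m J *m P) lab &
    fits lab (shape t A B)].
Proof.
move=> [/= e12 nil1 nil2 [h [/= h12 [ss1 ss2] _ [h1e1 h2e2] [h1e2 h2e1]]]].
rewrite /almost_principal (lie_rank_so charK J_sym J_unit sqrtK psiK phiK psi_lie).
rewrite (dim_centralizer J_sym J_unit psiK phiK psi_lie) => dimZ.
have lieE u v : so_mx (phi (lie u v)) = mx_comm (so_mx (phi u)) (so_mx (phi v)).
  by rewrite (phi_lie psiK phiK psi_lie) so_lieE.
have lie0 u v : lie u v = 0 -> so_mx (phi u) *m so_mx (phi v) = so_mx (phi v) *m so_mx (phi u).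
  by move=> uv; have := lieE u v; rewrite uv !linear0 => /esym/eqP; rewrite subr_eq0 => /eqP.
have soE (x : so J) : (so_mx x)^T *m J + J *m so_mx x = 0 by exact: so_mxP.
have diag u : ad_semisimple u -> diagonalizable (so_mx (phi u)).
  by move=> uss; apply: (ad_semisimple_diag charK J_sym J_unit psiK phiK psi_lie); rewrite phiK.
have := lie0 _ _ e12; rewrite !psiK => xx.
have := lieE h.1 (psi x1); rewrite h1e1 !psiK => hx1.
have := lieE h.2 (psi x2); rewrite h2e2 !psiK => hx2.
have := lieE h.1 (psi x2); rewrite h1e2 !psiK !linear0 => hx12.
have := lieE h.2 (psi x1); rewrite h2e1 !psiK !linear0 => hx21.
have [P [w [Pu W]]] := weighted_exists xx (soE _) (soE _) (soE _) (soE _) J_sym J_unit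
  (lie0 _ _ h12) (diag _ ss1) (diag _ ss2) (esym hx1) (esym hx2) (esym hx12) (esym hx21).
have PQ := mulmxV Pu; have QP := mulVmx Pu.
have [winj [o wo]] : injective w /\ exists o, w o = 0.
  by apply: (weights_distinct charK W); rewrite (zforms_conj _ _ PQ QP) dimZ.
have [s sJ] := det_neq0_perm (wt_Junit W).
have ws i : w (s i) = - w i by apply/eqP; rewrite -addr_eq0 addrC (wt_J W (sJ i)).
have [k1 xk1] := (ad_nilpotentP charK J_sym J_unit psiK phiK psi_lie x1).1 nil1.
have [k2 xk2] := (ad_nilpotentP charK J_sym J_unit psiK phiK psi_lie x2).1 nil2.
have C : cells (invmx P *m so_mx x1 *m P) (invmx P *m so_mx x2 *m P) (P^T *m J *m P) w s
    (k1 + k2) o.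
  split=> //.
  - move=> i j; apply/idP/eqP => [/(wt_J W) e|->]; last exact: sJ.
    by apply: winj; rewrite ws; apply/eqP; rewrite -addr_eq0 addrC e.
  - by rewrite expr_conj // exprD xk1 mul0r mulmx0 mul0mx.
  - by rewrite expr_conj // exprD xk2 mulr0 mulmx0 mul0mx.
  by rewrite (zforms_conj _ _ PQ QP).
have [t [A [B [lab [v G f]]]]] := cells_grid charK n_gt0 C.
by exists P, t, A, B, lab.
Qed.

End NilpotentPair.

(** * Two grids of the same shape are isometric *)

Lemma skew_entry (K : fieldType) m (Z J : 'M[K]_m) (s : 'I_m -> 'I_m) i j : involutive s ->
  (forall i j, J i j != 0 -> j = s i) -> Z^T *m J + J *m Z = 0 ->
  Z i j * J i (s i) = - (J j (s j) * Z (s j) (s i)).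
Proof.
move=> sK JE /matrixP/(_ j (s i)); rewrite !mxE.
rewrite (bigD1 i) //= [X in _ + X + _]big1 => [|k ki]; last first.
  apply/eqP; rewrite mulf_eq0; apply: contraNT ki; rewrite negb_or => /andP[_ /JE e].
  by apply/eqP/(inv_inj sK).
rewrite (bigD1 (s j)) //= [X in _ + (_ + X)]big1 => [|k ki]; last first.
  apply/eqP; rewrite mulf_eq0; apply: contraNT ki; rewrite negb_or => /andP[/JE e _].
  by rewrite e.
by rewrite !addr0 mxE => /eqP; rewrite addr_eq0 => /eqP.
Qed.

Section Monomial.
Variables (K : fieldType) (m m2 : nat) (f : 'I_m -> 'I_m2) (f' : 'I_m2 -> 'I_m) (a : 'I_m -> K).
Hypotheses (fK : cancel f f') (f'K : cancel f' f) (a0 : forall i, a i != 0).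

Definition monomial_mx : 'M[K]_(m, m2) := \matrix_(i, j) (if j == f i then a i else 0).
Definition monomial_inv : 'M[K]_(m2, m) := \matrix_(j, i) (if j == f i then (a i)^-1 else 0).

Lemma mul_monomial r (B : 'M[K]_(m2, r)) i j : (monomial_mx *m B) i j = a i * B (f i) j.
Proof.
rewrite mxE (bigD1 (f i)) //= big1 => [|k /negPf ki]; first by rewrite mxE eqxx addr0.
by rewrite mxE ki mul0r.
Qed.

Lemma mulr_monomial r (A : 'M[K]_(r, m)) i j : (A *m monomial_mx) i j = A i (f' j) * a (f' j).
Proof.
rewrite mxE (bigD1 (f' j)) //= big1 => [|k ki]; first by rewrite mxE f'K eqxx addr0.
rewrite mxE; case: eqP => [e|_]; last by rewrite mulr0.
by move: ki; rewrite e fK eqxx.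
Qed.

Lemma mul_monomial_tr r (A : 'M[K]_(m, r)) i j :
  (monomial_mx^T *m A) i j = a (f' i) * A (f' i) j.
Proof.
rewrite mxE (bigD1 (f' i)) //= big1 => [|k ki]; first by rewrite !mxE f'K eqxx addr0.
rewrite !mxE; case: eqP => [e|_]; last by rewrite mul0r.
by move: ki; rewrite e fK eqxx.
Qed.

Lemma monomialV : monomial_mx *m monomial_inv = 1%:M.
Proof.
apply/matrixP=> i j; rewrite mul_monomial !mxE (inj_eq (can_inj fK)).
by case: eqP => [->|_]; [rewrite mulfV|rewrite mulr0].
Qed.

Lemma monomialVl : monomial_inv *m monomial_mx = 1%:M.
Proof.
apply/matrixP=> i j; rewrite mulr_monomial !mxE f'K.
by case: eqP => _; [rewrite mulVf|rewrite mul0r].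
Qed.
End Monomial.

Section GridHits.
Variable K : fieldType.
Hypothesis charK : forall k, k.+1%:R != 0 :> K.

Section One.
Variables (m : nat) (X Y J : 'M[K]_m) (lab : 'I_m -> int * int).
Hypothesis G : grid X Y J lab.

Lemma grid_winj : injective (fun i => half K (lab i)).
Proof. by move=> i j /(half_inj charK)/(gr_inj G). Qed.

Lemma grid_XE i j : X i j != 0 <-> lab i = lab j + (2, 0).
Proof.
split=> [/(wt_X (gr_W G)) e|]; last exact: (gr_X G).
by apply: (half_inj charK); rewrite e halfD (half_dbl charK 1 0).
Qed.

Lemma grid_YE i j : Y i j != 0 <-> lab i = lab j + (0, 2).
Proof.
split=> [/(wt_Y (gr_W G)) e|]; last exact: (gr_Y G).
by apply: (half_inj charK); rewrite e halfD (half_dbl charK 0 1).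
Qed.

Lemma grid_JE i j : J i j != 0 <-> lab i = - lab j.
Proof.
split=> [/(wt_J (gr_W G)) /eqP|]; last exact: (gr_J G).
by rewrite addr_eq0 -halfN => /eqP/(half_inj charK).
Qed.

Lemma grid_hits p k l i : hits X Y p k l i -> lab i = lab p + (k%:Z + k%:Z, l%:Z + l%:Z).
Proof.
move=> /(hits_weight (gr_W G)) e; apply: (half_inj charK).
by rewrite e halfD (half_dbl charK).
Qed.

Lemma hits_path p k l :
  (forall l', (l' <= l)%N -> exists i, lab i = lab p + (0, l'%:Z + l'%:Z)) ->
  (forall k', (k' <= k)%N -> exists i, lab i = lab p + (k'%:Z + k'%:Z, l%:Z + l%:Z)) ->
  exists i, hits X Y p k l i.
Proof.
have W := gr_W G; have winj := grid_winj.
move=> vert hor; have [j pj] : exists j, hits X Y p 0 l j.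
  elim: l {hor} vert => [|l IH] vert; first by exists p; exact: hits0.
  have [j pj] := IH (fun l' h => vert l' (leqW h)); have [i ei] := vert _ (leqnn _).
  exists i; apply: (@hits_comp _ _ _ _ _ _ W winj p 0 l j 0 1 i pj).
  rewrite hitsY; apply/grid_YE; rewrite ei (grid_hits pj) -addrA; congr (_ + _).
  by congr pair => /=; lia.
elim: k hor => [|k IH] hor; first by exists j.
have [j' pj'] := IH (fun k' h => hor k' (leqW h)); have [i ei] := hor _ (leqnn _).
exists i; apply: (@hits_comp _ _ _ _ _ _ W winj p k l j' 1 0 i pj').
rewrite hitsX; apply/grid_XE; rewrite ei (grid_hits pj') -addrA; congr (_ + _).
by congr pair => /=; lia.
Qed.

Lemma mon_stepX p k l i j : hits X Y p k l j -> mon X Y (1 + k) l i p = X i j * mon X Y k l j p.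
Proof.
have W := gr_W G; move=> pj; rewrite -[l in LHS]add0n -(monD W) mxE (bigD1 j) //= big1.
  by rewrite addr0 /mon expr0 expr1 mulmx1.
move=> j' ne; apply/eqP; rewrite mulf_eq0; apply: contraNT ne; rewrite negb_or.
move=> /andP[_ pj']; apply/eqP/grid_winj.
by rewrite (hits_weight W pj) (hits_weight W pj').
Qed.

Lemma mon_stepY p k l i j : hits X Y p k l j -> mon X Y k (1 + l) i p = Y i j * mon X Y k l j p.
Proof.
have W := gr_W G; move=> pj; rewrite -[k in LHS]add0n -(monD W) mxE (bigD1 j) //= big1.
  by rewrite addr0 /mon expr0 expr1 mul1mx.
move=> j' ne; apply/eqP; rewrite mulf_eq0; apply: contraNT ne; rewrite negb_or.
move=> /andP[_ pj']; apply/eqP/grid_winj.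
by rewrite (hits_weight W pj) (hits_weight W pj').
Qed.

End One.

Section Gauge.
Variables (m m2 : nat) (X Y J : 'M[K]_m) (X2 Y2 J2 : 'M[K]_m2).
Variables (lab : 'I_m -> int * int) (lab2 : 'I_m2 -> int * int).
Hypotheses (G : grid X Y J lab) (G2 : grid X2 Y2 J2 lab2).
Variables (f : 'I_m -> 'I_m2) (f' : 'I_m2 -> 'I_m).
Hypotheses (labf : forall i, lab2 (f i) = lab i) (fK : cancel f f') (f'K : cancel f' f).

Lemma scaling_exists p q :
  (forall i, i != q -> exists k l, hits X Y p k l i /\ hits X2 Y2 (f p) k l (f i)) ->
  (forall j, X q j = 0) -> (forall j, Y q j = 0) -> (forall i, X i q = 0) ->
  exists a : 'I_m -> K, [/\ forall i, a i != 0,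
    forall i j, X i j != 0 -> X i j * a j = a i * X2 (f i) (f j) &
    forall i j, Y i j != 0 -> Y i j * a j = a i * Y2 (f i) (f j)].
Proof.
move=> hq Xq0 Yq0 X0q.
have ex i : exists k : nat * nat, i != q ->
    hits X Y p k.1 k.2 i /\ hits X2 Y2 (f p) k.1 k.2 (f i).
  have [->|/hq[k [l h]]] := eqVneq i q; first by exists (0, 0)%N.
  by exists (k, l).
have {ex} /choice[d hd] := ex.
pose b i := mon X Y (d i).1 (d i).2 i p / mon X2 Y2 (d i).1 (d i).2 (f i) (f p).
have b0 i : i != q -> b i != 0.
  by move=> /hd[h1 h2]; rewrite mulf_neq0 // invr_neq0.
have YE i j : Y i j != 0 -> Y2 (f i) (f j) != 0.
  by move=> /(grid_YE G) e; apply/(grid_YE G2); rewrite !labf.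
have XE i j : X i j != 0 -> X2 (f i) (f j) != 0.
  by move=> /(grid_XE G) e; apply/(grid_XE G2); rewrite !labf.
(* [q] need not be reached from [p]. By the three vanishing hypotheses its only possible edge goes
   upwards; the factor at [q] is read off that edge, and is 1 if there is none. *)
pose c := if [pick i | Y i q != 0] is Some i then b i * Y2 (f i) (f q) / Y i q else 1.
pose a i := if i == q then c else b i.
have notq i j : X i j != 0 \/ Y i j != 0 -> i != q.
  by move=> h; apply/eqP => e; move: h; rewrite e Xq0 Yq0 eqxx; case.
exists a; split.
- move=> i; rewrite /a; have [_|iq] := eqVneq i q; last exact: b0.
  rewrite /c; case: pickP => [i' h|_]; last exact: oner_neq0.
  apply: mulf_neq0; last exact: invr_neq0.
  by apply: mulf_neq0; [apply: b0; apply: (notq i' q); right|exact: YE].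
- move=> i j Xij; have iq := notq i j (or_introl Xij).
  have jq : j != q by apply/eqP => e; move: Xij; rewrite e X0q eqxx.
  rewrite /a (negPf iq) (negPf jq); have [h1 h2] := hd j jq; have [h3 h4] := hd i iq.
  have e : (d i) = ((1 + (d j).1)%N, (d j).2).
    have := (grid_XE G _ _).1 Xij; rewrite (grid_hits G h1) (grid_hits G h3) -addrA.
    move=> /addrI[e1 e2]; rewrite [d i]surjective_pairing; congr pair.
      by move: e1; clear; lia.
    by move: e2; clear; lia.
  rewrite /b e /= (mon_stepX G _ h1) (mon_stepX G2 _ h2).
  by field; apply/andP; split; [exact: h2|exact: XE].
move=> i j Yij; have iq := notq i j (or_intror Yij).
rewrite /a (negPf iq); have [jq|jq] := eqVneq j q.
  rewrite /c; case: pickP => [i' h|/(_ i)]; last by rewrite -jq Yij.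
  have -> : i' = i.
    by apply: (gr_inj G); rewrite ((grid_YE G _ _).1 h) ((grid_YE G _ _).1 Yij) jq.
  by rewrite jq in Yij *; rewrite mulrCA mulfV // mulr1.
have [h1 h2] := hd j jq; have [h3 h4] := hd i iq.
have e : (d i) = ((d j).1, (1 + (d j).2)%N).
  have := (grid_YE G _ _).1 Yij; rewrite (grid_hits G h1) (grid_hits G h3) -addrA.
  move=> /addrI[e1 e2]; rewrite [d i]surjective_pairing; congr pair.
    by move: e1; clear; lia.
  by move: e2; clear; lia.
rewrite /b e /= (mon_stepY G _ h1) (mon_stepY G2 _ h2).
by field; apply/andP; split; [exact: h2|exact: YE].
Qed.

Hypothesis sqrtK : forall c : K, exists d, d ^+ 2 = c.

(* The discrepancy mu between the two forms is constant along edges and invariant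
   under the duality i |-> s i, so its square root can be absorbed in the scaling. *)
Lemma scaling_isometry (a : 'I_m -> K) : (forall i, a i != 0) ->
  (forall i j, X i j != 0 -> X i j * a j = a i * X2 (f i) (f j)) ->
  (forall i j, Y i j != 0 -> Y i j * a j = a i * Y2 (f i) (f j)) ->
  exists (P : 'M[K]_(m, m2)) (Q : 'M[K]_(m2, m)),
    [/\ P *m Q = 1%:M, Q *m P = 1%:M, P^T *m J *m P = J2, X *m P = P *m X2 & Y *m P = P *m Y2].
Proof.
have W := gr_W G; have W2 := gr_W G2; have winj := grid_winj G.
have [s sJ] : exists s : 'I_m -> 'I_m, forall i j, (J i j != 0) = (j == s i).
  have [s sJ] := det_neq0_perm (wt_Junit W); exists s => i j.
  apply/idP/eqP => [/(grid_JE G) e|->//]; apply: (gr_inj G).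
  by have /(grid_JE G) := sJ i; rewrite e => /eqP; rewrite eqr_opp => /eqP.
have sK := involK W winj sJ; have s_inj := inv_inj sK.
have Jsym i j : J i j = J j i by rewrite -{1}(wt_Jsym W) mxE.
have J2sym i j : J2 i j = J2 j i by rewrite -{1}(wt_Jsym W2) mxE.
have Js i : J i (s i) != 0 by rewrite sJ.
have J2s i : J2 (f i) (f (s i)) != 0.
  by apply/(grid_JE G2); rewrite !labf; apply/(grid_JE G).
have J2E i j : j != s i -> J2 (f i) (f j) = 0.
  rewrite -sJ => h; apply/eqP; apply: contraNT h => /(grid_JE G2); rewrite !labf => e.
  exact/(grid_JE G).
have XE i j : X i j = 0 -> X2 (f i) (f j) = 0.
  move=> /eqP h; apply/eqP; apply: contraTT h => /(grid_XE G2); rewrite !labf => e.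
  exact/(grid_XE G).
have YE i j : Y i j = 0 -> Y2 (f i) (f j) = 0.
  move=> /eqP h; apply/eqP; apply: contraTT h => /(grid_YE G2); rewrite !labf => e.
  exact/(grid_YE G).
move=> a0 aX aY.
pose mu i := J2 (f i) (f (s i)) / (a i * a (s i) * J i (s i)).
have mu_s i : mu (s i) = mu i.
  by rewrite /mu sK J2sym Jsym; congr (_ / (_ * _)); rewrite mulrC.
have sE i j : J i j != 0 -> j = s i by rewrite sJ => /eqP.
pose s2 j := f (s (f' j)).
have s2K : involutive s2 by move=> j; rewrite /s2 fK sK f'K.
have s2E i j : J2 i j != 0 -> j = s2 i.
  rewrite -[i]f'K -[j]f'K /s2 fK; have [->//|/J2E ->] := eqVneq (f' j) (s (f' i)).
  by rewrite eqxx.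
have mu_edge (Z : 'M[K]_m) (Z2 : 'M[K]_m2) i j :
    Z^T *m J + J *m Z = 0 -> Z2^T *m J2 + J2 *m Z2 = 0 ->
    (forall i j, Z i j != 0 -> Z i j * a j = a i * Z2 (f i) (f j)) ->
    Z i j != 0 -> mu i = mu j.
  move=> ZJ ZJ2 aZ Zij; have e1 := skew_entry i j sK sE ZJ.
  have := skew_entry (f i) (f j) s2K s2E ZJ2; rewrite /s2 !fK => e2.
  have Zs : Z (s j) (s i) != 0.
    apply: contraNneq Zij => e; move/eqP: e1; rewrite e mulr0 oppr0 mulf_eq0.
    by rewrite (negPf (Js i)) orbF.
  have e3 := aZ _ _ Zij; have e4 := aZ _ _ Zs.
  rewrite /mu; apply/eqP; rewrite eqr_div ?mulf_neq0 //; apply/eqP.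
  (* The edge from j to i is compared with its dual from [s i] to [s j]: after multiplying by both
     entries, the intertwining relation on each edge and the skewness of both matrices match the two
     sides. *)
  apply: (mulIf (mulf_neq0 Zij Zs)).
  set x := Z i j in e1 e3 *; set y := Z (s j) (s i) in e1 e4 *.
  transitivity (x * a j * J2 (f i) (f (s i)) * a (s j) * J j (s j) * y); first by ring.
  rewrite e3; transitivity (Z2 (f i) (f j) * J2 (f i) (f (s i)) * a i * a (s j) * J j (s j) * y).
    by ring.
  rewrite e2; transitivity (- (a (s j) * Z2 (f (s j)) (f (s i))) * J2 (f j) (f (s j)) * a i *
    J j (s j) * y); first by ring.
  rewrite -e4; transitivity (- (J j (s j) * y) * J2 (f j) (f (s j)) * a i * a (s i) * y).
    by ring.
  by rewrite -e1; ring.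
have /choice[sq sqK] := sqrtK.
have mu0 i : mu i != 0 by rewrite /mu mulf_neq0 ?invr_neq0 ?mulf_neq0.
have sq0 i : sq (mu i) != 0 by have := mu0 i; rewrite -[mu i]sqK expf_eq0 sqK.
pose b i := a i * sq (mu i).
have b0 i : b i != 0 by rewrite mulf_neq0.
have b_edge (Z : 'M[K]_m) (Z2 : 'M[K]_m2) :
    Z^T *m J + J *m Z = 0 -> Z2^T *m J2 + J2 *m Z2 = 0 ->
    (forall i j, Z i j != 0 -> Z i j * a j = a i * Z2 (f i) (f j)) ->
    (forall i j, Z i j = 0 -> Z2 (f i) (f j) = 0) ->
    Z *m monomial_mx f b = monomial_mx f b *m Z2.
  move=> ZJ ZJ2 aZ ZE; apply/matrixP=> i j; rewrite (mulr_monomial _ fK f'K) mul_monomial.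
  rewrite -{3}[j]f'K; have [z0|z0] := eqVneq (Z i (f' j)) 0.
    by rewrite z0 (ZE _ _ z0) mul0r mulr0.
  by rewrite /b mulrA (aZ _ _ z0) (mu_edge Z Z2 _ _ ZJ ZJ2 aZ z0); ring.
exists (monomial_mx f b), (monomial_inv f b); split.
- exact: (monomialV fK b0).
- exact: (monomialVl fK f'K b0).
- apply/matrixP=> i j; rewrite -mulmxA (mul_monomial_tr _ fK f'K) (mulr_monomial _ fK f'K).
  have -> : J2 i j = J2 (f (f' i)) (f (f' j)) by rewrite !f'K.
  have [->|ne] := eqVneq (f' j) (s (f' i)); last first.
    rewrite J2E //; suff -> : J (f' i) (f' j) = 0 by rewrite mul0r mulr0.
    by apply/eqP; rewrite -[_ == 0]negbK sJ.
  rewrite /b mu_s; have := sqK (mu (f' i)); rewrite {2}/mu expr2 => e.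
  transitivity (sq (mu (f' i)) * sq (mu (f' i)) *
    (a (f' i) * a (s (f' i)) * J (f' i) (s (f' i)))); first by ring.
  by rewrite e divfK // !mulf_neq0.
- by apply: b_edge; [exact: wt_Xso W|exact: wt_Xso W2|exact: aX|exact: XE].
by apply: b_edge; [exact: wt_Yso W|exact: wt_Yso W2|exact: aY|exact: YE].
Qed.

End Gauge.
End GridHits.

(** Going up and then right inside [S] from [zp] guarantees that the corresponding entry of X^k Y^l
    does not vanish. *)
Definition covered (S : int * int -> Prop) (zp zq : int * int) : Prop :=
  forall z, S z -> z <> zq -> exists k l : nat, [/\ z = zp + (k%:Z + k%:Z, l%:Z + l%:Z),
    forall l', (l' <= l)%N -> S (zp + (0, l'%:Z + l'%:Z)) &
    forall k', (k' <= k)%N -> S (zp + (k'%:Z + k'%:Z, l%:Z + l%:Z))].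

(** No step enters [zq] and no horizontal step leaves it: the three vanishing hypotheses of
    [scaling_exists]. *)
Definition terminal (S : int * int -> Prop) (zq : int * int) : Prop :=
  forall z, S z -> [/\ zq <> z + (2, 0), zq <> z + (0, 2) & z <> zq + (2, 0)].

Lemma boxP (A B k l : nat) : (k <= A)%N -> (l <= B)%N ->
  box A B ((- A%:Z, - B%:Z) + (k%:Z + k%:Z, l%:Z + l%:Z)).
Proof. by move=> kA lB; exists k, l; split=> //; congr pair; rewrite /= addrC. Qed.

Lemma box_covered A B (z : int * int) : box A B z ->
  exists k l : nat, [/\ z = (- A%:Z, - B%:Z) + (k%:Z + k%:Z, l%:Z + l%:Z), (k <= A)%N & (l <= B)%N].
Proof. by move=> [k [l [kA lB ->]]]; exists k, l; split=> //; congr pair; rewrite /= addrC. Qed.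

Lemma near_box_covered A B : covered (near_box A B) (- A%:Z, - B%:Z) (A%:Z, - (B%:Z + 2)).
Proof.
have bx k l : (k <= A)%N -> (l <= B)%N ->
  near_box A B ((- A%:Z, - B%:Z) + (k%:Z + k%:Z, l%:Z + l%:Z)).
  by move=> kA lB; apply: Or31; exact: boxP.
have b0 l : (l <= B)%N -> near_box A B ((- A%:Z, - B%:Z) + (0, l%:Z + l%:Z)).
  exact: (bx 0%N).
move=> z [/box_covered[k [l [-> kA lB]]]|//|-> _].
  exists k, l; split=> //.
    by move=> l' h; apply: b0; exact: leq_trans lB.
  by move=> k' h; apply: bx => //; exact: leq_trans kA.
have top : near_box A B ((- A%:Z, - B%:Z) + (0, B.+1%:Z + B.+1%:Z)).
  by apply: Or33; congr pair => /=; lia.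
exists 0%N, B.+1; split.
- by congr pair => /=; lia.
- by move=> l'; rewrite leq_eqVlt => /orP[/eqP->|] //; exact: b0.
by move=> k'; rewrite leqn0 => /eqP->.
Qed.

Lemma near_box_terminal A B : terminal (near_box A B) (A%:Z, - (B%:Z + 2)).
Proof.
move=> z h; have : - (B%:Z + 2) <= z.2 /\ (z.2 = - (B%:Z + 2) -> z.1 = A%:Z \/ z.2 = B%:Z + 2).
  by case: h => [[k [l [_ _ ->]]]|->|->] /=; lia.
case: z h => x y h /= [h1 h2]; by split=> -[e1 e2]; lia.
Qed.

Lemma point_box_covered A B : covered (shape PointBox A B) (- A%:Z, - B%:Z) 0.
Proof.
move=> z [//|/box_covered[k [l [-> kA lB]]] _]; exists k, l; split=> //.
  by move=> l' h; right; apply: (boxP (k := 0%N)) => //; exact: leq_trans lB.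
by move=> k' h; right; apply: boxP => //; exact: leq_trans kA.
Qed.

Lemma point_box_terminal A B : odd A -> odd B -> terminal (shape PointBox A B) 0.
Proof.
move=> oA oB z [->|[k [l [_ _ ->]]]]; first by split.
have nA : A%:Z != k%:Z + k%:Z.
  apply: contraTneq oA => e; have -> : A = k.*2 by move: e; clear; lia.
  by rewrite odd_double.
have nB : B%:Z != l%:Z + l%:Z.
  apply: contraTneq oB => e; have -> : B = l.*2 by move: e; clear; lia.
  by rewrite odd_double.
by split=> -[e1 e2]; move: nA nB e1 e2; clear; lia.
Qed.

Section GridIsometry.
Variable K : fieldType.
Hypothesis charK : forall k, k.+1%:R != 0 :> K.

Lemma grid_isometry_covered m m2 (X Y J : 'M[K]_m) (X2 Y2 J2 : 'M[K]_m2) lab lab2 S zp zq :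
  (forall c : K, exists d, d ^+ 2 = c) ->
  grid X Y J lab -> grid X2 Y2 J2 lab2 -> fits lab S -> fits lab2 S ->
  S zp -> S zq -> covered S zp zq -> terminal S zq ->
  exists (P : 'M[K]_(m, m2)) (Q : 'M[K]_(m2, m)),
    [/\ P *m Q = 1%:M, Q *m P = 1%:M, P^T *m J *m P = J2, X *m P = P *m X2 & Y *m P = P *m Y2].
Proof.
move=> sqrtK G G2 [f1 f2] [f3 f4] Sp Sq cov term.
have /choice[f labf] : forall i, exists j, lab2 j = lab i by move=> i; exact: f4 (f1 i).
have /choice[f' labf'] : forall j, exists i, lab i = lab2 j by move=> j; exact: f2 (f3 j).
have fK : cancel f f' by move=> i; apply: (gr_inj G); rewrite labf' labf.
have f'K : cancel f' f by move=> i; apply: (gr_inj G2); rewrite labf labf'.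
have [p lp] := f2 _ Sp; have [q lq] := f2 _ Sq.
have hits_S m' (X' Y' J' : 'M[K]_m') lab' p' k l i' : grid X' Y' J' lab' ->
    (forall z, S z -> exists i, lab' i = z) -> lab' p' = zp ->
    (forall l', (l' <= l)%N -> S (zp + (0, l'%:Z + l'%:Z))) ->
    (forall k', (k' <= k)%N -> S (zp + (k'%:Z + k'%:Z, l%:Z + l%:Z))) ->
    lab' i' = zp + (k%:Z + k%:Z, l%:Z + l%:Z) -> hits X' Y' p' k l i'.
  move=> G' ex lp' h1 h2 e.
  have [||i h] := hits_path charK G' (p := p') (k := k) (l := l).
  - by move=> l' /h1/ex; rewrite lp'.
  - by move=> k' /h2/ex; rewrite lp'.
  suff <- : i = i' by [].
  by apply: (gr_inj G'); rewrite (grid_hits charK G' h) lp' e.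
have [|||| a [a0 aX aY]] := scaling_exists charK G G2 labf (p := p) (q := q).
- move=> i iq; have [|k [l [e h1 h2]]] := cov _ (f1 i).
    by rewrite -lq => /(gr_inj G)/eqP; rewrite (negPf iq).
  exists k, l; split; first exact: hits_S G f2 lp h1 h2 e.
  by apply: (hits_S _ _ _ _ _ _ _ _ _ G2 f4); rewrite ?labf.
- move=> j; apply/eqP; apply: contraT => /(grid_XE charK G); rewrite lq => e.
  by case: (term _ (f1 j)).
- move=> j; apply/eqP; apply: contraT => /(grid_YE charK G); rewrite lq => e.
  by case: (term _ (f1 j)).
- move=> j; apply/eqP; apply: contraT => /(grid_XE charK G); rewrite lq => e.
  by case: (term _ (f1 j)).
exact: (scaling_isometry charK G G2 labf fK f'K sqrtK a0 aX aY).
Qed.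

Lemma fits_swap m (lab : 'I_m -> int * int) A B :
  fits lab (shape NearBoxA A B) -> fits (swap_pos lab) (near_box A B).
Proof.
move=> [f1 f2]; split=> [i|[x y] h]; first exact: f1.
by have [i e] := f2 (y, x) h; exists i; rewrite /swap_pos e.
Qed.

Lemma grid_isometry m m2 (X Y J : 'M[K]_m) (X2 Y2 J2 : 'M[K]_m2) lab lab2 t A B :
  (forall c : K, exists d, d ^+ 2 = c) -> shape_valid t A B ->
  grid X Y J lab -> grid X2 Y2 J2 lab2 -> fits lab (shape t A B) -> fits lab2 (shape t A B) ->
  exists (P : 'M[K]_(m, m2)) (Q : 'M[K]_(m2, m)),
    [/\ P *m Q = 1%:M, Q *m P = 1%:M, P^T *m J *m P = J2, X *m P = P *m X2 & Y *m P = P *m Y2].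
Proof.
move=> sqrtK v G G2 f f2.
have box0 : box A B (- A%:Z, - B%:Z).
  by rewrite -[X in box _ _ X]addr0; apply: (boxP (k := 0%N) (l := 0%N)).
case: t v f f2 => v f f2.
- have [P [Q [h1 h2 h3 h4 h5]]] := grid_isometry_covered sqrtK (grid_transpose G)
    (grid_transpose G2) (fits_swap f) (fits_swap f2) (Or31 _ _ box0)
    (Or32 _ _ erefl) (@near_box_covered A B) (@near_box_terminal A B).
  by exists P, Q.
- exact: (grid_isometry_covered sqrtK G G2 f f2 (Or31 _ _ box0)
    (Or32 _ _ erefl) (@near_box_covered A B) (@near_box_terminal A B)).
case/andP: v => oA oB.
exact: (grid_isometry_covered sqrtK G G2 f f2 (or_intror box0) (or_introl erefl)
  (@point_box_covered A B) (point_box_terminal oA oB)).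
Qed.

End GridIsometry.

(** * Dimension of the centralizer *)

Section GridDim.
Variables (K : fieldType) (n : nat).
Local Notation m := n.*2.+1.
Hypothesis charK : forall k, k.+1%:R != 0 :> K.

Lemma int_not_nonposN (z : int) : nonposN (z%:~R / 2%:R : K) -> exists k : nat, z = - (k%:Z + k%:Z).
Proof.
move=> /asboolP[k e]; exists k; apply: (intr_inj0 charK) => /=.
rewrite -[LHS](divfK (charK 1)) e [RHS]rmorphN /= rmorphD /= mulNr.
by rewrite mulr_natr mulr2n.
Qed.

(* The n dual pairs of cells account for n dimensions, a form supported outside
   the degrees of those pairs for one more. *)
Lemma grid_dim_ge (X Y J : 'M[K]_m) lab i0 j0 : grid X Y J lab ->
  (exists B, [/\ B \in zforms X Y, B != 0 & forall a b, B a b != 0 ->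
     half K (lab a) + half K (lab b) = half K (lab i0) + half K (lab j0)]) ->
  ~~ wneg (half K (lab i0) + half K (lab j0)) ->
  (n.+1 <= \dim (zforms X Y))%N.
Proof.
move=> G [B [BZ B0 BE]] out; have W := gr_W G; have winj := grid_winj charK G.
pose w i := half K (lab i).
have := zforms_weight_ge charK (D := fun _ _ => true) W (fun _ _ => erefl)
    (fun _ _ _ _ => id) (fun _ _ _ _ => id).
apply: leq_trans; rewrite -addn1; apply: leq_add; last first.
  rewrite lt0n dimv_eq0; apply: contraNneq B0 => e; rewrite -memv0 -e memv_cap BZ /=.
  apply/formsP; split; first by case/zformsP: BZ.
  move=> a b; rewrite negbK => /andP[_ h]; apply/eqP; apply: contraT => /BE e'.
  by rewrite -e' h in out.
have [s sJ] := det_neq0_perm (wt_Junit W).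
have ws i : w (s i) = - w i by apply/eqP; rewrite -addr_eq0 addrC (wt_J W (sJ i)).
pose r : rel 'I_m := fun i j => (w i + w j == 0).
have rs : symmetric r by move=> i j; rewrite /r addrC.
have := card_sym_rel rs.
have -> : #|[pred p : 'I_m * 'I_m | r p.1 p.2]| = m.
  have i_inj : injective (fun i => (i, s i)) by move=> i j [].
  rewrite -[RHS]card_ord -(card_codom i_inj); apply: eq_card => -[i j].
  rewrite !inE /r /=; apply/eqP/codomP => [e|[k [-> ->]]]; last by rewrite ws subrr.
  exists i; congr pair; apply: winj; rewrite -/(w j) -/(w (s i)) ws.
  by apply/eqP; rewrite -addr_eq0 addrC e.
have : (#|[pred i | r i i]| <= 1)%N.
  apply/card_le1_eqP => i j; rewrite !inE /r !weight_dbl // => /eqP e1 /eqP e2.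
  by apply: winj; rewrite -/(w i) -/(w j) e1 e2.
set N := #|[pred p : 'I_m * 'I_m | (p.1 < p.2)%N && r p.1 p.2]|.
move=> h1 h2; apply: (@leq_trans N); last by apply/eq_leq/eq_card => p; rewrite !inE.
by move: h1 h2; move: (#|[pred i | r i i]|) N => c N'; clear; rewrite -muln2; lia.
Qed.

Lemma covered_hits (X Y J : 'M[K]_m) lab S zp zq p : grid X Y J lab -> fits lab S ->
  covered S zp zq -> lab p = zp -> 
  forall i, lab i <> zq -> exists k l, hits X Y p k l i.
Proof.
move=> G [f1 f2] cov lp i iq; have [k [l [e h1 h2]]] := cov _ (f1 i) iq.
have [||i' h] := hits_path charK G (p := p) (k := k) (l := l).
- by move=> l' /h1/f2; rewrite lp.
- by move=> k' /h2/f2; rewrite lp.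
suff <- : i' = i by exists k, l.
by apply: (gr_inj G); rewrite (grid_hits charK G h) lp e.
Qed.

Lemma box_hits (X Y J : 'M[K]_m) lab S A B p : grid X Y J lab -> fits lab S ->
  (forall z, box A B z -> S z) -> lab p = (- A%:Z, - B%:Z) ->
  forall k l, (k <= A)%N -> (l <= B)%N -> exists i, hits X Y p k l i.
Proof.
move=> G [f1 f2] bS lp k l kA lB; apply: (hits_path charK G); rewrite lp.
  move=> l' h; apply/f2/bS; apply: (boxP (k := 0%N)) => //; exact: leq_trans lB.
by move=> k' h; apply/f2/bS/boxP => //; exact: leq_trans kA.
Qed.

Lemma fits_card (lab : 'I_m -> int * int) S A B (e : seq (int * int)) : injective lab ->
  fits lab S -> (forall z, S z -> z \in e \/ box A B z) -> (m <= A.+1 * B.+1 + size e)%N.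
Proof.
move=> linj [f1 _] SE.
pose E := [seq (k.1%:Z + k.1%:Z - A%:Z, k.2%:Z + k.2%:Z - B%:Z) |
  k : 'I_A.+1 * 'I_B.+1] ++ e.
have -> : (A.+1 * B.+1 + size e = size E)%N.
  by rewrite size_cat size_map -cardE card_prod !card_ord.
have -> : m = size (map lab (enum 'I_m)) by rewrite size_map -cardE card_ord.
apply: uniq_leq_size; first by rewrite map_inj_uniq ?enum_uniq.
move=> _ /mapP[i _ ->]; rewrite mem_cat; have [->|] := SE _ (f1 i); first by rewrite orbT.
move=> [k [l [kA lB ->]]]; apply/orP; left; apply/mapP.
by exists (Ordinal (kA : (k < A.+1)%N), Ordinal (lB : (l < B.+1)%N)); rewrite ?mem_enum.
Qed.

(** Two cells lie outside the box, so 2 dim Z(e) <= m + 2 = 2n + 3. For the lower bound, the left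
    column with its extra top cell has even height B + 2, and its chain form has the outer degree
    (-A, 1). *)
Lemma near_box_dim (X Y J : 'M[K]_m) lab A B : grid X Y J lab -> fits lab (near_box A B) ->
  shape_valid NearBoxB A B -> \dim (zforms X Y) = n.+1.
Proof.
move=> G f v; have [f1 f2] := f; have W := gr_W G; have winj := grid_winj charK G.
have bS z : box A B z -> near_box A B z by apply: Or31.
have [p lp] : exists p, lab p = (- A%:Z, - B%:Z).
  by apply/f2/bS; rewrite -[X in box _ _ X]addr0; apply: (boxP (k := 0%N) (l := 0%N)).
have [q lq] := f2 _ (Or32 _ _ erefl); have [d ld] := f2 _ (Or33 _ _ erefl).
apply/eqP; rewrite eqn_leq; apply/andP; split.
  have := @zforms_hits_le K m charK X Y J _ W winj p q A B 2.
  have h1 i : i != q -> exists k l, hits X Y p k l i.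
    move=> iq; apply: (covered_hits G f (@near_box_covered A B) lp).
    by rewrite -lq => /(gr_inj G)/eqP; rewrite (negPf iq).
  move=> /(_ h1 (box_hits G f bS lp)).
  have /= := fits_card (e := [:: (A%:Z, - (B%:Z + 2)); (- A%:Z, B%:Z + 2)]) (A := A) (B := B)
    (gr_inj G) f.
  have SE z : near_box A B z ->
      z \in [:: (A%:Z, - (B%:Z + 2)); (- A%:Z, B%:Z + 2)] \/ box A B z.
    by case=> [|->|->]; [right|left; rewrite mem_head|left; rewrite inE mem_head orbT].
  move=> /(_ SE) h /(_ h); move: (\dim _) => D; clear; rewrite -muln2; lia.
have oB : odd B.+1 by case/and3P: v.
have hd : hits X Y p 0 B.+1 d.
  have top l' : (l' <= B.+1)%N -> exists i, lab i = lab p + (0, l'%:Z + l'%:Z).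
    rewrite leq_eqVlt => /orP[/eqP->|h].
      by exists d; rewrite lp ld; congr pair => /=; lia.
    by rewrite lp; apply/f2/bS; apply: (boxP (k := 0%N)).
  have [||i h] := hits_path charK G (p := p) (k := 0) (l := B.+1).
  - exact: top.
  - by move=> k'; rewrite leqn0 => /eqP->; exact: top.
  suff <- : i = d by [].
  apply: (gr_inj G); rewrite (grid_hits charK G h) lp ld; congr pair => /=; lia.
apply: (grid_dim_ge (i0 := d) (j0 := p) G); last first.
  rewrite -halfD ld lp; apply/negP => /andP[_ /int_not_nonposN[k]] /=; lia.
apply: (weighted_chain charK W oB) => //.
  move=> j; apply/eqP; apply: contraT => /(grid_XE charK G); rewrite ld => e.
  by case: (f1 j) => [[k [l [_ _ ej]]]|ej|ej]; move: e; rewrite ej => -[e1 _]; move: e1;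
    clear; lia.
move=> j; rewrite -(half_dbl charK 0 1) -halfD => /(half_inj charK); rewrite lp => e.
have := f1 j; case=> [[k [l [kA lB ej]]]|ej|ej]; move: e; rewrite ej => -[e1 e2];
  have A0 : (0 < A)%N by case/and3P: v.
- by move: e1 e2; clear; lia.
- by move: e1 A0; clear; lia.
by move: e2; clear; lia.
Qed.

(** One cell lies outside the box, so 2 dim Z(e) <= 2n + 2. The corner form of the isolated point
    and the southwest corner of the box has degree (-A/2, -B/2), which is not integral and hence
    outer. *)
Lemma point_box_dim (X Y J : 'M[K]_m) lab A B : grid X Y J lab ->
  fits lab (shape PointBox A B) -> shape_valid PointBox A B -> \dim (zforms X Y) = n.+1.
Proof.
move=> G f /andP[oA oB]; have [f1 f2] := f; have W := gr_W G; have winj := grid_winj charK G.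
have bS z : box A B z -> shape PointBox A B z by right.
have [p lp] : exists p, lab p = (- A%:Z, - B%:Z).
  by apply/f2/bS; rewrite -[X in box _ _ X]addr0; apply: (boxP (k := 0%N) (l := 0%N)).
have [q lq] := f2 _ (or_introl erefl).
apply/eqP; rewrite eqn_leq; apply/andP; split.
  have := @zforms_hits_le K m charK X Y J _ W winj p q A B 1.
  have h1 i : i != q -> exists k l, hits X Y p k l i.
    move=> iq; apply: (covered_hits G f (@point_box_covered A B) lp).
    by rewrite -lq => /(gr_inj G)/eqP; rewrite (negPf iq).
  move=> /(_ h1 (box_hits G f bS lp)).
  have /= := fits_card (e := [:: (0 : int * int)]) (A := A) (B := B) (gr_inj G) f.
  have SE z : shape PointBox A B z -> z \in [:: (0 : int * int)] \/ box A B z.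
    by case=> [->|]; [left; rewrite mem_head|right].
  move=> /(_ SE) h /(_ h); move: (\dim _) => D; clear; rewrite -muln2; lia.
have low i u : lab i = u + (2, 0) \/ lab i = u + (0, 2) -> shape PointBox A B u ->
    lab i <> 0 /\ lab i <> (- A%:Z, - B%:Z).
  move=> h Su; split=> li; last first.
    by case: Su h => [->|[k [l [_ _ ->]]]]; rewrite li => -[] [e1 e2]; move: e1 e2; clear; lia.
  by have [h1 h2 _] := point_box_terminal oA oB Su; case: h; rewrite li.
have term i : lab i = 0 \/ lab i = (- A%:Z, - B%:Z) ->
    (forall j, X i j = 0) /\ (forall j, Y i j = 0).
  move=> li; split=> j; apply/eqP; apply: contraT.
    by move=> /(grid_XE charK G) e; case: (low i _ (or_introl e) (f1 j)); case: li.
  by move=> /(grid_YE charK G) e; case: (low i _ (or_intror e) (f1 j)); case: li.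
apply: (grid_dim_ge (i0 := q) (j0 := p) G); last first.
  rewrite -halfD lq lp add0r; apply/negP => /andP[/int_not_nonposN[k /= e] _].
  by move: oA; have -> : A = k.*2 by [move: e; clear; lia]; rewrite odd_double.
exists (corner (delta_mx 0 q) (delta_mx 0 p)).
have [qX qY] := term q (or_introl lq); have [pX pY] := term p (or_intror lp).
have qp : q != p.
  apply/eqP => e; move: lq; rewrite e lp => -[e1 _]; move: oA e1; clear; lia.
split.
- by apply: corner_zforms; exact: delta_mul_eq0.
- apply: contraTneq (corner_dlt_neq0 K qp) => e; rewrite negbK; apply/eqP.
  by move/matrixP: e => /(_ q p) ->; rewrite mxE.
by move=> a b /corner_dltE[[-> ->]|[-> ->]] //; rewrite addrC.
Qed.

Lemma shape_dim (X Y J : 'M[K]_m) lab t A B : grid X Y J lab ->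
  fits lab (shape t A B) -> shape_valid t A B -> \dim (zforms X Y) = n.+1.
Proof.
case: t => G f v.
- by rewrite zformsC; apply: (near_box_dim (grid_transpose G) (fits_swap f)).
- exact: near_box_dim G f v.
exact: point_box_dim G f v.
Qed.

End GridDim.

(** * Nilpotent pairs from grids *)

Lemma spanning_basis (K : fieldType) (V : vectType K) (s : seq V) :
  exists b, [/\ free b, (<<b>> = <<s>>)%VS & {subset b <= s}].
Proof.
elim: s => [|v s [b [fb bs sub]]]; first by exists [::]; rewrite nil_free.
have [vb|vb] := boolP (v \in <<b>>%VS).
  exists b; split=> //; last by move=> u /sub; rewrite inE orbC => ->.
  rewrite span_cons -bs; apply/esym/addv_idPr; by rewrite -memvE.
exists (v :: b); split; first by rewrite free_cons vb.
  by rewrite !span_cons bs.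
by move=> u; rewrite !inE => /orP[->//|/sub->]; rewrite orbT.
Qed.

Lemma ratr_half (K : fieldType) (charK : forall k, k.+1%:R != 0 :> K) (z : int) :
  ratr (z%:~R / 2%:R) = z%:~R / 2%:R :> K.
Proof.
rewrite /ratr; set q : rat := z%:~R / 2%:R.
have e : numq q * 2 = z * denq q.
  apply: (@intr_inj rat); rewrite !rmorphM /=.
  have <- : q * (denq q)%:~R = (numq q)%:~R.
    by rewrite -{1}[q]divq_num_den divfK // intr_eq0 denq_neq0.
  by rewrite /q; field.
have d0 : (denq q)%:~R != 0 :> K.
  by apply/negP => /eqP h; have := denq_neq0 q; rewrite (intr_inj0 charK (x2 := 0) h) eqxx.
apply/eqP; rewrite eqr_div ?(charK 1) //; apply/eqP.
by have /= := congr1 (fun z : int => z%:~R : K) e; rewrite !rmorphM.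
Qed.

Section SoProjection.
Variables (K : fieldType) (m : nat) (J : 'M[K]_m).
Hypotheses (J_sym : J^T = J) (J_unit : J \in unitmx).

(** Twice the projection onto so(J) along the self-adjoint matrices. *)
Definition so_proj (A : 'M[K]_m) : 'M[K]_m := A - invmx J *m A^T *m J.

Lemma so_proj_so A : (so_proj A)^T *m J + J *m so_proj A = 0.
Proof.
rewrite /so_proj linearB /= !trmx_mul trmxK trmx_inv J_sym mulmxBl mulmxBr.
rewrite !mulmxA mulmxV // mul1mx -[_ *m A *m _ *m J]mulmxA mulVmx // mulmx1.
by rewrite addrA subrK subrr.
Qed.

Lemma so_proj_comm H A c : H^T *m J + J *m H = 0 -> mx_comm H A = c *: A ->
  mx_comm H (so_proj A) = c *: so_proj A.
Proof.
move=> HJ HA; have JH : J *m H = - (H^T *m J) by apply/eqP; rewrite -addr_eq0 addrC HJ.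
have HJV : H *m invmx J = - (invmx J *m H^T).
  rewrite -[H in LHS](mulKmx J_unit) JH mulmxN mulNmx.
  by rewrite mulmxA -[_ *m J *m _]mulmxA mulmxV // mulmx1.
have HAT : A^T *m H^T - H^T *m A^T = c *: A^T.
  by rewrite -!trmx_mul -linearB /= -/(mx_comm H A) HA linearZ.
rewrite /mx_comm /so_proj mulmxBr mulmxBl scalerBr -HA.
have -> : H *m (invmx J *m A^T *m J) = - (invmx J *m (H^T *m A^T) *m J).
  by rewrite !mulmxA HJV !mulNmx.
have -> : invmx J *m A^T *m J *m H = - (invmx J *m (A^T *m H^T) *m J).
  by rewrite -!mulmxA JH !mulmxN.
have -> : c *: (invmx J *m A^T *m J) = invmx J *m (A^T *m H^T - H^T *m A^T) *m J.
  by rewrite HAT -scalemxAr -scalemxAl.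
rewrite mulmxBr mulmxBl /mx_comm.
move: (invmx J *m (A^T *m H^T) *m J) (invmx J *m (H^T *m A^T) *m J) => U V.
by apply/matrixP=> i j; rewrite !mxE; ring.
Qed.

Lemma so_proj_id A : A^T *m J + J *m A = 0 -> so_proj A = 2%:R *: A.
Proof.
move=> /eqP; rewrite addr_eq0 => /eqP AJ.
rewrite /so_proj -mulmxA AJ mulmxN mulKmx // opprK.
by rewrite -mulr2n scaler_nat.
Qed.

End SoProjection.

Section GridPair.
Variables (K : fieldType) (n : nat).
Local Notation m := n.*2.+1.
Variables (J : 'M[K]_m) (g : lieAlgType K).
Variables (psi : {linear so J -> g}) (phi : {linear g -> so J}).
Hypotheses (charK : forall k, k.+1%:R != 0 :> K).
Hypotheses (J_sym : J^T = J) (J_unit : J \in unitmx).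
Hypothesis sqrtK : forall c : K, exists d, d ^+ 2 = c.
Hypotheses (psiK : cancel psi phi) (phiK : cancel phi psi).
Hypothesis psi_lie : forall x y, psi (lie x y) = lie (psi x) (psi y).
Variables (P Q : 'M[K]_m).
Hypotheses (PQ : P *m Q = 1%:M) (QP : Q *m P = 1%:M).

Lemma diag_comm (d : 'rV[K]_m) (A : 'M[K]_m) i j :
  mx_comm (diag_mx d) A i j = (d 0 i - d 0 j) * A i j.
Proof. by rewrite /mx_comm mul_diag_mx mul_mx_diag !mxE mulrBl [_ * d 0 j]mulrC. Qed.

Lemma conj_mx_comm (A B : 'M[K]_m) :
  Q *m mx_comm A B *m P = mx_comm (Q *m A *m P) (Q *m B *m P).
Proof.
by rewrite /mx_comm mulmxBr mulmxBl !mulmxA -![_ *m P *m Q]mulmxA PQ !mulmx1.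
Qed.

Lemma conj_inj (A B : 'M[K]_m) : Q *m A *m P = Q *m B *m P -> A = B.
Proof.
move=> /(congr1 (fun Z => P *m Z *m Q)).
by rewrite !mulmxA PQ !mul1mx -![_ *m P *m Q]mulmxA PQ !mulmx1.
Qed.

Lemma lie_psiE (x y : so J) c : lie (psi x) (psi y) = c *: psi y <->
  mx_comm (so_mx x) (so_mx y) = c *: so_mx y.
Proof.
split=> e.
  rewrite -so_lieE; suff -> : so_lie x y = c *: y by [].
  by apply: (can_inj psiK); rewrite linearZ /= -e; exact: psi_lie.
rewrite -psi_lie -[RHS]linearZ; congr (psi _); apply: so_mx_inj.
by rewrite [LHS]so_lieE e.
Qed.

(** The projections to so(J) of the matrix units in the eigenbasis are eigenvectors of [ad h] or
    zero, and they span so(J); a basis is extracted from them. *)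
Lemma diag_semisimple (h : so J) (d : 'rV[K]_m) : Q *m so_mx h *m P = diag_mx d ->
  ad_semisimple (psi h).
Proof.
move=> hd; have soJ (x : so J) := so_mxP x.
pose F0 (p : 'I_m * 'I_m) := P *m delta_mx p.1 p.2 *m Q.
have QF0 p : Q *m F0 p *m P = delta_mx p.1 p.2.
  by rewrite /F0 !mulmxA QP mul1mx -mulmxA QP mulmx1.
have /choice[F FE] p : exists x : so J, so_mx x = so_proj J (F0 p).
  exact: (so_mx_surj (so_proj_so J_sym J_unit (F0 p))).
have [b [fb bs sub]] := spanning_basis [seq psi (F p) | p : 'I_m * 'I_m].
exists b; split.
  rewrite basisEfree fb /=; apply/andP; split; first exact: subvf.
  have : (fullv <= <<b>>)%VS.
    rewrite bs; apply/subvP=> v _; rewrite -[v]phiK; set z := phi v.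
    have zE : z = 2%:R^-1 *: \sum_p (Q *m so_mx z *m P) p.1 p.2 *: F p.
      have sumE a : so_mx (\sum_p a p *: F p) = \sum_p a p *: so_proj J (F0 p).
        by rewrite linear_sum; apply: eq_bigr => p _; rewrite -FE; exact: linearZ.
      apply: so_mx_inj; rewrite linearZ.
      transitivity (2%:R^-1 *: so_mx (\sum_p (Q *m so_mx z *m P) p.1 p.2 *: F p)); last by [].
      rewrite sumE.
      apply: (scalerI (charK 1)); rewrite scalerA mulfV ?(charK 1) // scale1r.
      rewrite -(so_proj_id J_unit (soJ z)).
      have {1}-> : so_mx z = \sum_p (Q *m so_mx z *m P) p.1 p.2 *: F0 p.
        apply: conj_inj; rewrite mulmx_sumr mulmx_suml.
        rewrite [LHS]matrix_sum_delta pair_bigA /=; apply: eq_bigr => p _.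
        by rewrite -scalemxAr -scalemxAl QF0.
      rewrite /so_proj linear_sum mulmx_sumr mulmx_suml -sumrB; apply: eq_bigr => p _.
      by rewrite scalerBr linearZ /= -scalemxAr -scalemxAl.
    rewrite zE linearZ linear_sum; apply/memvZ/memv_suml => p _.
    by rewrite linearZ; apply/memvZ/memv_span/map_f; rewrite mem_enum.
  by move=> h'; exact: leq_trans (dimvS h') (dim_span b).
move=> v /sub /mapP[p _ ->]; exists (d 0 p.1 - d 0 p.2); apply/lie_psiE; rewrite FE.
apply: (so_proj_comm J_unit (soJ h)); apply: conj_inj; rewrite conj_mx_comm hd.
rewrite QF0; apply/matrixP=> i j; rewrite diag_comm -scalemxAr -scalemxAl QF0.
rewrite !mxE; case: andP => [[/eqP-> /eqP->]|_] //.
by rewrite !mulr0.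
Qed.

Lemma diag_rational (h : so J) (d : 'rV[K]_m) : Q *m so_mx h *m P = diag_mx d ->
  (forall i j, exists q : rat, d 0 i - d 0 j = ratr q) -> ad_rational (psi h).
Proof.
move=> hd dq c; rewrite /passmx.leigenvalue => nz.
pose v := vpick (passmx.leigenspace (ad (psi h)) c).
have v0 : v != 0 by rewrite vpick0.
have : lie (psi h) v = c *: v.
  have := memv_pick (passmx.leigenspace (ad (psi h)) c).
  rewrite memv_ker add_lfunE opp_lfunE scale_lfunE id_lfunE adE subr_eq0 => /eqP //.
rewrite -[v]phiK => /lie_psiE; set z := phi v => hz.
have z0 : so_mx z != 0.
  by apply: contraNneq v0 => /so_mx_eq0 z0; rewrite -[v]phiK -/z z0 linear0.
have [i [j zij]] : exists i j, (Q *m so_mx z *m P) i j != 0.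
  apply: contrapT => /forallNP h'; case/eqP: z0; apply: conj_inj.
  rewrite mulmx0 mul0mx; apply/matrixP=> i j; rewrite [RHS]mxE; apply/eqP.
  by have /forallNP/(_ j)/negP := h' i; rewrite negbK.
have [q dij] := dq i j; exists q; rewrite -dij.
have /matrixP/(_ i j) := conj_mx_comm (so_mx h) (so_mx z).
rewrite hz hd diag_comm -scalemxAr -scalemxAl mxE => /(mulIf zij) ->.
by [].
Qed.

Lemma grid_nilp m' (X Y J' : 'M[K]_m') lab : grid X Y J' lab -> exists k, X ^+ k = 0.
Proof.
(* [X] raises the first label by 2 and labels lie between -M and M, so M + 1 steps leave this
   range. *)
move=> G; pose M := (\max_i absz (lab i).1)%N; exists M.+1.
apply/matrixP=> i j; rewrite [RHS]mxE; apply/eqP; apply: contraT => h.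
have : hits X Y j M.+1 0 i by rewrite /hits /mon expr0 mulmx1.
move=> /(grid_hits charK G) e.
have hi : (absz (lab i).1 <= M)%N by exact: (leq_bigmax (F := fun i => absz (lab i).1)).
have hj : (absz (lab j).1 <= M)%N by exact: (leq_bigmax (F := fun i => absz (lab i).1)).
by move: hi hj; rewrite e /=; move: (M) ((lab j).1) => M' a; clear; lia.
Qed.

Lemma grid_nilpotent_pair x1 x2 lab :
  grid (Q *m so_mx x1 *m P) (Q *m so_mx x2 *m P) (P^T *m J *m P) lab ->
  nilpotent_pair (psi x1, psi x2).
Proof.
move=> G; have W := gr_W G.
have lie_eq (x y z : so J) : mx_comm (so_mx x) (so_mx y) = so_mx z -> lie (psi x) (psi y) = psi z.
  by move=> e; rewrite -psi_lie; congr (psi _); apply: so_mx_inj; rewrite [LHS]so_lieE.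
have lie_eq0 (x y : so J) : mx_comm (so_mx x) (so_mx y) = 0 -> lie (psi x) (psi y) = 0.
  by move=> e; rewrite (lie_eq x y 0) ?linear0.
have [D DE] : exists D : bool -> 'rV[K]_m, forall k i,
    D k 0 i = if k then (half K (lab i)).2 else (half K (lab i)).1.
  by exists (fun k => \row_i if k then (half K (lab i)).2 else (half K (lab i)).1) => k i;
    rewrite mxE.
have QPT : Q^T *m P^T = 1%:M by rewrite -trmx_mul PQ trmx1.
have /choice[h hE] k : exists x : so J, so_mx x = P *m diag_mx (D k) *m Q.
  apply: so_mx_surj.
  have e : (diag_mx (D k))^T *m (P^T *m J *m P) + P^T *m J *m P *m diag_mx (D k) = 0.
    apply/matrixP=> i j; rewrite mxE tr_diag_mx mul_diag_mx mul_mx_diag.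
    rewrite ![(\matrix_(_, _) _) _ _]mxE [RHS]mxE [_ * D k 0 j]mulrC -mulrDl.
    apply/eqP; rewrite mulf_eq0 orbC; case: eqP => //= /eqP /(wt_J W) /eqP.
    by rewrite -[_ + _ == 0]/((_ == 0) && (_ == 0)) !DE => /andP[]; case: k.
  have := so_conj QP e.
  suff -> : Q^T *m (P^T *m J *m P) *m Q = J by [].
  by rewrite !mulmxA QPT mul1mx -mulmxA PQ mulmx1.
have hD k : Q *m so_mx (h k) *m P = diag_mx (D k).
  by rewrite hE !mulmxA QP mul1mx -mulmxA QP mulmx1.
have eig k (x : so J) (c : K) :
    (forall i j, (Q *m so_mx x *m P) i j != 0 -> D k 0 i = D k 0 j + c) ->
    mx_comm (so_mx (h k)) (so_mx x) = c *: so_mx x.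
  move=> hx; apply: conj_inj; rewrite conj_mx_comm hD; apply/matrixP=> i j.
  rewrite diag_comm -scalemxAr -scalemxAl [RHS]mxE.
  have [->|/hx ->] := eqVneq ((Q *m so_mx x *m P) i j) 0; first by rewrite !mulr0.
  by congr (_ * _); ring.
have hh k l : mx_comm (so_mx (h k)) (so_mx (h l)) = 0.
  rewrite -[RHS](scale0r (so_mx (h l))); apply: eig => i j; rewrite hD !mxE addr0.
  by have [->//|ij] := eqVneq i j; rewrite eqxx.
have rat k : ad_rational (psi (h k)).
  apply: (diag_rational (hD k)) => i j.
  exists (((if k then (lab i).2 else (lab i).1) - (if k then (lab j).2 else (lab j).1))%:~R / 2%:R).
  rewrite !DE (ratr_half charK).
  by case: k; rewrite rmorphB mulrBl.
have xx : mx_comm (so_mx x1) (so_mx x2) = 0.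
  apply: conj_inj; rewrite conj_mx_comm mulmx0 mul0mx /mx_comm (wt_comm W).
  by rewrite subrr.
split.
- exact: lie_eq0.
- have [k xk] := grid_nilp G.
  apply/(ad_nilpotentP charK J_sym J_unit psiK phiK psi_lie); exists k.
  by apply: conj_inj; rewrite -(expr_conj _ _ PQ QP) xk mulmx0 mul0mx.
- have [k xk] := grid_nilp (grid_transpose G).
  apply/(ad_nilpotentP charK J_sym J_unit psiK phiK psi_lie); exists k.
  by apply: conj_inj; rewrite -(expr_conj _ _ PQ QP) xk mulmx0 mul0mx.
exists (psi (h false), psi (h true)); split=> /=.
- exact: lie_eq0.
- by split; apply: diag_semisimple (hD _).
- by split; exact: rat.
- split; apply: lie_eq; rewrite -[RHS]scale1r; apply: eig => i j; rewrite !DE.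
    by move=> /(wt_X W) ->.
  by move=> /(wt_Y W) ->.
split; apply: lie_eq0.
  rewrite -[RHS](scale0r (so_mx x2)).
  by apply: (eig false x2) => i j; rewrite !DE => /(wt_Y W) ->.
rewrite -[RHS](scale0r (so_mx x1)).
by apply: (eig true x1) => i j; rewrite !DE => /(wt_X W) ->.
Qed.

Lemma grid_almost_principal x1 x2 lab t A B :
  grid (Q *m so_mx x1 *m P) (Q *m so_mx x2 *m P) (P^T *m J *m P) lab ->
  fits lab (shape t A B) -> shape_valid t A B -> almost_principal (psi x1, psi x2).
Proof.
move=> G f v; rewrite /almost_principal (lie_rank_so charK J_sym J_unit sqrtK psiK phiK psi_lie).
rewrite (dim_centralizer J_sym J_unit psiK phiK psi_lie) -(zforms_conj _ _ PQ QP).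
exact: shape_dim G f v.
Qed.

End GridPair.

(** * Grids with the signs of the model pair *)

Definition cell_sum (z : int * int) : int := ((z.1 + z.2) %/ 2%Z)%Z.

Lemma box_opp A B z : box A B z -> box A B (- z).
Proof.
move=> [k [l [kA lB ->]]]; exists (A - k)%N, (B - l)%N; rewrite !leq_subr; split=> //.
by congr pair; rewrite /=; move: kA lB; clear; lia.
Qed.

Lemma box_swap A B z : box A B z <-> box B A (z.2, z.1).
Proof.
by split=> -[k [l [kA lB]]]; case: z => x y [e1 e2]; exists l, k; split; rewrite //= ?e1 ?e2.
Qed.

Lemma shape_opp t A B z : shape t A B z -> shape t A B (- z).
Proof.
have nr A' B' z' : near_box A' B' z' -> near_box A' B' (- z').
  case=> [/box_opp h|->|->]; first exact: Or31.
    by apply: Or33; congr pair; rewrite /=; clear; lia.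
  by apply: Or32; congr pair; rewrite /=; clear; lia.
case: t => /=; first exact: nr.
  exact: nr.
by case=> [->|/box_opp]; [left; rewrite oppr0|right].
Qed.

Lemma shape_skew t A B z : shape_valid t A B -> shape t A B z -> shape t A B (z + (2, 2)) ->
  shape t A B (z + (2, 0)) /\ shape t A B (z + (0, 2)).
Proof.
have bx A' B' z' : box A' B' z' -> box A' B' (z' + (2, 2)) ->
    box A' B' (z' + (2, 0)) /\ box A' B' (z' + (0, 2)).
  move=> [k [l [kA lB ->]]] [k' [l' [kA' lB' [e1 e2]]]]; split.
    exists k.+1, l; split=> //; first by move: kA' e1; clear; lia.
    by congr pair; rewrite /=; clear; lia.
  exists k, l.+1; split=> //; first by move: lB' e2; clear; lia.
  by congr pair; rewrite /=; clear; lia.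
have nr A' B' z' : (0 < A')%N -> near_box A' B' z' -> near_box A' B' (z' + (2, 2)) ->
    near_box A' B' (z' + (2, 0)) /\ near_box A' B' (z' + (0, 2)).
  move=> A0 [h|->|->]; first last.
  - move=> [[k [l [kA lB [e1 e2]]]]|[e1 e2]|[e1 e2]]; exfalso;
      by move: e1 e2; try move: kA lB; move: A0; clear; lia.
  - move=> [[k [l [kA lB [e1 e2]]]]|[e1 e2]|[e1 e2]]; exfalso;
      by move: e1 e2; try move: kA lB; move: A0; clear; lia.
  move=> [h'|e|e].
  - by have [h1 h2] := bx _ _ _ h h'; split; apply: Or31.
  - exfalso; case: h e => [k [l [kA lB ->]]] [e1 e2]; move: kA lB e1 e2; clear; lia.
  exfalso; case: h e => [k [l [kA lB ->]]] [e1 e2]; move: kA lB e1 e2; clear; lia.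
case: t => /= v.
- case/and3P: v => _ _ A0 h1 h2.
  by have [h3 h4] := nr A B (z.2, z.1) A0 h1 h2; split.
- by case/and3P: v => _ _ A0; exact: nr.
case/andP: v => oA oB; move=> [->|h] [e|h'].
- by case: e.
- exfalso; case: h' => [k [l [_ _ [e1 e2]]]].
  have e : A = (k.-1).*2 by move: e1; clear; lia.
  by move: oA; rewrite e odd_double.
- exfalso; case: h e => [k [l [_ _ ->]]] [e1 e2].
  have e : A = (k.+1).*2 by move: e1; clear; lia.
  by move: oA; rewrite e odd_double.
by have [h1 h2] := bx _ _ _ h h'; split; right.
Qed.

(** [A] and [B] have the same parity, so the doubled coordinates of a cell have even sum and
    [cell_sum] is exactly i + j. *)
Lemma shape_even t A B z : shape_valid t A B -> shape t A B z ->
  z.1 + z.2 = cell_sum z + cell_sum z.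
Proof.
move=> v h; suff [c e] : exists c, z.1 + z.2 = c + c by rewrite /cell_sum e; lia.
have bx A' B' z' : odd A' = odd B' -> box A' B' z' -> exists c, z'.1 + z'.2 = c + c.
  move=> o [k [l [_ _ ->]]] /=.
  have [c e] : exists c : int, A'%:Z + B'%:Z = c + c.
    exists (((A' + B')%N./2)%:Z); have := odd_double_half (A' + B')%N.
    by rewrite oddD o addbb; set x := (_./2); rewrite -addnn; clearbody x; clear; lia.
  by exists (k%:Z + l%:Z - c); move: e; clear; lia.
have ev A' : ~~ odd A' -> exists c : int, A'%:Z = c + c.
  move=> o; exists ((A'./2)%:Z); have := odd_double_half A'.
  by rewrite (negPf o); set x := (A'./2); rewrite -addnn; clearbody x; clear; lia.
have nr A' B' z' : ~~ odd A' -> ~~ odd B' -> near_box A' B' z' -> exists c, z'.1 + z'.2 = c + c.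
  move=> oA oB [/bx|->|->]; first by apply; rewrite (negPf oA) (negPf oB).
    have [a ea] := ev _ oA; have [b eb] := ev _ oB.
    by exists (a - b - 1); rewrite /=; move: ea eb; clear; lia.
  have [a ea] := ev _ oA; have [b eb] := ev _ oB.
  by exists (b + 1 - a); rewrite /=; move: ea eb; clear; lia.
case: t v h => /= v h.
- by case/and3P: v => oA oB _; rewrite addrC; exact: nr oA oB h.
- by case/and3P: v => oA oB _; exact: nr oA oB h.
by case: h => [->|/bx]; [exists 0|apply; case/andP: v => -> ->].
Qed.

Lemma cell_sum_add z a b : a + a = b -> cell_sum (z + (b, 0)) = cell_sum z + a /\
  cell_sum (z + (0, b)) = cell_sum z + a.
Proof. by rewrite /cell_sum; case: z => x y /= <-; split; lia. Qed.

Section CanonicalGrid.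
Variables (K : fieldType) (m : nat) (lab : 'I_m -> int * int).
Hypothesis charK : forall k, k.+1%:R != 0 :> K.

Definition lab_e1 : 'M[K]_m :=
  \matrix_(a, b) if lab a == lab b + (2, 0) then (-1) ^ cell_sum (lab b) else 0.
Definition lab_e2 : 'M[K]_m :=
  \matrix_(a, b) if lab a == lab b + (0, 2) then (-1) ^ (cell_sum (lab b) + 1) else 0.
Definition lab_form : 'M[K]_m := \matrix_(a, b) (lab a == - lab b)%:R.

Lemma sign_neq0 (c : int) : (-1) ^ c != 0 :> K.
Proof. by rewrite expfz_neq0 // oppr_eq0 oner_eq0. Qed.

Lemma signS (c : int) : (-1) ^ (c + 1) = - (-1) ^ c :> K.
Proof. by rewrite expfzDr ?oppr_eq0 ?oner_eq0 // expr1z mulrN1. Qed.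

Lemma signN (c : int) : (-1) ^ (- c) = (-1) ^ c :> K.
Proof. by rewrite -exprz_inv invrN invr1. Qed.

Variables (t : shape_kind) (A B : nat).
Hypotheses (v : shape_valid t A B) (linj : injective lab) (f : fits lab (shape t A B)).

Lemma lab_opp_ex i : exists j, lab j = - lab i.
Proof. by case: f => f1 f2; apply/f2/shape_opp. Qed.

Lemma lab_form_mul (Z : 'M[K]_m) i j i' : lab i' = - lab i -> (lab_form *m Z) i j = Z i' j.
Proof.
move=> e; rewrite mxE (bigD1 i') //= big1 ?addr0 => [|k ki].
  by rewrite mxE e opprK eqxx mul1r.
rewrite mxE; case: eqP => [e'|_]; last by rewrite mul0r.
by case/eqP: ki; apply: linj; rewrite e e' opprK.
Qed.

Lemma lab_form_mulr (Z : 'M[K]_m) i j j' : lab j' = - lab j -> (Z *m lab_form) i j = Z i j'.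
Proof.
move=> e; rewrite mxE (bigD1 j') //= big1 ?addr0 => [|k ki].
  by rewrite mxE e eqxx mulr1.
rewrite mxE; case: eqP => [e'|_]; last by rewrite mulr0.
by case/eqP: ki; apply: linj; rewrite e e'.
Qed.

Lemma lab_form_sym : lab_form^T = lab_form.
Proof. by apply/matrixP=> i j; rewrite !mxE eq_sym eqr_oppLR. Qed.

(** An arrow and its dual start at cells whose sums add up to -1, so they carry opposite signs and
    cancel in the skewness relation. *)
Lemma lab_skew (d : int * int) (c : int) (Z : 'M[K]_m) :
  (forall i j, lab i = lab j + d -> cell_sum (lab i) = cell_sum (lab j) + 1) ->
  (forall i j, Z i j = if lab i == lab j + d then (-1) ^ (cell_sum (lab j) + c) else 0) ->
  Z^T *m lab_form + lab_form *m Z = 0.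
Proof.
move=> hd ZE; apply/matrixP=> i j; rewrite mxE [RHS]mxE.
have [i' ei] := lab_opp_ex i; have [j' ej] := lab_opp_ex j.
rewrite (lab_form_mulr _ _ ej) (lab_form_mul _ _ ei) mxE !ZE ei ej.
have -> : (- lab j == lab i + d) = (- lab i == lab j + d).
  apply/eqP/eqP => e; first by rewrite -[lab i](addrK d) -e opprD !opprK.
  by rewrite -[lab j](addrK d) -e opprD !opprK.
case: eqP => e; last by rewrite addr0.
have e1 : cell_sum (lab i') = cell_sum (lab j) + 1 by apply: hd; rewrite ei.
have e2 : cell_sum (lab i') = - cell_sum (lab i).
  have ev := shape_even v (proj1 f i'); have ev' := shape_even v (proj1 f i).
  by move: ev ev'; rewrite ei /=; clear; lia.
have -> : cell_sum (lab j) = - cell_sum (lab i) - 1 by rewrite -e2 e1 addrK.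
have s1 x : (-1) ^ (x + c) = (-1) ^ x * (-1) ^ c :> K.
  by rewrite expfzDr // oppr_eq0 oner_eq0.
rewrite !s1 -mulrDl; apply/eqP; rewrite mulf_eq0; apply/orP; left.
have -> : (-1) ^ (- cell_sum (lab i) - 1) = - (-1) ^ cell_sum (lab i) :> K.
  by rewrite -(signN (cell_sum _)) -[in RHS](subrK 1 (- cell_sum _)) signS opprK.
by rewrite subrr.
Qed.

Lemma lab_grid : grid lab_e1 lab_e2 lab_form lab.
Proof.
have [f1 f2] := f.
have add2 z : cell_sum (z + (2, 0)) = cell_sum z + 1 /\ cell_sum (z + (0, 2)) = cell_sum z + 1.
  exact: cell_sum_add.
split=> //; first split.
- apply/matrixP=> i j; rewrite !mxE.
  have [e|ne] := eqVneq (lab i) (lab j + (2, 2)); last first.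
    rewrite !big1 // => k _; rewrite !mxE; case: eqP => [e1|]; case: eqP => [e2|];
      rewrite ?mul0r ?mulr0 //.
      by case/eqP: ne; rewrite e1 e2 -addrA; congr (_ + _).
    by case/eqP: ne; rewrite e1 e2 -addrA; congr (_ + _).
  have [s1 s2] : shape t A B (lab j + (2, 0)) /\ shape t A B (lab j + (0, 2)).
    by apply: shape_skew => //; rewrite -e.
  have [a ea] := f2 _ s1; have [b eb] := f2 _ s2.
  rewrite (bigD1 b) //= [X in _ + X]big1 ?addr0 => [|k kb]; last first.
    rewrite !mxE; case: (lab k =P _) => [ek|]; last by rewrite mulr0.
    by case/eqP: kb; apply: linj; rewrite ek eb.
  rewrite (bigD1 a) //= [X in _ + X]big1 ?addr0 => [|k kb]; last first.
    rewrite !mxE; case: (lab k =P _) => [ek|]; last by rewrite mulr0.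
    by case/eqP: kb; apply: linj; rewrite ek ea.
  rewrite !mxE ea eb !eqxx e.
  have -> : (lab j + (2, 2) == lab j + (0, 2) + (2, 0)) by rewrite -addrA; apply/eqP; congr (_ + _).
  have -> : (lab j + (2, 2) == lab j + (2, 0) + (0, 2)) by rewrite -addrA; apply/eqP; congr (_ + _).
  (* Both ways around a unit square have total sign +1: the cell sum grows by 1 at the intermediate
     cell, and [lab_e2] has an additional sign. *)
  rewrite (add2 _).1 (add2 _).2 !signS.
  by ring.
- apply: (@lab_skew (2, 0) 0) => [i j ->|i j]; first by case: (add2 (lab j)).
  by rewrite mxE addr0.
- apply: (@lab_skew (0, 2) 1) => [i j ->|i j]; first by case: (add2 (lab j)).
  by rewrite mxE.
- exact: lab_form_sym.
- have : lab_form *m lab_form = 1%:M.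
    apply/matrixP=> i j; have [i' ei] := lab_opp_ex i.
    by rewrite (lab_form_mul _ _ ei) !mxE ei eqr_opp (inj_eq linj).
  by move=> /mulmx1_unit[].
- move=> i j; rewrite mxE; case: ifP => [/eqP-> _|]; last by rewrite eqxx.
  by rewrite halfD (half_dbl charK 1 0).
- move=> i j; rewrite mxE; case: ifP => [/eqP-> _|]; last by rewrite eqxx.
  by rewrite halfD (half_dbl charK 0 1).
- move=> i j; rewrite mxE; have [-> _|_] := eqVneq (lab i) (- lab j); last by rewrite eqxx.
  by rewrite halfN addNr.
- by move=> i j e; rewrite mxE e eqxx sign_neq0.
- by move=> i j e; rewrite mxE e eqxx sign_neq0.
by move=> i j e; rewrite mxE e eqxx oner_neq0.
Qed.

End CanonicalGrid.

(** * Diagrams and their shapes *)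

Section Points.
Variable R : realType.
Implicit Types (G : {fset R * R}) (z : int * int).

Definition pt z : R * R := (z.1%:~R / 2%:R, z.2%:~R / 2%:R).

Lemma pt_inj : injective pt.
Proof.
move=> [a b] [c d] [e1 e2].
have h (x y : int) : x%:~R / 2%:R = y%:~R / 2%:R :> R -> x = y.
  by apply: contra_eq => xy; rewrite (inj_eq (mulIf _)) ?invr_eq0 ?pnatr_eq0 // eqr_int.
by rewrite (h _ _ e1) (h _ _ e2).
Qed.

Lemma pt_add1 z : pt (z + (2, 0)) = ((pt z).1 + 1, (pt z).2).
Proof. by congr pair; rewrite /= ?addr0 // rmorphD /= mulrDl divff ?pnatr_eq0. Qed.

Lemma pt_add2 z : pt (z + (0, 2)) = ((pt z).1, (pt z).2 + 1).
Proof. by congr pair; rewrite /= ?addr0 // rmorphD /= mulrDl divff ?pnatr_eq0. Qed.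

Lemma pt_sub1 z : pt (z - (2, 0)) = ((pt z).1 - 1, (pt z).2).
Proof. by congr pair; rewrite /= ?subr0 // rmorphB /= mulrBl divff ?pnatr_eq0. Qed.

Lemma pt_sub2 z : pt (z - (0, 2)) = ((pt z).1, (pt z).2 - 1).
Proof. by congr pair; rewrite /= ?subr0 // rmorphB /= mulrBl divff ?pnatr_eq0. Qed.

Lemma pt_opp z : pt (- z) = - pt z.
Proof. by congr pair; rewrite /= rmorphN mulNr. Qed.

Lemma pt0 : pt 0 = (0, 0).
Proof. by rewrite /pt /= mul0r. Qed.

Definition describes G (S : int * int -> Prop) := forall p, p \in G <-> exists2 z, S z & p = pt z.

Lemma describes_pt G S z : describes G S -> pt z \in G <-> S z.
Proof. by move=> d; split=> [/d[z' h /pt_inj->]|h] //; apply/d; exists z. Qed.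

Definition in_point_box (t : shape_kind) z : bool := if t is PointBox then z != 0 else false.

Definition describes_pair (G : {fset R * R} * {fset R * R}) t A B :=
  describes G.1 (fun z => shape t A B z /\ ~~ in_point_box t z) /\
  describes G.2 (fun z => shape t A B z /\ in_point_box t z).

(** The model matrices compare the diagram index as well as the position. The point and the odd box
    are never one step apart, so the labels alone determine these matrices. *)
Lemma in_point_box_step t A B z z' : shape_valid t A B -> shape t A B z -> shape t A B z' ->
  z' = z + (2, 0) \/ z' = z + (0, 2) -> in_point_box t z' = in_point_box t z.
Proof.
case: t => //= /andP[oA oB] Sz Sz' h.
have t1 := point_box_terminal oA oB Sz; have t2 := point_box_terminal oA oB Sz'.
have t3 := point_box_terminal oA oB (shape_opp (t := PointBox) Sz').
have [z0|z0] := eqVneq z 0; have [z0'|z0'] := eqVneq z' 0 => //; exfalso.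
  case: h => e; first by case: t2 => _ _; rewrite e z0.
  by case: t3 => _ h _; apply: h; rewrite e z0 add0r addNr.
by case: t1 => h1 h2 _; case: h => e; [apply: h1|apply: h2]; rewrite -e z0'.
Qed.

Lemma model_pos_inj (G : {fset R * R} * {fset R * R}) : injective (@model_pos R G).
Proof.
move=> a b; rewrite /model_pos => e; apply: enum_val_inj; move: e.
by case: (enum_val a) => p; case: (enum_val b) => q // [] /val_inj->.
Qed.

Lemma model_pos_mem (G : {fset R * R} * {fset R * R}) a :
  (model_pos (G := G) a).2 \in (if (model_pos a).1 then G.2 else G.1).
Proof. by rewrite /model_pos; case: (enum_val a) => p /=; exact: fsvalP. Qed.

Lemma model_pos_ex (G : {fset R * R} * {fset R * R}) (k : bool) p :
  p \in (if k then G.2 else G.1) -> exists a, model_pos (G := G) a = (k, p).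
Proof.
case: k => pG; [pose x : model_index G := inr [` pG]%fset|pose x : model_index G := inl [` pG]%fset];
  by exists (enum_rank x); rewrite /model_pos enum_rankK.
Qed.

Lemma model_grid (K : fieldType) (G : {fset R * R} * {fset R * R}) t A B :
  (forall k, k.+1%:R != 0 :> K) -> shape_valid t A B -> describes_pair G t A B ->
  exists lab, grid (model_e1 K G) (model_e2 K G) (model_form K G) lab /\
    fits lab (shape t A B).
Proof.
move=> charK v [d1 d2].
have /choice[lab hlab] (a : 'I_(model_dim G)) : exists z, shape t A B z /\
    model_pos a = (in_point_box t z, pt z).
  have := model_pos_mem a; case: (model_pos a) => -[] p /=.
    by move=> /d2[z [Sz kz] ->]; exists z; rewrite kz.
  by move=> /d1[z [Sz kz] ->]; exists z; rewrite (negPf kz).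
have labS a : shape t A B (lab a) by case: (hlab a).
have labE a : model_pos a = (in_point_box t (lab a), pt (lab a)) by case: (hlab a).
have linj : injective lab by move=> a b e; apply: model_pos_inj; rewrite !labE e.
have f : fits lab (shape t A B).
  split=> // z Sz; have zG : pt z \in (if in_point_box t z then G.2 else G.1).
    case: ifP => kz; [apply/d2|apply/d1]; exists z => //; split=> //.
    by rewrite kz.
  have [a ea] := model_pos_ex zG; exists a.
  by move: ea; rewrite labE => -[_ e1 e2]; apply: pt_inj; rewrite /pt e1 e2.
have floorE a : Num.floor ((lab a).1%:~R / 2%:R + (lab a).2%:~R / 2%:R : R) = cell_sum (lab a).
  rewrite -mulrDl -rmorphD /= (shape_even v (labS a)) rmorphD /= -mulr2n -[X in X / _]mulr_natr mulfK.
    exact: intrKfloor.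
  by rewrite pnatr_eq0.
exists lab; split=> //.
have -> : model_e1 K G = lab_e1 K lab.
  apply/matrixP=> a b; rewrite !mxE (labE b) /= (labE a) floorE.
  have -> : (in_point_box t (lab a), pt (lab a)) ==
      (in_point_box t (lab b), ((lab b).1%:~R / 2%:R + 1, (lab b).2%:~R / 2%:R)) =
      (lab a == lab b + (2, 0)).
    apply/eqP/eqP => [[_ e1 e2]|e]; last first.
      by rewrite (in_point_box_step v (labS b) (labS a) (or_introl e)) e pt_add1.
    by apply: pt_inj; rewrite pt_add1 /pt e1 e2.
  by [].
have -> : model_e2 K G = lab_e2 K lab.
  apply/matrixP=> a b; rewrite !mxE (labE b) /= (labE a) floorE.
  have -> : (in_point_box t (lab a), pt (lab a)) ==
      (in_point_box t (lab b), ((lab b).1%:~R / 2%:R, (lab b).2%:~R / 2%:R + 1)) =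
      (lab a == lab b + (0, 2)).
    apply/eqP/eqP => [[_ e1 e2]|e]; last first.
      by rewrite (in_point_box_step v (labS b) (labS a) (or_intror e)) e pt_add2.
    by apply: pt_inj; rewrite pt_add2 /pt e1 e2.
  by [].
have -> : model_form K G = lab_form K lab.
  apply/matrixP=> a b; rewrite !mxE (labE b) /= (labE a); congr (nat_of_bool _)%:R.
  apply/eqP/eqP => [[_ e1 e2]|->]; last first.
    by rewrite pt_opp; congr pair; rewrite /in_point_box; case: (t) => //; rewrite oppr_eq0.
  by apply: pt_inj; rewrite pt_opp /pt e1 e2.
exact: (lab_grid charK v linj f).
Qed.

End Points.

(** * Sets with one southwest and one northeast corner *)

Section UniqueCorners.
Variable U : int * int -> Prop.
Variables (M : int) (c d : int * int).
Hypothesis U_bnd : forall z, U z -> - M <= z.1 + z.2 <= M.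
Hypothesis U_skew : forall z, U z -> U (z + (1, 1)) -> U (z + (1, 0)) /\ U (z + (0, 1)).
Hypothesis U_sw : forall z, U z -> ~ U (z - (1, 0)) -> ~ U (z - (0, 1)) -> z = c.
Hypothesis U_ne : forall z, U z -> ~ U (z + (1, 0)) -> ~ U (z + (0, 1)) -> z = d.

Let T := {z | U z}.
Let eX (a b : T) := sval b = sval a + (1, 0).
Let eY (a b : T) := sval b = sval a + (0, 1).

Let U_grid : grid_rel eX eY (sval : T -> int * int).
Proof.
split=> //.
- by move=> [a Ua] [b Ub] /= e; subst b; congr exist; exact: Prop_irrelevance.
- move=> [x Ux] [y Uy] [z Uz]; rewrite /eX /eY /= => exy eyz.
  have [|_ h] := U_skew Ux; first by move: Uz; rewrite eyz exy -addrA.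
  by exists (exist _ _ h) => //=; rewrite eyz exy -!addrA.
move=> [x Ux] [y Uy] [z Uz]; rewrite /eX /eY /= => exy eyz.
have [|h _] := U_skew Ux; first by move: Uz; rewrite eyz exy -addrA.
by exists (exist _ _ h) => //=; rewrite eyz exy -!addrA.
Qed.

Let down (z : T) : exists2 a : T, rpath eX eY a z & sval a = c.
Proof.
have [k hk] : exists k : nat, (sval z).1 + (sval z).2 = k%:Z - M.
  by exists (absz ((sval z).1 + (sval z).2 + M)%R); have := U_bnd (svalP z); lia.
elim: k z hk => [|k IH] [z Uz] /= hk.
  have e : z = c.
    by apply: U_sw => // /U_bnd /=; rewrite ?subr0; move: hk; clear; lia.
  by exists (exist _ z Uz) => //; exact: RPath0.
have [h|n1] := pselect (U (z - (1, 0))).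
  have [|a aw ac] := IH (exist _ _ h); first by move: hk; rewrite /=; clear; lia.
  by exists a => //; apply: (RPath1 aw); rewrite /eX /= subrK.
have [h|n2] := pselect (U (z - (0, 1))).
  have [|a aw ac] := IH (exist _ _ h); first by move: hk; rewrite /=; clear; lia.
  by exists a => //; apply: (RPath2 aw); rewrite /eY /= subrK.
by exists (exist _ z Uz); [exact: RPath0|exact: U_sw].
Qed.

Let up (z : T) : exists2 a : T, rpath eX eY z a & sval a = d.
Proof.
have [k hk] : exists k : nat, (sval z).1 + (sval z).2 = M - k%:Z.
  by exists (absz (M - ((sval z).1 + (sval z).2))%R); have := U_bnd (svalP z); lia.
elim: k z hk => [|k IH] [z Uz] /= hk.
  have e : z = d.
    by apply: U_ne => // /U_bnd /=; rewrite ?addr0; move: hk; clear; lia.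
  by exists (exist _ z Uz) => //; exact: RPath0.
have [h|n1] := pselect (U (z + (1, 0))).
  have [|a aw ac] := IH (exist _ _ h); first by move: hk; rewrite /=; clear; lia.
  by exists a => //; apply: (rpath_cat _ aw); apply: rpath1.
have [h|n2] := pselect (U (z + (0, 1))).
  have [|a aw ac] := IH (exist _ _ h); first by move: hk; rewrite /=; clear; lia.
  by exists a => //; apply: (rpath_cat _ aw); apply: rpath2.
by exists (exist _ z Uz); [exact: RPath0|exact: U_ne].
Qed.

(** Descending as far as possible from any point ends at [c], and ascending ends at [d]. So all
    points lie between the two, and a monotone path from c to d through [z0] lets [reach_box] fill
    the rectangle. *)
Lemma unique_corners_box z0 : U z0 ->
  forall z, U z <-> (c.1 <= z.1 <= d.1) && (c.2 <= z.2 <= d.2).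
Proof.
move=> Uz0.
have le (a b : T) : rpath eX eY a b -> (sval a).1 <= (sval b).1 /\ (sval a).2 <= (sval b).2.
  elim=> [|b' c' _ [h1 h2] e|b' c' _ [h1 h2] e]; first by [].
    by rewrite e /=; move: h1 h2; clear; lia.
  by rewrite e /=; move: h1 h2; clear; lia.
move=> z; split=> [Uz|/andP[h1 h2]].
  have [a /le[l1 l2] ac] := down (exist _ z Uz); have [b /le[l3 l4] bd] := up (exist _ z Uz).
  by move: l1 l2 l3 l4; rewrite ac bd /= => -> -> -> ->.
have [a ar ac] := down (exist _ z0 Uz0); have [b br bd] := up (exist _ z0 Uz0).
have [|| x xz] := reach_box U_grid (rpath_cat ar br) (u := z.1) (v := z.2).
- by rewrite ac bd.
- by rewrite ac bd.
by have := svalP x; rewrite xz -surjective_pairing.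
Qed.

End UniqueCorners.

(** If p has its neighbour on the right, it lies just left of the box, and in the top row: lower
    down, the square on p and p + (1, 1) would force a cell above p. A box of height one is
    excluded, since U would be a single row and q would have a left neighbour. The case of a
    neighbour above is the transpose. *)
Lemma near_corner (U : int * int -> Prop) (p q : int * int) (a b : int) : 0 <= a -> 0 <= b ->
  (forall z, U z <-> [\/ z = p, z = - p | (- a <= z.1 <= a) && (- b <= z.2 <= b)]) ->
  ~~ ((- a <= p.1 <= a) && (- b <= p.2 <= b)) ->
  (forall z, U z -> U (z + (1, 1)) -> U (z + (1, 0)) /\ U (z + (0, 1))) ->
  U (p + (1, 0)) \/ U (p + (0, 1)) ->
  q <> p -> U q -> ~ U (q - (1, 0)) -> ~ U (q - (0, 1)) ->
  (p = (a, - b - 1) /\ 0 < a) \/ (p = (- a - 1, b) /\ 0 < b).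
Proof.
case: p q => x y [x' y'] a0 b0 UE /= out skew nb qp Uq q1 q2.
have Up : U (x, y) by apply/UE; exact: Or31.
have in_box u v : (- a <= u <= a) && (- b <= v <= b) -> U (u, v) by move=> h; apply/UE; exact: Or33.
case: nb => /UE [[]|[e1 e2]|/= h]; try by move: out a0 b0; clear; lia.
- by exfalso; move: e1 e2 => /=; clear; lia.
- have ex : x = - a - 1 by move: h out; rewrite addr0; clear; lia.
  have ey : y = b.
    apply/eqP; rewrite eq_le; apply/andP; split; first by move: h; rewrite addr0; clear; lia.
    rewrite leNgt; apply/negP => yb.
    have [|_ /UE h'] := skew _ Up.
      by apply: in_box; move: h yb; rewrite /= addr0; clear; lia.
    by case: h' => [[_ e]|[e _]|/= h']; [move: e|move: e|move: h']; rewrite ?ex; move: a0; clear; lia.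
  right; rewrite ex ey; split=> //; rewrite lt_def b0 andbT; apply/eqP => b_eq0.
  have {ey} ey : y = 0 by rewrite ey b_eq0.
  have U' u : - a - 1 <= u <= a + 1 -> U (u, 0).
    move=> hu; have [->|n1] := eqVneq u x; first by rewrite -ey.
    have [e|n2] := eqVneq u (- x); first by apply/UE/Or32; rewrite e ey -[RHS]/(- x, - 0) oppr0.
    by apply: in_box; rewrite b_eq0; move: hu n1 n2; rewrite ex; clear; lia.
  have [hx' ey'] : - a - 1 <= x' <= a + 1 /\ y' = 0.
    case/UE: Uq => [[-> ->]|[-> ->]|/=]; rewrite ?ex ?ey ?b_eq0; move: a0; clear; lia.
  apply: q1; rewrite -[_ - _]/(x' - 1, y' - 0) ey' subr0; apply: U'.
  have : x' <> x by move=> e; apply: qp; rewrite e ey ey'.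
  by move: hx'; rewrite ex; clear; lia.
- by exfalso; move: e1 e2 => /=; clear; lia.
have ey : y = - b - 1 by move: h out; rewrite addr0; clear; lia.
have ex : x = a.
  apply/eqP; rewrite eq_le; apply/andP; split; first by move: h; rewrite addr0; clear; lia.
  rewrite leNgt; apply/negP => xa.
  have [|/UE h' _] := skew _ Up.
    by apply: in_box; move: h xa; rewrite /= addr0; clear; lia.
  by case: h' => [[e _]|[_ e]|/= h']; [move: e|move: e|move: h']; rewrite ?ey; move: b0; clear; lia.
left; rewrite ex ey; split=> //; rewrite lt_def a0 andbT; apply/eqP => a_eq0.
have {ex} ex : x = 0 by rewrite ex a_eq0.
have U' u : - b - 1 <= u <= b + 1 -> U (0, u).
  move=> hu; have [->|n1] := eqVneq u y; first by rewrite -ex.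
  have [e|n2] := eqVneq u (- y); first by apply/UE/Or32; rewrite e ex -[RHS]/(- 0, - y) oppr0.
  by apply: in_box; rewrite a_eq0; move: hu n1 n2; rewrite ey; clear; lia.
have [hy' ex'] : - b - 1 <= y' <= b + 1 /\ x' = 0.
  case/UE: Uq => [[-> ->]|[-> ->]|/=]; rewrite ?ex ?ey ?a_eq0; move: b0; clear; lia.
apply: q2; rewrite -[_ - _]/(x' - 0, y' - 1) ex' subr0; apply: U'.
have : y' <> y by move=> e; apply: qp; rewrite e ex ex'.
by move: hy'; rewrite ey; clear; lia.
Qed.

(** Doubled coordinates of the point z + (e/2, e/2): e = 0 in the integral case, e = 1 in the
    half-integral one. *)
Definition cell (e : int) (z : int * int) : int * int := (z.1 + z.1 + e, z.2 + z.2 + e).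

Lemma cell_add1 e z : cell e (z + (1, 0)) = cell e z + (2, 0).
Proof. by congr pair; rewrite /=; lia. Qed.
Lemma cell_add2 e z : cell e (z + (0, 1)) = cell e z + (0, 2).
Proof. by congr pair; rewrite /=; lia. Qed.
Lemma cell_sub1 e z : cell e (z - (1, 0)) = cell e z - (2, 0).
Proof. by congr pair; rewrite /=; lia. Qed.
Lemma cell_sub2 e z : cell e (z - (0, 1)) = cell e z - (0, 2).
Proof. by congr pair; rewrite /=; lia. Qed.
Lemma cell_opp e z : - cell e z = cell e (- z - (e, e)).
Proof. by congr pair; rewrite /=; lia. Qed.
Lemma cell_inj e : injective (cell e).
Proof. by move=> [a b] [c d] [e1 e2]; congr pair; [move: e1|move: e2]; clear; lia. Qed.

Section Diagrams.
Variable R : realType.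
Implicit Types (G : {fset R * R}) (z : int * int).
Local Notation pt := (pt R).

Lemma pt_half z : pt (z.1 + z.1, z.2 + z.2) = (z.1%:~R, z.2%:~R).
Proof.
by congr pair; rewrite /= rmorphD /= -mulr2n -[X in X / _]mulr_natr mulfK // pnatr_eq0.
Qed.

Lemma ptD z1 z2 : pt (z1 + z2) = pt z1 + pt z2.
Proof. by congr pair; rewrite /= rmorphD mulrDl. Qed.

Lemma pt_cell e z : pt (cell e z) = (z.1%:~R, z.2%:~R) + pt (e, e).
Proof. by rewrite -pt_half -ptD. Qed.

Lemma lattice_cell e G p : in_lattice (pt (e, e)) G -> p \in G -> exists z, p = pt (cell e z).
Proof.
move=> lat /lat /andP[/intrP[a ea] /intrP[b eb]]; exists (a, b).
by rewrite pt_cell [LHS]surjective_pairing; congr pair; rewrite /= -?ea -?eb subrK.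
Qed.

Lemma adjacent_cell e z z' : adjacent (pt (cell e z)) (pt (cell e z')) =
  ((z.1 - z'.1) ^+ 2 + (z.2 - z'.2) ^+ 2 == 1).
Proof.
rewrite /adjacent !pt_cell /=.
have d (a b c : R) : a + c - (b + c) = a - b by rewrite opprD addrACA subrr addr0.
rewrite !d -!rmorphB -!rmorphXn -rmorphD /= -[X in _ == X](sqrtr1 R) eqr_sqrt ?ler01 //.
  by rewrite -[1]/(1%:~R) eqr_int.
by rewrite ler0z addr_ge0 // sqr_ge0.
Qed.

End Diagrams.

Lemma unit_step (u w : int) : u ^+ 2 + w ^+ 2 = 1 ->
  [\/ u = 1 /\ w = 0, u = -1 /\ w = 0, u = 0 /\ w = 1 | u = 0 /\ w = -1].
Proof.
have small (x y : int) : x ^+ 2 + y ^+ 2 = 1 -> [\/ x = -1, x = 0 | x = 1].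
  move=> h; have : `|x| ^+ 2 <= 1 ^+ 2.
    by rewrite real_normK ?num_real // expr1n -h lerDl sqr_ge0.
  by rewrite ler_pXn2r ?nnegrE ?normr_ge0 // => h'; case: (ltrgtP x 0) => hx;
    [apply: Or31|apply: Or33|apply: Or32]; move: h' hx; clear; lia.
move=> h; have h' : w ^+ 2 + u ^+ 2 = 1 by rewrite addrC.
case: (small _ _ h) (small _ _ h') (h) => -> [] -> //= _;
  [exact: Or42|exact: Or44|exact: Or43|exact: Or41].
Qed.

(** * From admissible diagrams to shapes *)

Section Classification.
Variable R : realType.
Implicit Types (G : {fset R * R}) (z : int * int).
Local Notation pt := (pt R).

Definition skew_closed G := forall i j : R, (i, j) \in G -> (i + 1, j + 1) \in G ->
  (i + 1, j) \in G /\ (i, j + 1) \in G.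

Lemma skew_closed_cells e G : skew_closed G -> forall z, pt (cell e z) \in G ->
  pt (cell e (z + (1, 1))) \in G ->
  pt (cell e (z + (1, 0))) \in G /\ pt (cell e (z + (0, 1))) \in G.
Proof.
move=> sk z h1 h2; rewrite cell_add1 cell_add2 pt_add1 pt_add2.
apply: sk; first by rewrite -surjective_pairing.
suff <- : pt (cell e (z + (1, 1))) = ((pt (cell e z)).1 + 1, (pt (cell e z)).2 + 1) by [].
have -> : z + (1, 1) = z + (1, 0) + (0, 1) by rewrite -addrA.
by rewrite cell_add2 pt_add2 cell_add1 pt_add1.
Qed.

Lemma bounded_cells e G : 0 <= e <= 1 ->
  exists M, forall z, pt (cell e z) \in G -> - M <= z.1 + z.2 <= M.
Proof.
move=> he; pose F (p : R * R) := absz (Num.floor (p.1 + p.2)).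
exists ((\max_(p <- G) F p)%N%:Z + 1) => z zG.
have h : (F (pt (cell e z)) <= \max_(p <- G) F p)%N by exact: leq_bigmax_seq zG _.
have Fz : F (pt (cell e z)) = absz (z.1 + z.2 + e).
  rewrite /F; congr absz; rewrite -[RHS](@intrKfloor R); congr Num.floor.
  by rewrite pt_cell /= addrACA -splitr !rmorphD.
by move: h he; rewrite Fz; move: (\max_(p <- G) F p)%N => N; clear; lia.
Qed.

Lemma sw_cells e G z : pt (cell e z) \in sw_corners G <->
  [/\ pt (cell e z) \in G, pt (cell e (z - (1, 0))) \notin G & pt (cell e (z - (0, 1))) \notin G].
Proof.
rewrite cell_sub1 cell_sub2 pt_sub1 pt_sub2 !inE /=.
by split=> [/and3P[]|[-> -> ->]].
Qed.

Lemma ne_cells e G z : pt (cell e z) \in ne_corners G <->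
  [/\ pt (cell e z) \in G, pt (cell e (z + (1, 0))) \notin G & pt (cell e (z + (0, 1))) \notin G].
Proof.
rewrite cell_add1 cell_add2 pt_add1 pt_add2 !inE /=.
by split=> [/and3P[]|[-> -> ->]].
Qed.

Lemma cell_pt_inj e z z' : pt (cell e z) = pt (cell e z') -> z = z'.
Proof. by move=> /(@pt_inj R)/cell_inj. Qed.

(** The two corners c and d bound a full box by [unique_corners_box], and central symmetry forces c
    = - d - (e, e). *)
Lemma rectangular_box e G : 0 <= e <= 1 -> (forall p, p \in G -> exists z, p = pt (cell e z)) ->
  skew_closed G -> (forall p, p \in G -> - p \in G) -> rectangular G ->
  exists d : int * int, [/\ 0 <= d.1 + d.1 + e, 0 <= d.2 + d.2 + e & forall z,
    pt (cell e z) \in G <-> (- d.1 - e <= z.1 <= d.1) && (- d.2 - e <= z.2 <= d.2)].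
Proof.
move=> he lat sk sym [/eqP/cardfs1P[p1 sw] /eqP/cardfs1P[p2 ne]].
have p1G : p1 \in G.
  by have := fset11 p1; rewrite -sw !inE => /and3P[].
have p2G : p2 \in G.
  by have := fset11 p2; rewrite -ne !inE => /and3P[].
have [c pc] := lat _ p1G; have [d pd] := lat _ p2G.
have [M bnd] := bounded_cells G he.
have box := @unique_corners_box (fun z => pt (cell e z) \in G) M c d bnd
  (skew_closed_cells (e := e) sk).
have {}box z : pt (cell e z) \in G <-> (c.1 <= z.1 <= d.1) && (c.2 <= z.2 <= d.2).
  apply: (box _ _ c); last by rewrite -pc.
    move=> z' h1 /negP h2 /negP h3; apply: (@cell_pt_inj e); rewrite -pc.
    by have := (sw_cells e G z').2 (And3 h1 h2 h3); rewrite sw inE => /eqP.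
  move=> z' h1 /negP h2 /negP h3; apply: (@cell_pt_inj e); rewrite -pd.
  by have := (ne_cells e G z').2 (And3 h1 h2 h3); rewrite ne inE => /eqP.
have opp z : pt (cell e z) \in G -> pt (cell e (- z - (e, e))) \in G.
  by rewrite -cell_opp pt_opp; exact: sym.
have cG : pt (cell e c) \in G by rewrite -pc.
have dG : pt (cell e d) \in G by rewrite -pd.
have := (box _).1 (opp _ cG); have := (box _).1 (opp _ dG); have := (box _).1 cG.
rewrite /= => h1 h2 h3; have ec1 : c.1 = - d.1 - e by move: h1 h2 h3; clear; lia.
have ec2 : c.2 = - d.2 - e by move: h1 h2 h3; clear; lia.
exists d; split; last by rewrite -ec1 -ec2.
  by move: h1; rewrite ec1; clear; lia.
by move: h1; rewrite ec2; clear; lia.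
Qed.

Lemma near_rectangular_ex G : near_rectangular_a G \/ near_rectangular_b G ->
  exists p q, [/\ p <> q, sw_corners G = [fset p; q]%fset & rectangular (G `\` [fset p; - p])%fset].
Proof.
case=> -[i [j [k [l [sw ik rect]]]]].
  exists (i, j), (k, l); split=> // -[e _]; by rewrite e ltxx in ik.
exists (k, l), (i, j); split=> //; last by rewrite sw; apply/fsetP => x; rewrite !inE orbC.
by move=> [e _]; rewrite e ltxx in ik.
Qed.

Lemma near_box_cell (a b : int) z : 0 <= a -> 0 <= b ->
  box (absz a).*2 (absz b).*2 (cell 0 z) <-> (- a <= z.1 <= a) && (- b <= z.2 <= b).
Proof.
move=> a0 b0; split=> [[k [l [kA lB [e1 e2]]]]|h].
  by move: kA lB e1 e2; rewrite -!muln2; move: a0 b0; clear; lia.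
exists (absz (z.1 + a)%R), (absz (z.2 + b)%R); rewrite -!muln2.
by split; last congr pair; rewrite /=; move: h a0 b0; clear; lia.
Qed.

Lemma near_rectangular_shape G : skew_diagram G -> centrally_symmetric G -> integral_diagram G ->
  near_rectangular_a G \/ near_rectangular_b G ->
  exists t A B, [/\ shape_valid t A B, t <> PointBox & describes G (shape t A B)].
Proof.
move=> [_ conG sk] cs int /near_rectangular_ex[p0 [q0 [pq0 sw rect]]].
have lat p : p \in G -> exists z, p = pt (cell 0 z).
  by apply: lattice_cell; rewrite pt0.
have sym p : p \in G -> - p \in G by move=> pG; rewrite cs; apply/imfsetP; exists p.
have p0sw : p0 \in sw_corners G by rewrite sw !inE eqxx.
have q0sw : q0 \in sw_corners G by rewrite sw !inE eqxx orbT.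
have p0G : p0 \in G by move: p0sw; rewrite !inE => /and3P[].
have q0G : q0 \in G by move: q0sw; rewrite !inE => /and3P[].
have [p ep] := lat _ p0G; have [q eq] := lat _ q0G.
have qp : q <> p by move=> e; apply: pq0; rewrite ep eq e.
move: p0sw q0sw; rewrite ep eq => /sw_cells[pG /negP p1 /negP p2] /sw_cells[qG /negP q1 /negP q2].
set G' := (G `\` _)%fset in rect.
have G'E z : pt (cell 0 z) \in G' <-> [/\ pt (cell 0 z) \in G, z <> p & z <> - p].
  rewrite !inE negb_or ep -pt_opp cell_opp subr0 !(inj_eq (@pt_inj R)) !(inj_eq (@cell_inj 0)).
  by split=> [/andP[/andP[/eqP h1 /eqP h2] h3]|[-> /eqP-> /eqP->]].
have pN1 : pt (cell 0 (- p + (1, 0))) \notin G.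
  apply/negP => /sym; rewrite -pt_opp cell_opp subr0 opprD opprK; exact: p1.
have pN2 : pt (cell 0 (- p + (0, 1))) \notin G.
  apply/negP => /sym; rewrite -pt_opp cell_opp subr0 opprD opprK; exact: p2.
(* The two cells required by a square have a left or lower neighbour and also a right or upper
   neighbour in G; the corner p lacks the former and -p the latter, so neither of them is
   required. *)
have sk' : skew_closed G'.
  move=> i j h1 h2; have h1' : (i, j) \in G by move: h1; rewrite !inE => /andP[].
  have h2' : (i + 1, j + 1) \in G by move: h2; rewrite !inE => /andP[].
  have [z ez] := lat _ h1'; have [h3 h4] := sk _ _ h1' h2'.
  have e1 : (i + 1, j) = pt (cell 0 (z + (1, 0))) by rewrite cell_add1 pt_add1 -ez.
  have e2 : (i, j + 1) = pt (cell 0 (z + (0, 1))) by rewrite cell_add2 pt_add2 -ez.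
  have e3 : (i + 1, j + 1) = pt (cell 0 (z + (1, 0) + (0, 1))).
    by rewrite cell_add2 pt_add2 -e1.
  have e4 : (i + 1, j + 1) = pt (cell 0 (z + (0, 1) + (1, 0))).
    by rewrite cell_add1 pt_add1 -e2.
  rewrite e1 e2; split; apply/G'E; split; rewrite -?e1 -?e2 // => e.
  - by apply: p1; rewrite -e addrK -ez.
  - by move/negP: pN2; apply; rewrite -e -e3.
  - by apply: p2; rewrite -e addrK -ez.
  by move/negP: pN1; apply; rewrite -e -e4.
have lat' r : r \in G' -> exists z, r = pt (cell 0 z) by rewrite inE => /andP[_ /lat].
have sym' r : r \in G' -> - r \in G'.
  move=> rG; have [z ez] := lat' _ rG; move: rG; rewrite ez -pt_opp cell_opp subr0 => /G'E[h1 h2 h3].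
  apply/G'E; split; last by move=> /oppr_inj.
    by have := sym _ h1; rewrite -pt_opp cell_opp subr0.
  by move=> e; apply: h3; rewrite -e opprK.
have [[a b] [/= a0 b0 box']] := rectangular_box (e := 0) isT lat' sk' sym' rect.
have {}a0 : 0 <= a by move: a0; clear; lia.
have {}b0 : 0 <= b by move: b0; clear; lia.
have {}box' z : pt (cell 0 z) \in G' <-> (- a <= z.1 <= a) && (- b <= z.2 <= b).
  by have := box' z; rewrite !subr0.
have UE z : pt (cell 0 z) \in G <-> [\/ z = p, z = - p | (- a <= z.1 <= a) && (- b <= z.2 <= b)].
  split=> [zG|[->|->|/box'/G'E[]]] //; last first.
    by have := sym _ pG; rewrite -pt_opp cell_opp subr0.
  have [->|/eqP zp] := eqVneq z p; first exact: Or31.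
  have [->|/eqP zp'] := eqVneq z (- p); first exact: Or32.
  by apply/Or33/box'/G'E.
have out : ~~ ((- a <= p.1 <= a) && (- b <= p.2 <= b)).
  by apply/negP => /box'/G'E[].
have nb : pt (cell 0 (p + (1, 0))) \in G \/ pt (cell 0 (p + (0, 1))) \in G.
  have [s [ps /allP sG ls]] := conG _ _ pG qG.
  case: s ps sG ls => [_ _ /= /cell_pt_inj e|x s]; first by case: qp.
  move=> /= /andP[ax _] sG _; have xG : x \in G by apply: sG; rewrite inE eqxx.
  have [z ez] := lat _ xG; move: ax; rewrite ez adjacent_cell => /eqP ax.
  have xG' : pt (cell 0 z) \in G by rewrite -ez.
  have [|||] : [\/ z = p + (1, 0), z = p + (0, 1), z = p - (1, 0) | z = p - (0, 1)].
    have := @unit_step (p - z).1 (p - z).2 ax.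
    have : z = p - (p - z) by rewrite opprB addrC subrK.
    by move: (p - z) => [u w] /= -> [] [-> ->];
      [exact: Or43|exact: Or41|exact: Or44|exact: Or42].
  - by move=> <-; left.
  - by move=> <-; right.
  - by move=> e; case: p1; rewrite -e.
  by move=> e; case: p2; rewrite -e.
have sh : (p = (a, - b - 1) /\ 0 < a) \/ (p = (- a - 1, b) /\ 0 < b).
  apply: (near_corner (U := fun z => pt (cell 0 z) \in G) (q := q)) => //.
  exact: skew_closed_cells.
have boxE := near_box_cell _ a0 b0.
have Gpt r : r \in G <-> exists2 z, pt (cell 0 z) \in G & r = pt (cell 0 z).
  by split=> [rG|[z zG ->] //]; have [z ez] := lat _ rG; exists z; rewrite -?ez.
have box_cell A B z : ~~ odd A -> ~~ odd B -> box A B z -> exists z', z = cell 0 z'.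
  move=> oA oB [k [l [_ _ ->]]]; exists (k%:Z - (A./2)%:Z, l%:Z - (B./2)%:Z).
  have := odd_double_half A; have := odd_double_half B; rewrite (negPf oA) (negPf oB) -!addnn.
  by move: (A./2) (B./2) => x y e1 e2; congr pair; rewrite /=; move: e1 e2; clear; lia.
case: sh => -[pE pos].
- exists NearBoxB, (absz a).*2, (absz b).*2; split=> //.
    by rewrite /= !odd_double /=; move: pos; clear; lia.
  have extra : cell 0 p = ((absz a).*2%:Z, - ((absz b).*2%:Z + 2)).
    by rewrite pE -!muln2; congr pair; rewrite /=; move: a0 b0; clear; lia.
  have extra' : cell 0 (- p) = (- (absz a).*2%:Z, (absz b).*2%:Z + 2).
    by rewrite pE -!muln2; congr pair; rewrite /=; move: a0 b0; clear; lia.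
  move=> r; rewrite Gpt; split=> -[z].
    move=> /UE h ->; exists (cell 0 z) => //; case: h => [->|->|h].
    - by apply: Or32.
    - by apply: Or33.
    by apply: Or31; apply/boxE.
  case=> [h|->|->] ->.
  - have [z' ez'] := box_cell _ _ _ (negbT (odd_double _)) (negbT (odd_double _)) h.
    by exists z'; rewrite -?ez' //; rewrite ez'; apply/UE/Or33/boxE; rewrite -ez'.
  - by exists p => //; rewrite extra.
  by exists (- p); [apply/UE/Or32|rewrite extra'].
exists NearBoxA, (absz b).*2, (absz a).*2; split=> //.
  by rewrite /= !odd_double /=; move: pos; clear; lia.
have extra : cell 0 (- p) = ((absz a).*2%:Z + 2, - (absz b).*2%:Z).
  by rewrite pE -!muln2; congr pair; rewrite /=; move: a0 b0; clear; lia.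
have extra' : cell 0 p = (- ((absz a).*2%:Z + 2), (absz b).*2%:Z).
  by rewrite pE -!muln2; congr pair; rewrite /=; move: a0 b0; clear; lia.
move=> r; rewrite Gpt; split=> -[z].
  move=> /UE h ->; exists (cell 0 z) => //; case: h => [->|->|h].
  - by apply: Or32; rewrite extra'.
  - by apply: Or33; rewrite extra.
  by apply: Or31; apply/box_swap/boxE.
case: z => x y; case=> [/box_swap /= h|[ex ey]|[ex ey]] ->.
- have [z' ez'] := box_cell _ _ _ (negbT (odd_double _)) (negbT (odd_double _)) h.
  by exists z'; rewrite -?ez' //; rewrite ez'; apply/UE/Or33/boxE; rewrite -ez'.
- by exists p => //; rewrite extra' ex ey.
by exists (- p); [apply/UE/Or32|rewrite extra ex ey].
Qed.

End Classification.

Lemma odd_box_cell (a b : int) z : 0 <= a -> 0 <= b ->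
  box (absz a).*2.+1 (absz b).*2.+1 (cell 1 z) <->
  (- a - 1 <= z.1 <= a) && (- b - 1 <= z.2 <= b).
Proof.
move=> a0 b0; split=> [[k [l [kA lB [e1 e2]]]]|h].
  by move: kA lB e1 e2; rewrite -!muln2; move: a0 b0; clear; lia.
exists (absz (z.1 + a + 1)%R), (absz (z.2 + b + 1)%R); rewrite -!muln2.
by split; last congr pair; rewrite /=; move: h a0 b0; clear; lia.
Qed.

Lemma box_cell (e A B : nat) z : odd A = (e == 1)%N -> odd B = (e == 1)%N -> (e <= 1)%N ->
  box A B z -> exists z', z = cell e z'.
Proof.
move=> oA oB he [k [l [_ _ ->]]]; exists (k%:Z - (A./2)%:Z - e%:Z, l%:Z - (B./2)%:Z - e%:Z).
have eo : (e == 1)%N = e :> nat by case: e he {oA oB} => [|[]].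
have := odd_double_half A; have := odd_double_half B; rewrite oA oB eo -!addnn.
by move: (A./2) (B./2) => x y e1 e2; congr pair; rewrite /=; move: e1 e2; clear; lia.
Qed.

(** * From shapes to admissible diagrams *)

Definition sw_corner (S : int * int -> Prop) z := [/\ S z, ~ S (z - (2, 0)) & ~ S (z - (0, 2))].
Definition ne_corner (S : int * int -> Prop) z := [/\ S z, ~ S (z + (2, 0)) & ~ S (z + (0, 2))].

Lemma box_sw A B z : sw_corner (box A B) z <-> z = (- A%:Z, - B%:Z).
Proof.
split=> [[[k [l [kA lB ->]]] n1 n2]|->].
  case: k kA n1 n2 => [|k] kA n1 n2; last first.
    case: n1; exists k, l; split=> //; first exact: ltnW.
    by congr pair; rewrite /=; clear; lia.
  case: l lB n1 n2 => [|l] lB n1 n2; last first.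
    case: n2; exists 0%N, l; split=> //; first exact: ltnW.
    by congr pair; rewrite /=; clear; lia.
  by congr pair; rewrite /=; clear; lia.
split; first by exists 0%N, 0%N; split=> //; congr pair; rewrite /=; clear; lia.
  by move=> [k [l [_ _ [e _]]]]; move: e; clear; lia.
by move=> [k [l [_ _ [_ e]]]]; move: e; clear; lia.
Qed.

Lemma box_ne A B z : ne_corner (box A B) z <-> z = (A%:Z, B%:Z).
Proof.
have opp u : box A B u = box A B (- u).
  by apply: propext; split=> /box_opp; rewrite ?opprK.
have -> : ne_corner (box A B) z = sw_corner (box A B) (- z).
  by rewrite /ne_corner /sw_corner (opp z) (opp (z + (2, 0))) (opp (z + (0, 2))) !opprD.
by rewrite box_sw; split=> [e|->] //; rewrite -[z]opprK e; congr pair; rewrite /= opprK.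
Qed.

Lemma near_box_sw A B z : (0 < A)%N ->
  sw_corner (near_box A B) z <-> z = (- A%:Z, - B%:Z) \/ z = (A%:Z, - (B%:Z + 2)).
Proof.
move=> A0; split=> [[[bz|->|->] n1 n2]|[->|->]].
- left; apply/box_sw; split=> // h; [apply: n1|apply: n2]; exact: Or31.
- by right.
- case: n2; apply: Or31; exists 0%N, B; split=> //.
  by congr pair; rewrite /=; clear; lia.
- split; first by apply: Or31; case/box_sw: (erefl (- A%:Z, - B%:Z)).
    by case=> [[k [l [_ _ [e1 e2]]]]|[e1 e2]|[e1 e2]]; move: e1 e2 A0; clear; lia.
  by case=> [[k [l [_ _ [e1 e2]]]]|[e1 e2]|[e1 e2]]; move: e1 e2 A0; clear; lia.
split; first exact: Or32.
  by case=> [[k [l [_ _ [e1 e2]]]]|[e1 e2]|[e1 e2]]; move: e1 e2 A0; clear; lia.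
by case=> [[k [l [_ _ [e1 e2]]]]|[e1 e2]|[e1 e2]]; move: e1 e2 A0; clear; lia.
Qed.

Section Admissible.
Variable R : realType.
Implicit Types (G : {fset R * R}) (z : int * int).
Local Notation pt := (pt R).

Lemma describes_sw G S p : describes G S ->
  p \in sw_corners G <-> exists2 z, sw_corner S z & p = pt z.
Proof.
move=> d; have E z := describes_pt z d; rewrite !inE; split=> [/and3P[]|[z [Sz n1 n2] ->]].
  move=> /d[z Sz ->]; rewrite -pt_sub1 -pt_sub2 => /negP n1 /negP n2.
  by exists z => //; split=> // /E.
by rewrite -pt_sub1 -pt_sub2; apply/and3P; split; [exact/E|apply/negP => /E|apply/negP => /E].
Qed.

Lemma describes_ne G S p : describes G S ->
  p \in ne_corners G <-> exists2 z, ne_corner S z & p = pt z.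
Proof.
move=> d; have E z := describes_pt z d; rewrite !inE; split=> [/and3P[]|[z [Sz n1 n2] ->]].
  move=> /d[z Sz ->]; rewrite -pt_add1 -pt_add2 => /negP n1 /negP n2.
  by exists z => //; split=> // /E.
by rewrite -pt_add1 -pt_add2; apply/and3P; split; [exact/E|apply/negP => /E|apply/negP => /E].
Qed.

Lemma describes_rectangular G A B : describes G (box A B) -> rectangular G.
Proof.
move=> d; split; apply/eqP/cardfs1P.
  exists (pt (- A%:Z, - B%:Z)); apply/fsetP => p; rewrite in_fset1.
  by apply/idP/eqP => [/(describes_sw _ d)[z /box_sw-> //]|->]; apply/(describes_sw _ d);
    exists (- A%:Z, - B%:Z) => //; apply/box_sw.
exists (pt (A%:Z, B%:Z)); apply/fsetP => p; rewrite in_fset1.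
by apply/idP/eqP => [/(describes_ne _ d)[z /box_ne-> //]|->]; apply/(describes_ne _ d);
  exists (A%:Z, B%:Z) => //; apply/box_ne.
Qed.

Lemma describes_lattice (e : int) G S : describes G S ->
  (forall z, S z -> exists z', z = cell e z') -> in_lattice (pt (e, e)) G.
Proof.
move=> d lat p /d[z /lat[z' ->] ->]; rewrite pt_cell /= !addrK.
by rewrite !intr_int.
Qed.

Lemma describes_symmetric G S : describes G S -> (forall z, S z -> S (- z)) -> centrally_symmetric G.
Proof.
move=> d sym; apply/fsetP => p; apply/idP/imfsetP => [/d[z Sz ->]|[q /= /d[z Sz ->] ->]].
  by exists (pt (- z)); rewrite ?pt_opp ?opprK //=; rewrite -pt_opp; apply/d; exists (- z); auto.
by rewrite -pt_opp; apply/d; exists (- z); auto.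
Qed.

Lemma describes_skew G S : describes G S ->
  (forall z, S z -> S (z + (2, 2)) -> S (z + (2, 0)) /\ S (z + (0, 2))) -> skew_closed G.
Proof.
move=> d sk i j /d[z Sz e]; have E := describes_pt _ d.
have -> : (i + 1, j) = pt (z + (2, 0)) by rewrite pt_add1 -e.
have -> : (i, j + 1) = pt (z + (0, 2)) by rewrite pt_add2 -e.
have -> : (i + 1, j + 1) = pt (z + (2, 2)).
  by rewrite -[z + (2, 2)]/(z + ((2, 0) + (0, 2))) addrA pt_add2 pt_add1 -e.
by move=> /E h; have [h1 h2] := sk _ Sz h; split; apply/E.
Qed.

Definition linked G p q := exists s, [/\ path (@adjacent R) p s, all (mem G) s & last p s = q].

Lemma linked_trans G p q r : linked G p q -> linked G q r -> linked G p r.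
Proof.
move=> [s [ps Gs ls]] [s' [ps' Gs' ls']]; exists (s ++ s').
by rewrite cat_path all_cat last_cat ps Gs ls ps' Gs' ls'.
Qed.

Lemma adjacent_sym (p q : R * R) : adjacent p q = adjacent q p.
Proof. by rewrite /adjacent -sqrrN opprB -[X in _ + X]sqrrN opprB. Qed.

Lemma linked_step G p q : adjacent p q -> p \in G -> q \in G -> linked G p q /\ linked G q p.
Proof.
move=> pq pG qG; split; [exists [:: q]|exists [:: p]].
  by rewrite /= pq qG.
by rewrite /= adjacent_sym pq pG.
Qed.

(** The flag transposes, so that near rectangles of both types share one connectedness argument. *)
Definition spt (sw : bool) z := if sw then pt (z.2, z.1) else pt z.

Lemma spt_step sw z : adjacent (spt sw z) (spt sw (z + (2, 0))) /\
  adjacent (spt sw z) (spt sw (z + (0, 2))).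
Proof.
have h (x y : R) : adjacent (x, y) (x + 1, y) /\ adjacent (x, y) (x, y + 1).
  rewrite /adjacent /=; have -> : (x - (x + 1)) ^+ 2 + (y - y) ^+ 2 = 1 by ring.
  have -> : (x - x) ^+ 2 + (y - (y + 1)) ^+ 2 = 1 by ring.
  by rewrite sqrtr1.
case: sw; rewrite /spt.
  have -> : pt ((z + (2, 0)).2, (z + (2, 0)).1) = pt ((z.2, z.1) + (0, 2)) by [].
  have -> : pt ((z + (0, 2)).2, (z + (0, 2)).1) = pt ((z.2, z.1) + (2, 0)) by [].
  by rewrite pt_add1 pt_add2; have [] := h (pt (z.2, z.1)).1 (pt (z.2, z.1)).2.
by rewrite pt_add1 pt_add2; have [] := h (pt z).1 (pt z).2.
Qed.

(** A covered point is linked to [zp] by its path up and then right; the exceptional [zq], if it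
    belongs to [S], is linked through the point above it. *)
Lemma covered_connected sw G S zp zq : (forall p, p \in G <-> exists2 z, S z & p = spt sw z) ->
  covered S zp zq -> S zp -> (S zq -> S (zq + (0, 2))) -> connected_diagram G.
Proof.
move=> d cov Sp Sq; have E z : S z -> spt sw z \in G by move=> Sz; apply/d; exists z.
pose L p q := linked G p q /\ linked G q p.
have Ltrans p q r : L p q -> L q r -> L p r.
  by move=> [h1 h2] [h3 h4]; split; [exact: linked_trans h1 h3|exact: linked_trans h4 h2].
have vert l : (forall l', (l' <= l)%N -> S (zp + (0, l'%:Z + l'%:Z))) ->
    L (spt sw zp) (spt sw (zp + (0, l%:Z + l%:Z))).
  elim: l => [|l IH] h; first by rewrite addr0; split; exists [::].
  apply: (Ltrans _ _ _ (IH (fun l' h' => h l' (leqW h')))).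
  have e : zp + (0, l.+1%:Z + l.+1%:Z) = zp + (0, l%:Z + l%:Z) + (0, 2).
    by rewrite -addrA; congr (_ + _); congr pair; rewrite /=; clear; lia.
  by rewrite e; apply: linked_step; [case: (spt_step sw (zp + (0, l%:Z + l%:Z)))|apply/E/h|
    rewrite -e; apply/E/h].
have hor k l : (forall k', (k' <= k)%N -> S (zp + (k'%:Z + k'%:Z, l%:Z + l%:Z))) ->
    L (spt sw (zp + (0, l%:Z + l%:Z))) (spt sw (zp + (k%:Z + k%:Z, l%:Z + l%:Z))).
  elim: k => [|k IH] h; first by split; exists [::].
  apply: (Ltrans _ _ _ (IH (fun l' h' => h l' (leqW h')))).
  have e : zp + (k.+1%:Z + k.+1%:Z, l%:Z + l%:Z) = zp + (k%:Z + k%:Z, l%:Z + l%:Z) + (2, 0).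
    by rewrite -addrA; congr (_ + _); congr pair; rewrite /=; clear; lia.
  by rewrite e; apply: linked_step; [case: (spt_step sw (zp + (k%:Z + k%:Z, l%:Z + l%:Z)))|
    apply/E/h|rewrite -e; apply/E/h].
have base z : S z -> z <> zq -> L (spt sw zp) (spt sw z).
  move=> Sz /(cov _ Sz)[k [l [-> h1 h2]]]; exact: Ltrans (vert _ h1) (hor _ _ h2).
have all_base z : S z -> L (spt sw zp) (spt sw z).
  move=> Sz; have [e|/eqP ne] := eqVneq z zq; last exact: base.
  have Sq' : S (z + (0, 2)) by rewrite e in Sz *; exact: Sq.
  apply: (Ltrans _ (spt sw (z + (0, 2)))).
    by apply: base => // e'; move: e' e; case: (z) (zq) => x y [x' y'] /= [e1 e2] [e3 e4];
      move: e2 e4; clear; lia.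
  have [h1 h2] := linked_step (spt_step sw z).2 (E _ Sz) (E _ Sq'); by split.
move=> p q /d[z Sz ->] /d[z' Sz' ->]; have [_ h] := all_base z Sz; have [h' _] := all_base z' Sz'.
exact: linked_trans h h'.
Qed.

End Admissible.

Section Correspondence.
Variable R : realType.
Implicit Types (G : {fset R * R}) (z : int * int).
Local Notation pt := (pt R).

Lemma describes_fset0 : describes (fset0 : {fset R * R}) (fun _ => False).
Proof. by move=> p; rewrite inE; split=> // -[]. Qed.

Lemma describes_ext G S S' : (forall z, S z <-> S' z) -> describes G S -> describes G S'.
Proof. by move=> e d p; rewrite d; split=> -[z /e Sz ->]; exists z. Qed.

Lemma describes_eq G G' S : describes G S -> describes G' S -> G = G'.
Proof. by move=> d d'; apply/fsetP => p; apply/idP/idP => [/d/d'|/d'/d]. Qed.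

Lemma describes_point G : describes G (fun z => z = 0) <-> G = [fset (0, 0)]%fset.
Proof.
have d : describes [fset ((0, 0) : R * R)]%fset (fun z => z = 0).
  move=> p; rewrite in_fset1; split=> [/eqP->|[z -> ->]]; last by rewrite pt0.
  by exists 0; rewrite ?pt0.
by split=> [d'|->] //; exact: describes_eq d' d.
Qed.

Lemma describes_remove G S S' p : describes G S ->
  (forall z, S' z <-> [/\ S z, z <> p & z <> - p]) ->
  describes (G `\` [fset pt p; - pt p])%fset S'.
Proof.
move=> d E r; rewrite in_fsetD in_fset2 negb_or -pt_opp.
split=> [/andP[/andP[/eqP r1 /eqP r2] /d[z Sz ez]]|[z /E[Sz z1 z2] ->]].
  exists z => //; apply/E; split=> // e; [apply: r1|apply: r2]; by rewrite ez e.
by rewrite !(inj_eq (@pt_inj R)); apply/andP; split; [apply/andP; split; exact/eqP|apply/d; exists z].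
Qed.

Lemma fset2_eqP G S c p : describes G S -> (forall z, sw_corner S z <-> z = c \/ z = p) ->
  sw_corners G = [fset pt c; pt p]%fset.
Proof.
move=> d E; apply/fsetP => r; rewrite in_fset2; apply/idP/orP.
  by move=> /(describes_sw _ d)[z /E[->|->] ->]; [left|right].
by case=> /eqP->; apply/(describes_sw _ d); [exists c|exists p] => //; apply/E; [left|right].
Qed.

Lemma near_box_remove A B z : (0 < A)%N ->
  box A B z <-> [/\ near_box A B z, z <> (A%:Z, - (B%:Z + 2)) & z <> - (A%:Z, - (B%:Z + 2))].
Proof.
move=> A0; split=> [h|[[//|->|->] n1 n2]]; last first.
- by case: n2; congr pair; rewrite /= opprK.
- by [].
split; first exact: Or31.
  by case: h => [k [l [kA lB ->]]] [e1 e2]; move: kA lB e1 e2; clear; lia.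
by case: h => [k [l [kA lB ->]]] [e1 e2]; move: kA lB e1 e2; clear; lia.
Qed.

Lemma near_shape_cell t A B z : shape_valid t A B -> t <> PointBox -> shape t A B z ->
  exists z', z = cell 0 z'.
Proof.
have nr A' B' z' : ~~ odd A' -> ~~ odd B' -> near_box A' B' z' -> exists z'', z' = cell 0 z''.
  move=> oA oB; have eA := odd_double_half A'; have eB := odd_double_half B'.
  move: eA eB; rewrite (negPf oA) (negPf oB) -!addnn => eA eB.
  case=> [h|->|->]; first by apply: (box_cell (e := 0) (A := A') (B := B')); rewrite ?(negPf oA) ?(negPf oB).
    exists ((A'./2)%:Z, - (B'./2)%:Z - 1); move: (A'./2) (B'./2) eA eB => x y <- <-.
    by congr pair; rewrite /=; clear; lia.
  exists (- (A'./2)%:Z, (B'./2)%:Z + 1); move: (A'./2) (B'./2) eA eB => x y <- <-.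
  by congr pair; rewrite /=; clear; lia.
case: t => //= /and3P[oA oB _] _; last exact: nr.
move=> /(nr _ _ _ oA oB)[z' e]; exists (z'.2, z'.1); move: e; rewrite /cell /=.
by case: z => x y [/= <- <-].
Qed.

Lemma near_shape_admissible n (G : {fset R * R} * {fset R * R}) t A B :
  shape_valid t A B -> t <> PointBox -> describes_pair G t A B ->
  (#|` G.1| + #|` G.2|)%N = n.*2.+1 -> admissible_pairs R n G.
Proof.
move=> v tP [d1 d2] card.
have kf z : in_point_box t z = false by case: (t) tP.
have {}d1 : describes G.1 (shape t A B).
  by apply: describes_ext d1 => z; rewrite kf; split=> [[]|].
have {d2} G2 : G.2 = fset0.
  apply: (describes_eq (S := fun _ => False)); last exact: describes_fset0.
  by apply: describes_ext d2 => z; rewrite kf; split=> // -[].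
have lat0 : in_lattice (0, 0) G.1.
  by rewrite -(pt0 R); apply: (describes_lattice d1) => z; exact: near_shape_cell.
have box0 : box A B (- A%:Z, - B%:Z) by case/box_sw: (erefl (- A%:Z, - B%:Z)).
have Sq : near_box A B (A%:Z, - (B%:Z + 2)) ->
    near_box A B ((A%:Z, - (B%:Z + 2)) + (0, 2)).
  move=> _; apply: Or31; exists A, 0%N; split=> //; congr pair; rewrite /=; clear; lia.
split=> //.
- split; last exact: describes_symmetric d1 (fun z => @shape_opp t A B z).
  split; [by exists (0, 0)| |exact: describes_skew d1 (fun z => @shape_skew t A B z v)].
  case: t v tP {kf} d1 => // v _ d1.
    apply: (covered_connected (sw := true) _ (@near_box_covered A B) (Or31 _ _ box0) Sq).
    move=> p; rewrite d1; split=> -[[x y] Sz ->]; last by exists (y, x).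
    by exists (y, x).
  exact: (covered_connected (sw := false) d1 (@near_box_covered A B) (Or31 _ _ box0) Sq).
- rewrite G2; split; last exact: describes_symmetric describes_fset0 (fun _ h => h).
  split; first by exists (0, 0) => p; rewrite inE.
    by move=> p q; rewrite inE.
  exact: describes_skew describes_fset0 (fun _ h _ => False_ind _ h).
- by split=> // p; rewrite G2 inE.
left; split=> //; have A0 : (0 < A)%N by case: (t) v tP => //= /and3P[].
case: t v tP {kf} d1 => // v _ d1; [left|right].
  pose p : int * int := (- (B%:Z + 2), A%:Z); pose c : int * int := (- B%:Z, - A%:Z).
  exists (pt p).1, (pt p).2, (pt c).1, (pt c).2; split.
  - rewrite -!surjective_pairing; apply: (fset2_eqP d1) => z.
    case: z => x y; split=> [[h1 h2 h3]|].
      by case: ((near_box_sw B (y, x) A0).1 (And3 h1 h3 h2)) => -[-> ->]; [right|left].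
    case=> ->.
      by have [h1 h2 h3] := (near_box_sw B _ A0).2 (or_intror erefl).
    by have [h1 h2 h3] := (near_box_sw B _ A0).2 (or_introl erefl).
  - rewrite /= ltr_pM2r ?invr_gt0 ?ltr0n // ltr_int; clear; lia.
  apply: (@describes_rectangular _ _ B A).
  rewrite -[((pt p).1, _)]surjective_pairing -[(- _, - _)]/(- pt p).
  apply: (describes_remove d1) => -[x y]; rewrite box_swap near_box_remove //=.
  by split=> -[h1 n1 n2]; split=> // -[ex ey]; [apply: n1|apply: n2|apply: n1|apply: n2];
    rewrite ex ey.
pose p : int * int := (A%:Z, - (B%:Z + 2)); pose c : int * int := (- A%:Z, - B%:Z).
exists (pt c).1, (pt c).2, (pt p).1, (pt p).2; split.
- rewrite -!surjective_pairing; apply: (fset2_eqP d1) => z.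
  exact: near_box_sw.
- rewrite /= ltr_pM2r ?invr_gt0 ?ltr0n // ltr_int; move: A0; clear; lia.
apply: (@describes_rectangular _ _ A B).
rewrite -[((pt p).1, _)]surjective_pairing -[(- _, - _)]/(- pt p).
by apply: (describes_remove d1) => z; exact: near_box_remove.
Qed.

Lemma point_shape_admissible n (G : {fset R * R} * {fset R * R}) A B :
  shape_valid PointBox A B -> describes_pair G PointBox A B ->
  (#|` G.1| + #|` G.2|)%N = n.*2.+1 -> admissible_pairs R n G.
Proof.
move=> /andP[oA oB] [d1 d2] card.
have box_nz z : box A B z -> z != 0.
  move=> [k [l [_ _ ->]]]; apply/eqP => -[e _].
  have e_A : A = k.*2 by move: e; clear; lia.
  by move: oA; rewrite e_A odd_double.
have {}d1 : describes G.1 (fun z => z = 0).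
  by apply: describes_ext d1 => z; split=> [[_ /negPn/eqP]|->] //; split; [by left|by rewrite /= ?eqxx].
have {}d2 : describes G.2 (box A B).
  apply: describes_ext d2 => z; split=> [[[-> /eqP|]]|h] //; split; [by right|exact: box_nz].
have box0 : box A B (- A%:Z, - B%:Z) by case/box_sw: (erefl (- A%:Z, - B%:Z)).
have G1 := (describes_point G.1).1 d1.
have lat1 : in_lattice (1 / 2, 1 / 2) G.2.
  rewrite -[(_, _)]/(pt (1, 1)); apply: (describes_lattice d2) => z.
  by apply: (box_cell (e := 1)); rewrite ?oA ?oB.
have lat0 : in_lattice (0, 0) G.1.
  by move=> p; rewrite G1 in_fset1 => /eqP->; rewrite /= !subrr !rpred0.
split=> //.
- split; last by apply: (describes_symmetric d1) => z ->; rewrite oppr0.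
  split; first by exists (0, 0).
    by move=> p q /d1[z -> ->] /d1[z' -> ->]; exists [::].
  by apply: (describes_skew d1) => z -> [].
- split; last exact: describes_symmetric d2 (fun z => @box_opp A B z).
  split; first by exists (1 / 2, 1 / 2).
    apply: (covered_connected (sw := false) d2 (zp := (- A%:Z, - B%:Z)) (zq := 0)) => //.
      move=> z /box_covered[k [l [-> kA lB]]] _; exists k, l; split=> //.
        by move=> l' h; apply: (boxP (k := 0%N)) => //; exact: leq_trans lB.
      by move=> k' h; apply: boxP => //; exact: leq_trans kA.
    by move=> /box_nz; rewrite eqxx.
  apply: (describes_skew d2) => z h1 h2.
  have v : shape_valid PointBox A B by rewrite /= oA.
  have [[e|h3] [e'|h4]] := shape_skew v (or_intror h1) (or_intror h2) => //; exfalso.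
  - by case: (point_box_terminal oA oB (or_intror h1)) => h _ _; apply: h; rewrite e.
  - by case: (point_box_terminal oA oB (or_intror h1)) => h _ _; apply: h; rewrite e.
  by case: (point_box_terminal oA oB (or_intror h1)) => _ h _; apply: h; rewrite e'.
right; split=> //; last exact: describes_rectangular d2.
by apply/fset0Pn; exists (pt (- A%:Z, - B%:Z)); apply/d2; exists (- A%:Z, - B%:Z).
Qed.

Lemma admissible_shape n (G : {fset R * R} * {fset R * R}) : admissible_pairs R n G ->
  exists t A B, shape_valid t A B /\ describes_pair G t A B.
Proof.
move=> [[sk1 cs1] [[_ _ sk2] cs2] _ [int1 int2] [[near G2]|[G1 G20 rect]]].
  have [t [A [B [v tP d]]]] := near_rectangular_shape sk1 cs1 int1 near.
  have kf z : in_point_box t z = false by case: (t) tP.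
  exists t, A, B; split=> //; split.
    by apply: describes_ext d => z; rewrite kf; split=> [|[]].
  by rewrite G2; apply: describes_ext describes_fset0 => z; rewrite kf; split=> // -[].
have lat p : p \in G.2 -> exists z, p = pt (cell 1 z) by exact: lattice_cell.
have sym p : p \in G.2 -> - p \in G.2 by move=> pG; rewrite cs2; apply/imfsetP; exists p.
have [[a b] [/= a0 b0 boxE]] := rectangular_box (e := 1) isT lat sk2 sym rect.
have {}a0 : 0 <= a by move: a0; clear; lia.
have {}b0 : 0 <= b by move: b0; clear; lia.
exists PointBox, (absz a).*2.+1, (absz b).*2.+1.
have v : shape_valid PointBox (absz a).*2.+1 (absz b).*2.+1 by rewrite /= !odd_double.
split=> //; split.
  have d := (describes_point G.1).2 G1; apply: describes_ext d => z.
  by split=> [->|[_ /negPn/eqP]] //; split; [by left|by rewrite /= ?eqxx].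
have cellP z : pt (cell 1 z) \in G.2 <-> box (absz a).*2.+1 (absz b).*2.+1 (cell 1 z).
  by rewrite (odd_box_cell _ a0 b0); exact: boxE.
have nz z : cell 1 z != 0 by apply/eqP => -[e _]; move: e; clear; lia.
move=> p; split=> [pG|[z [[->|h]] nz0 ->]].
- have [z ez] := lat _ pG; exists (cell 1 z) => //; split; last exact: nz.
  by right; apply/cellP; rewrite -ez.
- by move: nz0; rewrite /= ?eqxx.
have [z' ez'] : exists z', z = cell 1 z'.
  by apply: (box_cell (e := 1)) h; rewrite //= odd_double.
by rewrite ez'; apply/cellP; rewrite -ez'.
Qed.

End Correspondence.

(** * The correspondence *)

Lemma fits_size m m2 (lab : 'I_m -> int * int) (lab2 : 'I_m2 -> int * int) S :
  injective lab -> injective lab2 -> fits lab S -> fits lab2 S -> m = m2.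
Proof.
have le m3 m4 (l3 : 'I_m3 -> int * int) (l4 : 'I_m4 -> int * int) : injective l3 ->
    fits l3 S -> fits l4 S -> (m3 <= m4)%N.
  move=> inj [f1 _] [_ f2]; have /choice[f fE] i : exists j, l4 j = l3 i by exact: f2 (f1 i).
  have f_inj : injective f by move=> i j e; apply: inj; rewrite -!fE e.
  by rewrite -[m3]card_ord -[m4]card_ord -(card_codom f_inj) max_card.
by move=> i1 i2 f1 f2; apply/eqP; rewrite eqn_leq (le _ _ _ _ i1 f1 f2) (le _ _ _ _ i2 f2 f1).
Qed.

(* The nilpotency indices of the two members of the pair, minus one; their
   parities determine the kind of shape. *)
Definition row_length (t : shape_kind) (A B : nat) : nat :=
  if t is NearBoxA then B.+1 else A.
Definition column_length (t : shape_kind) (A B : nat) : nat :=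
  match t with NearBoxA => A | NearBoxB => B.+1 | PointBox => B end.

(** The parities of the row and column lengths are (odd, even) for [NearBoxA], (even, odd) for
    [NearBoxB] and (odd, odd) for [PointBox]. *)
Lemma lengths_inj t A B t' A' B' : shape_valid t A B -> shape_valid t' A' B' ->
  row_length t A B = row_length t' A' B' -> column_length t A B = column_length t' A' B' ->
  [/\ t = t', A = A' & B = B'].
Proof.
case: t; case: t' => /=.
- by move=> _ _ [->] ->.
- by case/and3P=> _ oB _ /and3P[oA' _ _] e; move: oA'; rewrite -e /= negbK (negPf oB).
- by case/and3P=> oA _ _ /andP[_ oB'] _ e; move: oB'; rewrite -e (negPf oA).
- by case/and3P=> oA _ _ /and3P[_ oB' _] e; move: oA; rewrite e /= negbK (negPf oB').
- by move=> _ _ -> [->].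
- by case/and3P=> oA _ _ /andP[oA' _] e; move: oA'; rewrite -e (negPf oA).
- by case/andP=> _ oB /and3P[oA' _ _] _ e; move: oB; rewrite e (negPf oA').
- by case/andP=> oA _ /and3P[oA' _ _] e; move: oA; rewrite e (negPf oA').
by move=> _ _ -> ->.
Qed.

Lemma shape_row t A B : shape_valid t A B -> exists2 zp, 
  forall k, (k <= row_length t A B)%N -> shape t A B (zp + (k%:Z + k%:Z, 0)) &
  forall z k, shape t A B z -> shape t A B (z + (k%:Z + k%:Z, 0)) -> (k <= row_length t A B)%N.
Proof.
have lenb A' B' z (k : nat) : box A' B' z -> box A' B' (z + (k%:Z + k%:Z, 0)) -> (k <= A')%N.
  move=> [k1 [l1 [h1 h2 ->]]] [k2 [l2 [h3 h4 [e1 e2]]]]; move: h1 h3 e1; clear; lia.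
have rowb k : (k <= A)%N -> box A B ((- A%:Z, - B%:Z) + (k%:Z + k%:Z, 0)).
  by move=> kA; apply: (boxP (l := 0%N)).
case: t => /= v.
- have A0 : (0 < A)%N by case/and3P: v.
  exists (- B%:Z, - A%:Z) => [k|z k].
    rewrite leq_eqVlt => /orP[/eqP->|kB]; last first.
      apply: Or31; rewrite /=; exists 0%N, k; split=> //.
      by congr pair; rewrite /=; clear; lia.
    by apply: Or33; congr pair; rewrite /=; clear; lia.
  case: z => x y /= [[k1 [l1 [h1 h2 [e1 e2]]]]|[e1 e2]|[e1 e2]]
    [[k2 [l2 [h3 h4 [e3 e4]]]]|[e3 e4]|[e3 e4]]; move: e2 e4 e1 e3;
    try move: h1 h2; try move: h3 h4; move: A0; clear; lia.
- have A0 : (0 < A)%N by case/and3P: v.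
  exists (- A%:Z, - B%:Z) => [k /rowb|z k]; first by exact: Or31.
  by case: z => x y /= [[k1 [l1 [h1 h2 [e1 e2]]]]|[e1 e2]|[e1 e2]]
    [[k2 [l2 [h3 h4 [e3 e4]]]]|[e3 e4]|[e3 e4]]; move: e2 e4 e1 e3;
    try move: h1 h2; try move: h3 h4; move: A0; clear; lia.
exists (- A%:Z, - B%:Z) => [k /rowb|z k]; first by right.
case=> [->|h1] [e|h2]; last exact: lenb h1 h2.
- by case: e => e; move: e; clear; lia.
- by rewrite add0r in h2; case: h2 => k2 [l2 [h3 h4 [e1 e2]]]; move: h3 e1; clear; lia.
by case: z h1 e => x y [k1 [l1 [h1 h2 [-> _]]]] [e _]; move: h1 e; clear; lia.
Qed.

Section Invariants.
Variable K : fieldType.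
Hypothesis charK : forall k, k.+1%:R != 0 :> K.

Lemma grid_row m (X Y J : 'M[K]_m) lab t A B k : grid X Y J lab -> fits lab (shape t A B) ->
  shape_valid t A B -> (X ^+ k != 0) = (k <= row_length t A B)%N.
Proof.
move=> G [f1 f2] v; have [zp hp hz] := shape_row v; apply/idP/idP => [Xk|kr].
  have [i [j h]] : exists i j, (X ^+ k) i j != 0.
    apply: contrapT => /forallNP n; case/eqP: Xk; apply/matrixP=> i j; rewrite [RHS]mxE.
    by apply/eqP; have /forallNP/(_ j)/negP := n i; rewrite negbK.
  have : hits X Y j k 0 i by rewrite /hits /mon expr0 mulmx1.
  by move=> /(grid_hits charK G) e; apply: (hz _ _ (f1 j)); have := f1 i; rewrite e.
have [p lp] := f2 _ (hp 0%N (leq0n _)); rewrite addr0 in lp.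
have [||i h] := hits_path charK G (p := p) (k := k) (l := 0).
- by move=> l'; rewrite leqn0 => /eqP->; exists p; rewrite addr0.
- by move=> k' kk; rewrite lp; apply/f2/hp; exact: leq_trans kr.
by apply: contraNneq h => e; rewrite /mon e mul0mx mxE.
Qed.

Lemma grid_column m (X Y J : 'M[K]_m) lab t A B k : grid X Y J lab -> fits lab (shape t A B) ->
  shape_valid t A B -> (Y ^+ k != 0) = (k <= column_length t A B)%N.
Proof.
move=> G [f1 f2] v; have G' := grid_transpose G.
have fs t' A' B' : (forall z, shape t' A' B' (z.2, z.1) <-> shape t A B z) ->
    fits (swap_pos lab) (shape t' A' B').
  move=> e; split=> [i|[x y] /(e (y, x))/f2[i li]]; first by have /e := f1 i.
  by exists i; rewrite /swap_pos li.
case: t v f1 f2 fs => v f1 f2 fs.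
- by apply: (grid_row (t := NearBoxB) _ G' _ v); apply: fs => -[x y].
- by apply: (grid_row (t := NearBoxA) _ G' _ v); apply: fs => -[x y].
apply: (grid_row (t := PointBox) (A := B) (B := A) _ G').
  by apply: fs => -[x y] /=; rewrite -[box A B (x, y)](propext (box_swap B A (y, x)));
    split=> [] [[-> ->]|]; by [left|right].
by rewrite /= andbC.
Qed.

End Invariants.

Section Final.
Variables (R : realType) (K : fieldType) (n : nat).
Local Notation m := n.*2.+1.
Variables (J : 'M[K]_m) (g : lieAlgType K).
Variables (psi : {linear so J -> g}) (phi : {linear g -> so J}).
Hypotheses (charK : forall k, k.+1%:R != 0 :> K).
Hypotheses (J_sym : J^T = J) (J_unit : J \in unitmx) (n_gt0 : (0 < n)%N).
Hypothesis sqrtK : forall c : K, exists d, d ^+ 2 = c.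
Hypotheses (psiK : cancel psi phi) (phiK : cancel phi psi).
Hypothesis psi_lie : forall x y, psi (lie x y) = lie (psi x) (psi y).
Implicit Types (G : {fset R * R} * {fset R * R}).

Let classE := conjugacy_classE charK J_sym J_unit n_gt0 sqrtK psiK phiK psi_lie.

Lemma conj_isometry m' (F E : 'M[K]_m') (P : 'M[K]_(m, m')) (Q : 'M[K]_(m', m)) :
  P *m Q = 1%:M -> P^T *m J *m P = F -> Q^T *m F *m Q = J.
Proof.
move=> PQ <-; have QPT : Q^T *m P^T = 1%:M by rewrite -trmx_mul PQ trmx1.
by rewrite !mulmxA QPT mul1mx -mulmxA PQ mulmx1.
Qed.

(** Two isometries P, P' from the model space differ by the isometry D = P' Q of J, and conjugation
    by D is realized in the adjoint group; so the union in [model_class] is a single class. *)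
Lemma model_classE G (P : 'M[K]_(m, model_dim G)) (Q : 'M[K]_(model_dim G, m)) x1 x2 :
  P *m Q = 1%:M -> Q *m P = 1%:M -> P^T *m J *m P = model_form K G ->
  so_mx x1 = P *m model_e1 K G *m Q -> so_mx x2 = P *m model_e2 K G *m Q ->
  model_class psi G = conjugacy_class (psi x1, psi x2).
Proof.
move=> PQ QP PF e1 e2; apply/seteqP; split=> f; last first.
  by move=> hf; exists P, Q, x1, x2.
move=> [P' [Q' [y1 [y2 [[PQ' QP'] PF' e1' e2' /classE[A AJ [f1 f2]]]]]]]; apply/classE.
pose D := P' *m Q.
have DJ : isom J D.
  have QJ := conj_isometry (model_form K G) PQ PF.
  rewrite /isom /D trmx_mul !mulmxA -[_ *m J *m P']mulmxA.
  by rewrite -[Q^T *m P'^T *m (J *m P')]mulmxA [P'^T *m _]mulmxA PF'.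
have Du : D \in unitmx by exact: (isom_unit J_unit DJ).
have Au : A \in unitmx by exact: (isom_unit J_unit AJ).
have iD : invmx D = P *m Q'.
  rewrite -[LHS]mulmx1 -PQ' -[P' in LHS]mulmx1 -QP !mulmxA -[_ *m P' *m Q]mulmxA -/D.
  by rewrite mulVmx // mul1mx.
have conjD (E : 'M[K]_(model_dim G)) : P' *m E *m Q' = D *m (P *m E *m Q) *m invmx D.
  by rewrite iD /D !mulmxA -[_ *m Q *m P]mulmxA QP mulmx1 -[_ *m Q *m P]mulmxA QP mulmx1.
exists (A *m D); first exact: isomM.
by rewrite f1 f2 e1' e2' !conjD e1 e2 invmxM // !mulmxA.
Qed.

Lemma isometry_exists m' (F : 'M[K]_m') : m' = m -> F^T = F -> F \in unitmx ->
  exists (P : 'M[K]_(m, m')) (Q : 'M[K]_(m', m)),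
    [/\ P *m Q = 1%:M, Q *m P = 1%:M & P^T *m J *m P = F].
Proof.
move=> e; subst m' => Fs Fu; have [P Pu PF] := symmetric_cong charK sqrtK J_sym J_unit Fs Fu.
by exists P, (invmx P); rewrite mulmxV ?mulVmx.
Qed.

Lemma grid_pair_properties m' (E1 E2 F : 'M[K]_m') (P : 'M[K]_(m, m')) (Q : 'M[K]_(m', m))
    lab t A B x1 x2 : m' = m -> grid E1 E2 F lab -> fits lab (shape t A B) ->
  shape_valid t A B -> P *m Q = 1%:M -> Q *m P = 1%:M -> P^T *m J *m P = F ->
  so_mx x1 = P *m E1 *m Q -> so_mx x2 = P *m E2 *m Q ->
  nilpotent_pair (psi x1, psi x2) /\ almost_principal (psi x1, psi x2).
Proof.
move=> e; subst m' => G f v PQ QP PF e1 e2.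
have G' : grid (Q *m so_mx x1 *m P) (Q *m so_mx x2 *m P) (P^T *m J *m P) lab.
  rewrite PF e1 e2 !mulmxA QP !mul1mx -![_ *m Q *m P]mulmxA QP !mulmx1; exact: G.
split.
  exact: (grid_nilpotent_pair charK J_sym J_unit psiK phiK psi_lie PQ QP G').
exact: (grid_almost_principal charK J_sym J_unit sqrtK psiK phiK psi_lie PQ QP G' f v).
Qed.

Lemma model_dimE G : model_dim G = (#|` G.1| + #|` G.2|)%N.
Proof. by rewrite /model_dim card_sum !cardfE. Qed.

Lemma model_pair G t A B : shape_valid t A B -> describes_pair G t A B ->
  (#|` G.1| + #|` G.2|)%N = m ->
  exists (P : 'M[K]_(m, model_dim G)) (Q : 'M[K]_(model_dim G, m)) (x1 x2 : so J),
    [/\ P *m Q = 1%:M /\ Q *m P = 1%:M,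
      so_mx x1 = P *m model_e1 K G *m Q /\ so_mx x2 = P *m model_e2 K G *m Q,
      model_class psi G = conjugacy_class (psi x1, psi x2),
      nilpotent_pair (psi x1, psi x2) & almost_principal (psi x1, psi x2)].
Proof.
move=> v d card; have [lab [Gr f]] := model_grid charK v d; have W := gr_W Gr.
have dm : model_dim G = m by rewrite model_dimE.
have [P [Q [PQ QP PF]]] := isometry_exists dm (wt_Jsym W) (wt_Junit W).
have QJ := conj_isometry (model_form K G) PQ PF.
have lift (E : 'M[K]_(model_dim G)) : E^T *m model_form K G + model_form K G *m E = 0 ->
    exists x : so J, so_mx x = P *m E *m Q.
  by move=> h; apply: so_mx_surj; have := so_conj QP h; rewrite QJ.
have [x1 e1] := lift _ (wt_Xso W); have [x2 e2] := lift _ (wt_Yso W).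
have [np ap] := grid_pair_properties dm Gr f v PQ QP PF e1 e2.
by exists P, Q, x1, x2; split=> //; exact: model_classE PQ QP PF e1 e2.
Qed.

Lemma model_class_inj G G' : admissible_pairs R n G -> admissible_pairs R n G' ->
  model_class psi G = model_class psi G' -> G = G'.
Proof.
move=> aG aG' cl; have [t [A [B [v d]]]] := admissible_shape aG.
have [t' [A' [B' [v' d']]]] := admissible_shape aG'.
have c : (#|` G.1| + #|` G.2|)%N = m by case: aG.
have c' : (#|` G'.1| + #|` G'.2|)%N = m by case: aG'.
have [P [Q [x1 [x2 [[PQ QP] [e1 e2] cE _ _]]]]] := model_pair v d c.
have [P' [Q' [y1 [y2 [[PQ' QP'] [e1' e2'] cE' _ _]]]]] := model_pair v' d' c'.
have : conjugacy_class (psi x1, psi x2) (psi x1, psi x2).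
  by exists \1%VF; [exact: AdjointId|rewrite !id_lfunE].
rewrite -cE cl cE' => /classE[D DJ [/= h1 h2]]; rewrite !psiK in h1 h2.
have Du : D \in unitmx by exact: (isom_unit J_unit DJ).
have eq0 m' (E : 'M[K]_m') (P0 : 'M[K]_(m, m')) (Q0 : 'M[K]_(m', m)) Z k : P0 *m Q0 = 1%:M ->
    Q0 *m P0 = 1%:M -> Z = P0 *m E *m Q0 -> (Z ^+ k != 0) = (E ^+ k != 0).
  move=> PQ0 QP0 ->; rewrite (expr_conj _ _ QP0 PQ0); apply/idP/idP; apply: contraNN => /eqP.
    by move=> ->; rewrite mulmx0 mul0mx.
  move=> /(congr1 (fun Z => Q0 *m Z *m P0)); rewrite !mulmxA QP0 mul1mx -mulmxA QP0 mulmx1.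
  by rewrite mulmx0 mul0mx => ->.
have [lab [Gr f]] := model_grid charK v d; have [lab' [Gr' f']] := model_grid charK v' d'.
have eqn a b : (forall k, (k <= a)%N = (k <= b)%N) -> a = b.
  by move=> h; apply/eqP; rewrite eqn_leq -h leqnn h leqnn.
have [et eA eB] : [/\ t = t', A = A' & B = B'].
  apply: (lengths_inj v v'); apply: eqn => k.
    rewrite -(grid_row charK k Gr f v) -(grid_row charK k Gr' f' v').
    rewrite -(eq0 _ _ _ _ _ k PQ QP e1) -(eq0 _ _ _ _ _ k PQ' QP' e1').
    exact: (eq0 _ _ _ _ _ k (mulmxV Du) (mulVmx Du) h1).
  rewrite -(grid_column charK k Gr f v) -(grid_column charK k Gr' f' v').
  rewrite -(eq0 _ _ _ _ _ k PQ QP e2) -(eq0 _ _ _ _ _ k PQ' QP' e2').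
  exact: (eq0 _ _ _ _ _ k (mulmxV Du) (mulVmx Du) h2).
subst t' A' B'; case: G G' d d' {aG aG' cl c c' P Q P' Q' e1 e2 cE e1' e2' cE' PQ QP PQ' QP'
  lab lab' Gr Gr' f f'} => G1 G2 [G1' G2'] [/= d1 d2] [/= d1' d2'].
by rewrite (describes_eq d1 d1') (describes_eq d2 d2').
Qed.

Lemma shape_pair (lab : 'I_m -> int * int) t A B : injective lab -> fits lab (shape t A B) ->
  shape_valid t A B -> exists2 G, admissible_pairs R n G & describes_pair G t A B.
Proof.
move=> linj f v; have [f1 f2] := f.
pose G : {fset R * R} * {fset R * R} :=
  ([fset pt R (lab i) | i in [pred i | ~~ in_point_box t (lab i)]]%fset,
   [fset pt R (lab i) | i in [pred i | in_point_box t (lab i)]]%fset).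
have d : describes_pair G t A B.
  split=> p; split.
  - by move=> /imfsetP[i /= hi ->]; exists (lab i).
  - by move=> [z [/f2[i <-] hi] ->]; apply/imfsetP; exists i.
  - by move=> /imfsetP[i /= hi ->]; exists (lab i).
  by move=> [z [/f2[i <-] hi] ->]; apply/imfsetP; exists i.
(* The index set of the model and ['I_m] are both labelled bijectively by the same shape. *)
have card : (#|` G.1| + #|` G.2|)%N = m.
  have [lab' [Gr f']] := model_grid charK v d; rewrite -model_dimE.
  exact: fits_size (gr_inj Gr) linj f' f.
exists G => //; clearbody G; case: t v d {f f1 f2} card => v d card.
- exact: near_shape_admissible v _ d card.
- exact: near_shape_admissible v _ d card.
exact: point_shape_admissible v d card.
Qed.

Lemma model_class_surj C : almost_principal_classes g C ->
  exists2 G, admissible_pairs R n G & model_class psi G = C.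
Proof.
move=> [[u1 u2] [np ap ->]]; rewrite -[u1]phiK -[u2]phiK in np ap *.
set x1 := phi u1 in np ap *; set x2 := phi u2 in np ap *.
have [P [t [A [B [lab [Pu v Gr f]]]]]] :=
  nilpotent_pair_grid charK J_sym J_unit n_gt0 sqrtK psiK phiK psi_lie np ap.
have [G aG d] := shape_pair (gr_inj Gr) f v; exists G => //.
have [lab' [Gr' f']] := model_grid charK v d.
have [S [T [ST TS SF S1 S2]]] := grid_isometry charK sqrtK v Gr' Gr f' f.
have PV := mulmxV Pu; have VP := mulVmx Pu.
have TST : T^T *m S^T = 1%:M by rewrite -trmx_mul ST trmx1.
(* [T] carries the model space to the basis in which the given pair is a grid, and [P] leads back to
   the original basis; P T is the isometry that [model_class] asks for. *)
have back (E : 'M[K]_(model_dim G)) Z : E *m S = S *m (invmx P *m Z *m P) ->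
    Z = P *m T *m E *m (S *m invmx P).
  move=> h; rewrite -!mulmxA [E *m _]mulmxA h !mulmxA -[_ *m T *m S]mulmxA TS mulmx1 PV mul1mx.
  by rewrite -mulmxA PV mulmx1.
apply: (@model_classE G (P *m T) (S *m invmx P)).
- by rewrite !mulmxA -[_ *m T *m S]mulmxA TS mulmx1 PV.
- by rewrite !mulmxA -[_ *m invmx P *m P]mulmxA VP mulmx1 ST.
- rewrite trmx_mul !mulmxA -[_ *m P^T *m J]mulmxA -[_ *m (P^T *m J) *m P]mulmxA -SF.
  by rewrite !mulmxA TST mul1mx -mulmxA ST mulmx1.
- exact: back.
exact: back.
Qed.

End Final.

Theorem theorem6p7 (R : realType) (K : closedFieldType)
  (charK : [pchar K] =i pred0)
  (n : nat) (n_gt0 : (0 < n)%N)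
  (J : 'M[K]_(n.*2.+1)) (J_sym : J^T = J) (J_nondeg : J \in unitmx)
  (g : lieAlgType K) (psi : so J -> g) (psi_iso : lie_isomorphism psi) :
  set_bij (admissible_pairs R n) (almost_principal_classes g)
    (model_class (R := R) psi).
Proof.
have charK' k : k.+1%:R != 0 :> K.
  by rewrite ((pcharf0P K).1 charK).
have sqrtK (c : K) : exists d, d ^+ 2 = c.
  have [d dE] := @solve_monicpoly K 2 (fun i => if i == 0%N then c else 0) isT.
  by exists d; rewrite dE !big_ord_recl big_ord0 /= mul0r !addr0 expr0 mulr1.
have [psi_lin [phi0 psiK phiK] psi_lie] := psi_iso.
pose psiL : {linear so J -> g} := HB.pack psi
  (GRing.isSemilinear.Build K (so J) g *:%R psi (GRing.semilinear_linear psi_lin)).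
have phi_lin : linear phi0.
  by move=> a x y; apply: (can_inj psiK); rewrite phiK psi_lin !phiK.
pose phiL : {linear g -> so J} := HB.pack phi0
  (GRing.isSemilinear.Build K g (so J) *:%R phi0 (GRing.semilinear_linear phi_lin)).
split.
- move=> G aG; have [t [A [B [v d]]]] := admissible_shape aG.
  have c : (#|` G.1| + #|` G.2|)%N = n.*2.+1 by case: aG.
  have [P [Q [x1 [x2 [_ _ cE np ap]]]]] := model_pair (psi := psiL) (phi := phiL)
    charK' J_sym J_nondeg n_gt0 sqrtK psiK phiK psi_lie v d c.
  by exists (psi x1, psi x2).
- move=> G G' /set_mem aG /set_mem aG'.
  exact: (model_class_inj (psi := psiL) (phi := phiL)
    charK' J_sym J_nondeg n_gt0 sqrtK psiK phiK psi_lie aG aG').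
move=> C hC; have [G aG GC] := model_class_surj R (psi := psiL) (phi := phiL)
    charK' J_sym J_nondeg n_gt0 sqrtK psiK phiK psi_lie hC.
by exists G.
Qed.
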